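(* Let $n>2$ be odd and let $|\cdot|$ be an arbitrary norm on $\mathbb{R}^n$. Then there is no algorithm that, given a finite simplicial complex $K$ of dimension $2n-2$ and a piecewise linear function $f\colon|K|\to\mathbb{R}^n$ (with rational values on the vertices), correctly chooses at least one of the following answers: ''$\mathrm{rob}(f)>0$'', ''$\mathrm{rob}(f)<1$''.
   Context: A function $f\colon|K|\to\mathbb{R}^n$ on the geometric realization of a finite simplicial complex $K$ is piecewise linear if it is affine on each simplex; it is given by its values on the vertices. For $h\colon|K|\to\mathbb{R}^n$ let $\|h\|:=\max_{x\in|K|}|h(x)|$. For $\alpha\ge 0$, an $\alpha$-perturbation of $f$ is any continuous $g\colon|K|\to\mathbb{R}^n$ with $\|g-f\|\le\alpha$. Let $S_f$ be the set of all $\alpha\ge0$ such that every $\alpha$-perturbation of $f$ has a root in $|K|$; when $f$ has a root, $S_f$ is a closed bounded interval $[0,\mathrm{rob}(f)]$ and $\mathrm{rob}(f):=\max S_f$ (the robustness of the root of $f$). The answer ''$\mathrm{rob}(f)>0$'' is correct iff $S_f$ contains a positive number, and the answer ''$\mathrm{rob}(f)<1$'' is correct iff $1\notin S_f$. *)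

(* Defs.v *)
From HB Require Import structures.
From mathcomp Require Import all_boot all_order all_algebra.
From mathcomp Require Import all_classical all_reals all_analysis.
Set Implicit Arguments. Unset Strict Implicit. Unset Printing Implicit Defensive.
Import Order.TTheory GRing.Theory Num.Theory.
Import numFieldNormedType.Exports.
Local Open Scope classical_set_scope.
Local Open Scope ring_scope.

(* Model of computation: partial mu-recursive functions on nat.         *)
(* An "algorithm" is a term [phi : recf]; [rec_eval phi args y] means that  *)
(* the computation of phi on argument list args halts with output y.    *)
(* Missing arguments default to 0 (this does not change the class of    *)
(* computable partial functions).                                       *)
Inductive recf : Type :=
  | RZero
  | RSucc
  | RProj of nat
  | RComp of recf & seq recf
  | RPrec of recf & recf
  | RMu of recf.

Inductive rec_eval : recf -> seq nat -> nat -> Prop :=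
  | evZero v : rec_eval RZero v 0
  | evSucc v : rec_eval RSucc v (head 0%N v).+1
  | evProj i v : rec_eval (RProj i) v (nth 0%N v i)
  | evComp h gs v ws y : rec_evals gs v ws -> rec_eval h ws y -> rec_eval (RComp h gs) v y
  | evPrec0 b s w y : rec_eval b w y -> rec_eval (RPrec b s) (0%N :: w) y
  | evPrecS b s k w z y :
      rec_eval (RPrec b s) (k :: w) z -> rec_eval s (k :: z :: w) y ->
      rec_eval (RPrec b s) (k.+1 :: w) y
  | evMu f v m :
      rec_eval f (m :: v) 0 ->
      (forall j, (j < m)%N -> exists k, rec_eval f (j :: v) k.+1) ->
      rec_eval (RMu f) v m
with rec_evals : seq recf -> seq nat -> seq nat -> Prop :=
  | evsNil v : rec_evals [::] v [::]
  | evsCons g gs v y ys : rec_eval g v y -> rec_evals gs v ys -> rec_evals (g :: gs) v (y :: ys).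

(* Instances: a finite simplicial complex K on vertices 0..N-1, given   *)
(* by a list of simplices (K is their downward closure), together with  *)
(* rational values f(v_i) in Q^n for every vertex i < N (N := number of *)
(* value vectors).  Instances are encoded as naturals by [pickle].      *)
Definition inst := (seq (seq nat) * seq (seq rat))%type.

Definition nverts (I : inst) : nat := size I.2.

Definition valid_inst (n d : nat) (I : inst) : Prop :=
  [/\ all (fun s => (0 < size s)%N && uniq s && all (fun i => i < nverts I)%N s
                    && (size s <= d.+1)%N) I.1,
      has (fun s => size s == d.+1) I.1 &
      all (fun v => size v == n) I.2].

(* geometric realization |K| inside the standard simplex of R^N *)
Definition realiz {R : realType} (I : inst) : set 'rV[R]_(nverts I) :=
  [set x | (forall i, 0 <= x ord0 i) /\ \sum_i x ord0 i = 1 /\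
           exists2 s, s \in I.1 & forall i, x ord0 i != 0 -> (val i \in s)].

Arguments realiz {R} I _.

Definition plmap (R : realType) (n : nat) (I : inst)
    (x : 'rV[R]_(nverts I)) : 'rV[R]_n :=
  \row_(j < n) \sum_(i < nverts I) x ord0 i * ratr (nth 0 (nth [::] I.2 i) j).

Arguments plmap {R} n I x.

Definition is_norm (R : realType) (n : nat) (nrm : 'rV[R]_n -> R) : Prop :=
  [/\ forall x, nrm x = 0 -> x = 0,
      forall (a : R) x, nrm (a *: x) = `|a| * nrm x &
      forall x y, nrm (x + y) <= nrm x + nrm y].

Definition Sf (R : realType) (n : nat) (nrm : 'rV[R]_n -> R) (I : inst)
    (alpha : R) : Prop :=
  0 <= alpha /\
  forall g : 'rV[R]_(nverts I) -> 'rV[R]_n,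
    {within realiz I, continuous g} ->
    (forall x, realiz I x -> nrm (g x - plmap n I x) <= alpha) ->
    exists x, realiz I x /\ g x = 0.

Definition rob_pos_correct (R : realType) (n : nat) (nrm : 'rV[R]_n -> R)
    (I : inst) : Prop := exists alpha : R, 0 < alpha /\ Sf nrm I alpha.

Definition rob_lt1_correct (R : realType) (n : nat) (nrm : 'rV[R]_n -> R)
    (I : inst) : Prop := ~ Sf nrm I 1.

(* Main.v *)
(**
Solvability of a Diophantine equation is coded into the robustness of a piecewise linear map, and
the undecidability comes from the MRDP theorem in the form of a diagonal argument: for a purported
algorithm phi there is an instance on which phi answers "rob > 0" if and only if a certain system
attached to that instance is solvable.

The systems have integer unknowns a_i, d_j with a_0 = d_0 = 1, and equations that are either sums of
at most three of the d_j equal to 0, or links a_i d_j = d_k. A system yields a complex made of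
triangulated tori (Z/20)^N and of cones over some of their subtori. With h = n - 2 the tori have
coordinates r, C0, C1 (h - 1 coordinates in each of C0 and C1), t_i and s_j. The map f is C times the
degree one simplicial map onto the boundary of a simplex on the subtori [s_0][t_0]C0 and
[s_0][r]C1, and 0 at all other vertices.

If g is 1-close to f (and C is large) and has no zero, then g / |g| has a degree on each
(n-1)-dimensional torus. This degree is additive in each direction and vanishes on coned tori.
Let d_j be the degree on [s_j][r]C1 and a_i the one on [s_0][t_i]C0. The cup product relation on
the main tori (this uses n odd, through the sign of a shuffle) gives degree a_i d_j on [s_j][t_i]C0,
and the coned diagonal tori turn into the equations of the system; hence the system is solvable.
Degrees are computed combinatorially, by a Sperner labelling of a fine subdivision that is uniform
by compactness, and a determinant cocycle on the labels.

Conversely, a solution gives a periodic map Phi that depends only on sum_j d_j s_j, sum_i a_i t_i and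
the coordinates in r, C0, C1, does not vanish, equals f / C near the support of f, and avoids a
fixed ray on every coned torus, so that it extends to the cones. Then f, shrunk slightly near its
support, plus epsilon times Phi is an arbitrarily small perturbation without zeros.
*)

(* Both answers are often correct at once, so a gap is needed: a solvable system leaves no positive
   number in $S_f$, an unsolvable one puts 1 into $S_f$. The parameter k of the systems is forced by
   a unary chain of sums, so the code of the instance is itself a Diophantine function of k, and the
   diagonal argument needs no program that writes instances. Products of degrees come from the
   vanishing cup square of a class pulled back from the (n-1)-sphere, evaluated on a torus of
   dimension 2n - 2; for even n the signs would make the relation trivial. For n = 3 this dimension
   has room for sums of three terms only. In the converse direction all cones share one apex, so Phi
   has to avoid the same ray on every cone. The ray is chosen so that on the diagonal of a link it
   would require L = 15/4 and W = 7/2 modulo 20 for the sums L of the d_j s_j and W of the a_i t_i;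
   but L = d_j W holds there, and 4L cannot be both odd and even. The period 20 leaves room: the
   reference simplex lies between 3 and 4, its hats vanish outside (2, 5), and a shift by 3 moves
   this window off itself. *)
Require Import Defs.
From HB Require Import structures.
From mathcomp Require all_boot all_order all_fingroup all_algebra.
From mathcomp Require boolp all_classical all_reals all_analysis.
From mathcomp Require zify ring lra.

(** * Diophantine sets *)

Module PellSequence.
Import all_boot all_order all_algebra.
Import zify ring.
Set Implicit Arguments. Unset Strict Implicit. Unset Printing Implicit Defensive.
Import Order.TTheory GRing.Theory Num.Theory.
Local Open Scope ring_scope.

Fixpoint pell (b : int) (n : nat) : int :=
  match n with
  | 0 => 0
  | 1 => 1
  | (k.+1 as m).+1 => b * pell b m - pell b k
  end.

Lemma pellSS b n : pell b n.+2 = b * pell b n.+1 - pell b n.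
Proof. by []. Qed.

Lemma nat_ind2 (P : nat -> Prop) :
  P 0%N -> P 1%N -> (forall n, P n -> P n.+1 -> P n.+2) -> forall n, P n.
Proof.
move=> P0 P1 PS n; suff: P n /\ P n.+1 by case.
by elim: n => [|n [IH1 IH2]]; split => //; apply: PS.
Qed.

(** Cassini's identity: the form x^2 - bxy + y^2 is invariant under the step (x, y) -> (bx - y,
    x). *)
Lemma pell_inv b n :
  pell b n.+1 ^+ 2 - b * pell b n.+1 * pell b n + pell b n ^+ 2 = 1.
Proof.
elim: n => [|n IH]; first by rewrite /=; ring.
by rewrite pellSS -[RHS]IH; ring.
Qed.

Lemma pell_add b m n :
  pell b (m + n.+1) = pell b m.+1 * pell b n.+1 - pell b m * pell b n.
Proof.
elim/nat_ind2: m => [||m IH1 IH2].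
- by rewrite add0n /=; ring.
- by rewrite add1n !pellSS /=; ring.
by rewrite !addSn pellSS -addSn IH1 IH2 !pellSS; ring.
Qed.

Lemma pell_ltS b n : 2 <= b -> 0 <= pell b n < pell b n.+1.
Proof.
move=> hb; elim: n => [//|n IH].
rewrite pellSS; move: IH; move: (pell b n.+1) (pell b n) => x y /andP[y0 yx].
have : 0 <= (b - 2) * x by apply: mulr_ge0; lia.
lia.
Qed.

Lemma pell_ge0 b n : 2 <= b -> 0 <= pell b n.
Proof. by move/(pell_ltS n)/andP=> []. Qed.

Lemma pell_lt b n m : 2 <= b -> (n < m)%N -> pell b n < pell b m.
Proof.
move=> hb; elim: m => // m IH; rewrite ltnS leq_eqVlt => /orP[/eqP->|/IH h].
  by case/andP: (pell_ltS m hb).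
by apply: lt_trans h _; case/andP: (pell_ltS m hb).
Qed.

Lemma pell_le b n m : 2 <= b -> (n <= m)%N -> pell b n <= pell b m.
Proof.
by move=> hb; rewrite leq_eqVlt => /orP[/eqP->//|/(pell_lt hb)/ltW].
Qed.

Lemma pell_ge_id b n : 2 <= b -> n%:Z <= pell b n.
Proof.
move=> hb; elim: n => // n IH.
have := pell_ltS n hb; lia.
Qed.

Lemma pell_ge_exp b n : 2 <= b -> (b - 1) ^+ n <= pell b n.+1.
Proof.
move=> hb; elim: n => // n IH; rewrite exprS pellSS.
have h : (b - 1) * (b - 1) ^+ n <= (b - 1) * pell b n.+1.
  by apply: ler_wpM2l => //; lia.
have := pell_ltS n hb; lia.
Qed.

Lemma pell2 n : pell 2 n = n%:Z.
Proof.
elim/nat_ind2: n => // n IH1 IH2; rewrite pellSS IH1 IH2 -[n.+2]addn2 -[n.+1]addn1 !PoszD; ring.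
Qed.

Lemma pell_modb b b' d n : (d %| b - b')%Z -> (d %| pell b n - pell b' n)%Z.
Proof.
move=> hd; elim/nat_ind2: n => [||n IH1 IH2]; try by rewrite subrr.
have -> : pell b n.+2 - pell b' n.+2 = (b - b') * pell b n.+1
   + b' * (pell b n.+1 - pell b' n.+1) - (pell b n - pell b' n).
  by rewrite !pellSS; ring.
by apply: rpredB => //; apply: rpredD; [apply: dvdz_mulr|apply: dvdz_mull].
Qed.

(** Descent: (y, by - x) solves the same equation and has a smaller second entry, until this entry
    is 0. *)
Lemma pell_solve b (x y : int) : 2 <= b -> 0 <= y -> y < x ->
  x ^+ 2 - b * x * y + y ^+ 2 = 1 ->
  exists n, x = pell b n.+1 /\ y = pell b n.
Proof.
move=> hb; elim: {y}`|y|%N {-2}y (leqnn `|y|) x => [|k IH] y yk x y0 yx e.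
  have y00 : y = 0 by lia.
  have x1 : x = 1.
    rewrite y00 in e yx.
    have : (x - 1) * (x + 1) = 0.
      have -> : (x - 1) * (x + 1) = (x ^+ 2 - b * x * 0 + 0 ^+ 2) - 1 by ring.
      by rewrite e subrr.
    move/eqP; rewrite mulf_eq0 => /orP[] /eqP; lia.
  by exists 0%N.
have [y00|yn0] := eqVneq y 0; first by apply: (IH y); lia.
have ypos : 0 < y by lia.
have exy : x * (b * y - x) = y ^+ 2 - 1.
  have -> : x * (b * y - x) = y ^+ 2 - (x ^+ 2 - b * x * y + y ^+ 2) by ring.
  by rewrite e.
have y'0 : 0 <= b * y - x.
  rewrite leNgt; apply/negP => h.
  have : x * (b * y - x) < 0 by rewrite pmulr_rlt0 //; lia.
  rewrite exy; have : 1 <= y ^+ 2 by rewrite expr2; nia.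
  lia.
have y'y : b * y - x < y.
  rewrite ltNge; apply/negP => h.
  have : x * y <= x * (b * y - x) by apply: ler_wpM2l => //; lia.
  rewrite exy expr2; nia.
have [||n [ey1 ey]] := IH (b * y - x) _ y y'0 y'y.
- lia.
- by rewrite -[RHS]e; ring.
by exists n.+1; split => //; rewrite pellSS -ey1 -ey; ring.
Qed.

(** The factor [pell b m.+2 - pell b m] is the companion Lucas number of index m + 1. Modulo it, a
    shift of the index by 2(m + 1) changes the sign of the sequence. *)
Lemma pell_double b m i : pell b (i + m.+1 + m.+1) + pell b i =
  (pell b m.+2 - pell b m) * pell b (i + m.+1).
Proof.
elim/nat_ind2: i => [||i IH1 IH2].
- by rewrite !add0n addSn -addnS pell_add !pellSS /=; ring.
- rewrite (_ : (1 + m.+1 + m.+1 = m.+2 + m.+1)%N) // pell_add add1n !pellSS.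
  have := pell_inv b m; move: (pell b m.+1) (pell b m) => x y e.
  by rewrite [pell b 1]/= -e; ring.
rewrite !addSn !pellSS.
have -> : b * pell b (i + m.+1 + m.+1).+1 - pell b (i + m.+1 + m.+1)
   + (b * pell b i.+1 - pell b i) =
  b * (pell b (i.+1 + m.+1 + m.+1) + pell b i.+1)
  - (pell b (i + m.+1 + m.+1) + pell b i) by rewrite !addSn; ring.
by rewrite IH1 IH2 !addSn !addnS !pellSS; ring.
Qed.

Lemma pell_reflect b m i : (i <= m.+1)%N -> pell b (m.+1 + i) - pell b (m.+1 - i) =
  (pell b m.+2 - pell b m) * pell b i.
Proof.
elim/nat_ind2: i => [||i IH1 IH2] h.
- by rewrite addn0 subn0 /=; ring.
- by rewrite addn1 subn1 /=; ring.
have := IH1 (ltnW (ltnW h)); have := IH2 (ltnW h).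
set k := (m.+1 - i.+2)%N.
have -> : (m.+1 - i.+1 = k.+1)%N by rewrite /k; lia.
have -> : (m.+1 - i = k.+2)%N by rewrite /k; lia.
rewrite !addnS !pellSS => e1 e2.
set v := (X in _ = X * _).
have -> : v * (b * pell b i.+1 - pell b i) = b * (v * pell b i.+1) - v * pell b i by ring.
by rewrite -e1 -e2; ring.
Qed.

(** Reduces an arbitrary index modulo the companion number. The signs in the two disjunctions are
    independent; [pell_cond_sound] disposes of each minus sign by a size bound. *)
Lemma pell_period b m n : exists j,
  [/\ (j <= m.+1)%N,
      ((m.+1 + m.+1)%:Z %| n%:Z - j%:Z)%Z \/ ((m.+1 + m.+1)%:Z %| n%:Z + j%:Z)%Z &
      ((pell b m.+2 - pell b m) %| pell b n - pell b j)%Z \/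
      ((pell b m.+2 - pell b m) %| pell b n + pell b j)%Z].
Proof.
elim/ltn_ind: n => n IH.
have [nm|mn] := leqP n m.+1.
  by exists n; split=> //; left; rewrite subrr dvdz0.
have [n2|n2] := leqP n (m.+1 + m.+1).
  exists (m.+1 + m.+1 - n)%N; split; first lia.
    by right; have -> : n%:Z + (m.+1 + m.+1 - n)%N%:Z = (m.+1 + m.+1)%:Z by lia.
  left; have := @pell_reflect b m (n - m.+1) ltac:(lia).
  have -> : (m.+1 + (n - m.+1) = n)%N by lia.
  have -> : (m.+1 - (n - m.+1) = m.+1 + m.+1 - n)%N by lia.
  by move=> ->; rewrite dvdz_mulr.
have [|j [jm hj hp]] := IH (n - (m.+1 + m.+1))%N; first lia.
exists j; split => //.
  have e : n%:Z = (n - (m.+1 + m.+1))%N%:Z + (m.+1 + m.+1)%N%:Z by clear -n2; lia.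
  by rewrite {1 2}e; case: hj => hj; [left|right]; rewrite addrAC rpredD.
have := pell_double b m (n - (m.+1 + m.+1)).
have -> : (n - (m.+1 + m.+1) + m.+1 + m.+1 = n)%N by clear -n2; lia.
move: (pell _ (_ - _)) hp (pell b (_ - _ + _)) => x hp y e.
have -> : pell b n = (pell b m.+2 - pell b m) * y - x by rewrite -e; ring.
case: hp => hp; [right|left].
  have -> : (pell b m.+2 - pell b m) * y - x + pell b j =
    (pell b m.+2 - pell b m) * y - (x - pell b j) by ring.
  by rewrite rpredB // dvdz_mulr.
have -> : (pell b m.+2 - pell b m) * y - x - pell b j =
  (pell b m.+2 - pell b m) * y - (x + pell b j) by ring.
by rewrite rpredB // dvdz_mulr.
Qed.
End PellSequence.

(** * Divisibility conditions that define Pell terms and powers *)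

Module PellDefinability.
Import all_boot all_order all_algebra.
Import zify ring.
Import PellSequence.
Set Implicit Arguments. Unset Strict Implicit. Unset Printing Implicit Defensive.
Import Order.TTheory GRing.Theory Num.Theory.
Local Open Scope ring_scope.

Lemma dvdz_small (d z : int) : (d %| z)%Z -> - d < z -> z < d -> z = 0.
Proof.
move/dvdzP=> [k ->] h1 h2; have d0 : 0 < d by lia.
move: h1 h2; rewrite -{1}mulN1r -{4}[d]mul1r !ltr_pM2r // => h1 h2.
have -> : k = 0 by lia.
by rewrite mul0r.
Qed.

Lemma pell_coprime b n : coprimez (pell b n.+1) (pell b n).
Proof.
apply/coprimezP; exists (pell b n.+1 - b * pell b n, pell b n).
by rewrite /= -[RHS](pell_inv b n); ring.
Qed.

(** Modulo A = [pell b k.+1] the transition matrix over k + 1 steps is scalar, with entry P =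
    [pell b k.+2]. Its powers are therefore known modulo A, and the off-diagonal entry is known
    modulo A^2, as in a first-order expansion. *)
Lemma pell_mulmod b k l :
  (pell b k.+1 %| pell b (k.+1 * l).+1 - pell b k.+2 ^+ l)%Z /\
  (pell b k.+1 ^+ 2 %| pell b (k.+1 * l.+1)
     - l.+1%:Z * pell b k.+1 * pell b k.+2 ^+ l)%Z.
Proof.
have base1 : (pell b k.+1 %| pell b (k.+1 * 0).+1 - pell b k.+2 ^+ 0)%Z.
  by rewrite muln0 expr0 subrr dvdz0.
have h1 : forall l, (pell b k.+1 %| pell b (k.+1 * l).+1 - pell b k.+2 ^+ l)%Z.
  elim=> [//|j IH].
  rewrite (_ : ((k.+1 * j.+1).+1 = (k.+1 * j).+1 + k.+1)%N); last by lia.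
  rewrite pell_add exprS.
  have -> : pell b (k.+1 * j).+2 = b * pell b (k.+1 * j).+1 - pell b (k.+1 * j) by [].
  have -> : (b * pell b (k.+1 * j).+1 - pell b (k.+1 * j)) * pell b k.+1
     - pell b (k.+1 * j).+1 * pell b k - pell b k.+2 * pell b k.+2 ^+ j
    = pell b k.+2 * (pell b (k.+1 * j).+1 - pell b k.+2 ^+ j)
      - pell b (k.+1 * j) * pell b k.+1 by rewrite (pellSS b k); ring.
  by apply: rpredB; [apply: dvdz_mull|apply: dvdz_mull].
split; first exact: h1.
elim: l => [|l IH]; first by rewrite muln1 expr0 mulr1 mul1r subrr dvdz0.
rewrite mulnS addnC pell_add.
have /dvdzP[x ex] := h1 l.+1; have /dvdzP[y ey] := IH.
set A := pell b k.+1 in x ex y ey *; set P := pell b k.+2 in ex ey *.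
have -> : pell b k = b * A - P by rewrite /A /P pellSS; ring.
have -> : pell b (k.+1 * l.+1).+1 = x * A + P ^+ l.+1 by rewrite -ex; ring.
have -> : pell b (k.+1 * l.+1) = y * A ^+ 2 + l.+1%:Z * A * P ^+ l by rewrite -ey; ring.
apply/dvdzP; exists (x - y * (b * A - P) - l.+1%:Z * b * P ^+ l).
by rewrite -[l.+2]addn1 PoszD exprS; ring.
Qed.

Lemma pell_dvd b k l : (pell b k.+1 %| pell b (k.+1 * l))%Z.
Proof.
case: l => [|l]; first by rewrite muln0 dvdz0.
have [_ /dvdzP[y ey]] := pell_mulmod b k l.
apply/dvdzP; exists (y * pell b k.+1 + l.+1%:Z * pell b k.+2 ^+ l).
apply/eqP; rewrite -subr_eq0; apply/eqP.
move: ey => /eqP; rewrite subr_eq => /eqP ->; ring.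
Qed.

Lemma pell_dvd_idx b k m : 2 <= b -> (pell b k.+1 %| pell b m)%Z -> (k.+1 %| m)%N.
Proof.
move=> hb; rewrite {1}(divn_eq m k.+1) mulnC /dvdn.
move: (m %/ k.+1)%N => l; have := ltn_pmod m (isT : (0 < k.+1)%N).
case: (m %% k.+1)%N => // j jk.
rewrite pell_add => h.
have : (pell b k.+1 %| pell b (k.+1 * l).+1 * pell b j.+1)%Z.
  have -> : pell b (k.+1 * l).+1 * pell b j.+1 =
    (pell b (k.+1 * l).+1 * pell b j.+1 - pell b (k.+1 * l) * pell b j)
    + pell b (k.+1 * l) * pell b j by ring.
  by apply: rpredD => //; apply: dvdz_mulr; apply: pell_dvd.
rewrite Gauss_dvdzr; last first.
  rewrite coprimez_sym; have := pell_coprime b (k.+1 * l).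
  by apply: coprimez_dvdr; apply: pell_dvd.
move=> /dvdz_small; have := pell_lt hb jk; have := pell_ltS k hb.
have := pell_ltS j hb. lia.
Qed.

(** Matiyasevich's step-down: by the expansion modulo A^2, divisibility of a term by a square forces
    a divisibility of its index. *)
Lemma pell_sq_dvd b k m : 2 <= b -> (pell b k.+1 ^+ 2 %| pell b m)%Z ->
  (pell b k.+1 %| m%:Z)%Z.
Proof.
move=> hb h.
have /dvdnP[l em] : (k.+1 %| m)%N.
  by apply: (@pell_dvd_idx b) => //; apply: dvdz_trans h; rewrite expr2 dvdz_mulr.
case: l em => [->|l em]; first by rewrite mul0n.
move: h; rewrite {m}em mulnC => h.
have [_ h2] := pell_mulmod b k l.
have : (pell b k.+1 ^+ 2 %| pell b k.+1 * (l.+1%:Z * pell b k.+2 ^+ l))%Z.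
  have -> : pell b k.+1 * (l.+1%:Z * pell b k.+2 ^+ l) = pell b (k.+1 * l.+1) -
     (pell b (k.+1 * l.+1) - l.+1%:Z * pell b k.+1 * pell b k.+2 ^+ l) by ring.
  by apply: rpredB.
have p0 : pell b k.+1 != 0 by have := pell_ltS k hb; lia.
rewrite expr2 dvdz_mul2l // Gauss_dvdzl; last first.
  by rewrite coprimez_sym coprimezXl // pell_coprime.
by rewrite PoszM; apply: dvdz_mull.
Qed.

(** The pairs (u, t) and (s, r) consist of consecutive terms for b, v = bs - 2r is the companion
    number at the index of s, and x is a term for the base w, of unknown index n. As w is b modulo v
    and 2 modulo u, x is the term of index n for b modulo v, and it is n itself modulo u. The
    remaining congruences tie a and c to x. *)
Definition pell_cond (b c a : int) (u t r s w x y : int) : Prop :=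
  [/\ u ^+ 2 - b * u * t + t ^+ 2 = 1, s ^+ 2 - b * s * r + r ^+ 2 = 1,
      (r < s) /\ (u ^+ 2 %| s)%Z,
      ((b * s - 2 * r) %| w - b)%Z /\ (u %| w - 2)%Z &
      [/\ 2 < w, x ^+ 2 - w * x * y + y ^+ 2 = 1,
          (2 * a < u) /\ (2 * a < b * s - 2 * r),
          ((b * s - 2 * r) %| a - x)%Z & (2 * c < u) /\ (u %| c - x)%Z]].

Lemma pell_solve_sym b (x y : int) : 3 <= b -> 0 <= x -> 0 <= y ->
  x ^+ 2 - b * x * y + y ^+ 2 = 1 -> exists n, x = pell b n.
Proof.
move=> hb x0 y0 e.
have [yx|xy|xy] := ltgtP y x.
- have hb2 : 2 <= b by lia.
  by have [n [-> _]] := @pell_solve b x y hb2 y0 yx e; exists n.+1.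
- have hb2 : 2 <= b by lia.
  have [|n [_ ->]] := @pell_solve b y x hb2 x0 xy; last by exists n.
  by rewrite -[RHS]e; ring.
move: e; rewrite -xy; have -> : y ^+ 2 - b * y * y + y ^+ 2 = (2 - b) * y ^+ 2 by ring.
have : 0 <= y ^+ 2 by apply: sqr_ge0. nia.
Qed.

Lemma pell_cond_sound (b c a u t r s w x y : int) :
  4 <= b -> 0 <= c -> 0 <= a -> 0 <= u -> 0 <= t -> 0 <= r -> 0 <= s -> 0 <= x -> 0 <= y ->
  pell_cond b c a u t r s w x y -> a = pell b `|c|%N.
Proof.
move=> hb c0 a0 u0 t0 r0 s0 x0 y0.
move=> [eu es [rs us] [wb w2] [w3 ex [au av] ax [cu cx]]].
have hb2 : 2 <= b by lia. have hb3 : 3 <= b by lia.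
have [k ek] := pell_solve_sym hb3 u0 t0 eu.
have [m [em1 em0]] := @pell_solve b s r hb2 r0 rs es.
case: k ek => [ek|k ek]; first by move: au; rewrite ek /= => au; clear -au a0; lia.
(* Hence the period 2(m + 1) of the reduction modulo v is also a multiple of u, and the same reduced
   index j serves both moduli. *)
have um : (u %| m.+1%:Z)%Z by rewrite ek; apply: (pell_sq_dvd hb2); rewrite -ek -em1.
set v := b * s - 2 * r in wb av ax *.
have ev : v = pell b m.+2 - pell b m by rewrite /v pellSS em1 em0; ring.
have w3' : 3 <= w by clear -w3; lia.
have [n en] := pell_solve_sym w3' x0 y0 ex.
have [j [jm hj hp]] := pell_period b m n.
have xv : (v %| x - pell b n)%Z by rewrite en; apply: pell_modb.
have vj : 2 * pell b j < v.
  have := pell_le hb2 jm; have := pell_ltS m hb2.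
  rewrite /v em1 em0; clear -hb; nia.
have j0 := pell_ge0 j hb2.
have aj : a = pell b j.
  have av' : (v %| a - pell b n)%Z.
    have -> : a - pell b n = (a - x) + (x - pell b n) by ring.
    exact: rpredD.
  rewrite -ev in hp; case: hp => hp.
    have h : (v %| a - pell b j)%Z.
      have -> : a - pell b j = (a - pell b n) + (pell b n - pell b j) by ring.
      exact: rpredD.
    by have := dvdz_small h; clear -a0 j0 av vj; lia.
  have h : (v %| a + pell b j)%Z.
    have -> : a + pell b j = (a - pell b n) + (pell b n + pell b j) by ring.
    exact: rpredD.
  by have := dvdz_small h; clear -a0 j0 av vj; lia.
have xu : (u %| x - n%:Z)%Z.
  have := @pell_modb w 2 u n w2; by rewrite -en pell2.
have cn : (u %| c - n%:Z)%Z.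
  have -> : c - n%:Z = (c - x) + (x - n%:Z) by ring.
  exact: rpredD.
have um2 : (u %| (m.+1 + m.+1)%:Z)%Z by rewrite PoszD; apply: rpredD.
have ja := pell_ge_id j hb2; rewrite -aj in ja.
have cj : c = j%:Z.
  case: hj => hj; have {}hj := dvdz_trans um2 hj.
    have h : (u %| c - j%:Z)%Z.
      have -> : c - j%:Z = (c - n%:Z) + (n%:Z - j%:Z) by ring.
      exact: rpredD.
    by have := dvdz_small h; clear -c0 cu ja au; lia.
  have h : (u %| c + j%:Z)%Z.
    have -> : c + j%:Z = (c - n%:Z) + (n%:Z + j%:Z) by ring.
    exact: rpredD.
  by have := dvdz_small h; clear -c0 cu ja au; lia.
by rewrite cj aj.
Qed.

Lemma pell_cond_complete (b : int) (c : nat) : 4 <= b ->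
  exists u t r s w x y : nat, 
  pell_cond b c%:Z (pell b c) u%:Z t%:Z r%:Z s%:Z w%:Z x%:Z y%:Z.
Proof.
move=> hb; have hb2 : 2 <= b by lia.
have a0 := pell_ge0 c hb2; set a := pell b c in a0 *.
(* An odd term exists because two consecutive terms are coprime. As u divides s, v is -2r modulo u,
   so an odd u is coprime to v and w exists by the Chinese remainder theorem. *)
have [k [ku uodd]] : exists k, (`|a| + `|a| + (c + c) <= k)%N /\ coprimez (pell b k.+1) 2.
  set k0 := (`|a| + `|a| + (c + c))%N.
  have c2 (z : int) : coprimez z 2 \/ (2 %| z)%Z.
    have [h|h] := boolP (2 %| z)%Z; [by right|left].
    rewrite coprimezE /= coprimen2; move: h; rewrite dvdzE /= dvdn2.
    by rewrite negbK.
  have [h|h] := c2 (pell b k0.+1); first by exists k0.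
  have [h'|h'] := c2 (pell b k0.+2); first by exists k0.+1.
  have := pell_coprime b k0.+1; rewrite coprimezE => /eqP e.
  have : (2 %| gcdn `|pell b k0.+2| `|pell b k0.+1|)%N by rewrite dvdn_gcd; move: h h'; rewrite !dvdzE /= => -> ->.
  by rewrite e.
have u0 := pell_ge0 k.+1 hb2; have t0 := pell_ge0 k hb2.
set u := pell b k.+1 in uodd u0 *; set t := pell b k in t0 *.
have ku2 : k.+1%:Z <= u by apply: pell_ge_id.
have [m em] : exists m, m.+1 = (k.+1 * `|u|)%N.
  by exists (k.+1 * `|u|).-1; rewrite prednK // muln_gt0 /=; lia.
have s0 := pell_ge0 m.+1 hb2; have r0 := pell_ge0 m hb2.
have rs := pell_ltS m hb2.
set s := pell b m.+1 in s0 rs *; set r := pell b m in r0 rs *.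
have us : (u ^+ 2 %| s)%Z.
  have [l el] : exists l, `|u|%N = l.+1 by exists `|u|%N.-1; lia.
  have := (pell_mulmod b k l).2; rewrite -el -em -/u -/s => h.
  have -> : s = (s - `|u|%N%:Z * u * pell b k.+2 ^+ l) + `|u|%N%:Z * u * pell b k.+2 ^+ l by ring.
  apply: rpredD => //; rewrite gez0_abs //; apply: dvdz_mulr; by rewrite expr2.
have us1 : (u %| s)%Z by apply: dvdz_trans us; rewrite expr2 dvdz_mulr.
set v := b * s - 2 * r.
have uv : coprimez u v.
  rewrite /v.
  have -> : b * s - 2 * r = - (2 * r - b * s) by ring.
  rewrite coprimezN.
  have /dvdzP[z ez] := us1.
  have -> : 2 * r - b * s = (- (b * z)) * u + 2 * r by rewrite {1}ez; ring.
  rewrite /coprimez gcdzMDl -/(coprimez _ _) coprimezMr uodd /=.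
  by have := pell_coprime b m; apply: coprimez_dvdl; rewrite -/s.
have us2 : u <= s by apply: pell_le => //; rewrite em; nia.
have vpos : 2 * s < v by rewrite /v; nia.
have [w [w3 wb w2]] : exists w : int, [/\ 2 < w, (v %| w - b)%Z & (u %| w - 2)%Z].
  have /coprimezP[[x y] /= e] := uv.
  set w0 := 2 + (b - 2) * x * u.
  exists (w0 + (`|w0|%N%:Z + 3) * (u * v)); split.
  - have : 1 <= u * v by nia.
    move: (u * v) => z z1; nia.
  - have -> : w0 + (`|w0|%N%:Z + 3) * (u * v) - b =
       ((b - 2) * (x * u + y * v) - (b - 2)) + v * ((`|w0|%N%:Z + 3) * u - (b - 2) * y).
      by rewrite /w0; ring.
    by rewrite e mulr1 subrr add0r dvdz_mulr.
  - have -> : w0 + (`|w0|%N%:Z + 3) * (u * v) - 2 =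
       u * ((b - 2) * x + (`|w0|%N%:Z + 3) * v) by rewrite /w0; ring.
    by rewrite dvdz_mulr.
have hw2 : 2 <= w by lia.
have x0 := pell_ge0 c hw2; have y0 := pell_ge0 c.+1 hw2.
have w0 : 0 <= w by lia.
exists `|u|%N, `|t|%N, `|r|%N, `|s|%N, `|w|%N, `|pell w c|%N, `|pell w c.+1|%N.
rewrite !gez0_abs //; split=> //.
- exact: pell_inv.
- exact: pell_inv.
- by split=> //; case/andP: rs.
split=> //.
- by rewrite -[RHS](pell_inv w c); ring.
- by split; move: ku us2 vpos ku2; rewrite -/v; clear -u0 s0; lia.
- by rewrite -/v -opprB rpredN; apply: pell_modb.
- split; first by clear -ku ku2 a0; lia.
  by rewrite -opprB rpredN -pell2; apply: pell_modb.
Qed.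

(** Modulo bq - q^2 - 1 the number q is a root of X^2 - bX + 1, so its powers obey the recurrence of
    the sequence. *)
Lemma pell_exp_mod b q n : ((b * q - q ^+ 2 - 1) %| q ^+ n - (pell b n.+1 - (b - q) * pell b n))%Z.
Proof.
elim/nat_ind2: n => [||n IH1 IH2].
- by rewrite /= mulr0 subr0 expr0 subrr dvdz0.
- by rewrite (_ : q ^+ 1 - _ = 0) ?dvdz0 //=; ring.
set d := b * q - q ^+ 2 - 1 in IH1 IH2 *.
have -> : q ^+ n.+2 - (pell b n.+3 - (b - q) * pell b n.+2) =
  - d * q ^+ n + (b * (q ^+ n.+1 - (pell b n.+2 - (b - q) * pell b n.+1))
  - (q ^+ n - (pell b n.+1 - (b - q) * pell b n))).
  by rewrite (pellSS b n.+1) (pellSS b n) /d !exprS; ring.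
apply: rpredD; first by apply: dvdz_mulr; rewrite rpredN.
by apply: rpredB => //; apply: dvdz_mull.
Qed.

(** A Pell term for the base q + 4 is a bound for q^n that is already known to be Diophantine: it is
    at least (q + 3)^n. With this b the modulus of [pell_exp_mod] exceeds q^n, so the congruence
    determines the power. *)
Lemma pell_exp_bound (q : int) n b : 1 <= q ->
  b = pell (q + 4) n.+1 + q ^+ 2 + 2 -> q ^+ n < b * q - q ^+ 2 - 1 /\ 4 <= b.
Proof.
move=> q1 eb.
have hq : 2 <= q + 4 by lia.
have h2 : q ^+ n <= (q + 4 - 1) ^+ n by apply: lerXn2r; rewrite ?nnegrE; lia.
have h3 := pell_ge_exp n hq; have h4 := pell_ge_id n.+1 hq; rewrite eb.
move: (q ^+ n) h2 => x h2; have {h2 h3} h := le_trans h2 h3.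
move: (pell _ _) h4 h => z h4 h.
have h5 : z <= z * q by apply: ler_peMr => //; lia.
have h6 : 1 <= q ^+ 2 by apply: exprn_ege1.
have h7 : q ^+ 2 <= q ^+ 2 * q by apply: ler_peMr => //; lia.
have -> : (z + q ^+ 2 + 2) * q - q ^+ 2 - 1 = z * q + q ^+ 2 * q + 2 * q - q ^+ 2 - 1 by ring.
move: (q ^+ 2 * q) (q ^+ 2) (z * q) h5 h6 h7 => y1 y2 y3 h5 h6 h7; clear -q1 h h4 h5 h6 h7; lia.
Qed.

Lemma pell_exp_unique (b q p : int) n : 1 <= q -> 0 <= p ->
  b = pell (q + 4) n.+1 + q ^+ 2 + 2 -> p < b * q - q ^+ 2 - 1 ->
  ((b * q - q ^+ 2 - 1) %| p - (pell b n.+1 - (b - q) * pell b n))%Z <-> p = q ^+ n.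
Proof.
move=> q1 p0 eb pb; split=> [h|->]; last exact: pell_exp_mod.
set d := b * q - q ^+ 2 - 1 in h pb *.
have h1 : (d %| p - q ^+ n)%Z.
  have -> : p - q ^+ n = (p - (pell b n.+1 - (b - q) * pell b n))
    - (q ^+ n - (pell b n.+1 - (b - q) * pell b n)) by ring.
  by apply: rpredB => //; apply: pell_exp_mod.
have [qn _] := pell_exp_bound q1 eb; rewrite -/d in qn.
have qn0 : 0 <= q ^+ n by apply: exprn_ge0; lia.
move: (q ^+ n) h1 qn qn0 => z h1 qn qn0.
by have := dvdz_small h1; clear -pb p0 qn qn0; clearbody d; lia.
Qed.
End PellDefinability.

(** * Diophantine sets and functions, and their closure properties *)

Module Diophantine.
Import all_boot all_order all_algebra.
Import zify ring.
Import PellSequence PellDefinability.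
Set Implicit Arguments. Unset Strict Implicit. Unset Printing Implicit Defensive.
Import Order.TTheory GRing.Theory Num.Theory.
Local Open Scope ring_scope.
Local Open Scope nat_scope.

(* [DP] are parameters, [DV] existentially quantified unknowns. *)
Inductive dexp := DC of nat | DP of nat | DV of nat | DA of dexp & dexp | DM of dexp & dexp.

Fixpoint dev (v x : nat -> nat) e := match e with
  | DC c => c | DP i => v i | DV i => x i
  | DA a b => dev v x a + dev v x b | DM a b => dev v x a * dev v x b end.

Definition dio (S : (nat -> nat) -> Prop) := exists p q, forall v,
  S v <-> exists x, dev v x p = dev v x q.

(** The graph of t with the value as parameter 0 and the arguments shifted by one. This matches the
    shift in [dio_ex], so that composition is quantification over the intermediate value. *)
Definition diof (t : (nat -> nat) -> nat) :=
  dio (fun v => v 0 = t (fun i => v i.+1)).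

Fixpoint dsub (fp fv : nat -> dexp) e := match e with
  | DC c => DC c | DP i => fp i | DV i => fv i
  | DA a b => DA (dsub fp fv a) (dsub fp fv b)
  | DM a b => DM (dsub fp fv a) (dsub fp fv b) end.

Lemma dev_sub fp fv v x e : dev v x (dsub fp fv e) =
  dev (fun i => dev v x (fp i)) (fun i => dev v x (fv i)) e.
Proof. by elim: e => //= a -> b ->. Qed.

Lemma dev_ext v v' x x' e : v =1 v' -> x =1 x' -> dev v x e = dev v' x' e.
Proof. by move=> h h'; elim: e => //= a -> b ->. Qed.

Lemma dio_ext S S' : (forall v, S v <-> S' v) -> dio S' -> dio S.
Proof. by move=> h [p [q H]]; exists p, q => v; rewrite h. Qed.

(** The unknowns of two equations are kept apart by the parity of their indices. *)
Definition evens (e : dexp) := dsub DP (fun i => DV (2 * i)) e.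
Definition odds (e : dexp) := dsub DP (fun i => DV (2 * i).+1) e.
Definition merge (x y : nat -> nat) i := if odd i then y i./2 else x i./2.

Lemma dev_evens v x y e : dev v (merge x y) (evens e) = dev v x e.
Proof.
by rewrite dev_sub; apply: dev_ext => i //=; rewrite /merge mul2n odd_double doubleK.
Qed.

Lemma dev_odds v x y e : dev v (merge x y) (odds e) = dev v y e.
Proof.
rewrite dev_sub; apply: dev_ext => i //=.
by rewrite /merge mul2n /= odd_double /= uphalf_double.
Qed.

(** The difference of the two sides of the equation is (a - b)^2 + (c - d)^2, written without
    subtraction. *)
Lemma sqr_sum (a b c d : nat) :
  a * a + b * b + (c * c + d * d) = 2 * (a * b + c * d) <-> a = b /\ c = d.
Proof.
split=> [h|[-> ->]]; last by lia.
have [h1 e1] := nat_Cauchy a b; have [h2 e2] := nat_Cauchy c d.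
by split; apply/eqP; rewrite -?e1 -?e2; lia.
Qed.

(** The difference of the two sides is (a - b)(c - d). *)
Lemma prod_sum (a b c d : nat) : a * c + b * d = a * d + b * c <-> a = b \/ c = d.
Proof. by split=> [h|[]->]; nia. Qed.

Lemma dio_and A B : dio A -> dio B -> dio (fun v => A v /\ B v).
Proof.
move=> [p1 [q1 H1]] [p2 [q2 H2]].
pose a := evens p1; pose b := evens q1; pose c := odds p2; pose d := odds q2.
exists (DA (DA (DM a a) (DM b b)) (DA (DM c c) (DM d d))).
exists (DM (DC 2) (DA (DM a b) (DM c d))) => v; rewrite H1 H2; split.
  move=> [[x hx] [y hy]]; exists (merge x y) => /=.
  by rewrite !dev_evens !dev_odds hx hy; lia.
move=> [x /= /sqr_sum[hx hy]]; split.
  exists (fun i => x (2 * i)); move: hx.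
  by rewrite !dev_sub.
exists (fun i => x (2 * i).+1); move: hy.
by rewrite !dev_sub.
Qed.

Lemma dio_or A B : dio A -> dio B -> dio (fun v => A v \/ B v).
Proof.
move=> [p1 [q1 H1]] [p2 [q2 H2]].
pose a := evens p1; pose b := evens q1; pose c := odds p2; pose d := odds q2.
exists (DA (DM a c) (DM b d)), (DA (DM a d) (DM b c)) => v; rewrite H1 H2; split.
  case=> [[x hx]|[y hy]].
    by exists (merge x (fun=> 0)) => /=; apply/prod_sum; left; rewrite !dev_evens.
  by exists (merge (fun=> 0) y) => /=; apply/prod_sum; right; rewrite !dev_odds.
move=> [x /= /prod_sum[hx|hy]].
  left; exists (fun i => x (2 * i)); move: hx.
  by rewrite !dev_sub.
right; exists (fun i => x (2 * i).+1); move: hy.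
by rewrite !dev_sub.
Qed.

Definition scons (n : nat) (v : nat -> nat) i := if i is j.+1 then v j else n.

Lemma dio_ex (R : nat -> (nat -> nat) -> Prop) :
  dio (fun v => R (v 0) (fun i => v i.+1)) -> dio (fun v => exists n, R n v).
Proof.
move=> [p [q H]].
pose f := dsub (fun i => if i is j.+1 then DP j else DV 0) (fun i => DV i.+1).
exists (f p), (f q) => v; split.
  move=> [n hn]; have /H[x hx] : R (scons n v 0) (fun i => scons n v i.+1) by [].
  exists (scons n x); rewrite !dev_sub.
  by rewrite !(@dev_ext _ (scons n v) _ x) // => -[].
move=> [x hx]; exists (x 0).
apply: (proj2 (H (scons (x 0) v))); exists (fun i => x i.+1).
by move: hx; rewrite !dev_sub !(@dev_ext _ (scons (x 0) v) _ (fun i => x i.+1)) // => -[].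
Qed.

Lemma dio_ren (S : (nat -> nat) -> Prop) (r : nat -> nat) :
  dio S -> dio (fun v => S (fun i => v (r i))).
Proof.
move=> [p [q H]]; exists (dsub (fun i => DP (r i)) DV p), (dsub (fun i => DP (r i)) DV q) => v.
by rewrite H; split=> -[x hx]; exists x; move: hx; rewrite !dev_sub.
Qed.

Lemma dio_let (t : (nat -> nat) -> nat) (R : nat -> (nat -> nat) -> Prop) :
  diof t -> dio (fun v => R (v 0) (fun i => v i.+1)) -> dio (fun v => R (t v) v).
Proof.
move=> ht hR.
apply: (@dio_ext _ (fun v => exists n, n = t v /\ R n v)).
  by move=> v; split=> [h|[n [-> //]]]; exists (t v).
by apply: dio_ex; apply: dio_and.
Qed.

Lemma diof_ren t (r : nat -> nat) : diof t -> diof (fun v => t (fun i => v (r i))).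
Proof. by move=> /(dio_ren (fun i => if i is j.+1 then (r j).+1 else 0)). Qed.

Lemma dio_rel2 (R : nat -> nat -> Prop) s t : dio (fun v => R (v 0) (v 1)) ->
  diof s -> diof t -> dio (fun v => R (s v) (t v)).
Proof.
move=> hR hs ht; apply: (@dio_let s (fun n v => R n (t v))) => //.
apply: (@dio_let (fun v => t (fun i => v i.+1)) (fun n v => R (v 0) n)).
  exact: diof_ren.
exact: (@dio_ren _ (fun i => if i is 0 then 1 else 0) hR).
Qed.

Lemma dio_rel3 (R : nat -> nat -> nat -> Prop) s t u :
  dio (fun v => R (v 0) (v 1) (v 2)) ->
  diof s -> diof t -> diof u -> dio (fun v => R (s v) (t v) (u v)).
Proof.
move=> hR hs ht hu; apply: (@dio_let s (fun n v => R n (t v) (u v))) => //.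
apply: (@dio_let (fun v => t (fun i => v i.+1)) (fun n v => R (v 0) n (u (fun i => v i.+1)))).
  exact: diof_ren.
apply: (@dio_let (fun v => u (fun i => v i.+2)) (fun n v => R (v 1) (v 0) n)).
  exact: diof_ren.
exact: (@dio_ren _ (fun i => match i with 0 => 2 | 1 => 1 | _ => 0 end) hR).
Qed.

Lemma diof_var k : diof (fun v => v k).
Proof. by exists (DP 0), (DP k.+1) => v; split=> [h|[x //]]; exists (fun=> 0). Qed.

Lemma diof_const c : diof (fun v => c).
Proof. by exists (DP 0), (DC c) => v; split=> [h|[x //]]; exists (fun=> 0). Qed.

Lemma dio_eq s t : diof s -> diof t -> dio (fun v => s v = t v).
Proof.
apply: dio_rel2; exists (DP 0), (DP 1) => v.
by split=> [h|[x //]]; exists (fun=> 0).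
Qed.

Lemma diof_fun1 (f : nat -> nat) s : dio (fun v => v 0 = f (v 1)) -> diof s ->
  diof (fun v => f (s v)).
Proof.
move=> hf hs; apply: (@dio_rel2 (fun a b => a = f b) (fun v => v 0)) => //.
  exact: diof_var.
exact: diof_ren.
Qed.

Lemma diof_fun2 (f : nat -> nat -> nat) s t : dio (fun v => v 0 = f (v 1) (v 2)) ->
  diof s -> diof t -> diof (fun v => f (s v) (t v)).
Proof.
move=> hf hs ht; apply: (@dio_rel3 (fun a b c => a = f b c) (fun v => v 0)) => //.
- exact: diof_var.
- exact: diof_ren.
- exact: diof_ren.
Qed.

Lemma diof_add s t : diof s -> diof t -> diof (fun v => s v + t v).
Proof.
apply: diof_fun2; exists (DP 0), (DA (DP 1) (DP 2)) => v.
by split=> [h|[x //]]; exists (fun=> 0).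
Qed.

Lemma diof_mul s t : diof s -> diof t -> diof (fun v => s v * t v).
Proof.
apply: diof_fun2; exists (DP 0), (DM (DP 1) (DP 2)) => v.
by split=> [h|[x //]]; exists (fun=> 0).
Qed.

Lemma diof_S s : diof s -> diof (fun v => (s v).+1).
Proof.
apply: diof_fun1; exists (DP 0), (DA (DP 1) (DC 1)) => v.
by split=> [h|[x]] /=; rewrite ?addn1 //; exists (fun=> 0); rewrite /= addn1.
Qed.

Lemma dio_leq s t : diof s -> diof t -> dio (fun v => s v <= t v).
Proof.
move=> hs ht; apply: (@dio_ext _ (fun v => exists k, t v = s v + k)).
  by move=> v; split=> [h|[k ->]]; [exists (t v - s v); lia|lia].
apply: dio_ex; apply: dio_eq; first exact: diof_ren.
by apply: diof_add; [exact: diof_ren|exact: diof_var].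
Qed.

Ltac dio_step :=
  lazymatch goal with
  | |- dio (fun v => @?A v /\ @?B v) => apply (@dio_and A B)
  | |- dio (fun v => @?A v \/ @?B v) => apply (@dio_or A B)
  | |- dio (fun v => exists n, @?R v n) => apply (@dio_ex (fun n v => R v n))
  | |- dio (fun v => @?s v = @?t v :> nat) => apply (@dio_eq s t)
  | |- dio (fun v => is_true (@?s v <= @?t v)) => apply (@dio_leq s t)
  | |- diof (fun v => v ?k) => exact (diof_var k)
  | |- diof (fun _ => ?c) => exact (diof_const c)
  | |- diof (fun v => @?s v + @?t v) => apply (@diof_add s t)
  | |- diof (fun v => @?s v * @?t v) => apply (@diof_mul s t)
  | |- diof (fun v => (@?s v).+1) => apply (@diof_S s)
  end.
(** A hook: it is redefined with [::=] whenever a further function or relation has been shown to be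
    Diophantine. *)
Ltac dio_step' := fail.
Ltac dio := repeat (cbv beta; first [dio_step | dio_step']); cbv beta.

Lemma dio_False : dio (fun _ => False).
Proof. by exists (DC 0), (DC 1) => v; split=> // -[]. Qed.

Lemma dio_True : dio (fun _ => True).
Proof. by exists (DC 0), (DC 0) => v; split=> // _; exists (fun=> 0). Qed.

Definition cong d x y := exists k, x = y + k * d \/ y = x + k * d.

Lemma congP d x y : cong d x y <-> (d%:Z %| (x%:Z - y%:Z)%R)%Z.
Proof.
split=> [[k [->|->]]|/dvdzP[k e]].
- by apply/dvdzP; exists k%:Z; lia.
- by apply/dvdzP; exists (- k%:Z)%R; lia.
exists `|k|%N; case: k e => k e; [left|right]; lia.
Qed.

Lemma dio_cong r s t : diof r -> diof s -> diof t -> dio (fun v => cong (r v) (s v) (t v)).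
Proof. by apply: dio_rel3; rewrite /cong; dio. Qed.

Lemma cong_modn d x y : cong d x y <-> x = y %[mod d].
Proof.
rewrite congP; split=> [h|e]; first by apply/eqP; rewrite -eqz_mod_dvd in h; move: h; rewrite !modz_nat.
by rewrite -eqz_mod_dvd !modz_nat e.
Qed.

Lemma dio_dvdn s t : diof s -> diof t -> dio (fun v => s v %| t v).
Proof.
apply: (@dio_rel2 (fun a b => a %| b)).
apply: (@dio_ext _ (fun v => exists k, v 1 = k * v 0)); last by dio.
by move=> v; split=> [/dvdnP //|h]; apply/dvdnP.
Qed.

Definition ispell (b c a : nat) := (4 <= b) /\ (a%:Z = pell b%:Z c).

Lemma dio_pell r s t : diof r -> diof s -> diof t -> dio (fun v => ispell (r v) (s v) (t v)).
Proof.
apply: dio_rel3 => {r s t}.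
pose E (b c a : nat) := 4 <= b /\ exists u t r s w x y d : nat,
  u * u + t * t = b * u * t + 1 /\ s * s + r * r = b * s * r + 1 /\ r < s /\
  (exists k, s = k * (u * u)) /\ d + 2 * r = b * s /\ cong d w b /\ cong u w 2 /\ 2 < w /\
  x * x + y * y = w * x * y + 1 /\ 2 * a < u /\ 2 * a < d /\ cong d a x /\
  2 * c < u /\ cong u c x.
apply: (@dio_ext _ (fun v => E (v 0) (v 1) (v 2))); last first.
  rewrite /E; dio; apply: dio_cong; dio.
move=> v; rewrite /ispell /E; move: (v 0) (v 1) (v 2) => b c a; split; case=> hb h; split=> //.
  have hb' : (4 <= b%:Z)%R by lia.
  have [u [t [r [s [w [x [y]]]]]]] := pell_cond_complete c hb'; rewrite -h.
  move=> [e1 e2 [rs us] [wb w2] [w3 ex [au av] ax [cu cx]]].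
  have [d ed] : exists d : nat, d%:Z = (b%:Z * s%:Z - 2 * r%:Z)%R 
    by exists (absz (b%:Z * s%:Z - 2 * r%:Z)%R); rewrite gez0_abs //; clear -av; lia.
  rewrite -ed in wb av ax.
  exists u, t, r, s, w, x, y, d; rewrite !congP; do !split=> //.
  - by move: e1; rewrite !expr2; clear; lia.
  - by move: e2; rewrite !expr2; clear; lia.
  - by move: us; rewrite expr2 => /dvdzP[k /(congr1 absz)]; rewrite !abszM /= => ->; exists `|k|%N.
  - by clear -ed; lia.
  - by move: ex; rewrite !expr2; clear; lia.
case: h => u [t [r [s [w [x [y [d]]]]]]].
rewrite !congP => -[e1 [e2 [rs [[k ek] [ed [wb [w2 [w3 [ex [au [av [ax [cu cx]]]]]]]]]]]]].
have ed' : d%:Z = (b%:Z * s%:Z - 2 * r%:Z)%R by clear -ed; lia.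
have -> : c = `|c%:Z|%N by [].
apply: (@pell_cond_sound _ _ _ u t r s w x y) => //.
rewrite /pell_cond -ed' !expr2; do !split=> //.
- by clear -e1; lia.
- by clear -e2; lia.
- by apply/dvdzP; exists k%:Z; clear -ek; lia.
- by clear -ex; lia.
Qed.

(** Makes [pell_exp_unique] into a system over the naturals, with d the modulus bq - q^2 - 1. The
    base 0 is separate because the bound on b needs q >= 1. *)
Lemma exp_pellE p q n : p = q ^ n <->
  (q = 0 /\ n = 0 /\ p = 1) \/ (q = 0 /\ 1 <= n /\ p = 0) \/
  (1 <= q /\ exists z b d x y, ispell (q + 4) n.+1 z /\ b = z + q * q + 2 /\
    d + q * q + 1 = b * q /\ p < d /\ ispell b n.+1 x /\ ispell b n y /\
    cong d (p + b * y) (x + q * y)).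
Proof.
case: q => [|q].
  split=> [->|[[_ [-> ->]]|[[_ [n1 ->]]|[//]]]] //; last by rewrite exp0n.
  by case: n => [|n]; [left|right; left; rewrite exp0n].
have [Q eQ] : exists Q, Q = q.+1 by eexists.
rewrite -eQ; have q1 : (1 <= Q%:Z)%R by rewrite eQ; lia.
have [z ez] : exists z : nat, z%:Z = pell (Q%:Z + 4) n.+1.
  by exists `|pell (Q%:Z + 4) n.+1|%N; rewrite gez0_abs // pell_ge0 //; lia.
have [b eb0] : exists b, b = z + Q * Q + 2 by eexists.
have eb : (b%:Z = pell (Q%:Z + 4) n.+1 + Q%:Z ^+ 2 + 2)%R by rewrite -ez eb0 expr2; lia.
have [hd b4] := pell_exp_bound q1 eb.
have [d ed] : exists d : nat, (d%:Z = b%:Z * Q%:Z - Q%:Z ^+ 2 - 1)%R.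
  exists (absz (b%:Z * Q%:Z - Q%:Z ^+ 2 - 1)%R); rewrite gez0_abs //.
  have : (0 <= Q%:Z ^+ n)%R by apply: exprn_ge0. lia.
have hE : (p < d) -> cong d (p + b * `|pell b%:Z n|%N) (`|pell b%:Z n.+1|%N + Q * `|pell b%:Z n|%N) <-> p%:Z = (Q%:Z ^+ n)%R.
  move=> pd; rewrite -(@pell_exp_unique b%:Z Q%:Z p%:Z n) //; last by rewrite -ed; lia.
  have hb2 : (2 <= b%:Z)%R by clear -b4; lia.
  rewrite congP ed !PoszD !PoszM !gez0_abs ?pell_ge0 //.
  set P := pell _ n.+1; set P' := pell _ n.
  by have -> : (p%:Z + b%:Z * P' - (P + Q%:Z * P') = p%:Z - (P - (b%:Z - Q%:Z) * P'))%R by ring.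
have hpow : p = Q ^ n <-> p%:Z = (Q%:Z ^+ n)%R 
  by have -> : (Q%:Z ^+ n = (Q ^ n)%N%:Z)%R; [rewrite -!natz natrX|split=> [->|[]]].
have pe k : (`|pell b%:Z k|%N%:Z = pell b%:Z k)%R by rewrite gez0_abs // pell_ge0 //; clear -b4; lia.
split.
  move=> /hpow e; right; right; split=> //; exists z, b, d, `|pell b%:Z n.+1|%N, `|pell b%:Z n|%N.
  have pd : p < d by rewrite -e -ed in hd; clear -hd; lia.
  rewrite /ispell !pe; do !split=> //.
  - by clear; lia.
  - by move: ed; rewrite expr2; clear; lia.
  - by apply/(hE pd).
case=> [[e0]|[[e0]|[_ [z' [b' [d' [x [y]]]]]]]]; try by rewrite e0 in eQ.
move=> [[_ ez'] [eb' [ed' [pd [[_ ex] [[_ ey] hc]]]]]].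
have zz : z' = z by apply/eqP; rewrite -eqz_nat ez ez' PoszD.
rewrite zz -eb0 in eb'; rewrite eb' in ed' ex ey hc.
have dd : d' = d by move: ed ed'; rewrite expr2; clear; lia.
rewrite dd in hc pd; apply/hpow/(hE pd).
have -> : `|pell b%:Z n|%N = y by clear -ey; lia.
by have -> : `|pell b%:Z n.+1|%N = x by clear -ex; lia.
Qed.

Lemma diof_exp s t : diof s -> diof t -> diof (fun v => s v ^ t v).
Proof.
apply: diof_fun2; apply: dio_ext; first by move=> v; exact: exp_pellE.
dio; first [apply: dio_pell|apply: dio_cong]; dio.
Qed.

Ltac dio_step' ::= lazymatch goal with
  | |- diof (fun v => @?s v ^ @?t v) => apply (@diof_exp s t)
  | |- dio (fun v => is_true (@?s v %| @?t v)) => apply (@dio_dvdn s t)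
  | |- dio (fun v => cong (@?r v) (@?s v) (@?t v)) => apply (@dio_cong r s t)
  end.
End Diophantine.

(** * Binomials, factorials and bounded universal quantifiers *)

Module BoundedQuantifier.
Import all_boot all_order all_algebra.
Import boolp.
Import zify ring.
Import PellSequence PellDefinability Diophantine.
Set Implicit Arguments. Unset Strict Implicit. Unset Printing Implicit Defensive.

Lemma digitE (c : nat -> nat) u n k : (forall i, c i < u) ->
  ((\sum_(i < n) c i * u ^ i) %/ u ^ k) %% u = if k < n then c k else 0.
Proof.
move=> hc; have u0 : 0 < u by apply: leq_trans (hc 0).
elim: k n c hc => [|k IH] [|n] c hc.
- by rewrite big_ord0 div0n mod0n.
- rewrite expn0 divn1 big_ord_recl /= expn0 muln1.
  under eq_bigr => i _ do rewrite /bump /= add1n expnS mulnCA.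
  by rewrite -big_distrr /= addnC mulnC modnMDl modn_small.
- by rewrite big_ord0 div0n mod0n.
rewrite expnS divnMA big_ord_recl /= expn0 muln1.
under eq_bigr => i _ do rewrite /bump /= add1n expnS mulnCA.
rewrite -big_distrr /= addnC mulnC divnMDl // (divn_small (hc 0)) addn0 ltnS.
exact: (IH n (fun i => c i.+1)).
Qed.

(** The binomial theorem for (u + 1)^n with u = 2^n + 1: all coefficients are below u, hence they
    are the digits in base u. *)
Lemma binom_digit n k : 'C(n, k) = ((2 ^ n).+2 ^ n %/ (2 ^ n).+1 ^ k) %% (2 ^ n).+1.
Proof.
have bin_le i : 'C(n, i) <= 2 ^ n.
  have [h|h] := leqP i n; last by rewrite bin_small.
  rewrite (Pascal 1 1) (bigD1 (Ordinal (h : i < n.+1))) //= !exp1n !muln1.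
  exact: leq_addr.
set u := (2 ^ n).+1.
have -> : u.+1 ^ n = \sum_(i < n.+1) 'C(n, i) * u ^ i.
  rewrite -add1n Pascal; apply: eq_bigr => i _.
  by rewrite exp1n mul1n.
rewrite (@digitE (fun i => 'C(n, i))) => [|i]; last by rewrite ltnS.
by case: ltnP => // h; rewrite bin_small.
Qed.

Lemma diof_divn s t : diof s -> diof t -> diof (fun v => s v %/ t v).
Proof.
apply: diof_fun2; apply: (@dio_ext _ (fun v => (v 2 = 0 /\ v 0 = 0) \/
   (1 <= v 2 /\ v 0 * v 2 <= v 1 /\ v 1 < (v 0).+1 * v 2))); last by dio.
move=> v; move: (v 0) (v 1) (v 2) => q a b; split=> [->|[[-> ->]|[b0 [h1 h2]]]].
- case: (posnP b) => [->|b0]; [by left|right].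
  by rewrite leq_divM ltn_ceil.
- by rewrite divn0.
- by apply/eqP; rewrite eqn_leq leq_divRL // h1 -ltnS ltn_divLR // h2.
Qed.

Lemma diof_modn s t : diof s -> diof t -> diof (fun v => s v %% t v).
Proof.
apply: diof_fun2.
apply: (@dio_ext _ (fun v => v 1 = (v 1 %/ v 2) * v 2 + v 0)); last first.
  by dio; apply: diof_divn; dio.
move=> v; split=> [->|]; first exact: divn_eq.
by rewrite {1}(divn_eq (v 1) (v 2)); lia.
Qed.

Ltac dio_step' ::= lazymatch goal with
  | |- diof (fun v => @?s v ^ @?t v) => apply (@diof_exp s t)
  | |- dio (fun v => is_true (@?s v %| @?t v)) => apply (@dio_dvdn s t)
  | |- dio (fun v => cong (@?r v) (@?s v) (@?t v)) => apply (@dio_cong r s t)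
  | |- diof (fun v => @?s v %/ @?t v) => apply (@diof_divn s t)
  | |- diof (fun v => @?s v %% @?t v) => apply (@diof_modn s t)
  end.

Lemma diof_bin s t : diof s -> diof t -> diof (fun v => 'C(s v, t v)).
Proof.
apply: diof_fun2; apply: (@dio_ext _ (fun v => v 0 =
  ((2 ^ v 1).+2 ^ v 1 %/ (2 ^ v 1).+1 ^ v 2) %% (2 ^ v 1).+1)); last by dio.
by move=> v; rewrite binom_digit.
Qed.

Lemma ffact_le_exp r n : r ^_ n <= r ^ n.
Proof.
elim: n => // n IH; rewrite ffactnSr expnSr; apply: leq_mul => //; exact: leq_subr.
Qed.

(** Says that the falling factorial loses at most the fraction n^2 / r of the power. *)
Lemma exp_le_ffact r n : n <= r -> r ^ n.+1 <= r * r ^_ n + n * n * r ^ n.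
Proof.
elim: n => [|n IH] h; first by rewrite expn1 ffactn0 muln1 leq_addr.
have := IH (ltnW h); have := ffact_le_exp r n; rewrite ffactnSr.
rewrite [r ^ n.+2]expnS => h1 h2.
have h3 : r * r ^ n.+1 <= r * (r * r ^_ n + n * n * r ^ n) by rewrite leq_mul2l h2 orbT.
apply: leq_trans h3 _.
have e : r * (r ^_ n * (r - n)) + r * (n * r ^_ n) = r * (r * r ^_ n).
  by rewrite -mulnDr [n * _]mulnC -mulnDr subnK ?(ltnW h) // [_ * r]mulnC.
have h4 : r * (n * r ^_ n) <= r * (n * r ^ n) by rewrite !leq_mul2l h1 !orbT.
rewrite mulnDr -e expnS; nia.
Qed.

Lemma fact_le_exp n : n`! <= n ^ n.
Proof. by rewrite -ffactnn; exact: ffact_le_exp. Qed.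

(** The quotient of r^n by the binomial is n! times r^n over the falling factorial, hence slightly
    above n!. The chosen r makes the excess smaller than 1, because n! <= n^n. *)
Lemma fact_div n : n`! = (((n ^ n).+1 * (n * n) + n).+1 ^ n) %/ 'C(((n ^ n).+1 * (n * n) + n).+1, n).
Proof.
set r := _.+1; have nr : n <= r by rewrite /r; lia.
have c0 : 0 < 'C(r, n) by rewrite bin_gt0.
have e := bin_ffact r n; have f0 := fact_gt0 n.
apply/eqP; rewrite eqn_leq; apply/andP; split.
  by rewrite leq_divRL // mulnC e ffact_le_exp.
rewrite -ltnS ltn_divLR // -(ltn_pmul2r f0) -mulnA e mulSn.
have r0 : 0 < r by [].
rewrite -(ltn_pmul2l r0) mulnA -expnS.
have h := exp_le_ffact nr.
have h1 : r ^ n.+1 * n`! <= (r * r ^_ n + n * n * r ^ n) * n`! by rewrite leq_mul2r h orbT.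
apply: leq_ltn_trans h1 _.
have h2 : (n * n) * n`!.+1 < r by have := fact_le_exp n; rewrite /r; nia.
have p0 : 0 < r ^ n by rewrite expn_gt0 r0.
have h3 : (n * n) * n`!.+1 * r ^ n < r ^ n.+1 by rewrite expnS ltn_pmul2r.
move: (r ^ n) (r ^_ n) (n`!) (r ^ n.+1) h h3 => x y f z; clear; lia.
Qed.

Lemma diof_fact s : diof s -> diof (fun v => (s v)`!).
Proof.
apply: diof_fun1; apply: (@dio_ext _ (fun v => v 0 =
  (((v 1 ^ v 1).+1 * (v 1 * v 1) + v 1).+1 ^ v 1) %/
   'C(((v 1 ^ v 1).+1 * (v 1 * v 1) + v 1).+1, v 1))).
  by move=> v; rewrite -fact_div.
by dio; apply: diof_bin; dio.
Qed.

Ltac dio_step' ::= lazymatch goal with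
  | |- diof (fun v => @?s v ^ @?t v) => apply (@diof_exp s t)
  | |- dio (fun v => is_true (@?s v %| @?t v)) => apply (@dio_dvdn s t)
  | |- dio (fun v => cong (@?r v) (@?s v) (@?t v)) => apply (@dio_cong r s t)
  | |- diof (fun v => @?s v %/ @?t v) => apply (@diof_divn s t)
  | |- diof (fun v => @?s v %% @?t v) => apply (@diof_modn s t)
  | |- diof (fun v => 'C(@?s v, @?t v)) => apply (@diof_bin s t)
  | |- diof (fun v => (@?s v)`!) => apply (@diof_fact s)
  end.

Section BoundedForall.

(** Equal to 1 + (W!)^2 / (k + 1) for k < W. Such moduli are pairwise coprime, have only prime
    factors above W, and the product of the first y of them is a single binomial coefficient. *)
Definition modulus W k := (W`! * (W`! %/ k.+1)).+1.

Lemma modulusE W k : k < W -> (modulus W k).-1 * k.+1 = W`! * W`!.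
Proof. by move=> h; rewrite /= -mulnA divnK // dvdn_fact. Qed.

Lemma modulus_prime W k p : prime p -> p %| modulus W k -> W < p.
Proof.
move=> pp; rewrite ltnNge; apply: contraL => pW.
rewrite /modulus -addn1 dvdn_addr ?dvdn1; first by case: eqP pp => // ->.
by apply: dvdn_mulr; apply: dvdn_fact; rewrite prime_gt0.
Qed.

(** Here p divides N + 1 and (W!)^2 + k + 1, so the product is (-1)(-k) modulo p. One number thus
    stands for each k modulo the corresponding modulus. *)
Lemma modulus_cong W k p : k < W -> p %| modulus W k ->
  forall N, p %| N.+1 -> N * (W`! * W`!).+1 = k %[mod p].
Proof.
move=> kW /dvdnP[x ex] N /dvdnP[y ey].
have := modulusE kW; rewrite ex => e.
apply/eqP; rewrite -(eqn_modDr (W`! * W`! + k.+1)).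
have -> : W`! * W`! + k.+1 = x * p * k.+1.
  by rewrite -e -ex /modulus /=; lia.
have -> : N * (W`! * W`!).+1 + x * p * k.+1 =
  k + (y * (W`! * W`!).+1) * p.
  have -> : y * (W`! * W`!).+1 * p = N.+1 * (W`! * W`!).+1 by rewrite ey; lia.
  have : x * p * k.+1 = W`! * W`! + k.+1 by rewrite -e -ex /modulus /=; lia.
  by clear; lia.
have -> : k + x * p * k.+1 = k + (x * k.+1) * p by lia.
by rewrite -!(addnC (_ * p)) !modnMDl.
Qed.

Lemma modulus_coprime W j k : j < W -> k < W -> j != k ->
  coprime (modulus W j) (modulus W k).
Proof.
move=> jW kW jk; rewrite /coprime; apply/negPn/negP => g1.
set g := gcdn _ _ in g1.
have g0 : 0 < g by rewrite gcdn_gt0.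
have pp : prime (pdiv g) by rewrite pdiv_prime // ltn_neqAle eq_sym g1.
have pj : pdiv g %| modulus W j by apply: dvdn_trans (pdiv_dvd _) (dvdn_gcdl _ _).
have pk : pdiv g %| modulus W k by apply: dvdn_trans (pdiv_dvd _) (dvdn_gcdr _ _).
have := modulus_prime pp pj => Wp.
have e1 := modulus_cong jW pj; have e2 := modulus_cong kW pk.
have h : j = k %[mod pdiv g].
  by rewrite -(e1 (pdiv g).-1) ?prednK ?pdiv_gt0 // (e2 (pdiv g).-1) ?prednK ?pdiv_gt0.
move/eqP: jk; apply; move: h; rewrite !modn_small //; lia.
Qed.

(** With T = (W!)^2 the coefficient is the product of the (T + k + 1)/(k + 1), and each factor is
    [modulus W k]. *)
Lemma binom_modulus W y : y <= W ->
  'C(W`! * W`! + y, y) = \prod_(k < y) modulus W k.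
Proof.
elim: y => [|y IH] h; first by rewrite bin0 big_ord0.
rewrite big_ord_recr /= -IH; last exact: ltnW.
apply/eqP; rewrite -(eqn_pmul2l (ltn0Sn y)) addnS -mul_bin_diag /=.
have -> : (W`! * W`! + y).+1 = y.+1 * modulus W y.
  by rewrite -(modulusE h) /modulus /=; lia.
by rewrite -mulnA eqn_pmul2l // mulnC.
Qed.

Lemma modulus_prod_coprime W y : y < W ->
  coprime (\prod_(k < y) modulus W k) (modulus W y).
Proof.
move=> h; rewrite coprime_sym.
apply: (big_ind (fun x => coprime (modulus W y) x)) => [|a b|k _]; first exact: coprimen1.
  by rewrite coprimeMr => -> ->.
by rewrite modulus_coprime ?gtn_eqF //; apply: ltn_trans h.
Qed.

Lemma modulus_prod_dvd W y x : y <= W -> (forall k, k < y -> modulus W k %| x) ->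
  \prod_(k < y) modulus W k %| x.
Proof.
elim: y => [|y IH] h hk; first by rewrite big_ord0 dvd1n.
rewrite big_ord_recr /= Gauss_dvd; last exact: modulus_prod_coprime.
apply/andP; split; last exact: hk.
by apply: IH => [|k ky]; [exact: ltnW|exact/hk/ltnW].
Qed.

Lemma modulus_crt W y (r : nat -> nat) : y <= W ->
  exists a, forall k, k < y -> a = r k %[mod modulus W k].
Proof.
elim: y => [|y IH] h; first by exists 0.
have [a ha] := IH (ltnW h).
have co := modulus_prod_coprime h.
exists (chinese (\prod_(k < y) modulus W k) (modulus W y) a (r y)) => k.
rewrite ltnS leq_eqVlt => /orP[/eqP->|ky]; first by rewrite chinese_modr.
rewrite -ha //.
have /dvdnP[z ez] : modulus W k %| \prod_(k < y) modulus W k.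
  by rewrite (bigD1 (Ordinal ky)) //= dvdn_mulr.
have := chinese_modl co a (r y); rewrite ez mulnC => e.
by rewrite -[LHS](modn_dvdm _ (dvdn_mulr z (dvdnn _))) e modn_dvdm // dvdn_mulr.
Qed.

Lemma prime_ffact p a n : prime p -> p %| a ^_ n -> exists2 j, j < n & a = j %[mod p].
Proof.
move=> pp; elim: n => [|n IH]; first by rewrite ffactn0 dvdn1; case: eqP pp => // ->.
rewrite ffactnSr Euclid_dvdM // => /orP[/IH[j jn e]|h]; first by exists j => //; apply: ltnW.
have [na|an] := leqP n a; last by exists a => //; apply: ltnW.
by exists n => //; apply/eqP; rewrite eqn_mod_dvd.
Qed.

Lemma ffact_dvd m a j n : j < n -> a = j %[mod m] -> m %| a ^_ n.
Proof.
move=> jn e; have [ja|aj] := leqP j a; last by rewrite ffact_small // (ltn_trans aj).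
have h : m %| a - j by rewrite -eqn_mod_dvd //; apply/eqP.
elim: n jn => // n IH; rewrite ltnS leq_eqVlt ffactnSr => /orP[/eqP<-|/IH h'].
  exact: dvdn_mull.
exact: dvdn_mulr.
Qed.

Fixpoint dvars e := match e with DV i => i.+1
  | DA a b => maxn (dvars a) (dvars b) | DM a b => maxn (dvars a) (dvars b) | _ => 0 end.

Lemma dev_vars v x x' n e : dvars e <= n -> (forall i, i < n -> x i = x' i) ->
  dev v x e = dev v x' e.
Proof.
move=> + h; elim: e => //= a IHa b IHb.
  by rewrite geq_max => /andP[/IHa-> /IHb->].
by rewrite geq_max => /andP[/IHa-> /IHb->].
Qed.

Lemma dev_mod d v v' x x' e : (forall i, v i = v' i %[mod d]) ->
  (forall i, x i = x' i %[mod d]) -> dev v x e = dev v' x' e %[mod d].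
Proof.
move=> hv hx; elim: e => //= a IHa b IHb.
  by rewrite -modnDm IHa IHb modnDm.
by rewrite -modnMm IHa IHb modnMm.
Qed.

Lemma dev_mono v v' x x' e : (forall i, v i <= v' i) -> (forall i, x i <= x' i) ->
  dev v x e <= dev v' x' e.
Proof.
by move=> hv hx; elim: e => //= a IHa b IHb; [apply: leq_add|apply: leq_mul].
Qed.

(** Here u bounds the unknowns, W exceeds the values of both sides on arguments up to u, and N + 1
    is the product of the moduli. Given a solution for each k, the Chinese remainder theorem glues
    them into one tuple x. Conversely, a prime P dividing [modulus W k] divides the binomial of x_i
    and u + 1, so x_i modulo P is at most u; both sides are then below P, and their congruence is an
    equality. *)
Lemma bounded_forallE p q v y : let n := maxn (dvars p) (dvars q) in
  (forall k, k < y -> exists x, dev (scons k v) x p = dev (scons k v) x q) <->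
  exists u W t N, W = dev (scons y v) (fun=> u) p + dev (scons y v) (fun=> u) q + u + y + 1
    /\ t = W`! * W`! /\ N.+1 = 'C(t + y, y) /\ exists x,
    cong N.+1 (dev (scons (N * t.+1) v) x p) (dev (scons (N * t.+1) v) x q) /\
    forall i, i < n -> N.+1 %| 'C(x i, u.+1).
Proof.
move=> n; have np : dvars p <= n by rewrite leq_maxl.
have nq : dvars q <= n by rewrite leq_maxr.
split=> [h|[u [W [t [N [eW [et [eN [x [hc hx]]]]]]]]] k ky].
  have /choice[X hX] : forall k, exists x, k < y -> dev (scons k v) x p = dev (scons k v) x q.
    by move=> k; case: (ltnP k y) => [/h[x hx]|_]; [exists x|exists (fun=> 0)].
  pose u := \sum_(k < y) \sum_(i < n) X k i.
  have Xu k i : k < y -> i < n -> X k i <= u.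
    move=> ky ni; rewrite /u (bigD1 (Ordinal ky)) //= (bigD1 (Ordinal ni)) //=.
    by rewrite -addnA leq_addr.
  set W := dev (scons y v) (fun=> u) p + dev (scons y v) (fun=> u) q + u + y + 1.
  have yW : y <= W by rewrite /W; lia.
  have uW : u.+1 <= W by rewrite /W; lia.
  have eN := binom_modulus yW.
  have N0 : 0 < 'C(W`! * W`! + y, y) by rewrite bin_gt0 leq_addl.
  exists u, W, (W`! * W`!), ('C(W`! * W`! + y, y)).-1; rewrite prednK //; do 3!split=> //.
  have /choice[a ha] : forall i, exists a, forall k, k < y -> a = X k i %[mod modulus W k].
    by move=> i; apply: (modulus_crt (fun k => X k i) yW).
  exists a; split.
    rewrite cong_modn.
    have key k : k < y -> dev (scons (('C(W`! * W`! + y, y)).-1 * (W`! * W`!).+1) v) a p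
       = dev (scons (('C(W`! * W`! + y, y)).-1 * (W`! * W`!).+1) v) a q %[mod modulus W k].
      move=> ky; have kW := leq_trans ky yW.
      have hk : ('C(W`! * W`! + y, y)).-1 * (W`! * W`!).+1 = k %[mod modulus W k].
        apply: modulus_cong => //; rewrite prednK // eN.
        by rewrite (bigD1 (Ordinal ky)) //= dvdn_mulr.
      have step e : dev (scons (('C(W`! * W`! + y, y)).-1 * (W`! * W`!).+1) v) a e =
        dev (scons k v) (X k) e %[mod modulus W k].
        by apply: dev_mod => [[|i]|i] //=; apply: ha.
      by rewrite !step hX.
    move: key; set A := dev _ a p; set B := dev _ a q => key.
    wlog AB : A B key / A <= B.
      by move=> H; case: (leqP A B) => [/H|/ltnW/H e]; [exact|symmetry; apply: e => k /key].
    apply/eqP; rewrite eq_sym eqn_mod_dvd // eN; apply: modulus_prod_dvd => // k ky.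
    by rewrite -eqn_mod_dvd // eq_sym; apply/eqP/key.
  move=> i ni; rewrite eN; apply: modulus_prod_dvd => // k ky.
  have kW := leq_trans ky yW.
  have cop : coprime (modulus W k) u.+1`!.
    rewrite /coprime; apply/negPn/negP => g1; set g := gcdn _ _ in g1.
    have g0 : 0 < g by rewrite gcdn_gt0.
    have pp : prime (pdiv g) by rewrite pdiv_prime // ltn_neqAle eq_sym g1.
    have pk : pdiv g %| modulus W k by apply: dvdn_trans (pdiv_dvd _) (dvdn_gcdl _ _).
    have pf : pdiv g %| u.+1`! by apply: dvdn_trans (pdiv_dvd _) (dvdn_gcdr _ _).
    have := modulus_prime pp pk.
    have : exists2 j, j < u.+1 & u.+1 = j %[mod pdiv g] by apply: prime_ffact; rewrite ?ffactnn.
    case=> j ju e Wp; move: e; rewrite !modn_small; lia.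
  rewrite -(Gauss_dvdl _ cop) bin_ffact; apply: (@ffact_dvd _ _ (X k i)).
    by rewrite ltnS Xu.
  exact: ha.
have yW : y <= W by rewrite eW; lia.
have kW := leq_trans ky yW.
pose P := pdiv (modulus W k).
have pp : prime P by rewrite pdiv_prime // /modulus ltnS muln_gt0 fact_gt0 divn_gt0 // dvdn_leq ?fact_gt0 // dvdn_fact.
have pk : P %| modulus W k by apply: pdiv_dvd.
have WP := modulus_prime pp pk.
have eN' := binom_modulus yW; rewrite -et -eN in eN'.
have PN : P %| N.+1 by apply: dvdn_trans pk _; rewrite eN' (bigD1 (Ordinal ky)) //= dvdn_mulr.
pose z i := if i < n then x i %% P else 0.
have zu i : z i <= u.
  rewrite /z; case: ifP => // /hx h.
  have [j ju ->] : exists2 j, j < u.+1 & x i = j %[mod P].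
    by apply: prime_ffact => //; rewrite -bin_ffact; apply: dvdn_mulr; apply: dvdn_trans h.
  by apply: leq_trans (leq_mod _ _) _.
pose x' i := if i < n then x i else 0.
have hk : N * t.+1 = k %[mod P] by rewrite et; apply: modulus_cong.
have step e : dvars e <= n -> dev (scons k v) z e = dev (scons (N * t.+1) v) x e %[mod P].
  move=> en; rewrite (@dev_vars _ x x' n) // => [|i ni]; last by rewrite /x' ni.
  apply: dev_mod => [[|i]|i] //=; rewrite /z /x'; case: ifP => //; by rewrite modn_mod.
have zW e : dev (scons k v) z e <= dev (scons y v) (fun=> u) e.
  by apply: dev_mono => [[|i]|i] //=; rewrite ltnW.
exists z; have /cong_modn hc' := hc.
have hcP : dev (scons (N * t.+1) v) x p = dev (scons (N * t.+1) v) x q %[mod P].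
  by rewrite -(modn_dvdm _ PN) hc' modn_dvdm.
move: hcP; rewrite -(step p np) -(step q nq).
have [hp hq] : dev (scons k v) z p < P /\ dev (scons k v) z q < P.
  by move: (zW p) (zW q) WP; rewrite eW; clear; lia.
by rewrite (modn_small hp) (modn_small hq).
Qed.

End BoundedForall.

Lemma dio_feq S v v' : dio S -> v =1 v' -> S v -> S v'.
Proof.
move=> [p [q H]] e /H[x hx]; apply/H; exists x.
by rewrite -!(@dev_ext v v' x x).
Qed.

(** The number n of new unknowns is arbitrary, so they enter as one function spliced in front of the
    parameters. *)
Lemma dio_exn n (Q : (nat -> nat) -> Prop) : dio Q ->
  dio (fun v => exists x : nat -> nat, Q (fun i => if i < n then x i else v (i - n))).
Proof.
elim: n Q => [|n IH] Q hQ.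
  apply: (@dio_ext _ Q) => // v; split=> [[x]|h]; last exists (fun=> 0).
    by apply: (dio_feq hQ) => i; rewrite subn0.
  by apply: (dio_feq hQ) h => i; rewrite subn0.
have h1 : dio (fun v => exists a, Q (scons a v)).
  apply: dio_ex; apply: (@dio_ext _ Q) => // v.
  by split; apply: (dio_feq hQ) => -[].
apply: dio_ext (IH _ h1) => v; split=> [[x hx]|[x [a ha]]].
  exists (fun i => x i.+1), (x 0); apply: (dio_feq hQ) hx => -[|i] //=.
by exists (scons a x); apply: (dio_feq hQ) ha => -[|i] //=.
Qed.

Lemma dio_alln n (P : nat -> (nat -> nat) -> Prop) : (forall i, i < n -> dio (P i)) ->
  dio (fun v => forall i, i < n -> P i v).
Proof.
elim: n => [|n IH] h.
  by apply: dio_ext dio_True => v; split.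
apply: (@dio_ext _ (fun v => (forall i, i < n -> P i v) /\ P n v)).
  move=> v; split=> [H|[H1 H2] i]; first by split=> [i ni|]; apply: H => //; apply: ltnW.
  by rewrite ltnS leq_eqVlt => /orP[/eqP->|/H1].
by apply: dio_and; [apply: IH => i ni; apply/h/ltnW|apply: h].
Qed.

Lemma diof_dev (fp fv : (nat -> nat) -> nat -> nat) e :
  (forall i, diof (fun w => fp w i)) -> (forall i, diof (fun w => fv w i)) ->
  diof (fun w => dev (fp w) (fv w) e).
Proof.
move=> hp hv; elim: e => /= [c|i|i|a ha b hb|a ha b hb].
- exact: diof_const.
- exact: hp.
- exact: hv.
- exact: diof_add.
- exact: diof_mul.
Qed.

Lemma dio_all t (R : nat -> (nat -> nat) -> Prop) : diof t ->
  dio (fun v => R (v 0) (fun i => v i.+1)) ->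
  dio (fun v => forall k, k < t v -> R k v).
Proof.
move=> ht [p [q H]]; apply: (@dio_let t (fun y v => forall k, k < y -> R k v)) => //.
set n := maxn (dvars p) (dvars q).
apply: (@dio_ext _ (fun v => exists u W t N,
  W = dev v (fun=> u) p + dev v (fun=> u) q + u + v 0 + 1
    /\ t = W`! * W`! /\ N.+1 = 'C(t + v 0, v 0) /\ exists x,
    cong N.+1 (dev (scons (N * t.+1) (fun i => v i.+1)) x p) (dev (scons (N * t.+1) (fun i => v i.+1)) x q) /\
    forall i, i < n -> N.+1 %| 'C(x i, u.+1))).
  move=> v.
  have sc : scons (v 0) (fun i => v i.+1) =1 v by case.
  have := bounded_forallE p q (fun i => v i.+1) (v 0); rewrite -/n /= => B.
  have B1 : (forall k, k < v 0 -> R k (fun i => v i.+1)) <-> (forall k, k < v 0 ->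
      exists x, dev (scons k (fun i => v i.+1)) x p = dev (scons k (fun i => v i.+1)) x q).
    by split=> h k /h /(H (scons k (fun i => v i.+1))).
  rewrite B1 {}B; split=> -[u [W [t' [N hN]]]]; exists u, W, t', N; move: hN.
    by rewrite !(dev_ext _ sc (frefl (fun=> u))).
  by rewrite !(dev_ext _ sc (frefl (fun=> u))).
do 4!(apply: dio_ex; cbv beta); dio.
- by apply: diof_dev => i; dio.
- by apply: diof_dev => i; dio.
(* After the n unknowns come N, t, W and u, the innermost quantifier first, then the bound and
   finally the parameters. *)
pose Q w := cong (w (n + 0)).+1
    (dev (scons (w (n + 0) * (w (n + 1)).+1) (fun i => w (n + i.+4.+1))) w p)
    (dev (scons (w (n + 0) * (w (n + 1)).+1) (fun i => w (n + i.+4.+1))) w q) /\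
  forall i, i < n -> (w (n + 0)).+1 %| 'C(w i, (w (n + 3)).+1).
have hQ : dio Q.
  apply: dio_and; last by apply: dio_alln => i _; dio.
  by dio; apply: diof_dev => -[|i] /=; dio.
apply: dio_ext (dio_exn n hQ) => v.
have key (x : nat -> nat) : let w := fun i => if i < n then x i else v (i - n) in
    Q w <-> cong (v 0).+1 (dev (scons (v 0 * (v 1).+1) (fun i => v i.+4.+1)) x p)
       (dev (scons (v 0 * (v 1).+1) (fun i => v i.+4.+1)) x q) /\
      forall i, i < n -> (v 0).+1 %| 'C(x i, (v 3).+1).
  move=> w; have wE k : w (n + k) = v k by rewrite /w ltnNge leq_addr /= addKn.
  have devE e : dvars e <= n -> dev (scons (w (n + 0) * (w (n + 1)).+1)
      (fun i => w (n + i.+4.+1))) w e = dev (scons (v 0 * (v 1).+1) (fun i => v i.+4.+1)) x e.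
    move=> en; rewrite (@dev_vars _ w x n) // => [|i ni]; last by rewrite /w ni.
    by apply: dev_ext => // -[|i] /=; rewrite !wE.
  rewrite /Q !devE ?leq_maxl ?leq_maxr // !wE.
  by split=> -[h0 h]; split=> // i ni; move: (h i ni); rewrite /w ni.
by split=> -[x hx]; exists x; apply/key.
Qed.
End BoundedQuantifier.

(** * Graphs of partial recursive functions are Diophantine *)

Module RecursiveGraph.
Import all_boot all_order all_algebra.
Import boolp.
Import zify ring.
Import PellSequence PellDefinability Diophantine BoundedQuantifier.
Set Implicit Arguments. Unset Strict Implicit. Unset Printing Implicit Defensive.
Local Open Scope nat_scope.

Lemma diof_feq t v v' : diof t -> v =1 v' -> t v = t v'.
Proof.
move=> ht e; have := @dio_feq _ (scons (t v) v) (scons (t v) v') ht.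
by apply=> // -[].
Qed.

Lemma dio_subst (S : (nat -> nat) -> Prop) (f : nat -> (nat -> nat) -> nat) :
  dio S -> (forall i, diof (f i)) -> dio (fun v => S (fun i => f i v)).
Proof.
move=> [p [q H]] hf; set n := maxn (dvars p) (dvars q).
pose Q w := dev (fun i => f i (fun j => w (n + j))) w p =
            dev (fun i => f i (fun j => w (n + j))) w q.
have hQ : dio Q.
  by apply: dio_eq; apply: diof_dev => i; first [exact: (diof_ren (fun j => n + j))|exact: diof_var].
apply: dio_ext (dio_exn n hQ) => v; rewrite H.
have key (x : nat -> nat) e : let w := fun i => if i < n then x i else v (i - n) in
   dvars e <= n -> dev (fun i => f i (fun j => w (n + j))) w e = dev (fun i => f i v) x e.
  move=> w en; rewrite (@dev_vars _ w x n) // => [|i ni]; last by rewrite /w ni.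
  apply: dev_ext => // i; apply: diof_feq => // j.
  by rewrite /w ltnNge leq_addr /= addKn.
by split=> -[x hx]; exists x; move: hx; rewrite /Q !key ?leq_maxl ?leq_maxr.
Qed.

(** Finite sequences are coded by digits in a base C that is itself quantified, as powers, quotients
    and remainders are Diophantine by now. *)
Definition dig S C i := (S %/ C ^ i) %% C.

Lemma diof_dig s t u : diof s -> diof t -> diof u -> diof (fun v => dig (s v) (t v) (u v)).
Proof. by move=> hs ht hu; rewrite /dig; apply: diof_modn => //; apply: diof_divn => //; apply: diof_exp. Qed.

Lemma dig_code (z : nat -> nat) n : exists C S, forall i, i < n -> dig S C i = z i.
Proof.
pose c i := if i < n then z i else 0; pose u := (\sum_(i < n) z i).+1.
have cu i : c i < u.
  rewrite /c /u; case: ifP => // ni.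
  by rewrite ltnS (bigD1 (Ordinal ni)) //= leq_addr.
exists u, (\sum_(i < n) c i * u ^ i) => i ni.
by rewrite /dig (digitE _ _ cu) ni /c ni.
Qed.

Lemma rec_evalsP gs l ws : rec_evals gs l ws <->
  size ws = size gs /\ forall j, j < size gs -> rec_eval (nth RZero gs j) l (nth 0 ws j).
Proof.
split.
  elim: gs ws => [|g gs IH] ws h; inversion h; subst; first by [].
  by have [/= e' h'] := IH _ H4; split=> [|[|j]] /=; [rewrite e'| |apply: h'].
elim: gs ws => [|g gs IH] [|w ws] [] //= => [_ _|]; first exact: evsNil.
move=> [e] h; apply: evsCons; first exact: (h 0).
by apply: IH; split=> // j; apply: (h j.+1).
Qed.

Lemma rec_precP b s k w y : rec_eval (RPrec b s) (k :: w) y <->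
  exists z : nat -> nat, [/\ rec_eval b w (z 0),
    forall i, i < k -> rec_eval s [:: i, z i & w] (z i.+1) & z k = y].
Proof.
split.
  elim: k y => [|k IH] y h; inversion h; subst.
    by exists (fun=> y).
  have [x [x0 xs xk]] := IH _ H4.
  exists (fun i => if i <= k then x i else y); split=> //; last by rewrite ltnn.
  move=> i hi; have /orP[/eqP->|ik] : (i == k) || (i < k) by rewrite -leq_eqVlt.
    by rewrite leqnn ltnn xk.
  by rewrite (ltnW ik) ik; apply: xs.
elim: k y => [|k IH] y [z [z0 zs <-]]; first exact: evPrec0.
apply: (@evPrecS _ _ _ _ (z k)); last exact: zs.
by apply: IH; exists z; split=> // i ik; apply/zs/ltnW.
Qed.

Lemma rec_muP f l y : rec_eval (RMu f) l y <->
  rec_eval f (y :: l) 0 /\ forall j, j < y -> exists k, rec_eval f (j :: l) k.+1.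
Proof. by split=> [h|[h1 h2]]; [inversion h|apply: evMu]. Qed.

Lemma rec_compP h gs l y : rec_eval (RComp h gs) l y <->
  exists ws, rec_evals gs l ws /\ rec_eval h ws y.
Proof.
split=> [H|[ws [h1 h2]]]; last exact: (evComp h1 h2).
by inversion H; exists ws.
Qed.

(** [recf] is nested through [seq recf], so an induction hypothesis for the members of the list has
    to be supplied by hand. The default [RZero] lets it range over all indices. *)
Lemma recf_rect' (P : recf -> Prop) :
  P RZero -> P RSucc -> (forall i, P (RProj i)) ->
  (forall h gs, P h -> (forall j, P (nth RZero gs j)) -> P (RComp h gs)) ->
  (forall b s, P b -> P s -> P (RPrec b s)) -> (forall f, P f -> P (RMu f)) ->
  forall phi, P phi.
Proof.
move=> h0 h1 h2 h3 h4 h5; fix IH 1; case=> [||i|h gs|b s|f].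
- exact h0.
- exact h1.
- exact (h2 i).
- apply: h3; first exact (IH h).
  by elim: gs => [|g gs IHg] [|j]; [exact h0|exact h0|exact (IH g)|exact (IHg j)].
- exact (h4 b s (IH b) (IH s)).
- exact (h5 f (IH f)).
Qed.

(** The arity n is general in the induction because composition and recursion change it. Primitive
    recursion quantifies over a coded sequence of intermediate values with a bounded quantifier for
    the steps; minimisation is a bounded quantifier as well. *)
Lemma dio_rec phi n : dio (fun v => rec_eval phi (mkseq (fun i => v i.+1) n) (v 0)).
Proof.
elim/recf_rect': phi n => [||i|h gs IHh IHg|b s IHb IHs|f IHf] n.
- apply: (@dio_ext _ (fun v => v 0 = 0)); last by dio.
  by move=> v; split=> [h|->]; [inversion h|constructor].
- apply: (@dio_ext _ (fun v => v 0 = (head 0 (mkseq (fun i => v i.+1) n)).+1)).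
    by move=> v; split=> [h|->]; [inversion h|constructor].
  by case: n => [|n] /=; dio.
- apply: (@dio_ext _ (fun v => v 0 = nth 0 (mkseq (fun i => v i.+1) n) i)).
    by move=> v; split=> [h|->]; [inversion h|constructor].
  case: (ltnP i n) => h.
    apply: (@dio_ext _ (fun v => v 0 = v i.+1)); last by dio.
    by move=> v; rewrite nth_mkseq.
  apply: (@dio_ext _ (fun v => v 0 = 0)); last by dio.
  by move=> v; rewrite nth_default ?size_mkseq.
- set m := size gs.
  pose Q w := (forall j, j < m -> rec_eval (nth RZero gs j) (mkseq (fun i => w (m + i.+1)) n) (w j))
     /\ rec_eval h (mkseq w m) (w (m + 0)).
  have hQ : dio Q.
    apply: dio_and.
      apply: dio_alln => j _.
      exact: (dio_ren (fun i => if i is k.+1 then m + k.+1 else j) (IHg j n)).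
    exact: (dio_ren (fun i => if i is k.+1 then k else m + 0) (IHh m)).
  apply: dio_ext (dio_exn m hQ) => v.
  have wE (x : nat -> nat) k : (if m + k < m then x (m + k) else v (m + k - m)) = v k.
    by rewrite ltnNge leq_addr /= addKn.
  have key (x : nat -> nat) : Q (fun i => if i < m then x i else v (i - m)) <->
    (forall j, j < m -> rec_eval (nth RZero gs j) (mkseq (fun i => v i.+1) n) (x j))
     /\ rec_eval h (mkseq x m) (v 0).
    rewrite /Q wE (eq_mkseq (g := fun i => v i.+1)) => [|i]; last exact: wE.
    have -> : mkseq (fun i => if i < m then x i else v (i - m)) m = mkseq x m.
      by apply/eq_in_map => i; rewrite mem_iota /= add0n => ->.
    by split=> -[H1 H2]; split=> // j jm; move: (H1 j jm); rewrite jm.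
  split=> [H|[x /key[H1 H2]]].
    inversion H; subst; move/rec_evalsP: H2 => [e hj].
    exists (nth 0 ws); apply/key; split; first exact: hj.
    by rewrite /m -e mkseq_nth.
  apply: (@evComp _ _ _ (mkseq x m)) => //; apply/rec_evalsP; rewrite size_mkseq; split=> // j jm.
  by rewrite nth_mkseq //; apply: H1.
- case: n => [|n].
    by apply: dio_ext dio_False => v; split=> // h; inversion h.
  apply: (@dio_ext _ (fun v => exists C S,
    [/\ rec_eval b (mkseq (fun i => v i.+2) n) (dig S C 0),
      forall i, i < v 1 -> rec_eval s [:: i, dig S C i & mkseq (fun i => v i.+2) n] (dig S C i.+1)
      & dig S C (v 1) = v 0])).
    move=> v; have -> : mkseq (fun i => v i.+1) n.+1 = v 1 :: mkseq (fun i => v i.+2) n.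
      by rewrite /mkseq /= -[1]addn0 iotaDl -map_comp.
    rewrite rec_precP; split=> [[z [h0 hs hk]]|[C [S [h0 hs hk]]]]; last first.
      by exists (dig S C).
    have [C [S hd]] := dig_code z (v 1).+1; exists C, S; split.
    - by rewrite hd.
    - by move=> i ik; rewrite (hd i (ltnW ik)) (hd i.+1 ik); apply: hs.
    - by rewrite hd.
  apply: dio_ex; apply: dio_ex; cbv beta.
  apply: (@dio_ext _ (fun v =>
    rec_eval b (mkseq (fun i => v i.+4) n) (dig (v 0) (v 1) 0) /\
    ((forall i, i < v 3 -> rec_eval s [:: i, dig (v 0) (v 1) i & mkseq (fun i => v i.+4) n] (dig (v 0) (v 1) i.+1))
      /\ dig (v 0) (v 1) (v 3) = v 2))).
    by move=> v; split=> [[]|[? []]].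
  apply: dio_and; last apply: dio_and.
  + apply: (dio_subst (f := fun i v => if i is j.+1 then v j.+4 else dig (v 0) (v 1) 0) (IHb n)).
    by case=> [|i]; dio; apply: diof_dig; dio.
  + apply: dio_all; first by dio.
    apply: (dio_ext _ (dio_subst (f := fun i v => match i with 0 => dig (v 1) (v 2) (v 0).+1
       | 1 => v 0 | 2 => dig (v 1) (v 2) (v 0) | j.+3 => v j.+4.+1 end) (IHs n.+2) _)).
      move=> v; set l := mkseq _ n.+2.
      suff -> : l = [:: v 0, dig (v 1) (v 2) (v 0) & mkseq (fun i => v i.+4.+1) n] by [].
      by rewrite /l /mkseq /= -[2]addn0 iotaDl -map_comp.
    by case=> [|[|[|i]]]; dio; apply: diof_dig; dio.
  + by dio; apply: diof_dig; dio.
- apply: (@dio_ext _ (fun v => rec_eval f (v 0 :: mkseq (fun i => v i.+1) n) 0 /\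
    forall j, j < v 0 -> exists k, rec_eval f (j :: mkseq (fun i => v i.+1) n) k.+1)).
    by move=> v; apply: rec_muP.
  have mk (g : nat -> nat) k : mkseq g k.+1 = g 0 :: mkseq (fun i => g i.+1) k.
    by rewrite /mkseq /= -[1]addn0 iotaDl -map_comp.
  apply: dio_and.
    apply: (dio_ext _ (dio_subst (f := fun i v => if i is j.+1 then v j else 0) (IHf n.+1) _)).
      by move=> v; rewrite mk.
    by case=> [|i]; dio.
  apply: dio_all; first by dio.
  apply: dio_ex; cbv beta.
  apply: (dio_ext _ (dio_subst (f := fun i v => match i with 0 => (v 0).+1 | 1 => v 1
    | j.+2 => v j.+3 end) (IHf n.+1) _)).
    by move=> v; rewrite mk.
  by case=> [|[|i]]; dio.
Qed.

Lemma rec_eval_det phi l y : rec_eval phi l y -> forall y', rec_eval phi l y' -> y = y'.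
Proof.
elim/recf_rect': phi l y => [||i|h gs IHh IHg|b s IHb IHs|f IHf] l y H y' H'.
- by inversion H; inversion H'.
- by inversion H; inversion H'.
- by inversion H; inversion H'.
- move: H H' => /rec_compP[ws [/rec_evalsP[e1 h1] H]] /rec_compP[ws' [/rec_evalsP[e2 h2] H']].
  suff ew : ws = ws' by rewrite ew in H; apply: IHh H _ H'.
  apply: (@eq_from_nth _ 0); first by rewrite e1 e2.
  by move=> j; rewrite e1 => jm; apply: IHg (h1 j jm) _ (h2 j jm).
- case: l H H' => [|k w] H H'; first by inversion H.
  move: H H' => /rec_precP[z [z0 zs <-]] /rec_precP[z' [z0' zs' <-]].
  suff: forall i, i <= k -> z i = z' i by apply.
  elim=> [|i IH] ik; first exact: IHb z0 _ z0'.
  by have := zs' i ik; rewrite -(IH (ltnW ik)); apply: IHs (zs i ik) _.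
- move: H H' => /rec_muP[h1 h2] /rec_muP[h1' h2'].
  have [yy|yy|//] := ltngtP y y'.
    by have [k hk] := h2' _ yy; have := IHf _ _ h1 _ hk.
  by have [k hk] := h2 _ yy; have := IHf _ _ h1' _ hk.
Qed.
End RecursiveGraph.

(** * A Diophantine set that runs coded equations on their own code *)

Module UniversalSet.
Import all_boot all_order all_algebra.
Import boolp.
Import zify ring.
Import PellSequence PellDefinability Diophantine BoundedQuantifier RecursiveGraph.
Set Implicit Arguments. Unset Strict Implicit. Unset Printing Implicit Defensive.
Local Open Scope nat_scope.

(** Needed for the parts of the code of an instance whose length grows with the parameter. *)
Lemma diof_iter (h : nat -> nat) (step : nat -> nat -> nat) t :
  (forall i, h i.+1 = step i (h i)) -> dio (fun v => v 0 = step (v 1) (v 2)) ->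
  diof t -> diof (fun v => h (t v)).
Proof.
move=> hS hs; apply: diof_fun1.
apply: (@dio_ext _ (fun v => exists C S, dig S C 0 = h 0 /\ v 0 = dig S C (v 1) /\
  forall i, i < v 1 -> dig S C i.+1 = step i (dig S C i))).
  move=> v; split=> [->|[C [S [h0 [-> hi]]]]].
    have [C [S hd]] := dig_code h (v 1).+1; exists C, S; rewrite !hd //; split=> //; split=> // i ik.
    by rewrite (hd i (ltnW ik)) (hd i.+1 ik).
  suff: forall i, i <= v 1 -> dig S C i = h i by apply.
  elim=> [|i IH] ik //; by rewrite hi // IH ?hS // ltnW.
dio; try (apply: diof_dig; dio).
apply: dio_all; first by dio.
apply: (@dio_rel3 (fun a b c => a = step b c)) => //; dio; apply: diof_dig; dio.
Qed.

(** An instruction (opcode, a, b) of a straight-line program: 0 is the constant a, 1 the parameter,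
    2 the unknown a, and 3 and 4 are the sum and product of the entries a and b. Checking a run is a
    bounded quantifier over the instructions. The default opcode 5 satisfies no clause of
    [node_ok]. *)
Definition node := (nat * nat * nat)%type.

Definition node_ok (k : nat) (x s : nat -> nat) i (nd : node) : Prop :=
  let: (o, a, b) := nd in
  (o = 0 /\ s i = a) \/ (o = 1 /\ s i = k) \/ (o = 2 /\ s i = x a) \/
  (o = 3 /\ s i = s a + s b) \/ (o = 4 /\ s i = s a * s b).

Fixpoint nodes off e : seq node := match e with
  | DC c => [:: (0, c, 0)] | DP _ => [:: (1, 0, 0)] | DV i => [:: (2, i, 0)]
  | DA a b => let na := nodes off a in let nb := nodes (off + size na) b in
     na ++ nb ++ [:: (3, off + (size na).-1, off + size na + (size nb).-1)]
  | DM a b => let na := nodes off a in let nb := nodes (off + size na) b in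
     na ++ nb ++ [:: (4, off + (size na).-1, off + size na + (size nb).-1)]
  end.

Fixpoint vals k x e : seq nat := match e with
  | DA a b | DM a b => vals k x a ++ vals k x b ++ [:: dev (fun=> k) x e]
  | _ => [:: dev (fun=> k) x e] end.

Lemma size_nodes off e : 0 < size (nodes off e).
Proof. by case: e => //= a b; rewrite !size_cat /= addnA addn1. Qed.

Lemma size_vals off k x e : size (vals k x e) = size (nodes off e).
Proof. by elim: e off => //= a IHa b IHb off; rewrite !size_cat /= (IHa off) (IHb (off + size (nodes off a))). Qed.

Lemma nth_vals_last off k x e : nth 0 (vals k x e) (size (nodes off e)).-1 = dev (fun=> k) x e.
Proof.
rewrite -(size_vals off k x); case: e => //= a b;
  by rewrite !size_cat /= addnA addn1 /= catA nth_cat size_cat ltnn subnn.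
Qed.

Lemma nodes_sound k x s off e :
  (forall j, j < size (nodes off e) -> node_ok k x s (off + j) (nth (5, 0, 0) (nodes off e) j)) ->
  s (off + (size (nodes off e)).-1) = dev (fun=> k) x e.
Proof.
have op : forall a b o off,
  (forall off, (forall j, j < size (nodes off a) -> node_ok k x s (off + j) (nth (5, 0, 0) (nodes off a) j)) ->
     s (off + (size (nodes off a)).-1) = dev (fun=> k) x a) ->
  (forall off, (forall j, j < size (nodes off b) -> node_ok k x s (off + j) (nth (5, 0, 0) (nodes off b) j)) ->
     s (off + (size (nodes off b)).-1) = dev (fun=> k) x b) ->
  let na := nodes off a in let nb := nodes (off + size na) b in
  let l := na ++ nb ++ [:: (o, off + (size na).-1, off + size na + (size nb).-1)] in
  (forall j, j < size l -> node_ok k x s (off + j) (nth (5, 0, 0) l j)) ->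
  [/\ s (off + (size na).-1) = dev (fun=> k) x a,
      s (off + size na + (size nb).-1) = dev (fun=> k) x b &
      node_ok k x s (off + (size l).-1) (o, off + (size na).-1, off + size na + (size nb).-1)].
  move=> {off} {e} a b o off IHa IHb na nb l h.
  have sl : size l = (size na + size nb).+1 by rewrite /l !size_cat /= addnA addn1.
  split.
  - apply: IHa => j ja; rewrite -/na.
    have -> : nth (5, 0, 0) na j = nth (5, 0, 0) l j by rewrite /l nth_cat ja.
    by apply: h; rewrite sl ltnS ltnW // ltn_addr.
  - apply: IHb => j jb; rewrite -/nb -addnA.
    have -> : nth (5, 0, 0) nb j = nth (5, 0, 0) l (size na + j).
      by rewrite /l nth_cat ltnNge leq_addr /= addKn nth_cat jb.
    by apply: h; rewrite sl ltnS ltnW // ltn_add2l.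
  - have := h (size l).-1; rewrite sl /= /l catA nth_cat size_cat ltnn subnn; exact.
elim: e off => [c|i|i|a IHa b IHb|a IHa b IHb] off.
- by move=> /(_ 0 isT) /= [[]|[[]|[[]|[[]|[]]]]] //; rewrite addn0.
- by move=> /(_ 0 isT) /= [[]|[[]|[[]|[[]|[]]]]] //; rewrite addn0.
- by move=> /(_ 0 isT) /= [[]|[[]|[[]|[[]|[]]]]] //; rewrite addn0.
- by move=> /(op a b 3 off IHa IHb) [e1 e2] [[]|[[]|[[]|[[]|[]]]]] //; rewrite e1 e2.
- by move=> /(op a b 4 off IHa IHb) [e1 e2] [[]|[[]|[[]|[[]|[]]]]] //; rewrite e1 e2.
Qed.

Lemma nodes_complete k x s off e :
  (forall j, j < size (nodes off e) -> s (off + j) = nth 0 (vals k x e) j) ->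
  forall j, j < size (nodes off e) -> node_ok k x s (off + j) (nth (5, 0, 0) (nodes off e) j).
Proof.
have op : forall a b o e off,
  (forall off, (forall j, j < size (nodes off a) -> s (off + j) = nth 0 (vals k x a) j) ->
    forall j, j < size (nodes off a) -> node_ok k x s (off + j) (nth (5, 0, 0) (nodes off a) j)) ->
  (forall off, (forall j, j < size (nodes off b) -> s (off + j) = nth 0 (vals k x b) j) ->
    forall j, j < size (nodes off b) -> node_ok k x s (off + j) (nth (5, 0, 0) (nodes off b) j)) ->
  (o = 3 /\ e = DA a b) \/ (o = 4 /\ e = DM a b) ->
  let na := nodes off a in let nb := nodes (off + size na) b in
  let l := na ++ nb ++ [:: (o, off + (size na).-1, off + size na + (size nb).-1)] in
  (forall j, j < size l -> s (off + j) = nth 0 (vals k x a ++ vals k x b ++ [:: dev (fun=> k) x e]) j) ->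
  forall j, j < size l -> node_ok k x s (off + j) (nth (5, 0, 0) l j).
  move=> {off} {e} a b o e off IHa IHb oe na nb l h.
  have sl : size l = (size na + size nb).+1 by rewrite /l !size_cat /= addnA addn1.
  have sa := size_vals off k x a; have sb := size_vals (off + size na) k x b.
  rewrite -/na in sa; rewrite -/nb in sb.
  have na0 : 0 < size na by apply: size_nodes.
  have nb0 : 0 < size nb by apply: size_nodes.
  have ha j : j < size na -> s (off + j) = nth 0 (vals k x a) j.
    by move=> ja; rewrite h ?nth_cat ?sa ?ja // sl ltnS ltnW // ltn_addr.
  have hb j : j < size nb -> s (off + size na + j) = nth 0 (vals k x b) j.
    move=> jb; rewrite -addnA h ?sl ?ltnS; last by rewrite ltnW // ltn_add2l.
    by rewrite nth_cat sa ltnNge leq_addr /= addKn nth_cat sb jb.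
  have ea : s (off + (size na).-1) = dev (fun=> k) x a.
    by rewrite ha ?prednK // /na nth_vals_last.
  have eb : s (off + size na + (size nb).-1) = dev (fun=> k) x b.
    by rewrite hb ?prednK // /nb nth_vals_last.
  move=> j; rewrite sl ltnS leq_eqVlt => /orP[/eqP->|jl].
    rewrite /l catA nth_cat size_cat ltnn subnn [nth _ _ 0]/= /node_ok ea eb.
    rewrite h ?sl // catA nth_cat size_cat sa sb ltnn subnn [nth _ _ 0]/=.
    by case: oe => -[-> ->] /=; do 3!right; [left|right].
  rewrite /l nth_cat; case: ifP => [ja|/negbT]; first exact: IHa.
  rewrite -leqNgt => aj; have jb : j - size na < size nb by lia.
  by rewrite nth_cat -/nb jb -{1}(subnKC aj) addnA; apply: IHb.
elim: e off => [c|i|i|a IHa b IHb|a IHa b IHb] off.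
- by move=> h [|//] _ /=; left; rewrite h.
- by move=> h [|//] _ /=; right; left; rewrite h.
- by move=> h [|//] _ /=; do 2!right; left; rewrite h.
- by apply: (op a b 3 (DA a b)) => //; left.
- by apply: (op a b 4 (DM a b)) => //; right.
Qed.

Definition prog_ok (k B n O A E r1 r2 : nat) : Prop := exists C S X,
  dig S C r1 = dig S C r2 /\ forall i, i < n ->
    node_ok k (dig X C) (dig S C) i (dig O B i, dig A B i, dig E B i).

(** The diagonal set: the program coded by k has a solution when its parameter is k itself. *)
Definition univ (k : nat) : Prop := exists B n O A E r1 r2,
  k = CodeSeq.code [:: B; n; O; A; E; r1; r2] /\ prog_ok k B n O A E r1 r2.

Lemma dio_univ : dio (fun v => univ (v 0)).
Proof.
rewrite /univ /prog_ok /=; under [fun v => _]funext => v do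
  under eq_exists => B do under eq_exists => n do under eq_exists => O do
  under eq_exists => A do under eq_exists => E do under eq_exists => r1 do
  under eq_exists => r2 do rewrite -!mul2n.
dio; try (apply: diof_dig; dio).
apply: dio_all; first by dio.
rewrite /node_ok; dio; apply: diof_dig; dio; apply: diof_dig; dio.
Qed.

Lemma prog_of_dexp p q : exists B n O A E r1 r2, forall k,
  prog_ok k B n O A E r1 r2 <-> exists x, dev (fun=> k) x p = dev (fun=> k) x q.
Proof.
pose np := nodes 0 p; pose nq := nodes (size np) q; pose l := np ++ nq.
pose B := (\sum_(i < size l) ((nth (5, 0, 0) l i).1.1 + (nth (5, 0, 0) l i).1.2
  + (nth (5, 0, 0) l i).2)).+1.
have arr (f : node -> nat) : (forall nd, f nd <= nd.1.1 + nd.1.2 + nd.2) ->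
    exists S, forall i, i < size l -> dig S B i = f (nth (5, 0, 0) l i).
  move=> hf; pose c i := if i < size l then f (nth (5, 0, 0) l i) else 0.
  have cB i : c i < B.
    rewrite /c /B; case: ifP => // il; rewrite ltnS (bigD1 (Ordinal il)) //=.
    by apply: leq_trans (hf _) _; rewrite leq_addr.
  exists (\sum_(i < size l) c i * B ^ i) => i il.
  by rewrite /dig (digitE _ _ cB) il /c il.
have [|O hO] := arr (fun nd => nd.1.1); first by move=> nd; lia.
have [|A hA] := arr (fun nd => nd.1.2); first by move=> nd; lia.
have [|E hE] := arr (fun nd => nd.2); first by move=> nd; lia.
have nodeE i : i < size l -> (dig O B i, dig A B i, dig E B i) = nth (5, 0, 0) l i.
  by move=> il; rewrite hO // hA // hE //; case: (nth _ _ _) => [[]].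
exists B, (size l), O, A, E, (size np).-1, (size np + (size nq).-1) => k; split.
  move=> [C [S [X [hr hn]]]]; exists (dig X C).
  have e1 : dig S C (size np).-1 = dev (fun=> k) (dig X C) p.
    rewrite -[(size np).-1]add0n; apply: nodes_sound => j jp.
    have jl : j < size l by rewrite /l size_cat ltn_addr.
    by have := hn j jl; rewrite nodeE // /l nth_cat jp add0n.
  have e2 : dig S C (size np + (size nq).-1) = dev (fun=> k) (dig X C) q.
    apply: nodes_sound => j jq; have := hn (size np + j).
    have hl : size np + j < size l by rewrite /l size_cat ltn_add2l.
    by rewrite nodeE // => /(_ hl); rewrite /l nth_cat ltnNge leq_addr /= addKn.
  by rewrite -e1 -e2.
move=> [x hx]; pose vs := vals k x p ++ vals k x q.
have sv : size vs = size l by rewrite /vs /l !size_cat (size_vals 0) (size_vals (size np)).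
pose N := size l + \sum_(i < size l) ((nth (5, 0, 0) l i).1.2 + (nth (5, 0, 0) l i).2).
pose C := (\sum_(i < N) (nth 0 vs i + x i)).+1.
have arr2 (f : nat -> nat) : (forall i, f i <= nth 0 vs i + x i) ->
    exists S, forall i, i < N -> dig S C i = f i.
  move=> hf; pose c i := if i < N then f i else 0.
  have cB i : c i < C.
    rewrite /c /C; case: ifP => // il; rewrite ltnS (bigD1 (Ordinal il)) //=.
    by apply: leq_trans (hf _) _; rewrite leq_addr.
  exists (\sum_(i < N) c i * C ^ i) => i il.
  by rewrite /dig (digitE _ _ cB) il /c il.
have [|S hS] := arr2 (nth 0 vs); first by move=> i; lia.
have [|X hX] := arr2 x; first by move=> i; lia.
have lN i : i < size l -> i < N by rewrite /N; lia.
have np0 : 0 < size np := size_nodes _ _.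
have nq0 : 0 < size nq := size_nodes _ _.
have szl : size l = size np + size nq by rewrite size_cat.
exists C, S, X; split.
  rewrite !hS; try (apply: lN; lia).
  rewrite /vs !nth_cat (size_vals 0) -/np prednK // leqnn nth_vals_last.
  by rewrite ltnNge leq_addr /= addKn nth_vals_last.
move=> i il; rewrite nodeE //.
have okv : node_ok k x (nth 0 vs) i (nth (5, 0, 0) l i).
  rewrite /l nth_cat; case: ifP => [ip|/negbT].
    rewrite -[X in node_ok _ _ _ X]add0n; apply: nodes_complete => // j jp.
    by rewrite add0n /vs nth_cat (size_vals 0) -/np jp.
  rewrite -leqNgt => pi; rewrite -[X in node_ok _ _ _ X](subnKC pi).
  apply: nodes_complete; last by rewrite -(ltn_add2l (size np)) subnKC // -szl.
  move=> j jq; by rewrite /vs nth_cat (size_vals 0) -/np ltnNge leq_addr /= addKn.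
move: okv; case e: (nth _ l i) => [[o a] b]; rewrite /node_ok hS ?lN //.
have [aN bN] : a < N /\ b < N.
  rewrite /N (bigD1 (Ordinal il)) //= e /=; lia.
by rewrite !hS // hX.
Qed.

(** The set of k on which the algorithm outputs 0 is Diophantine, hence given by some program, and k
    is taken to be the code of that program. *)
Lemma diagonal phi (h : nat -> nat) : diof (fun v => h (v 0)) ->
  exists k, rec_eval phi [:: h k] 0 <-> univ k.
Proof.
move=> hh.
have [p [q H]] : dio (fun v => rec_eval phi [:: h (v 0)] 0).
  apply: (dio_subst (f := fun i v => if i is 0 then 0 else h (v 0)) (dio_rec phi 1)).
  by case=> [|i]; dio.
have [B [n [O [A [E [r1 [r2 hprog]]]]]]] := prog_of_dexp p q.
exists (CodeSeq.code [:: B; n; O; A; E; r1; r2]); set k := CodeSeq.code _.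
rewrite (H (fun=> k)) -hprog; split.
  by move=> h'; exists B, n, O, A, E, r1, r2.
move=> [B' [n' [O' [A' [E' [r1' [r2' [ek h']]]]]]]].
have := can_inj CodeSeq.codeK ek => -[-> -> -> -> -> -> ->].
exact: h'.
Qed.
End UniversalSet.

(** * Integer systems *)

Module FourSquares.
Import all_boot all_order all_fingroup all_algebra.
Import zify ring.
Set Implicit Arguments. Unset Strict Implicit. Unset Printing Implicit Defensive.
Import Order.TTheory GRing.Theory Num.Theory.
Local Open Scope ring_scope.

Definition sum4 (n : int) := exists a b c d : int, n = a ^+ 2 + b ^+ 2 + c ^+ 2 + d ^+ 2.

Lemma sum4M m n : sum4 m -> sum4 n -> sum4 (m * n).
Proof.
move=> [a [b [c [d ->]]]] [x [y [z [t ->]]]].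
exists (a * x + b * y + c * z + d * t), (a * y - b * x + c * t - d * z),
  (a * z - b * t - c * x + d * y), (a * t + b * z - c * y - d * x).
by ring.
Qed.

Lemma sym_mod (m x : int) : 0 < m -> exists y, (m %| x - y)%Z /\ - m <= 2 * y <= m.
Proof.
move=> m0; have := divz_eq x m; have := modz_ge0 x (lt0r_neq0 m0); have := ltz_pmod x m0.
set q := (x %/ m)%Z; set r := (x %% m)%Z => r1 r0 e.
have [h|h] := leP (2 * r) m.
  exists r; split; last lia.
  by apply/dvdzP; exists q; rewrite {1}e; ring.
exists (r - m); split; last lia.
by apply/dvdzP; exists (q + 1); rewrite {1}e; ring.
Qed.

Lemma sq_bound (m w : int) : - m <= 2 * w <= m -> 4 * w ^+ 2 <= m ^+ 2.
Proof.
move=> h; rewrite -subr_ge0.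
have -> : m ^+ 2 - 4 * w ^+ 2 = (m - 2 * w) * (m + 2 * w) by ring.
by apply: mulr_ge0; lia.
Qed.

(** The squares, and the numbers -1 - a with a a square, each fill more than half of the prime
    field, so they meet. *)
Lemma sum_two_sq_mod p : prime p -> (2 < p)%N ->
  exists x y : int, (p%:Z %| x ^+ 2 + y ^+ 2 + 1)%Z.
Proof.
move=> pp p2.
pose A := [set x ^+ 2 | x : 'F_p]; pose B := [set - 1 - a | a in A].
have cB : #|B| = #|A| by apply: card_imset => a b /addrI/oppr_inj.
have cF : #|'F_p| = p by rewrite card_Fp.
have cA : (#|'F_p| <= 2 * #|A|)%N.
  have -> : #|'F_p| = (\sum_(a in A) \sum_(x : 'F_p | x ^+ 2 == a) 1)%N.
    rewrite -sum1_card (partition_big (fun x : 'F_p => x ^+ 2) (mem A)) //=.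
    by move=> x _; apply: imset_f.
  rewrite mulnC -sum_nat_const; apply: leq_sum => a /imsetP[x0 _ ->].
  rewrite sum1_card; apply: (@leq_trans #|[set x0; - x0]|); last by rewrite cards2; case: (_ != _).
  apply: subset_leq_card; apply/subsetP => x hx; have /eqP e : x ^+ 2 == x0 ^+ 2 := hx.
  rewrite !inE -[x == x0]subr_eq0 -[x == - x0]subr_eq0 opprK -mulf_eq0 -subr_sqr.
  by rewrite e subrr.
have : A :&: B != set0.
  apply/negP => /eqP AB; have := cardsUI A B; rewrite AB cards0 addn0 cB => e.
  have := subset_leq_card (subsetT (A :|: B)); rewrite cardsT e cF => h.
  have /eqP e2 : p == (2 * #|A|)%N by rewrite eqn_leq -{1}cF cA mul2n -addnn h.
  have := even_prime pp; rewrite e2 mul2n odd_double; case=> // h2.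
  by rewrite e2 mul2n h2 in p2.
case/set0Pn=> a /setIP[/imsetP[x _ ->] /imsetP[b /imsetP[y _ ->] e]].
exists (x : nat)%:Z, (y : nat)%:Z.
have -> : (x : nat)%:Z ^+ 2 + (y : nat)%:Z ^+ 2 + 1 = ((x : nat) ^ 2 + (y : nat) ^ 2 + 1)%N%:Z.
  by rewrite !PoszD -!mulnn !PoszM !expr2.
rewrite dvdzE /= (dvdn_pcharf (pchar_Fp pp)) !natrD !natrX !natr_Zp e.
by apply/eqP; ring.
Qed.

Lemma sum4_prime_mul p : prime p -> (2 < p)%N ->
  exists m : nat, (0 < m < p)%N /\ sum4 (m%:Z * p%:Z).
Proof.
move=> pp p2; have [x [y h]] := sum_two_sq_mod pp p2.
have p0 : 0 < p%:Z by have := prime_gt0 pp; lia.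
have [x' [hx bx]] := sym_mod x p0; have [y' [hy by_]] := sym_mod y p0.
have h' : (p%:Z %| x' ^+ 2 + y' ^+ 2 + 1)%Z.
  have -> : x' ^+ 2 + y' ^+ 2 + 1 = (x ^+ 2 + y ^+ 2 + 1) - (x - x') * (x + x')
     - (y - y') * (y + y') by ring.
  by apply: rpredB; [apply: rpredB => //|]; apply: dvdz_mulr.
case/dvdzP: h' => m em; exists `|m|%N.
have bx2 := sq_bound bx; have by2 := sq_bound by_.
have x0 : 0 <= x' ^+ 2 by apply: sqr_ge0.
have y0 : 0 <= y' ^+ 2 by apply: sqr_ge0.
have m0 : 0 < m by rewrite -(pmulr_lgt0 _ p0) -em; clear -x0 y0; lia.
have mp : m < p%:Z.
  rewrite -(ltr_pM2r p0) -em -expr2.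
  have : 3 ^+ 2 <= p%:Z ^+ 2 by rewrite lerXn2r ?nnegrE //; clear -p2; lia.
  by clear -bx2 by2; lia.
split; first by clear -m0 mp; lia.
by rewrite gez0_abs ?ltW // -em; exists x', y', 1, 0; ring.
Qed.

(** Lagrange's descent: the four entries are reduced modulo m to absolute value at most m/2,
    multiplied with the original ones by Euler's identity, and m^2 is divided out. In the extreme
    cases r = 0 and r = m the square of m would divide mp, which [nodiv] excludes. *)
Lemma sum4_descent (p m : nat) : prime p -> (1 < m < p)%N -> sum4 (m%:Z * p%:Z) ->
  exists r : nat, (0 < r < m)%N /\ sum4 (r%:Z * p%:Z).
Proof.
move=> pp /andP[m1 mp] [a [b [c [d e]]]].
have m0 : 0 < m%:Z by lia.
have nodiv : ~ (m%:Z ^+ 2 %| m%:Z * p%:Z)%Z.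
  rewrite expr2 dvdz_mul2l; last by lia.
  rewrite dvdzE /= => h; have := prime_nt_dvdP pp; move/(_ m).
  by move=> H; have /H := h; rewrite neq_ltn m1 orbT => /(_ isT) e1; rewrite e1 ltnn in mp.
have [x [hx bx]] := sym_mod a m0; have [y [hy by_]] := sym_mod b m0.
have [z [hz bz]] := sym_mod c m0; have [t [ht bt]] := sym_mod d m0.
have dm : (m%:Z %| x ^+ 2 + y ^+ 2 + z ^+ 2 + t ^+ 2)%Z.
  have -> : x ^+ 2 + y ^+ 2 + z ^+ 2 + t ^+ 2 = (a ^+ 2 + b ^+ 2 + c ^+ 2 + d ^+ 2)
    - (a - x) * (a + x) - (b - y) * (b + y) - (c - z) * (c + z) - (d - t) * (d + t) by ring.
  by rewrite -e; do 4!(apply: rpredB; last by apply: dvdz_mulr); apply: dvdz_mulr.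
case/dvdzP: dm => r er.
have bx2 := sq_bound bx; have by2 := sq_bound by_.
have bz2 := sq_bound bz; have bt2 := sq_bound bt.
have x0 := sqr_ge0 x; have y0 := sqr_ge0 y; have z0 := sqr_ge0 z; have t0 := sqr_ge0 t.
have r0 : 0 <= r by rewrite -(pmulr_lge0 _ m0) -er; clear -x0 y0 z0 t0; lia.
have rm : r <= m%:Z by rewrite -(ler_pM2r m0) -er -expr2; clear -bx2 by2 bz2 bt2; lia.
case/dvdzP: hx => ka ea; case/dvdzP: hy => kb eb; case/dvdzP: hz => kc ec; case/dvdzP: ht => kd ed.
have {ea}ea : a = ka * m%:Z + x by rewrite -ea; ring.
have {eb}eb : b = kb * m%:Z + y by rewrite -eb; ring.
have {ec}ec : c = kc * m%:Z + z by rewrite -ec; ring.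
have {ed}ed : d = kd * m%:Z + t by rewrite -ed; ring.
have rpos : 0 < r.
  rewrite lt0r r0 andbT; apply/negP => /eqP r00; apply: nodiv.
  move: er; rewrite r00 mul0r => er.
  have sq0 w : w ^+ 2 = 0 -> w = 0 :> int by move/eqP; rewrite expf_eq0 /= => /eqP.
  have xx : x = 0 by apply: sq0; clear -er x0 y0 z0 t0; lia.
  have yy : y = 0 by apply: sq0; clear -er x0 y0 z0 t0; lia.
  have zz : z = 0 by apply: sq0; clear -er x0 y0 z0 t0; lia.
  have tt : t = 0 by apply: sq0; clear -er x0 y0 z0 t0; lia.
  rewrite e ea eb ec ed xx yy zz tt; apply/dvdzP.
  by exists (ka ^+ 2 + kb ^+ 2 + kc ^+ 2 + kd ^+ 2); ring.
have rlt : r < m%:Z.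
  rewrite lt_neqAle rm andbT; apply/negP => /eqP rmm; apply: nodiv.
  rewrite rmm -expr2 in er.
  have half w : 4 * w ^+ 2 = m%:Z ^+ 2 -> 2 * w = m%:Z \/ 2 * w = - m%:Z.
    move=> h; have : (2 * w - m%:Z) * (2 * w + m%:Z) = 0.
      have -> : (2 * w - m%:Z) * (2 * w + m%:Z) = 4 * w ^+ 2 - m%:Z ^+ 2 by ring.
      by rewrite h subrr.
    by move/eqP; rewrite mulf_eq0 => /orP[] /eqP hw; [left|right]; clear -hw; lia.
  have term k w : 4 * w ^+ 2 = m%:Z ^+ 2 ->
     (m%:Z ^+ 2 %| (k * m%:Z + w) ^+ 2 - w ^+ 2)%Z.
    move=> /half h.
    have -> : (k * m%:Z + w) ^+ 2 - w ^+ 2 = k ^+ 2 * m%:Z ^+ 2 + k * m%:Z * (2 * w) by ring.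
    apply: rpredD; first exact: dvdz_mull.
    case: h => ->; apply/dvdzP; [exists k|exists (- k)]; ring.
  have -> : m%:Z * p%:Z = ((ka * m%:Z + x) ^+ 2 - x ^+ 2) + ((kb * m%:Z + y) ^+ 2 - y ^+ 2)
    + ((kc * m%:Z + z) ^+ 2 - z ^+ 2) + ((kd * m%:Z + t) ^+ 2 - t ^+ 2) + m%:Z ^+ 2.
    by rewrite e -er ea eb ec ed; ring.
  have ex : 4 * x ^+ 2 = m%:Z ^+ 2 by clear -er bx2 by2 bz2 bt2; lia.
  have ey : 4 * y ^+ 2 = m%:Z ^+ 2 by clear -er bx2 by2 bz2 bt2; lia.
  have ez : 4 * z ^+ 2 = m%:Z ^+ 2 by clear -er bx2 by2 bz2 bt2; lia.
  have et : 4 * t ^+ 2 = m%:Z ^+ 2 by clear -er bx2 by2 bz2 bt2; lia.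
  by apply: rpredD => //; do 3!(apply: rpredD; last exact: term); exact: term.
exists `|r|%N; split; first by clear -rpos rlt; lia.
rewrite gez0_abs //.
pose A := ka * x + kb * y + kc * z + kd * t + r.
pose B := ka * y - kb * x + kc * t - kd * z.
pose C := ka * z - kb * t - kc * x + kd * y.
pose D := ka * t + kb * z - kc * y - kd * x.
exists A, B, C, D.
have m2 : m%:Z ^+ 2 != 0 by rewrite expf_neq0 //; lia.
apply: (mulfI m2).
have -> : m%:Z ^+ 2 * (r * p%:Z) = (m%:Z * p%:Z) * (r * m%:Z) by ring.
rewrite e -er ea eb ec ed.
have e1 : m%:Z * A = (ka * m%:Z + x) * x + (kb * m%:Z + y) * y + (kc * m%:Z + z) * z + (kd * m%:Z + t) * t.
  have -> : m%:Z * A = (ka * x + kb * y + kc * z + kd * t) * m%:Z + r * m%:Z by rewrite /A; ring.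
  by rewrite -er; ring.
have -> : m%:Z ^+ 2 * (A ^+ 2 + B ^+ 2 + C ^+ 2 + D ^+ 2) =
  (m%:Z * A) ^+ 2 + (m%:Z * B) ^+ 2 + (m%:Z * C) ^+ 2 + (m%:Z * D) ^+ 2 by ring.
by rewrite e1 /B /C /D; ring.
Qed.

Theorem four_squares (n : nat) : sum4 n%:Z.
Proof.
have prime4 p : prime p -> sum4 p%:Z.
  move=> pp; case: (ltnP 2 p) => [p2|].
    have [m [/andP[m0 mp] h]] := sum4_prime_mul pp p2.
    elim/ltn_ind: m m0 mp h => m IH m0 mp h.
    have [m1|m1] := leqP m 1.
      by move: h; have -> : m = 1%N by [lia|]; rewrite mul1r.
    have [|r [/andP[r0 rm] hr]] := sum4_descent pp _ h; first by rewrite m1.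
    exact: (IH r rm r0 (ltn_trans rm mp) hr).
  have := prime_gt1 pp; move=> p1 p2; have -> : p = 2%N by lia.
  by exists 1, 1, 0, 0.
elim/ltn_ind: n => n IH.
case: (ltnP 1 n) => [n1|]; last first.
  by case: n IH => [|[|//]] _ _; [exists 0, 0, 0, 0|exists 1, 0, 0, 0].
have := pdiv_dvd n => /dvdnP[k ek].
rewrite ek PoszM; apply: sum4M; last exact/prime4/pdiv_prime.
apply: IH; rewrite {1}ek ltn_Pmulr ?prime_gt1 ?pdiv_prime //.
by move: ek n1; case: k => [->|].
Qed.
End FourSquares.

(** * Polynomial equations as systems of short sums and links *)

Module LinkSystem.
Import all_boot all_order all_algebra.
Import boolp.
Import zify ring.
Import Diophantine BoundedQuantifier FourSquares.
Set Implicit Arguments. Unset Strict Implicit. Unset Printing Implicit Defensive.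
Import Order.TTheory GRing.Theory Num.Theory.
Local Open Scope ring_scope.

Definition link := (nat * nat * nat)%type.

(* A link (i, j, k) stands for the equation a_i d_j = d_k. *)
Definition sat (A : seq (seq nat)) (K : seq link) (a d : nat -> int) : Prop :=
  (forall J, J \in A -> \sum_(j <- J) d j = 0) /\
  (forall l, l \in K -> a l.1.1 * d l.1.2 = d l.2).

Definition solvable A K := exists a d : nat -> int, [/\ a 0%N = 1, d 0%N = 1 & sat A K a d].

(** The torus of a sum over J has dimension |J| + h with h = n - 2, and the complex has dimension 2h
    + 2. For h = 1 exactly three summands fit. *)
Definition add_wf f (J : seq nat) :=
  [&& uniq J, (0 < size J <= 3)%N & all (fun j => j < f)%N J].
(** The conditions i > 0 and j != k make the directions s_j, s_k, t_0, t_i of the torus of a link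
    distinct. *)
Definition link_wf f g (l : link) :=
  [&& (0 < l.1.1 < g)%N, (l.1.2 < f)%N, (l.2 < f)%N & l.1.2 != l.2].
Definition sys_wf f g A K := all (add_wf f) A && all (link_wf f g) K.

Lemma sys_wf_le f g f' g' A K : (f <= f')%N -> (g <= g')%N -> sys_wf f g A K -> sys_wf f' g' A K.
Proof.
move=> ff gg /andP[hA hK]; apply/andP; split.
  apply: sub_all hA => J /and3P[u s h]; apply/and3P; split=> //.
  by apply: sub_all h => j /leq_trans; apply.
apply: sub_all hK => l /and4P[h1 h2 h3 h4]; apply/and4P; split=> //.
- by case/andP: h1 => -> /leq_trans; apply.
- exact: leq_trans ff.
- exact: leq_trans ff.
Qed.

Lemma sat_agree f g A K a d a' d' : sys_wf f g A K ->
  (forall i, (i < f)%N -> d' i = d i) -> (forall i, (i < g)%N -> a' i = a i) ->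
  sat A K a d -> sat A K a' d'.
Proof.
move=> /andP[/allP hA /allP hK] dd aa [h1 h2]; split=> [J JA|l lK].
  rewrite -[RHS](h1 J JA); apply: eq_big_seq => j jJ.
  by case/and3P: (hA J JA) => _ _ /allP/(_ j jJ)/dd.
case/and4P: (hK l lK) => /andP[_ h3] h4 h5 _.
by rewrite !dd // aa // h2.
Qed.

Lemma sat_cat A K A' K' a d : sat (A ++ A') (K ++ K') a d <-> sat A K a d /\ sat A' K' a d.
Proof.
split=> [[h1 h2]|[[h1 h2] [h3 h4]]].
  by split; split=> x hx; first [apply: h1|apply: h2]; rewrite mem_cat hx ?orbT.
by split=> x; rewrite mem_cat => /orP[]; auto.
Qed.

Definition upd (d : nat -> int) i x j : int := if j == i then x else d j.

Fixpoint zev (k : int) (x : nat -> int) e : int := match e with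
  | DC c => c%:Z | DP _ => k | DV i => x i
  | DA a b => zev k x a + zev k x b | DM a b => zev k x a * zev k x b end.

(** A sum equal to 0 copies a value only up to sign, hence twice. *)
Definition copy s f : seq (seq nat) := [:: [:: s; f]; [:: f; f.+1]].

(** Among the d, index 0 holds 1, index 1 the parameter and index i + 2 the unknown i; f and g are
    the first free indices of d and a. Every result goes to a fresh index, which keeps the indices
    in each sum distinct. A product takes two links: the first has second factor d_0 = 1 and
    transfers the left operand to a fresh a, the second multiplies. *)
Fixpoint comp e f g : nat * seq (seq nat) * seq link * nat * nat := match e with
  | DC 0 => (f, [:: [:: f]], [::], f.+1, g)
  | DC _ => (f.+1, copy 0 f, [::], f.+2, g)
  | DP _ => (f.+1, copy 1 f, [::], f.+2, g)
  | DV i => (f.+1, copy i.+2 f, [::], f.+2, g)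
  | DA a b => let: (ra, A, K, f1, g1) := comp a f g in
      let: (rb, A', K', f2, g2) := comp b f1 g1 in
      (f2.+1, A ++ A' ++ [:: [:: ra; rb; f2]; [:: f2; f2.+1]], K ++ K', f2.+2, g2)
  | DM a b => let: (ra, A, K, f1, g1) := comp a f g in
      let: (rb, A', K', f2, g2) := comp b f1 g1 in
      (f2, A ++ A', K ++ K' ++ [:: (g2, 0%N, ra); (g2, rb, f2)], f2.+1, g2.+1)
  end.

Fixpoint small_cst e := match e with DC c => (c <= 1)%N
  | DA a b | DM a b => small_cst a && small_cst b | _ => true end.

Lemma copy_sat s f K a d : sat (copy s f) K a d -> d f.+1 = d s.
Proof.
move=> [h _]; have := h [:: s; f] (mem_head _ _).
have := h [:: f; f.+1]; rewrite !inE eqxx orbT => /(_ isT).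
rewrite !big_cons !big_nil; lia.
Qed.

Lemma copy_complete s f (a d : nat -> int) : (s < f)%N ->
  exists d', (forall i, (i < f)%N -> d' i = d i) /\ sat (copy s f) [::] a d'.
Proof.
move=> sf; exists (upd (upd d f (- d s)) f.+1 (d s)); split=> [i fi|].
  by rewrite /upd !ltn_eqF // ltnW.
have e1 : (s == f.+1) = false by rewrite ltn_eqF // ltnW.
have e2 : (s == f) = false by rewrite ltn_eqF.
have e3 : (f == f.+1) = false by rewrite ltn_eqF.
split=> // J; rewrite !inE => /orP[]/eqP->; rewrite !big_cons big_nil /upd !eqxx ?e1 ?e2 ?e3; lia.
Qed.

Lemma copy_wf s f g : (s < f)%N -> sys_wf f.+2 g (copy s f) [::].
Proof. by move=> h; rewrite /sys_wf /add_wf /= !inE; lia. Qed.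

Lemma sys_wf_cat f g A K A' K' :
  sys_wf f g A K -> sys_wf f g A' K' -> sys_wf f g (A ++ A') (K ++ K').
Proof. by move=> /andP[h1 h2] /andP[h3 h4]; rewrite /sys_wf !all_cat h1 h2 h3 h4. Qed.

Lemma comp_wf e f g : (0 < g)%N -> (2 + dvars e <= f)%N ->
  let: (r, A, K, f', g') := comp e f g in
  [/\ (f <= r < f')%N, (g <= g')%N & sys_wf f' g' A K].
Proof.
elim: e f g => [[|c]|i|i|a IHa b IHb|a IHa b IHb] f g g0 /= hf.
- by split=> //; rewrite ?leqnn // /sys_wf /add_wf /= ltnSn.
- by split=> //; [lia|apply: copy_wf; lia].
- by split=> //; [lia|apply: copy_wf; lia].
- by split=> //; [lia|apply: copy_wf; lia].
- have /(IHa f g g0) : (2 + dvars a <= f)%N by lia.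
  case: (comp a f g) => [[[[ra A] K] f1] g1] [h1 h2 h3].
  have /(IHb f1 g1 (leq_trans g0 h2)) : (2 + dvars b <= f1)%N by lia.
  case: (comp b f1 g1) => [[[[rb A'] K'] f2] g2] [h4 h5 h6].
  split; [lia|lia|].
  rewrite -[K']cats0; apply: sys_wf_cat; first by apply: sys_wf_le h3; lia.
  apply: sys_wf_cat; first by apply: sys_wf_le h6; lia.
  by rewrite /sys_wf /add_wf /= !inE; lia.
have /(IHa f g g0) : (2 + dvars a <= f)%N by lia.
case: (comp a f g) => [[[[ra A] K] f1] g1] [h1 h2 h3].
have /(IHb f1 g1 (leq_trans g0 h2)) : (2 + dvars b <= f1)%N by lia.
case: (comp b f1 g1) => [[[[rb A'] K'] f2] g2] [h4 h5 h6].
split; [lia|lia|].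
rewrite -[A']cats0; apply: sys_wf_cat; first by apply: sys_wf_le h3; lia.
apply: sys_wf_cat; first by apply: sys_wf_le h6; lia.
by rewrite /sys_wf /link_wf /=; lia.
Qed.

Lemma comp_sound e f g a d : small_cst e -> d 0%N = 1 ->
  let: (r, A, K, _, _) := comp e f g in
  sat A K a d -> d r = zev (d 1%N) (fun i => d i.+2) e.
Proof.
move=> + d0; elim: e f g => [c|i|i|x IHx y IHy|x IHx y IHy] f g /=.
- case: c => [|[|//]] _; last by move=> /copy_sat ->.
  by move=> [/(_ [:: f] (mem_head _ _))]; rewrite big_cons big_nil addr0.
- by move=> _ /copy_sat ->.
- by move=> _ /copy_sat ->.
- case/andP => sx sy; have := IHx f g sx.
  case: (comp x f g) => [[[[ra A] K] f1] g1] hx; have := IHy f1 g1 sy.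
  case: (comp y f1 g1) => [[[[rb A'] K'] f2] g2] hy.
  rewrite -[K']cats0 => /sat_cat[/hx {}hx /sat_cat[/hy {}hy [h _]]].
  have := h _ (mem_head _ _); have := h [:: f2; f2.+1]; rewrite !inE eqxx orbT => /(_ isT).
  by rewrite !big_cons !big_nil hx hy; lia.
case/andP => sx sy; have := IHx f g sx.
case: (comp x f g) => [[[[ra A] K] f1] g1] hx; have := IHy f1 g1 sy.
case: (comp y f1 g1) => [[[[rb A'] K'] f2] g2] hy.
rewrite -[A']cats0 => /sat_cat[/hx {}hx /sat_cat[/hy {}hy [_ h]]].
have /= := h _ (mem_head _ _); have /= := h (g2, rb, f2); rewrite !inE eqxx orbT => /(_ isT) <-.
by rewrite d0 mulr1 hx hy => ->.
Qed.

Lemma comp_complete e f g a d : (0 < g)%N -> (2 + dvars e <= f)%N -> d 0%N = 1 ->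
  let: (r, A, K, f', g') := comp e f g in
  exists a' d', [/\ forall i, (i < f)%N -> d' i = d i, forall i, (i < g)%N -> a' i = a i
    & sat A K a' d'].
Proof.
have cp s f0 g0 a0 d0 : (s < f0)%N -> exists a' d',
   [/\ forall i, (i < f0)%N -> d' i = d0 i, forall i, (i < g0)%N -> a' i = a0 i
    & sat (copy s f0) [::] a' d'].
  by move=> /(copy_complete a0 d0)[d' [h1 h2]]; exists a0, d'.
elim: e f g a d => [[|c]|i|i|x IHx y IHy|x IHx y IHy] f g a d g0 /= hf d0.
- exists a, (upd d f 0); split=> // [j jf|]; first by rewrite /upd ltn_eqF.
  by split=> // J; rewrite inE => /eqP->; rewrite big_cons big_nil /upd eqxx.
- by apply: cp; lia.
- by apply: cp; lia.
- by apply: cp; lia.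
- have hx : (2 + dvars x <= f)%N by lia.
  have := comp_wf g0 hx; have := IHx f g a d g0 hx d0.
  case: (comp x f g) => [[[[ra A] K] f1] g1] [a1 [d1 [e1 e2 s1]]] [h1 h2 h3].
  have hy : (2 + dvars y <= f1)%N by lia.
  have g10 := leq_trans g0 h2.
  have := comp_wf g10 hy; have := IHy f1 g1 a1 d1 g10 hy.
  case: (comp y f1 g1) => [[[[rb A'] K'] f2] g2] []; first by rewrite e1 //; lia.
  move=> a2 [d2 [e3 e4 s2]] [h4 h5 h6].
  pose d3 := upd (upd d2 f2 (- (d2 ra + d2 rb))) f2.+1 (d2 ra + d2 rb).
  have e5 i : (i < f2)%N -> d3 i = d2 i by move=> hi; rewrite /d3 /upd !ltn_eqF // ltnW.
  exists a2, d3; split.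
  + by move=> i hi; rewrite e5 ?e3 ?e1 //; lia.
  + by move=> i hi; rewrite e4 ?e2 //; lia.
  rewrite -[K']cats0; apply/sat_cat; split.
    by apply: (sat_agree h3 _ _ s1) => i hi; rewrite ?e5 ?e3 ?e4 //; lia.
  apply/sat_cat; split; first by apply: (sat_agree h6 _ _ s2) => i hi; rewrite ?e5.
  split=> // J; rewrite !inE => /orP[]/eqP->; rewrite !big_cons big_nil.
    rewrite [d3 ra]e5 ?[d3 rb]e5; try lia.
    by rewrite /d3 /upd eqxx ltn_eqF //; lia.
  by rewrite /d3 /upd eqxx ltn_eqF // eqxx; lia.
have hx : (2 + dvars x <= f)%N by lia.
have := comp_wf g0 hx; have := IHx f g a d g0 hx d0.
case: (comp x f g) => [[[[ra A] K] f1] g1] [a1 [d1 [e1 e2 s1]]] [h1 h2 h3].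
have hy : (2 + dvars y <= f1)%N by lia.
have g10 := leq_trans g0 h2.
have := comp_wf g10 hy; have := IHy f1 g1 a1 d1 g10 hy.
case: (comp y f1 g1) => [[[[rb A'] K'] f2] g2] []; first by rewrite e1 //; lia.
move=> a2 [d2 [e3 e4 s2]] [h4 h5 h6].
pose d3 := upd d2 f2 (d2 ra * d2 rb); pose a3 := upd a2 g2 (d2 ra).
have e5 i : (i < f2)%N -> d3 i = d2 i by move=> hi; rewrite /d3 /upd ltn_eqF.
have e6 i : (i < g2)%N -> a3 i = a2 i by move=> hi; rewrite /a3 /upd ltn_eqF.
exists a3, d3; split.
+ by move=> i hi; rewrite e5 ?e3 ?e1 //; lia.
+ by move=> i hi; rewrite e6 ?e4 ?e2 //; lia.
rewrite -[A']cats0; apply/sat_cat; split.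
  by apply: (sat_agree h3 _ _ s1) => i hi; rewrite ?e5 ?e6 ?e3 ?e4 //; lia.
apply/sat_cat; split; first by apply: (sat_agree h6 _ _ s2) => i hi; rewrite ?e5 ?e6.
have d30 : d3 0%N = 1 by rewrite e5 ?e3 ?e1 //; lia.
split=> // l; rewrite !inE => /orP[]/eqP->/=; rewrite /a3 /upd eqxx.
  by rewrite d30 mulr1 e5 //; lia.
by rewrite [d3 rb]e5; [rewrite /d3 /upd eqxx|lia].
Qed.

Fixpoint cst_exp c := match c with 0 => DC 0 | c.+1 => DA (cst_exp c) (DC 1) end.

(** Natural unknowns become sums of four squares of integer unknowns, and constants become sums of
    ones, as [comp] handles only the constants 0 and 1. *)
Fixpoint pre e := match e with
  | DC c => cst_exp c | DP i => DP i
  | DV i => let sq j := DM (DV (4 * i + j)) (DV (4 * i + j)) in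
      DA (DA (sq 0%N) (sq 1%N)) (DA (sq 2%N) (sq 3%N))
  | DA a b => DA (pre a) (pre b) | DM a b => DM (pre a) (pre b) end.

Lemma small_pre e : small_cst (pre e).
Proof. by elim: e => //= [c|a -> b ->|a -> b ->] //; elim: c => //= c ->. Qed.

Lemma zev_pre (k : nat) (y : nat -> nat) (x : nat -> int) e :
  (forall i, (y i)%:Z = x (4 * i + 0)%N ^+ 2 + x (4 * i + 1)%N ^+ 2
     + x (4 * i + 2)%N ^+ 2 + x (4 * i + 3)%N ^+ 2) ->
  zev k%:Z x (pre e) = (dev (fun=> k) y e)%:Z.
Proof.
move=> h; elim: e => //= [c|i|a -> b ->|a -> b ->] //.
  by elim: c => //= c ->; lia.
by rewrite h; ring.
Qed.

Lemma zev_dev p q (k : nat) : (exists x, dev (fun=> k) x p = dev (fun=> k) x q) <->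
  exists x, zev k%:Z x (pre p) = zev k%:Z x (pre q).
Proof.
split=> [[y hy]|[x hx]].
  have /choice[z hz] : forall i, exists z : int * int * int * int,
     (y i)%:Z = z.1.1.1 ^+ 2 + z.1.1.2 ^+ 2 + z.1.2 ^+ 2 + z.2 ^+ 2.
    by move=> i; have [a [b [c [d e]]]] := four_squares (y i); exists (a, b, c, d).
  pose x j := let t := z (j %/ 4)%N in match (j %% 4)%N with
    0 => t.1.1.1 | 1 => t.1.1.2 | 2 => t.1.2 | _ => t.2 end.
  have hx i : (y i)%:Z = x (4 * i + 0)%N ^+ 2 + x (4 * i + 1)%N ^+ 2
     + x (4 * i + 2)%N ^+ 2 + x (4 * i + 3)%N ^+ 2.
    by rewrite /x hz ![(4 * i)%N]mulnC !divnMDl // !modnMDl /= !addn0.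
  by exists x; rewrite !(zev_pre _ _ hx) hy.
pose y i := absz (x (4 * i + 0)%N ^+ 2 + x (4 * i + 1)%N ^+ 2
     + x (4 * i + 2)%N ^+ 2 + x (4 * i + 3)%N ^+ 2).
exists y; apply/eqP; rewrite -eqz_nat; apply/eqP.
have hy i : (y i)%:Z = x (4 * i + 0)%N ^+ 2 + x (4 * i + 1)%N ^+ 2
   + x (4 * i + 2)%N ^+ 2 + x (4 * i + 3)%N ^+ 2.
  by rewrite /y gez0_abs // !addr_ge0 ?sqr_ge0.
by rewrite -!(zev_pre _ _ hy).
Qed.

Lemma zev_vars k x x' n e : (dvars e <= n)%N -> (forall i, (i < n)%N -> x i = x' i) ->
  zev k x e = zev k x' e.
Proof.
move=> + h; elim: e => //= a IHa b IHb.
  by rewrite geq_max => /andP[/IHa-> /IHb->].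
by rewrite geq_max => /andP[/IHa-> /IHb->].
Qed.

(** The system does not depend on k, which enters only as the prescribed value of d_1. *)
Lemma system_of_dexp p q : exists f g A K, [/\ (2 <= f)%N, (0 < g)%N, sys_wf f g A K &
  (forall k : nat, (exists x, dev (fun=> k) x p = dev (fun=> k) x q) <->
    exists a d : nat -> int, [/\ a 0%N = 1, d 0%N = 1, d 1%N = k%:Z & sat A K a d])].
Proof.
pose P := pre p; pose Q := pre q; pose nv := maxn (dvars P) (dvars Q).
have hP : (2 + dvars P <= 2 + nv)%N by rewrite leq_add2l leq_maxl.
case EP : (comp P (2 + nv) 1) => [[[[rp A1] K1] f1] g1].
have := @comp_wf P (2 + nv) 1 isT hP; rewrite EP => -[w1 w2 w3].
have hQ : (2 + dvars Q <= f1)%N by rewrite /nv in w1; lia.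
case EQ : (comp Q f1 g1) => [[[[rq A2] K2] f2] g2].
have := @comp_wf Q f1 g1 w2 hQ; rewrite EQ => -[w4 w5 w6].
exists f2.+1, g2, (A1 ++ A2 ++ [:: [:: rq; f2]; [:: rp; f2]]), (K1 ++ K2); split.
- lia.
- lia.
- rewrite -[K2]cats0; apply: sys_wf_cat; first by apply: sys_wf_le w3; lia.
  apply: sys_wf_cat; first by apply: sys_wf_le w6; lia.
  by rewrite /sys_wf /add_wf /= !inE; lia.
move=> k; rewrite zev_dev; split=> [[x hx]|[a [d [a0 d0 d1]]]].
  pose d i := match i with 0 => 1 | 1 => k%:Z | j.+2 => x j end : int.
  have := @comp_complete P (2 + nv) 1 (fun=> 1) d isT hP erefl; rewrite EP.
  move=> [a1 [d1 [e1 e2 s1]]].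
  have d10 : d1 0%N = 1 by rewrite e1.
  have := @comp_complete Q f1 g1 a1 d1 w2 hQ d10; rewrite EQ.
  move=> [a2 [d2 [e3 e4 s2]]].
  have dd i : (i < 2 + nv)%N -> d2 i = d i by move=> hi; rewrite e3 ?e1 //; lia.
  have d20 : d2 0%N = 1 by rewrite dd.
  have s1' : sat A1 K1 a2 d2 by apply: (sat_agree w3 _ _ s1) => i hi; rewrite ?e3 ?e4.
  have := @comp_sound P (2 + nv) 1 a2 d2 (small_pre p) d20; rewrite EP => /(_ s1') rP.
  have := @comp_sound Q f1 g1 a2 d2 (small_pre q) d20; rewrite EQ => /(_ s2) rQ.
  have zE e : (dvars e <= nv)%N -> zev (d2 1%N) (fun i => d2 i.+2) e = zev k%:Z x e.
    by move=> en; rewrite dd //; apply: (zev_vars _ en) => i hi; rewrite dd.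
  have rr : d2 rp = d2 rq by rewrite rP rQ !zE ?leq_maxl ?leq_maxr.
  exists a2, (upd d2 f2 (- d2 rq)); split.
  + by rewrite e4 // e2.
  + by rewrite /upd ltn_eqF ?dd //; lia.
  + by rewrite /upd ltn_eqF ?dd //; lia.
  rewrite -[K2]cats0; apply/sat_cat; split.
    apply: (sat_agree w3 _ _ s1') => i hi //; rewrite /upd ltn_eqF //; lia.
  apply/sat_cat; split; first by apply: (sat_agree w6 _ _ s2) => i hi //; rewrite /upd ltn_eqF.
  split=> // J; rewrite !inE => /orP[]/eqP->; rewrite !big_cons big_nil /upd eqxx ltn_eqF ?rr; lia.
rewrite -[K2]cats0 => /sat_cat[s1 /sat_cat[s2 [h _]]].
exists (fun i => d i.+2).
have := @comp_sound P (2 + nv) 1 a d (small_pre p) d0; rewrite EP => /(_ s1).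
have := @comp_sound Q f1 g1 a d (small_pre q) d0; rewrite EQ => /(_ s2).
rewrite d1 -/P -/Q => <- <-.
have := h _ (mem_head _ _); have := h [:: rp; f2]; rewrite !inE eqxx orbT => /(_ isT).
rewrite !big_cons !big_nil; lia.
Qed.

Section Chain.
Variable q1 : nat.
(** The chain counts in unary: d has the value -1 at [q1], i at [cx i] and -i at [cn i], and at the
    end d_1 is set equal to the last count. Only this part of the system varies with the
    parameter. *)
Definition cx i := (q1 + 1 + 2 * i)%N.
Definition cn i := (q1 + 2 + 2 * i)%N.
Definition chain_block i := [:: [:: cx i; cn i]; [:: q1; cn i; cx i.+1]].
Fixpoint chain_adds e := if e is i.+1 then chain_block i ++ chain_adds i else [::].
Definition end_adds e := [:: [:: cx e; cn e]; [:: 1%N; cn e]].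
Definition base_adds := [:: [:: 0%N; q1]; [:: cx 0]].
End Chain.

Definition param_adds A q1 e := A ++ base_adds q1 ++ end_adds q1 e ++ chain_adds q1 e.

Lemma mem_chain q1 e J : J \in chain_adds q1 e -> exists2 i, (i < e)%N & J \in chain_block q1 i.
Proof.
elim: e => // e IH; rewrite mem_cat => /orP[h|/IH[i ie h]]; first by exists e.
by exists i => //; apply: ltnW.
Qed.

Lemma chain_mem q1 e i J : (i < e)%N -> J \in chain_block q1 i -> J \in chain_adds q1 e.
Proof.
elim: e => // e IH; rewrite ltnS leq_eqVlt mem_cat => /orP[/eqP<- ->//|/IH h /h ->].
by rewrite orbT.
Qed.

Lemma param_solvable q1 g A K e : (2 <= q1)%N -> sys_wf q1 g A K ->
  solvable (param_adds A q1 e) K <->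
  exists a d : nat -> int, [/\ a 0%N = 1, d 0%N = 1, d 1%N = e%:Z & sat A K a d].
Proof.
move=> q2 wf; rewrite /solvable /param_adds -[K]cats0; split=> -[a [d []]].
  move=> a0 d0 /sat_cat[s1]; rewrite -[[::]]cats0 => /sat_cat[[s2 _]].
  rewrite -[[::]]cats0 => /sat_cat[[s3 _] [s4 _]].
  exists a, d; split=> //; last by rewrite ?cats0.
  have sum2 i j (B : seq (seq nat)) : [:: i; j] \in B -> (forall J, J \in B -> \sum_(j <- J) d j = 0) -> d j = - d i.
    by move=> hB /(_ _ hB); rewrite !big_cons big_nil; lia.
  have neg1 : d q1 = -1 by rewrite (sum2 0%N q1 _ _ s2) ?d0 // !inE eqxx.
  have x0 : d (cx q1 0) = 0.
    by have := s2 [:: cx q1 0]; rewrite !inE eqxx orbT big_cons big_nil addr0 => /(_ isT).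
  have xi i : (i <= e)%N -> d (cx q1 i) = i%:Z.
    elim: i => [|i IH] // ie; have xi := IH (ltnW ie).
    have b1 : [:: cx q1 i; cn q1 i] \in chain_adds q1 e by apply: (chain_mem ie); rewrite inE eqxx.
    have b2 : [:: q1; cn q1 i; cx q1 i.+1] \in chain_adds q1 e.
      by apply: (chain_mem ie); rewrite !inE eqxx orbT.
    have n1 := sum2 _ _ _ b1 s4; have := s4 _ b2; rewrite !big_cons big_nil n1 xi neg1; lia.
  have n1 : d (cn q1 e) = - d (cx q1 e) by apply: (sum2 _ _ _ _ s3); rewrite inE eqxx.
  have := s3 [:: 1%N; cn q1 e]; rewrite !inE eqxx orbT => /(_ isT).
  by rewrite !big_cons big_nil n1 xi //; lia.
move=> a0 d0 d1 s1.
pose d' i := if (i < q1)%N then d i else if (i == q1)%N then -1 else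
   if odd (i - q1) then ((i - q1).-1./2)%:Z else - ((i - q1 - 2)./2)%:Z : int.
have dl i : (i < q1)%N -> d' i = d i by rewrite /d' => ->.
have dq : d' q1 = -1 by rewrite /d' ltnn eqxx.
have dx i : d' (cx q1 i) = i%:Z.
  rewrite /d' /cx -addnA ltnNge leq_addr /= gtn_eqF; last by rewrite -[X in (X < _)%N]addn0 ltn_add2l.
  by rewrite addKn mul2n oddD odd_double /= doubleK.
have dn i : d' (cn q1 i) = - i%:Z.
  rewrite /d' /cn -addnA ltnNge leq_addr /= gtn_eqF; last by rewrite -[X in (X < _)%N]addn0 ltn_add2l.
  by rewrite addKn mul2n oddD odd_double /= addKn doubleK.
exists a, d'; split=> //; first by rewrite dl // (leq_trans _ q2).
apply/sat_cat; rewrite cats0 in s1; split; first by apply: (sat_agree wf _ _ s1) => i hi //; apply: dl.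
split=> // J; rewrite !mem_cat => /or3P[].
- rewrite !inE => /orP[]/eqP->; rewrite !big_cons big_nil ?dq ?dx ?dl ?d0 //; lia.
- rewrite !inE => /orP[]/eqP->; rewrite !big_cons big_nil ?dn ?dx ?dl ?d1 //; lia.
move=> /mem_chain[i _]; rewrite !inE => /orP[]/eqP->; rewrite !big_cons big_nil ?dn ?dx ?dq; lia.
Qed.
End LinkSystem.

(** * Degrees of labellings of tori *)

Module CubeChains.
Import all_boot all_order all_fingroup all_algebra.
Import zify ring.
Set Implicit Arguments. Unset Strict Implicit. Unset Printing Implicit Defensive.
Import Order.TTheory GRing.Theory Num.Theory.
Local Open Scope ring_scope.

Section Selection.
Variable A : Type.
Implicit Types (G : A -> seq A -> int) (L : seq A).

(** The alternating sum over the choice of one entry of L, together with the remaining entries in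
    their order: the pattern of a Laplace expansion. *)
Fixpoint Sel G L : int := if L is x :: L' then G x L' - Sel (fun y R => G y (x :: R)) L' else 0.

Lemma eq_Sel G G' L : (forall x R, size R = (size L).-1 -> G x R = G' x R) -> Sel G L = Sel G' L.
Proof.
elim: L G G' => //= x L IH G G' h; rewrite h //; congr (_ - _).
case: L IH h => // z L IH h; apply: IH => y R hR.
by apply: h; rewrite /= hR.
Qed.

Lemma Sel0 G L : (forall x R, size R = (size L).-1 -> G x R = 0) -> Sel G L = 0.
Proof.
move=> h; rewrite (eq_Sel (G' := fun _ _ => 0) h).
by elim: L {h} => //= x L ->; rewrite subr0.
Qed.

Lemma SelB G G' L : Sel (fun x R => G x R - G' x R) L = Sel G L - Sel G' L.
Proof. by elim: L G G' => [|x L IH] G G' /=; rewrite ?subrr // IH; ring. Qed.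

Lemma SelD G G' L : Sel (fun x R => G x R + G' x R) L = Sel G L + Sel G' L.
Proof. by elim: L G G' => [|x L IH] G G' /=; rewrite ?addr0 // IH; ring. Qed.

Lemma SelZ k G L : Sel (fun x R => k * G x R) L = k * Sel G L.
Proof. by elim: L G => [|x L IH] G /=; rewrite ?mulr0 // IH; ring. Qed.

Lemma Sel_mulr k G L : Sel (fun x R => G x R * k) L = Sel G L * k.
Proof. by elim: L G => [|x L IH] G /=; rewrite ?mul0r // IH; ring. Qed.

Lemma Sel_sum (I : finType) (G : I -> A -> seq A -> int) L :
  \sum_i Sel (G i) L = Sel (fun x R => \sum_i G i x R) L.
Proof.
elim: L G => [|x L IH] G /=; first by rewrite big1.
by rewrite -IH sumrB.
Qed.

(** Choosing two entries in the opposite order changes the sign. This is what cancels interior faces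
    in [cubn_delta]. *)
Lemma Sel_anti (H : A -> A -> seq A -> int) L :
  Sel (fun x R => Sel (fun y R' => H x y R') R) L =
  - Sel (fun x R => Sel (fun y R' => H y x R') R) L.
Proof.
elim: L H => [|x L IH] H /=; first by rewrite oppr0.
by rewrite !SelB (IH (fun y z R => H y z (x :: R))); ring.
Qed.

(** The sum over all splittings of L into a sublist S of length k and the rest R, with the sign of
    the shuffle: an entry that goes to R passes the k entries of S still to come. *)
Fixpoint Shuf k L (H : seq A -> seq A -> int) : int := match L with
  | [::] => if k is 0 then H [::] [::] else 0
  | x :: L' => (if k is k'.+1 then Shuf k' L' (fun S R => H (x :: S) R) else 0)
     + (-1) ^+ k * Shuf k L' (fun S R => H S (x :: R)) end.

Lemma eq_Shuf k L H H' : (forall S R, size S = k -> H S R = H' S R) -> Shuf k L H = Shuf k L H'.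
Proof.
elim: L k H H' => [[|k] H H' h|x L IH k H H' h] //=; first by rewrite h.
congr (_ + _ * _); last by apply: IH => S R hS; apply: h.
by case: k h => // k h; apply: IH => S R hS; apply: h; rewrite /= hS.
Qed.

Lemma ShufB k L H H' : Shuf k L (fun S R => H S R - H' S R) = Shuf k L H - Shuf k L H'.
Proof.
elim: L k H H' => [[|k] H H'|x L IH [|k] H H'] /=; rewrite ?subrr ?subr0 ?IH //; ring.
Qed.

Lemma Shuf0 k L H : (forall S R, size S = k -> H S R = 0) -> Shuf k L H = 0.
Proof.
move=> h; rewrite (eq_Shuf _ h) {h H}.
by elim: L k => [[|k]|x L IH [|k]] //=; rewrite !IH mulr0 addr0.
Qed.
Lemma Sel_Shuf k L (K : A -> seq A -> seq A -> int) :
  Sel (fun x R => Shuf k R (K x)) L =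
  Shuf k.+1 L (fun S R => Sel (fun x S' => K x S' R) S).
Proof.
elim: L k K => [|y L IH] k K //=.
rewrite ShufB SelD SelZ (IH k (fun x S R => K x S (y :: R))) exprS.
case: k => [|k].
  rewrite (@Sel0 (fun _ _ => 0)) // (@Shuf0 0 L (fun S R => Sel (fun x S' => K x (y :: S') R) S)).
    by ring.
  by move=> [].
by rewrite (IH k (fun x S R => K x (y :: S) R)); ring.
Qed.

End Selection.

Lemma Shuf_zero (A : eqType) k (L : seq A) H :
  (forall S R, subseq S L -> size S = k -> H S R = 0) -> Shuf k L H = 0.
Proof.
elim: L k H => [[|k] H h|x L IH k H h] //=; first exact: h.
rewrite (IH k) ?mulr0 ?addr0 => [|S R sS hS]; last by apply: h => //; apply: subseq_trans sS (subseq_cons _ _).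
case: k h => // k h; apply: IH => S R sS hS; apply: h; first by rewrite /= eqxx.
by rewrite /= hS.
Qed.

Lemma Shuf_first (A : eqType) (L1 L2 : seq A) H : uniq (L1 ++ L2) ->
  (forall S R, subseq S (L1 ++ L2) -> size S = size L1 -> S != L1 -> H S R = 0) ->
  Shuf (size L1) (L1 ++ L2) H = H L1 L2.
Proof.
elim: L1 H => [|x L1 IH] H /= u h.
  elim: L2 H {u h} => //= y L2 IH H; rewrite add0r mul1r; exact: IH.
case/andP: u => xn u.
rewrite IH => //= [|S R sS hS nS]; last first.
  apply: h; rewrite /= ?eqxx ?hS //; apply: contra nS => /eqP[->].
  exact: eqxx.
rewrite (@Shuf_zero _ _ _ (fun S R => H S (x :: R))) ?mulr0 ?addr0 // => S R sS hS.
apply: h => //; first by apply: subseq_trans sS (subseq_cons _ _).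
apply/negP => /eqP eS; rewrite eS in sS.
by move: xn; rewrite (mem_subseq sS) // mem_head.
Qed.

Lemma Shuf_second (A : eqType) (L1 L2 : seq A) k H : uniq (L1 ++ L2) -> size L2 = k ->
  (0 < k)%N ->
  (forall S R, subseq S (L1 ++ L2) -> size S = k -> S != L2 -> H S R = 0) ->
  Shuf k (L1 ++ L2) H = (-1) ^+ (k * size L1) * H L2 L1.
Proof.
move=> + sk k0; elim: L1 H => [|x L1 IH] H u h.
  rewrite muln0 expr0 mul1r; have := @Shuf_first _ L2 [::] H; rewrite cats0 sk.
  by apply=> // S R; apply: h.
case/andP: u => xn u; rewrite /= (IH (fun S R => H S (x :: R))) // => [|S R sS hS]; last first.
  by apply: h => //; apply: subseq_trans sS (subseq_cons _ _).
have -> : (if k is k'.+1 then Shuf k' (L1 ++ L2) (fun S R => H (x :: S) R) else 0) = 0.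
  case: k sk k0 h {IH} => // k sk _ h; apply: Shuf_zero => S R sS hS.
  apply: h; rewrite /= ?eqxx ?hS //.
  apply/negP => /eqP eS; move: xn; rewrite mem_cat -eS mem_head orbT //.
by rewrite add0r mulrA -exprD mulnS.
Qed.

Lemma eq_Sel_perm (A : eqType) (G G' : A -> seq A -> int) L :
  (forall x R, perm_eq (x :: R) L -> G x R = G' x R) -> Sel G L = Sel G' L.
Proof.
elim: L G G' => //= x L IH G G' h; rewrite h //; congr (_ - _); apply: IH => y R hR.
apply: h; rewrite -(perm_cons x) in hR; apply: perm_trans hR.
by rewrite -[y :: x :: R]/([:: y] ++ [:: x] ++ R) perm_catCA.
Qed.

Lemma Sel_map (A B : Type) (f : A -> B) G L :
  Sel G (map f L) = Sel (fun x R => G (f x) (map f R)) L.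
Proof. by elim: L G => //= x L IH G; rewrite IH. Qed.

Section Cubes.
Variables (X : Type) (V : zmodType).
Implicit Types (c : seq X -> int) (k : V -> X) (p : V) (L s : seq V).

(** The simplicial coboundary on ordered lists of vertices. *)
Fixpoint dlt c (s : seq X) : int := if s is a :: t then c t - dlt (fun r => c (a :: r)) t else 0.

Fixpoint pth p s : seq V := p :: (if s is x :: t then pth (p + x) t else [::]).

(** The value of the cochain c, pulled back along the vertex map k, on the cube at p with edge
    vectors L. The cube is cut into one simplex per order of L, with the sign of that order
    (Freudenthal triangulation). *)
Fixpoint cubn n c k p L : int := if n is n'.+1 then
  Sel (fun x R => cubn n' (fun t => c (k p :: t)) k (p + x) R) L else c [:: k p].

Lemma eq_dlt c c' (s : seq X) : c =1 c' -> dlt c s = dlt c' s.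
Proof.
elim: s c c' => //= a s IH c c' h; rewrite h; congr (_ - _); apply: IH => t; exact: h.
Qed.

Lemma dltZ x c (s : seq X) : dlt (fun t => x * c t) s = x * dlt c s.
Proof. by elim: s c => [|a s IH] c /=; rewrite ?mulr0 // IH; ring. Qed.

Lemma dlt_rcons c (s : seq X) a : dlt c (rcons s a) = dlt (fun t => c (rcons t a)) s + (-1) ^+ size s * c s.
Proof.
elim: s c => [|b s IH] c /=; first by rewrite add0r mul1r subr0.
by rewrite IH exprS; ring.
Qed.

Lemma dlt_sum c (s : seq X) : dlt c s = \sum_(i < size s) (-1) ^+ i * c (take i s ++ drop i.+1 s).
Proof.
elim: s c => [|a s IH] c /=; first by rewrite big_ord0.
rewrite IH big_ord_recl /= ?drop0 mul1r; congr (_ + _).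
rewrite -sumrN; apply: eq_bigr => i _; rewrite /bump /= add1n exprS; ring.
Qed.

Lemma eq_cubn n c c' k p L : c =1 c' -> cubn n c k p L = cubn n c' k p L.
Proof.
elim: n c c' p L => [|n IH] c c' p L h /=; first exact: h.
by apply: eq_Sel => x R _; apply: IH => t; apply: h.
Qed.

Lemma cubnB n c c' k p L : cubn n (fun t => c t - c' t) k p L = cubn n c k p L - cubn n c' k p L.
Proof.
elim: n c c' p L => [//|n IH] c c' p L /=; rewrite -SelB.
by apply: eq_Sel => x R _; apply: IH.
Qed.

Lemma cubnZ n x c k p L : cubn n (fun t => x * c t) k p L = x * cubn n c k p L.
Proof.
elim: n c p L => [//|n IH] c p L /=; rewrite -SelZ.
by apply: eq_Sel => y R _; apply: IH.
Qed.

(** Stokes for a cube: the faces interior to the triangulation cancel in pairs, and the pairs of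
    opposite facets remain. *)
Lemma cubn_delta n c k p L : size L = n.+1 -> cubn n.+1 (dlt c) k p L =
  Sel (fun x R => cubn n c k (p + x) R - cubn n c k p R) L.
Proof.
elim: n c p L => [|n IH] c p L sL.
  by case: L sL => [|x [|]] //= _; rewrite !subr0.
have -> : cubn n.+2 (dlt c) k p L =
    Sel (fun x R => cubn n.+1 c k (p + x) R - cubn n.+1 (dlt (fun t => c (k p :: t))) k (p + x) R) L.
  by apply: eq_Sel => x R _; rewrite -cubnB.
rewrite !SelB; congr (_ - _).
have -> : Sel (fun x R => cubn n.+1 (dlt (fun t => c (k p :: t))) k (p + x) R) L =
  Sel (fun x R => Sel (fun y R' => cubn n (fun t => c (k p :: t)) k (p + x + y) R') R) L
  - Sel (fun x R => Sel (fun y R' => cubn n (fun t => c (k p :: t)) k (p + x) R') R) L.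
  rewrite -SelB; apply: eq_Sel => x R hR; rewrite IH ?SelB //.
  by rewrite hR sL.
have -> : Sel (fun x R => Sel (fun y R' => cubn n (fun t => c (k p :: t)) k (p + x + y) R') R) L = 0.
  set S := Sel _ L; have : S = - S.
    rewrite {1}/S Sel_anti; congr (- _); apply: eq_Sel => x R _; apply: eq_Sel => y R' _.
    by rewrite addrAC.
  lia.
by rewrite sub0r Sel_anti opprK.
Qed.

Lemma eq_cubn_on (P : V -> Prop) n c k k' p L : P p -> size L = n ->
  (forall v x, P v -> x \in L -> P (v + x)) -> (forall v, P v -> k v = k' v) ->
  cubn n c k p L = cubn n c k' p L.
Proof.
move=> + + + hk; elim: n c p L => [|n IH] c p L Pp sL hP /=; first by rewrite hk.
apply: eq_Sel_perm => x R hR; rewrite hk //; apply: IH.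
- by apply: hP => //; rewrite -(perm_mem hR) mem_head.
- by have := perm_size hR; rewrite /= sL => -[].
by move=> v y Pv yR; apply: hP => //; rewrite -(perm_mem hR) inE yR orbT.
Qed.

Lemma cubn_zero n c k p L : size L = n ->
  (forall s, perm_eq s L -> c (map k (pth p s)) = 0) -> cubn n c k p L = 0.
Proof.
elim: n c p L => [|n IH] c p L sL h /=; first by case: L sL h => // _ /(_ [::] isT).
rewrite (eq_Sel_perm (G' := fun _ _ => 0)); first by apply: Sel0.
move=> x R hR; apply: IH; first by have := perm_size hR; rewrite /= sL => -[].
move=> s hs; have /= := h (x :: s); apply; apply: perm_trans hR.
by rewrite perm_cons.
Qed.

Lemma pth_prefix p s v : v \in pth p s -> exists t t', s = t ++ t' /\ v = p + \sum_(x <- t) x.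
Proof.
elim: s p => [|x s IH] p /=.
  by rewrite inE => /eqP->; exists [::], [::]; rewrite big_nil addr0.
rewrite inE => /orP[/eqP->|/IH[t [t' [-> ->]]]].
  by exists [::], (x :: s); rewrite big_nil addr0.
by exists (x :: t), t'; rewrite big_cons addrA.
Qed.
End Cubes.

Section Slice.
Variables (X : Type) (V : finZmodType).

Lemma sum_transl (F : V -> int) x : \sum_p F (p + x) = \sum_p F p.
Proof. by rewrite [RHS](reindex_inj (addIr x)). Qed.

(** A torus has no boundary: summed over all base points, opposite facets cancel by translation. *)
Lemma sum_delta n (c : seq X -> int) (k : V -> X) L : size L = n.+1 ->
  \sum_p cubn n.+1 (dlt c) k p L = 0.
Proof.
move=> sL; under eq_bigr => p _ do rewrite cubn_delta //.
rewrite Sel_sum; apply: Sel0 => x R _; rewrite sumrB.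
by rewrite (sum_transl (fun p => cubn n c k p R)) subrr.
Qed.

Lemma pair_shift (p x : V) (i : int) : (p, i) + (x, 0) = (p + x, i).
Proof. by apply: injective_projections => //=; rewrite addr0. Qed.

(** Homotopy invariance: Stokes on prisms with one additional integer direction, whose side facets
    cancel by translation. *)
Lemma slice n (c : seq X -> int) (k : V * int -> X) (L : seq V) : size L = n ->
  (forall p s, perm_eq s ((0, 1) :: map (fun x => (x, 0)) L) ->
     dlt c (map k (pth (p, 0) s)) = 0) ->
  \sum_p cubn n c (fun p => k (p, 0)) p L = \sum_p cubn n c (fun p => k (p, 1)) p L.
Proof.
move=> sL h; pose M := (0, 1) :: map (fun x : V => (x, 0 : int)) L.
have z p : cubn n.+1 (dlt c) k (p, 0) M = 0.
  by apply: cubn_zero => [|s hs]; [rewrite /= size_map sL|apply: h].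
have : \sum_p cubn n.+1 (dlt c) k (p, 0) M = 0 by rewrite big1.
under eq_bigr => p _ do rewrite cubn_delta /= ?size_map ?sL //.
rewrite sumrB Sel_sum Sel_map (Sel0 (L := L)); last first.
  move=> x R _; rewrite sumrB; apply/eqP; rewrite subr_eq0; apply/eqP.
  rewrite -[RHS](sum_transl (fun p => cubn n c k (p, 0) ((0, 1) :: map (fun x => (x, 0)) R)) x).
  by apply: eq_bigr => p _; rewrite pair_shift.
rewrite subr0 sumrB => /eqP; rewrite subr_eq0 => /eqP e.
have lvl (i : int) p : cubn n c k (p, i) (map (fun x => (x, 0)) L) = cubn n c (fun p => k (p, i)) p L.
  elim: n c p L {sL h z M e} => [//|n IH] c p L /=; rewrite Sel_map; apply: eq_Sel => x R _.
  by rewrite -IH pair_shift.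
under eq_bigr do rewrite -lvl; under [RHS]eq_bigr do rewrite -lvl.
rewrite -e; apply: eq_bigr => p _; congr (cubn _ _ _ _ _).
by apply: injective_projections => /=; rewrite ?addr0 ?add0r.
Qed.
End Slice.
End CubeChains.

(** * The determinant cocycle and the degree of a labelling *)

Module CochainDegree.
Import all_boot all_order all_fingroup all_algebra.
Import zify ring.
Import CubeChains.
Set Implicit Arguments. Unset Strict Implicit. Unset Printing Implicit Defensive.
Import Order.TTheory GRing.Theory Num.Theory.
Local Open Scope ring_scope.

Lemma det_ker n (B : 'M[int]_n) (v : 'cV_n) j : B *m v = 0 -> v j 0 = 1 -> \det B = 0.
Proof.
move=> h hj; have : \adj B *m (B *m v) = 0 by rewrite h mulmx0.
rewrite mulmxA mul_adj_mx mul_scalar_mx => /matrixP/(_ j 0).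
by rewrite !mxE hj mulr1.
Qed.

Lemma nth_del (T : Type) (x0 : T) (l : seq T) i j :
  nth x0 (take i l ++ drop i.+1 l) j = nth x0 l (bump i j).
Proof.
case: (ltnP i (size l)) => il.
  rewrite nth_cat size_take il /bump.
  case: (ltnP j i) => ji /=; first by rewrite nth_take.
  by rewrite nth_drop add1n addSn subnKC.
rewrite take_oversize // drop_oversize ?cats0 /bump; last exact: leqW.
case: leqP => ij //=.
by rewrite !nth_default //; lia.
Qed.

Section Cochain.
Variable m : nat.
Notation X := 'I_m.+2.

(** For lists of length m + 2: the sign of the order if all labels occur, and 0 otherwise. *)
Definition dt (l : seq X) : int :=
  \det (\matrix_(i < m.+2, j < m.+2) ((nth ord0 l i == j)%:R : int)).

(** The coboundary is the expansion, along a column of ones, of a matrix whose other columns add up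
    to that column. *)
Lemma dt_cramer l : size l = m.+3 -> dlt dt l = 0.
Proof.
move=> sl.
pose B := \matrix_(i < m.+3, j < m.+3)
  (if unlift ord0 j is Some j' then (nth ord0 l i == j')%:R else 1 : int).
have dB : \det B = 0.
  apply: (@det_ker _ _ (\col_j (if j == ord0 then 1 else -1)) ord0); last by rewrite mxE.
  apply/matrixP => i k; rewrite !mxE big_ord_recl !mxE unlift_none eqxx mulr1.
  have lf (j : 'I_m.+2) : (lift ord0 j == ord0 :> 'I_m.+3) = false.
    by rewrite eq_sym (negbTE (neq_lift _ _)).
  rewrite (bigD1 (nth ord0 l i)) //= !mxE liftK eqxx lf.
  rewrite big1 => [|j nj]; first by rewrite addr0 mul1r subrr.
  by rewrite !mxE liftK eq_sym (negbTE nj) mul0r.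
rewrite dlt_sum -[RHS]dB (expand_det_col _ ord0) sl; apply: eq_bigr => i _.
rewrite mxE unlift_none mul1r /cofactor addn0; congr (_ * _).
by congr (\det _); apply/matrixP => i' j; rewrite !mxE liftK nth_del.
Qed.

Lemma dt_missing l b : size l = m.+2 -> b \notin l -> dt l = 0.
Proof.
move=> sl bl; apply: (@det_ker _ _ (\col_j (j == b)%:R) b); last by rewrite mxE eqxx.
apply/matrixP => i k; rewrite !mxE big1 // => j _; rewrite !mxE.
case: (j =P b) => [->|_]; last by rewrite mulr0.
case: eqP => [e|_]; last by rewrite mul0r.
by case/negP: bl; rewrite -e mem_nth // sl.
Qed.

(** Counts with sign the facet opposite to the vertex a of the (m + 1)-simplex of labels. This
    represents the top class of the boundary sphere, and it is closed on simplices that miss a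
    label. *)
Definition uu a (l : seq X) := dt (rcons l a).

Lemma uu_missing a l b : size l = m.+1 -> b \notin l -> b != a -> uu a l = 0.
Proof.
move=> sl bl ba; apply: (@dt_missing _ b); first by rewrite size_rcons sl.
by rewrite mem_rcons inE negb_or ba.
Qed.

Lemma uu_closed a l b : size l = m.+2 -> b \notin l -> dlt (uu a) l = 0.
Proof.
move=> sl bl; have := @dt_cramer (rcons l a); rewrite size_rcons sl => /(_ erefl).
by rewrite dlt_rcons (dt_missing sl bl) mulr0 addr0.
Qed.

(** Two facets of a sphere give cohomologous cocycles, so the degree does not depend on the facet
    that is counted. *)
Lemma uu_change a b l : size l = m.+1 -> uu a l - uu b l =
  dlt (fun t => (-1) ^+ m.+1 * dt (rcons (rcons t a) b)) l.
Proof.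
move=> sl; have := @dt_cramer (rcons (rcons l a) b); rewrite !size_rcons sl => /(_ erefl).
rewrite !dlt_rcons size_rcons sl dltZ -/(uu b _) -/(uu a _) => e.
have {e}-> : dlt (fun t => dt (rcons (rcons t a) b)) l =
  - ((-1) ^+ m.+1 * uu b l + (-1) ^+ m.+2 * uu a l).
  by apply/eqP; rewrite -addr_eq0 addrA; apply/eqP.
have sq : (-1) ^+ m.+1 * (-1) ^+ m.+1 = 1 :> int by rewrite -expr2 sqrr_sign.
have -> : (-1) ^+ m.+1 * - ((-1) ^+ m.+1 * uu b l + (-1) ^+ m.+2 * uu a l) =
  (-1) ^+ m.+1 * (-1) ^+ m.+1 * (uu a l - uu b l) by rewrite [(-1) ^+ m.+2]exprS; ring.
by rewrite sq mul1r.
Qed.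

End Cochain.

Lemma eq_cubn_size (X : Type) (V : zmodType) n (c c' : seq X -> int) (k : V -> X) p L :
  (forall t, size t = n.+1 -> c t = c' t) -> cubn n c k p L = cubn n c' k p L.
Proof.
elim: n c c' p L => [|n IH] c c' p L h /=; first exact: h.
by apply: eq_Sel => x R _; apply: IH => t st; apply: h; rewrite /= st.
Qed.

Lemma cubn_swap (X : Type) (V : zmodType) n (c : seq X -> int) (k : V -> X) p x y L : size L = n ->
  cubn n.+2 c k p (x :: y :: L) = - cubn n.+2 c k p (y :: x :: L).
Proof.
elim: n c p L => [|n IH] c p L sL.
  by case: L sL => //= _; ring.
have E z t : cubn n.+3 c k p (z :: t :: L) =
   cubn n.+2 (fun s => c (k p :: s)) k (p + z) (t :: L)
   - (cubn n.+2 (fun s => c (k p :: s)) k (p + t) (z :: L)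
   - Sel (fun w R => cubn n.+2 (fun s => c (k p :: s)) k (p + w) (z :: t :: R)) L) by [].
rewrite (E x y) (E y x).
have -> : Sel (fun w R => cubn n.+2 (fun s => c (k p :: s)) k (p + w) (x :: y :: R)) L =
  -1 * Sel (fun w R => cubn n.+2 (fun s => c (k p :: s)) k (p + w) (y :: x :: R)) L.
  rewrite -SelZ; apply: eq_Sel => w R sR; rewrite IH ?mulN1r //.
  by rewrite sR sL.
by ring.
Qed.

Definition incube (V : zmodType) (p : V) (E : seq V) (v : V) :=
  exists t t', perm_eq (t ++ t') E /\ v = p + \sum_(x <- t) x.

Lemma pth_incube (V : zmodType) (p : V) s E v : perm_eq s E -> v \in pth p s -> incube p E v.
Proof. by move=> sE /pth_prefix[t [t' [es ->]]]; exists t, t'; rewrite -es. Qed.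

Lemma size_pth (V : zmodType) (p : V) s : size (pth p s) = (size s).+1.
Proof. by elim: s p => //= x s IH p; rewrite IH. Qed.

Lemma sum01 (x y : int) : 0 <= x -> 0 <= y -> x + y = 1 + 0 -> x = 0 \/ x = 1.
Proof. lia. Qed.

Lemma pth_slice (V : zmodType) (p : V) (L : seq V) s v :
  perm_eq s ((0, 1) :: map (fun x => (x, 0 : int)) L) -> v \in pth (p, 0 : int) s ->
  incube p (0 :: L) v.1 /\ (v.2 = 0 \/ v.2 = 1).
Proof.
move=> sE /(pth_incube sE)[t [t' [h ->]]] /=; split.
  exists (map fst t), (map fst t'); split.
    have := perm_map fst h; rewrite map_cat /= -map_comp.
    by rewrite (eq_map (g := id)) // map_id.
  by rewrite big_map (big_morph (fun z : V * int => z.1) (id1 := 0) (op1 := +%R)).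
rewrite add0r (big_morph (fun z : V * int => z.2) (id1 := 0) (op1 := +%R)) //.
have : \sum_(z <- t ++ t') z.2 = \sum_(z <- (0, 1) :: map (fun x => (x, 0 : int)) L) z.2.
  exact: perm_big.
rewrite big_cat big_cons big_map /= [X in _ = _ + X]big1 // => e.
have pos (r : seq (V * int)) : {subset r <= (0, 1) :: map (fun x => (x, 0 : int)) L} ->
    0 <= \sum_(z <- r) z.2.
  move=> sub; rewrite big_seq; apply: sumr_ge0 => z /sub.
  by rewrite inE => /orP[/eqP->//|/mapP[x _ ->]].
have h1 := pos t; have h2 := pos t'.
have s1 : {subset t <= (0, 1) :: map (fun x => (x, 0 : int)) L}.
  by move=> z zt; rewrite -(perm_mem h) mem_cat zt.
have s2 : {subset t' <= (0, 1) :: map (fun x => (x, 0 : int)) L}.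
  by move=> z zt; rewrite -(perm_mem h) mem_cat zt orbT.
exact: sum01 (h1 s1) (h2 s2) e.
Qed.

Lemma uu_dup m a (l : seq 'I_m.+2) : size l = m.+1 -> ~~ uniq l -> uu a l = 0.
Proof.
move=> sl nu; have sl2 : size (rcons l a) = m.+2 by rewrite size_rcons sl.
case: (boolP [forall b, b \in rcons l a]) => [/forallP all_in|].
  have : uniq (rcons l a).
    apply: (@leq_size_uniq _ (enum 'I_m.+2)); first exact: enum_uniq.
      by move=> b _; apply: all_in.
    by rewrite size_enum_ord sl2.
  by rewrite rcons_uniq (negbTE nu) andbF.
by rewrite negb_forall => /existsP[b hb]; apply: dt_missing hb.
Qed.

Lemma pth_dup (V : zmodType) (p : V) s E : perm_eq s (0 :: E) -> ~~ uniq (pth p s).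
Proof.
move=> hs; have : 0 \in s by rewrite (perm_mem hs) mem_head.
elim: s p {hs} => //= x s IH p; rewrite inE => /orP[/eqP<-|/IH h]; last by rewrite negb_and h orbT.
by rewrite addr0; case: s {IH} => [|y s]; rewrite /= mem_head.
Qed.

Lemma cubn_transl (X : Type) (V : zmodType) n (c : seq X -> int) (k : V -> X) w p L :
  cubn n c (fun v => k (v + w)) p L = cubn n c k (p + w) L.
Proof.
elim: n c p L => [//|n IH] c p L /=; apply: eq_Sel => x R _.
by rewrite IH addrAC.
Qed.

Lemma cubn_morph (X : Type) (V W : zmodType) (f : W -> V) : {morph f : y z / y + z} ->
  forall n (k : V -> X) (c : seq X -> int) p L,
  cubn n c (fun v => k (f v)) p L = cubn n c k (f p) (map f L).
Proof.
move=> fD n k; elim: n => [//|n IH] c p L /=; rewrite Sel_map; apply: eq_Sel => x R _.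
by rewrite IH fD.
Qed.

Lemma Sel_cons2 (A : Type) (G : A -> seq A -> int) x y L : Sel G (x :: y :: L) =
  G x (y :: L) - (G y (x :: L) - Sel (fun z R => G z (x :: y :: R)) L).
Proof. by []. Qed.

Section Degree.
Variables (h : nat) (V : finZmodType).
Notation m := h.+1.
Notation X := 'I_m.+2.
Implicit Types (l : V -> X) (L : seq V).

(** The sum runs over the whole group, so all parallel translates of the torus in the directions L
    are counted; [Tdeg_avg] accounts for their number. *)
Definition Deg a l L : int := \sum_p cubn m (uu a) l p L.

Lemma Deg_facet a b l L : size L = m -> Deg a l L = Deg b l L.
Proof.
move=> sL; apply/eqP; rewrite -subr_eq0 -sumrB.
under eq_bigr => p _ do rewrite -cubnB.
have e p : cubn m (fun t => uu a t - uu b t) l p L =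
  cubn m (dlt (fun t => (-1) ^+ m.+1 * dt (rcons (rcons t a) b))) l p L.
  by apply: eq_cubn_size => t st; apply: uu_change.
by under eq_bigr => p _ do rewrite e; rewrite sum_delta.
Qed.

Lemma Deg_swap a l x y L : size L = h.-1 -> (0 < h)%N ->
  Deg a l (x :: y :: L) = - Deg a l (y :: x :: L).
Proof.
move=> sL h0; rewrite /Deg -sumrN; apply: eq_bigr => p _.
have -> : cubn m = @cubn X V h.-1.+2 by rewrite prednK.
exact: cubn_swap.
Qed.

Lemma Deg_slice a (k : V * int -> X) L : size L = m ->
  (forall p s, perm_eq s ((0, 1) :: map (fun x => (x, 0)) L) ->
     exists b, forall z, z \in pth (p, 0) s -> k z != b) ->
  Deg a (fun p => k (p, 0)) L = Deg a (fun p => k (p, 1)) L.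
Proof.
move=> sL good; apply: slice => // p s hs.
have [b hb] := good p s hs; apply: (@uu_closed _ _ _ b).
  by rewrite size_map size_pth (perm_size hs) /= size_map sL.
by apply/mapP => -[z zs e]; have := hb z zs; rewrite -e eqxx.
Qed.

(** Stokes on a degenerate square times the directions L. The map k sends the corners (0,0), (1,0),
    (0,1), (1,1) to 0, w, w + w', w + w', so that three sides are w, w' and w + w', while the fourth
    is constant and contributes nothing because [uu] vanishes on repeated labels. *)
Lemma Deg_add a l w w' L : size L = h ->
  (forall p, exists b, forall v, incube p (w :: w' :: 0 :: 0 :: L) v -> l v != b) ->
  Deg a l (w + w' :: L) = Deg a l (w :: L) + Deg a l (w' :: L).
Proof.
move=> sL good.
pose W := (V * int * int)%type.
pose k (z : W) := l (z.1.1 + w *~ (z.1.2 * (1 - z.2)) + (w + w') *~ z.2).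
pose i1 : W := (0, 1, 0); pose i2 : W := (0, 0, 1).
pose lf (x : V) : W := (x, 0, 0).
pose M := i1 :: i2 :: map lf L.
have nonneg (P : W -> int) (r : seq W) : P i1 = 0 \/ P i1 = 1 -> P i2 = 0 \/ P i2 = 1 ->
    (forall x, P (lf x) = 0) -> {subset r <= M} -> 0 <= \sum_(z <- r) P z.
  move=> h1 h2 h3 sub; rewrite big_seq; apply: sumr_ge0 => z /sub.
  rewrite !inE => /or3P[/eqP->|/eqP->|/mapP[x _ ->]]; last by rewrite h3.
    by case: h1 => ->.
  by case: h2 => ->.
have z0 p : cubn m.+1 (dlt (uu a)) k (p, 0, 0) M = 0.
  apply: cubn_zero => [|s hs]; first by rewrite /= size_map sL.
  have [b hb] := good p; apply: (@uu_closed _ _ _ b).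
    by rewrite size_map size_pth (perm_size hs) /= size_map sL.
  apply/mapP => -[z zs e]; have [t [t' [ht ez]]] := pth_incube hs zs.
  have s1 : {subset t <= M} by move=> y yt; rewrite -(perm_mem ht) mem_cat yt.
  have s2 : {subset t' <= M} by move=> y yt; rewrite -(perm_mem ht) mem_cat yt orbT.
  have e1 : z.1.1 = p + \sum_(x <- map (fun y : W => y.1.1) t) x.
    by rewrite ez big_map /= (big_morph (fun z : W => z.1.1) (id1 := 0) (op1 := +%R)).
  have e2 : z.1.2 = \sum_(y <- t) y.1.2.
    by rewrite ez /= (big_morph (fun z : W => z.1.2) (id1 := 0) (op1 := +%R)) ?add0r.
  have e3 : z.2 = \sum_(y <- t) y.2.
    by rewrite ez /= (big_morph (fun z : W => z.2) (id1 := 0) (op1 := +%R)) ?add0r.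
  have b2 : z.1.2 = 0 \/ z.1.2 = 1.
    rewrite e2; apply: (@sum01 _ (\sum_(y <- t') y.1.2)).
    + by apply: (nonneg (fun y => y.1.2)) => //; [right|left].
    + by apply: (nonneg (fun y => y.1.2)) => //; [right|left].
    rewrite -big_cat (perm_big _ ht) /= !big_cons big_map big1 //.
  have b3 : z.2 = 0 \/ z.2 = 1.
    rewrite e3; apply: (@sum01 _ (\sum_(y <- t') y.2)).
    + by apply: (nonneg (fun y => y.2)) => //; [left|right].
    + by apply: (nonneg (fun y => y.2)) => //; [left|right].
    rewrite -big_cat (perm_big _ ht) /= !big_cons big_map big1 //.
  have pt : perm_eq (map (fun y : W => y.1.1) t ++ map (fun y : W => y.1.1) t') (0 :: 0 :: L).
    have := perm_map (fun y : W => y.1.1) ht; rewrite map_cat /= -map_comp.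
    by rewrite (eq_map (g := id)) // map_id.
  suff inc : incube p (w :: w' :: 0 :: 0 :: L)
      (z.1.1 + w *~ (z.1.2 * (1 - z.2)) + (w + w') *~ z.2).
    by have := hb _ inc; rewrite -/(k z) -e eqxx.
  set T := map _ t in e1 pt; set T' := map _ t' in pt; rewrite e1.
  case: b3 => ->; last first.
    exists (w :: w' :: T), T'; split; first by rewrite /= !perm_cons.
    by rewrite subrr mulr0 mulr0z addr0 mulr1z !big_cons; rewrite -!addrA; congr (p + _);
      rewrite addrC -addrA.
  rewrite subr0 mulr1 mulr0z addr0; case: b2 => ->.
    exists T, (w :: w' :: T'); split; last by rewrite mulr0z addr0.
    by rewrite -[w :: w' :: T']/([:: w; w'] ++ T') perm_catCA /= !perm_cons.
  exists (w :: T), (w' :: T'); split; last by rewrite mulr1z big_cons -addrA [_ + w]addrC.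
  by rewrite /= perm_cons -[w' :: T']/([:: w'] ++ T') perm_catCA /= !perm_cons.
have : \sum_p cubn m.+1 (dlt (uu a)) k (p, 0, 0) M = 0 by rewrite big1.
have sM : size M = m.+1 by rewrite /= size_map sL.
have [cb ecb] : exists cb, cb = cubn m (uu a) k by eexists.
under eq_bigr => p _ do rewrite (cubn_delta _ _ _ sM) Sel_cons2 -ecb.
rewrite !sumrB Sel_sum Sel_map (Sel0 (L := L)); last first.
  move=> x R _; rewrite sumrB; apply/eqP; rewrite subr_eq0; apply/eqP.
  rewrite -[RHS](sum_transl (fun p => cb (p, 0, 0) (i1 :: i2 :: map lf R)) x).
  by apply: eq_bigr => p _; congr (cb _ _); rewrite /lf !pair_shift.
rewrite subr0.
pose fa (x : V) (z : W) := z.1.1 + x *~ z.1.2.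
pose fb (x : V) (z : W) := z.1.1 + x *~ z.2.
have fa_add x : {morph fa x : y z / y + z}.
  by move=> [[? ?] ?] [[? ?] ?]; rewrite /fa /= mulrzDr addrACA.
have fb_add x : {morph fb x : y z / y + z}.
  by move=> [[? ?] ?] [[? ?] ?]; rewrite /fb /= mulrzDr addrACA.
have mapa x R : map (fa x) (map lf R) = R.
  by rewrite -map_comp -[RHS]map_id; apply: eq_map => y; rewrite /fa /= mulr0z addr0.
have mapb x R : map (fb x) (map lf R) = R.
  by rewrite -map_comp -[RHS]map_id; apply: eq_map => y; rewrite /fb /= mulr0z addr0.
have lfP (P : W -> int) y : y \in map lf L -> (forall x, P (lf x) = 0) -> P y = 0.
  by move=> /mapP[x _ ->] ->.
have T1 p : cb ((p, 0, 0) + i1) (i2 :: map lf L) = cubn m (uu a) l (p + w) (w' :: L).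
  rewrite ecb -(cubn_transl _ _ l w) (@eq_cubn_on _ _ (fun z => z.1.2 = 1) _ _ _ (fun z => l (fb w' z + w))).
  - by rewrite (cubn_morph (fb_add w') _ (fun v => l (v + w))) /= mapb /fb /= !(addr0, mulr1z, add0r).
  - by rewrite /= add0r.
  - by rewrite /= size_map sL.
  - move=> z y /= hz; rewrite inE => /orP[/eqP->|/(lfP (fun z => z.1.2)) ->] //=; by rewrite ?addr0.
  move=> z hz; rewrite /k /fb hz mul1r; congr l.
  by rewrite mulrzBr mulrzDl mulr1z -!addrA; congr (_ + _); rewrite addrA subrKA addrC.
have T2 p : cb (p, 0, 0) (i2 :: map lf L) = cubn m (uu a) l p (w + w' :: L).
  rewrite ecb (@eq_cubn_on _ _ (fun z => z.1.2 = 0) _ _ _ (fun z => l (fb (w + w') z))).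
  - by rewrite (cubn_morph (fb_add _) _ l) /= mapb /fb /= !(addr0, mulr1z, add0r, mulr0z).
  - by [].
  - by rewrite /= size_map sL.
  - move=> z y /= hz; rewrite inE => /orP[/eqP->|/(lfP (fun z => z.1.2)) ->] //=; by rewrite ?addr0.
  by move=> z hz; rewrite /k /fb hz mul0r mulr0z addr0.
have T3 p : cb ((p, 0, 0) + i2) (i1 :: map lf L) = 0.
  rewrite ecb (@eq_cubn_on _ _ (fun z => z.2 = 1) _ _ _ (fun z => l (fa 0 z + (w + w')))).
  - rewrite (cubn_morph (fa_add 0) _ (fun v => l (v + (w + w')))) [map _ _]/= mapa.
    have -> : fa 0 i1 = 0 by rewrite /fa /= add0r mul0rz.
    apply: cubn_zero => [|s hs]; first by rewrite /= sL.
    apply: uu_dup; first by rewrite size_map size_pth (perm_size hs) /= sL.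
    by apply/negP => /map_uniq; apply/negP; apply: pth_dup hs.
  - by rewrite /= add0r.
  - by rewrite /= size_map sL.
  - move=> z y /= hz; rewrite inE => /orP[/eqP->|/(lfP snd) ->] //=; by rewrite ?addr0.
  by move=> z hz; rewrite /k /fa hz subrr mulr0 mulr0z mul0rz mulr1z !addr0.
have T4 p : cb (p, 0, 0) (i1 :: map lf L) = cubn m (uu a) l p (w :: L).
  rewrite ecb (@eq_cubn_on _ _ (fun z => z.2 = 0) _ _ _ (fun z => l (fa w z))).
  - by rewrite (cubn_morph (fa_add w) _ l) [map _ _]/= mapa /fa /= !(addr0, mulr1z, add0r, mulr0z).
  - by [].
  - by rewrite /= size_map sL.
  - move=> z y /= hz; rewrite inE => /orP[/eqP->|/(lfP snd) ->] //=; by rewrite ?addr0.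
  by move=> z hz; rewrite /k /fa hz subr0 mulr1 mulr0z addr0.
rewrite (eq_bigr _ (fun p _ => T1 p)) (eq_bigr _ (fun p _ => T2 p)).
rewrite (eq_bigr _ (fun p _ => T3 p)) (eq_bigr _ (fun p _ => T4 p)).
rewrite (sum_transl (fun p => cubn m (uu a) l p (w' :: L))) -!/(Deg _ _ _).
rewrite sumr_const mul0rn sub0r opprK => /eqP; rewrite addrAC subr_eq0 => /eqP <-.
by rewrite addrC.
Qed.
End Degree.
End CochainDegree.

(** * Cup products and the quadratic relation between degrees *)

Module CupShuffle.
Import all_boot all_order all_fingroup all_algebra.
Import zify ring.
Import CubeChains CochainDegree.
Set Implicit Arguments. Unset Strict Implicit. Unset Printing Implicit Defensive.
Import Order.TTheory GRing.Theory Num.Theory.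
Local Open Scope ring_scope.

Lemma Shuf_nil (A : Type) (L : seq A) H : Shuf 0 L H = H [::] L.
Proof. by elim: L H => //= y L IH H; rewrite add0r mul1r IH. Qed.

Lemma Shuf_sum (A : Type) (I : finType) k (L : seq A) (H : I -> seq A -> seq A -> int) :
  \sum_i Shuf k L (H i) = Shuf k L (fun S R => \sum_i H i S R).
Proof.
elim: L k H => [[|k] H|x L IH k H] //=; first by rewrite big1.
rewrite big_split -mulr_sumr IH; congr (_ + _ * _).
by case: k => [|k]; [rewrite big1|rewrite IH].
Qed.

Lemma eq_cubnk (X : Type) (V : zmodType) n (c : seq X -> int) (k k' : V -> X) p L : k =1 k' ->
  cubn n c k p L = cubn n c k' p L.
Proof.
move=> e; elim: n c p L => [|n IH] c p L /=; rewrite e //.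
by apply: eq_Sel => x R _; rewrite IH.
Qed.

Lemma cubn_lab (X Y : Type) (V : zmodType) (f : X -> Y) n (c : seq Y -> int) (k : V -> X) p L :
  cubn n (fun t => c (map f t)) k p L = cubn n c (fun v => f (k v)) p L.
Proof.
elim: n c p L => [//|n IH] c p L /=; apply: eq_Sel => x R _.
by rewrite -IH.
Qed.

Lemma dlt_map (X Y : Type) (f : X -> Y) (c : seq Y -> int) s :
  dlt (fun r => c (map f r)) s = dlt c (map f s).
Proof. by elim: s c => //= a s IH c; rewrite -IH. Qed.

Section Cup.
Variables (X Y : Type).
Implicit Types (u : seq X -> int) (s : seq (X * Y)).

(** The Alexander-Whitney product; the two factors read different components, so that they may be
    evaluated at different points. *)
Definition cup k u (u' : seq Y -> int) s := u (map fst (take k.+1 s)) * u' (map snd (drop k s)).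

Lemma dlt_cup k u (u' : seq Y -> int) s : (k.+1 < size s)%N -> dlt (cup k u u') s =
  dlt u (map fst (take k.+2 s)) * u' (map snd (drop k.+1 s))
  + (-1) ^+ k * (u (map fst (take k.+1 s)) * dlt u' (map snd (drop k s))).
Proof.
elim: k u s => [|k IH] u [|a [|b s]] // hs.
  rewrite expr0 mul1r /= ?take0 ?drop0 /= ?subr0.
  rewrite (@eq_dlt _ _ (fun r => u [:: a.1] * u' [:: a.2, b.2 & map snd r])); last first.
    by move=> r; rewrite /cup /= ?take0.
  rewrite dltZ (dlt_map snd (fun r => u' [:: a.2, b.2 & r])) /cup /= ?take0; ring.
rewrite [LHS]/= -/(dlt (fun r => cup k.+1 u u' (a :: r)) (b :: s)).
rewrite (@eq_dlt _ _ (cup k (fun r => u (a.1 :: r)) u')) // IH //.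
have -> : dlt u [seq i.1 | i <- take k.+3 [:: a, b & s]] =
  u (map fst (take k.+2 (b :: s))) - dlt (fun r => u (a.1 :: r)) (map fst (take k.+2 (b :: s))) by [].
by rewrite /cup exprS /=; ring.
Qed.
End Cup.

(** An order of the edges is a choice of the k edges used first, an order of these and an order of
    the others; its sign is the product of the three signs. *)
Lemma cubn_cup (X Y : Type) (V : zmodType) k n (u : seq X -> int) (u' : seq Y -> int)
    (K : V -> X * Y) p L : size L = (k + n)%N ->
  cubn (k + n) (cup k u u') K p L =
  Shuf k L (fun S R => cubn k u (fun v => (K v).1) p S
    * cubn n u' (fun v => (K v).2) (p + \sum_(x <- S) x) R).
Proof.
elim: k u p L => [|k IH] u p L sL.
  rewrite Shuf_nil big_nil addr0 add0n -(cubn_lab snd); case: n sL => [|n] sL /=.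
    by rewrite /cup /= ?take0.
  rewrite -SelZ; apply: eq_Sel => x R _; rewrite -cubnZ; apply: eq_cubn => t.
  by rewrite /cup /= ?take0.
rewrite addSn [LHS]/=.
rewrite (@eq_Sel _ _ (fun x R => Shuf k R (fun S R' =>
    cubn k (fun t => u ((K p).1 :: t)) (fun v => (K v).1) (p + x) S
    * cubn n u' (fun v => (K v).2) (p + x + \sum_(y <- S) y) R'))); last first.
  by move=> x R sR; rewrite -IH ?sR ?sL //; apply: eq_cubn => t.
rewrite Sel_Shuf; apply: eq_Shuf => S R _ /=.
rewrite -Sel_mulr; apply: eq_Sel_perm => x S' pS.
by rewrite -addrA -(perm_big _ pS) big_cons.
Qed.

Lemma Shuf_two (A : eqType) (L1 L2 : seq A) k G : uniq (L1 ++ L2) -> size L1 = k -> size L2 = k ->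
  (0 < k)%N ->
  (forall S R, subseq S (L1 ++ L2) -> size S = k -> S != L1 -> S != L2 -> G S R = 0) ->
  Shuf k (L1 ++ L2) G = G L1 L2 + (-1) ^+ (k * k) * G L2 L1.
Proof.
move=> u s1 s2 k0 z.
have n12 : L2 != L1.
  apply/negP => /eqP e; move: u; rewrite e cat_uniq => /and3P[_ /hasPn h _].
  case: L1 s1 h {e z} => [s1|x L1 _ /(_ x)]; first by rewrite -s1 in k0.
  by rewrite /= !inE eqxx => /(_ isT).
pose G1 S R := if S == L1 then G S R else 0.
have -> : Shuf k (L1 ++ L2) G = Shuf k (L1 ++ L2) G1 - Shuf k (L1 ++ L2) (fun S R => G1 S R - G S R).
  by rewrite ShufB opprB addrC subrK.
rewrite -{1}s1 Shuf_first // => [|S R _ _ /negbTE nS]; last by rewrite /G1 nS.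
rewrite {1}/G1 eqxx Shuf_second // => [|S R sS hS nS]; last first.
  by rewrite /G1; case: eqP => [->|/eqP nL]; rewrite ?subrr // z // subrr.
by rewrite /G1 (negbTE n12) s1 sub0r mulrN opprK.
Qed.

Section Shuffle.
Variables (h : nat) (V : finZmodType).
Notation m := h.+1.
Notation X := 'I_m.+2.
Implicit Types (l : V -> X).

(** F r is the total cup product of [uu a] at p with [uu b] at p + r. Homotopy makes it independent
    of r. F 0 vanishes simplex by simplex: of the two cochains, at least one vanishes if a label is
    missing, since a != b; this is the vanishing of the cup square. The sum of F over all r
    decouples the factors and leaves products of degrees. *)
Lemma Deg_shuffle (a b : X) l (E : seq V) : a != b -> size E = (m + m)%N ->
  (forall F : V -> int, (forall r e, e \in E -> F (r + e) = F r) -> forall r, F r = F 0) ->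
  (forall p, exists b, forall e v, e \in E -> incube p [:: e, 0 & E] v -> l v != b) ->
  Shuf m E (fun S R => Deg a l S * Deg b l R) = 0.
Proof.
move=> ab sE gen good.
pose F r := \sum_p cubn (m + m) (cup m (uu a) (uu b)) (fun p => (l p, l (p + r))) p E.
have [e0 e0E] : exists e0, e0 \in E by case: E sE {gen good F} => // e0 E _; exists e0; rewrite mem_head.
have Fe r e : e \in E -> F (r + e) = F r.
  move=> eE; pose k (z : V * int) := (l z.1, l (z.1 + r + e *~ z.2)).
  have -> : F r = \sum_p cubn (m + m) (cup m (uu a) (uu b)) (fun p => k (p, 0)) p E.
    by apply: eq_bigr => p _; apply: eq_cubnk => v; rewrite /k /= addr0.
  have -> : F (r + e) = \sum_p cubn (m + m) (cup m (uu a) (uu b)) (fun p => k (p, 1)) p E.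
    by apply: eq_bigr => p _; apply: eq_cubnk => v; rewrite /k /= mulr1z addrA.
  symmetry; apply: slice => // p s hs.
  have ss : size (map k (pth (p, 0) s)) = (m + m).+2.
    by rewrite size_map size_pth (perm_size hs) /= size_map sE.
  rewrite dlt_cup; last by rewrite ss; lia.
  have [b1 hb1] := good p; have [b2 hb2] := good (p + r).
  rewrite (@uu_closed _ a _ b1) ?(@uu_closed _ b _ b2) ?mulr0 ?mul0r ?addr0 //.
  - by rewrite size_map size_drop ss; lia.
  - rewrite -map_drop -map_comp; apply/mapP => -[z /mem_drop zs e1].
    have [i1 i2] := pth_slice hs zs; have := hb2 e (z.1 + r + e *~ z.2) eE.
    rewrite -[l _]/((snd \o k) z) -e1 eqxx => hh; apply: notF; apply: hh.
    case: i1 => t [t' [pt ->]]; case: i2 => ->.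
      exists t, (e :: t'); split; last by rewrite mulr0z addr0 addrAC.
      by rewrite -[e :: t']/([:: e] ++ t') perm_catCA /= perm_cons.
    exists (e :: t), t'; split; first by rewrite /= perm_cons.
    by rewrite big_cons mulr1z -!addrA; congr (_ + _); rewrite addrC -addrA.
  - by rewrite size_map size_take ss; case: ifP => //; lia.
  rewrite -map_take -map_comp; apply/mapP => -[z /mem_take zs e1].
  have [[t [t' [pt ez]]] _] := pth_slice hs zs; have := hb1 e z.1 eE.
  rewrite -[l z.1]/((fst \o k) z) -e1 eqxx => hh; apply: notF; apply: hh.
  exists t, (e :: t'); split=> //.
  by rewrite -[e :: t']/([:: e] ++ t') perm_catCA /= perm_cons.
have F0 : F 0 = 0.
  rewrite /F big1 // => p _; apply: cubn_zero => // s hs; rewrite /cup.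
  have ss : size (pth p s) = (m + m).+1 by rewrite size_pth (perm_size hs) sE.
  have [b0 hb] := good p.
  have hb' v : v \in pth p s -> l v != b0.
    move=> /(pth_incube hs)[t [t' [pt ->]]]; apply: (hb e0) => //.
    exists t, [:: e0, 0 & t']; split=> //.
    by rewrite -[[:: e0, 0 & t']]/([:: e0; 0] ++ t') perm_catCA /= !perm_cons.
  rewrite -map_take -map_drop -!map_comp; case: (eqVneq b0 a) => [e1|n1].
    rewrite (@uu_missing _ b _ b0) ?mulr0 ?e1 //; first by rewrite size_map size_drop ss; lia.
    apply/mapP => -[v /mem_drop vs e2]; have := hb' v vs.
    by rewrite e1 e2 /= addr0 eqxx.
  rewrite (@uu_missing _ a _ b0) ?mul0r //; first by rewrite size_map size_take ss; case: ifP; lia.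
  by apply/mapP => -[v /mem_take vs e2]; have := hb' v vs; rewrite e2 eqxx.
have : \sum_r F r = 0 by rewrite big1 // => r _; rewrite gen.
rewrite /F; under eq_bigr => r _ do (under eq_bigr => p _ do rewrite cubn_cup //; rewrite Shuf_sum).
rewrite Shuf_sum => <-; apply: eq_Shuf => S R _.
rewrite exchange_big /= /Deg mulr_suml; apply: eq_bigr => p _.
rewrite -mulr_sumr; congr (_ * _).
rewrite -[LHS](sum_transl _ (p + \sum_(x <- S) x)); apply: eq_bigr => q _.
by rewrite addrC -(cubn_transl m (uu b) l q); apply: eq_cubnk => v.
Qed.

(** Let x and y be the two sides. When only the four listed subtori have nonzero degree, the shuffle
    relation reads -2(x - y) = 0 for odd h; for even h its terms would cancel identically. *)
Lemma Deg_wedge a l (s s' : V) (A B : seq V) : odd h -> size A = h -> size B = h ->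
  let E := [:: s, s' & A ++ B] in uniq E ->
  (forall F : V -> int, (forall r e, e \in E -> F (r + e) = F r) -> forall r, F r = F 0) ->
  (forall p, exists b, forall e v, e \in E -> incube p [:: e, 0 & E] v -> l v != b) ->
  (forall S, subseq S E -> size S = m -> S \notin [:: s :: A; s :: B; s' :: A; s' :: B] ->
     Deg a l S = 0) ->
  Deg a l (s :: A) * Deg a l (s' :: B) = Deg a l (s :: B) * Deg a l (s' :: A).
Proof.
move=> oh sA sB E uE gen good van.
have [b ab] : exists b : X, a != b.
  by exists (if a == ord0 then ord_max else ord0); case: ifP => [/eqP->|/negbT].
have sE : size E = (m + m)%N by rewrite /= size_cat sA sB; lia.
have := Deg_shuffle ab sE gen good.
have fct S : size S = m -> Deg b l S = Deg a l S by move=> sS; apply: Deg_facet.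
have uAB : uniq (A ++ B) by case/and3P: uE.
have [sAB s'AB] : s \notin A ++ B /\ s' \notin A ++ B.
  by move: uE => /= /and3P[]; rewrite inE negb_or => /andP[].
have ss' : s != s' by move: uE => /= /and3P[]; rewrite inE negb_or => /andP[].
have h0 : (0 < h)%N by case: h oh.
have sub1 S x : subseq S (A ++ B) -> x \in S -> x != s /\ x != s'.
  move=> /mem_subseq sS /sS xAB; split.
    by apply: contraNneq sAB => <-.
  by apply: contraNneq s'AB => <-.
have nin S : S \notin [:: A; B] -> forall x, x :: S \notin [:: x :: A; x :: B].
  by move=> hS x; apply: contra hS; rewrite !inE => /orP[/eqP[->]|/eqP[->]]; rewrite eqxx ?orbT.
have vs S : subseq S (A ++ B) -> size S = h -> S != A -> S != B -> Deg a l (s :: S) = 0.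
  move=> sS hS nA nB; apply: van; rewrite /= ?eqxx ?hS //.
    by apply: subseq_trans sS (subseq_cons _ _).
  by rewrite !inE !eqseq_cons eqxx (negbTE ss') (negbTE nA) (negbTE nB).
have vs' S : subseq S (A ++ B) -> size S = h -> S != A -> S != B -> Deg a l (s' :: S) = 0.
  move=> sS hS nA nB; apply: van; rewrite /= ?hS //.
    by rewrite eq_sym (negbTE ss') eqxx.
  by rewrite !inE !eqseq_cons eqxx [s' == s]eq_sym (negbTE ss') (negbTE nA) (negbTE nB).
have vss S : subseq S (A ++ B) -> size S = h.-1 -> Deg a l [:: s, s' & S] = 0.
  move=> sS hS; apply: van; rewrite /= ?eqxx ?hS ?prednK // !inE !eqseq_cons eqxx (negbTE ss') /=.
  rewrite orbF; apply/negP => /orP[]/eqP e; case/negP: s'AB.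
    by rewrite mem_cat -e mem_head.
  by rewrite mem_cat -e mem_head orbT.
have v0 S : subseq S (A ++ B) -> size S = m -> Deg a l S = 0.
  move=> sS hS; apply: van => //.
    by apply: subseq_trans sS _; apply: subseq_trans (subseq_cons _ _) (subseq_cons _ _).
  have hs x : x \in S -> x != s /\ x != s' by apply: sub1.
  rewrite !inE; apply/negP => /or4P[]/eqP e; have := hs (head s S);
    by rewrite e /= mem_head eqxx => /(_ isT)[].
have two1 : Shuf h (A ++ B) (fun S R => Deg a l (s :: S) * Deg b l (s' :: R)) =
    Deg a l (s :: A) * Deg a l (s' :: B) - Deg a l (s :: B) * Deg a l (s' :: A).
  rewrite Shuf_two // => [|S R sS hS nA nB]; last by rewrite vs ?mul0r.
  by rewrite -signr_odd oddM oh mulN1r !fct //= ?sA ?sB.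
have two2 : Shuf h (A ++ B) (fun S R => Deg a l (s' :: S) * Deg b l (s :: R)) =
    Deg a l (s' :: A) * Deg a l (s :: B) - Deg a l (s' :: B) * Deg a l (s :: A).
  rewrite Shuf_two // => [|S R sS hS nA nB]; last by rewrite vs' ?mul0r.
  by rewrite -signr_odd oddM oh mulN1r !fct //= ?sA ?sB.
have z1 : (if h is k.+1 then Shuf k (A ++ B) (fun S R => Deg a l [:: s, s' & S] * Deg b l R) else 0) = 0.
  have zz (k0 : nat) H : (forall S R, subseq S (A ++ B) -> size S = k0.-1 -> H S R = 0) ->
    (if k0 is k.+1 then Shuf k (A ++ B) H else 0) = 0 by case: k0 => // k; apply: Shuf_zero.
  by apply: zz => S R sS hS; rewrite vss ?mul0r.
have z2 : Shuf m (A ++ B) (fun S R => Deg a l S * Deg b l [:: s, s' & R]) = 0.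
  by apply: Shuf_zero => S R sS hS; rewrite v0 ?mul0r.
have -> : Shuf m E (fun S R => Deg a l S * Deg b l R) =
  (if h is k.+1 then Shuf k (A ++ B) (fun S R => Deg a l [:: s, s' & S] * Deg b l R) else 0)
  + (-1) ^+ h * Shuf h (A ++ B) (fun S R => Deg a l (s :: S) * Deg b l (s' :: R))
  + (-1) ^+ m * (Shuf h (A ++ B) (fun S R => Deg a l (s' :: S) * Deg b l (s :: R))
  + (-1) ^+ m * Shuf m (A ++ B) (fun S R => Deg a l S * Deg b l [:: s, s' & R])) by [].
rewrite z1 z2 two1 two2 exprS -!(signr_odd _ h) oh mulr0 add0r addr0 !mulN1r opprK mul1r.
set x := Deg a l _ * _; set y := Deg a l _ * _.
rewrite [Deg a l (s' :: A) * _]mulrC [Deg a l (s' :: B) * _]mulrC -/x -/y.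
by lia.
Qed.
End Shuffle.
End CupShuffle.

(** * Degrees on subtori of a discrete torus *)

Module TorusDegrees.
Import all_boot all_order all_fingroup all_algebra.
Import zify ring.
Import CubeChains CochainDegree CupShuffle.
Set Implicit Arguments. Unset Strict Implicit. Unset Printing Implicit Defensive.
Import Order.TTheory GRing.Theory Num.Theory.
Local Open Scope ring_scope.

Lemma perm_map_ex (S T : eqType) (f : S -> T) t (s : seq S) : perm_eq t (map f s) ->
  exists2 u, perm_eq u s & t = map f u.
Proof.
case: s => [/perm_nilP->|x0 s]; first by exists [::].
case/(perm_iotaP (f x0)) => Is hI ->; exists (map (nth x0 (x0 :: s)) Is).
  by apply/(perm_iotaP x0); exists Is => //; rewrite size_map in hI.
rewrite -map_comp; apply/eq_in_map => i iI /=.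
rewrite -(nth_map x0 (f x0) f) //.
by move: iI; rewrite (perm_mem hI) mem_iota size_map add0n.
Qed.

Section Torus.
Variables (Q : nat).
Notation Z := 'Z_Q.

Section Box.
Variable k : nat.
Notation V := 'rV[Z]_k.
Implicit Types (w : {ffun 'I_k -> nat}) (ws : seq {ffun 'I_k -> nat}).

Definition emb w : V := \row_j (w j)%:R.
Definition unitf i : {ffun 'I_k -> nat} := [ffun j => nat_of_bool (j == i)].
Definition std : seq V := [seq emb (unitf i) | i <- enum 'I_k].

Lemma embD w w' : emb [ffun j => w j + w' j]%N = emb w + emb w'.
Proof. by apply/matrixP => i j; rewrite !mxE ffunE natrD. Qed.

Lemma emb0 : emb [ffun => 0%N] = 0.
Proof. by apply/matrixP => i j; rewrite !mxE ffunE. Qed.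

Lemma sum_emb ws : \sum_(w <- ws) emb w = emb [ffun j => \sum_(w <- ws) w j]%N.
Proof.
elim: ws => [|w ws IH].
  by rewrite big_nil -emb0; congr emb; apply/ffunP => j; rewrite !ffunE big_nil.
rewrite big_cons IH -embD; congr emb; apply/ffunP => j.
by rewrite !ffunE big_cons.
Qed.

Lemma incube_emb p ws v : incube p (map emb ws) v ->
  exists n : {ffun 'I_k -> nat}, (forall j, n j <= \sum_(w <- ws) w j)%N /\ v = p + emb n.
Proof.
case=> t [t' [/perm_map_ex[u pu et] ->]].
exists [ffun j => \sum_(w <- take (size t) u) w j]%N; split; last first.
  by rewrite -sum_emb -(big_map emb predT id) map_take -et take_size_cat.
move=> j; rewrite ffunE -(perm_big _ pu) /= -{2}(cat_take_drop (size t) u) big_cat.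
exact: leq_addr.
Qed.

Lemma size_std : size std = k.
Proof. by rewrite size_map size_enum_ord. Qed.

Lemma sum_std (r : V) : r = \sum_i emb (unitf i) *+ (r 0 i).
Proof.
apply/matrixP => i j; rewrite summxE (bigD1 j) //= big1 => [|j' nj]; rewrite ?addr0.
  rewrite mulmxnE !mxE ffunE eqxx ord1; exact: esym (natr_Zp _).
by rewrite mulmxnE !mxE ffunE eq_sym (negbTE nj) mul0rn.
Qed.

Lemma std_gen (F : V -> int) : (forall r e, e \in std -> F (r + e) = F r) -> forall r, F r = F 0.
Proof.
move=> Fe r.
have FM r0 e n : e \in std -> F (r0 + e *+ n) = F r0.
  by move=> eE; elim: n => [|n IH]; rewrite ?mulr0n ?addr0 // mulrS [e + _]addrC addrA Fe.
have Fs (s : seq 'I_k) r0 : F (r0 + \sum_(i <- s) emb (unitf i) *+ (r 0 i)) = F r0.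
  elim: s r0 => [|i s IH] r0; first by rewrite big_nil addr0.
  by rewrite big_cons addrA IH FM //; apply: map_f; rewrite mem_enum.
by rewrite {1}[r]sum_std -[X in F X]add0r Fs.
Qed.

Lemma sum_unitf (s : seq 'I_k) j : uniq s -> (\sum_(w <- map unitf s) w j <= 1)%N.
Proof.
move=> us; rewrite big_map; under eq_bigr do rewrite ffunE.
rewrite -big_mkcond /= sum1_count; apply: leq_trans (_ : count_mem j s <= 1)%N.
  by apply: eq_leq; apply: eq_count => i /=; rewrite eq_sym.
by rewrite count_uniq_mem // leq_b1.
Qed.

Lemma stdE : std = map emb (map unitf (enum 'I_k)).
Proof. by rewrite -map_comp. Qed.

Definition comb (V : lmodType Z) (U : seq V) (c : 'rV[Z]_k) : V := \sum_(i < k) c 0 i *: U`_i.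

Lemma combD V U : {morph @comb V U : c c' / c + c'}.
Proof.
by move=> c c'; rewrite /comb -big_split; apply: eq_bigr => i _; rewrite mxE scalerDl.
Qed.

Lemma comb_unit V U i : @comb V U (emb (unitf i)) = U`_i.
Proof.
rewrite /comb (bigD1 i) //= big1 => [|j nj]; rewrite !mxE ffunE ?eqxx ?scale1r ?addr0 //.
by rewrite (negbTE nj) scale0r.
Qed.

Lemma map_comb_std V U : size U = k -> map (@comb V U) std = U.
Proof.
move=> sU; apply: (@eq_from_nth _ 0); rewrite size_map size_std ?sU // => i ik.
rewrite (nth_map 0) ?size_std // (nth_map (Ordinal ik)) ?size_enum_ord // comb_unit.
by rewrite nth_enum_ord.
Qed.
End Box.

Lemma comb_emb k k' (ws : seq {ffun 'I_k' -> nat}) (n : {ffun 'I_k -> nat}) :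
  comb (map (@emb k') ws) (emb n) =
  emb [ffun j => \sum_(i < k) n i * nth [ffun => 0] ws i j]%N.
Proof.
apply/matrixP => i j; rewrite summxE !mxE ffunE natr_sum; apply: eq_bigr => i' _.
rewrite !mxE natrM; congr (_ * _).
case: (ltnP i' (size ws)) => hi; first by rewrite (nth_map [ffun => 0%N]) // mxE.
by rewrite !nth_default ?size_map // mxE ffunE.
Qed.

Lemma comb_comp k k' (V : lmodType Z) (U : seq V) (W : seq 'rV[Z]_k') (c : 'rV[Z]_k) :
  comb U (comb W c) = comb (map (comb U) W) c.
Proof.
rewrite {1 3}/comb /comb; under eq_bigr => i _ do rewrite summxE scaler_suml.
rewrite exchange_big; apply: eq_bigr => j _.
case: (ltnP j (size W)) => hj.
  by rewrite (nth_map 0) // scaler_sumr; apply: eq_bigr => i _; rewrite mxE scalerA.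
rewrite big1 => [|i _]; first by rewrite nth_default ?size_map // scaler0.
by rewrite [W`_j]nth_default // !mxE mulr0 scale0r.
Qed.

Section TorusDegree.
Variables (h N : nat) (l : 'rV[Z]_N -> 'I_h.+3).
Notation m := h.+1.
Notation VF := 'rV[Z]_N.

(** The degree on the parametrised torus through 0 only, without translates, so that degrees seen
    from different ambient tori are comparable. *)
Definition Tdeg (W : seq VF) : int := Deg ord_max (fun c : 'rV[Z]_m => l (comb W c)) (std m).

(** Boxes of side 2 rather than unit cubes: the homotopies use one direction a second time. *)
Definition gd k (U : seq VF) := forall p : 'rV[Z]_k, exists b, forall n : {ffun 'I_k -> nat},
  (forall j, n j <= 2)%N -> l (comb U (p + emb n)) != b.

(** Translating the subtorus by a basis vector is a homotopy, so all translates have the same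
    degree. Summing over base points and over points of the subtorus in both orders gives the ratio
    of cardinalities, multiplied out to remain in the integers. *)
Lemma Tdeg_avg k U (ws : seq {ffun 'I_k -> nat}) : size ws = m ->
  (forall j, \sum_(w <- ws) w j <= 1)%N -> gd k U ->
  Deg ord_max (fun c : 'rV[Z]_k => l (comb U c)) (map (@emb k) ws) *+ #|{: 'rV[Z]_m}| =
  Tdeg (map (fun w => comb U (emb w)) ws) *+ #|{: 'rV[Z]_k}|.
Proof.
move=> sws ws1 good; set W := map _ ws; set lk := fun c => _.
pose F p := \sum_(c : 'rV[Z]_m) cubn m (uu ord_max) lk (p + comb W c) W.
have sW : size W = m by rewrite size_map.
have FE p : F p = Deg ord_max (fun c => lk (p + comb W c)) (std m).
  apply: eq_bigr => c _; rewrite (cubn_morph (combD W) m (fun v => lk (p + v))) map_comb_std //.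
  rewrite addrC -(cubn_transl m (uu ord_max) lk p).
  by apply: eq_cubnk => v; rewrite addrC.
have Fe p e : e \in std k -> F (p + e) = F p.
  move=> /mapP[i _ ee]; rewrite !FE.
  pose kf (z : 'rV[Z]_m * int) := lk (p + comb W z.1 + e *~ z.2).
  have d0 : Deg ord_max (fun c => lk (p + comb W c)) (std m) = Deg ord_max (fun c => kf (c, 0)) (std m).
    by apply: eq_bigr => c _; apply: eq_cubnk => v; rewrite /kf /= addr0.
  have d1 : Deg ord_max (fun c => lk (p + e + comb W c)) (std m) = Deg ord_max (fun c => kf (c, 1)) (std m).
    by apply: eq_bigr => c _; apply: eq_cubnk => v; rewrite /kf /= mulr1z addrAC.
  rewrite d0 d1; symmetry; apply: Deg_slice; first by rewrite size_std.
  move=> c s hs; have [b hb] := good (p + comb W c); exists b => z zs.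
  have [z1 z2] := pth_slice hs zs.
  have e0 : 0 :: std m = map (@emb m) ([ffun => 0%N] :: map (@unitf m) (enum 'I_m)).
    by rewrite /= emb0 stdE.
  rewrite e0 in z1; have [n [n1 ez]] := incube_emb z1.
  have {}n1 j : (n j <= 1)%N.
    by apply: leq_trans (n1 j) _; rewrite big_cons ffunE add0n sum_unitf ?enum_uniq.
  rewrite /kf ez combD addrA comb_emb.
  set n' := [ffun j => _].
  have n'1 j : (n' j <= 1)%N.
    rewrite ffunE; apply: leq_trans (ws1 j); rewrite [leqRHS](big_nth [ffun => 0%N]) big_mkord sws.
    by apply: leq_sum => i' _; have := n1 i'; case: (n i') => [|[|//]] _; rewrite ?mul0n ?mul1n.
  case: z2 => ->; first by rewrite mulr0z addr0; apply: hb => j; apply: leq_trans (n'1 j) _.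
  have -> : p + comb W c + emb n' + e *~ 1 = p + comb W c + emb [ffun j => n' j + unitf i j]%N.
    by rewrite embD addrA ee mulr1z.
  apply: hb => j; rewrite ffunE.
  by apply: (@leq_add _ _ 1 1); [exact: n'1|rewrite ffunE; exact: leq_b1].
have Fc := std_gen Fe.
have -> : Tdeg (map (fun w => comb U (emb w)) ws) = F 0.
  rewrite FE; apply: eq_bigr => c _; apply: eq_cubnk => v.
  by rewrite /lk add0r comb_comp /W -map_comp.
have : \sum_p F p = F 0 *+ #|{: 'rV[Z]_k}|.
  by rewrite (eq_bigr _ (fun p _ => Fc p)) sumr_const.
move=> <-; rewrite /F exchange_big /=.
under eq_bigr => c _ do rewrite (sum_transl (fun p => cubn m (uu ord_max) lk p W)).
by rewrite sumr_const.
Qed.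

Lemma card_pos k : (0 < #|{: 'rV[Z]_k}|)%N.
Proof. by apply/card_gt0P; exists 0. Qed.

Lemma mulrn_eq (x y : int) c : (0 < c)%N -> x *+ c = y *+ c -> x = y.
Proof.
move=> c0; rewrite -[x *+ c]mulr_natr -[y *+ c]mulr_natr; apply: mulIf.
by rewrite pnatr_eq0 -lt0n.
Qed.

Lemma mulrn_add (x0 x1 x2 y0 y1 y2 : int) c d : x0 *+ c = y0 *+ d -> x1 *+ c = y1 *+ d ->
  x2 *+ c = y2 *+ d -> x0 = x1 + x2 -> (0 < d)%N -> y0 = y1 + y2.
Proof.
move=> e0 e1 e2 e d0; apply: (mulrn_eq d0).
by rewrite -e0 e mulrnDl e1 e2 mulrnDl.
Qed.

Lemma mulrn_mul (x1 x2 x3 x4 y1 y2 y3 y4 : int) c d : x1 *+ c = y1 *+ d -> x2 *+ c = y2 *+ d ->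
  x3 *+ c = y3 *+ d -> x4 *+ c = y4 *+ d -> x1 * x2 = x3 * x4 -> (0 < d)%N -> y1 * y2 = y3 * y4.
Proof.
move=> e1 e2 e3 e4 e d0; have E (x y : int) k : (x *+ k) * (y *+ k) = (x * y) *+ k *+ k.
  by rewrite mulrnAl mulrnAr.
apply: (mulrn_eq d0); apply: (mulrn_eq d0).
by rewrite -E -e1 -e2 E e -E e3 e4 E.
Qed.

Lemma Tdeg_swap x y (L : seq VF) : size L = h.-1 -> (0 < h)%N -> gd m [:: x, y & L] ->
  Tdeg [:: y, x & L] = - Tdeg [:: x, y & L].
Proof.
move=> sL h0 good; set U := [:: x, y & L].
have sU : size U = m by rewrite /= sL prednK.
have [e0 [e1 [es ees]]] : exists e0 e1 es, enum 'I_m = [:: e0, e1 & es].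
  have := size_enum_ord m; case: (enum _) => [|e0 [|e1 es]] //=; first by move=> -[e]; rewrite -e in h0.
  by move=> _; exists e0, e1, es.
have um : uniq [:: e0, e1 & es] by rewrite -ees enum_uniq.
have um' : uniq [:: e1, e0 & es].
  by move: um; rewrite /= !inE !negb_or eq_sym => /and3P[/andP[-> ->] -> ->].
have ses : size [:: e0, e1 & es] = m by rewrite -ees size_enum_ord.
have mU : map (fun w => comb U (emb w)) (map (@unitf m) [:: e0, e1 & es]) = U.
  by rewrite -ees -[RHS](map_comb_std sU) stdE -!map_comp.
have a1 := @Tdeg_avg _ U (map (@unitf m) [:: e0, e1 & es]).
have a2 := @Tdeg_avg _ U (map (@unitf m) [:: e1, e0 & es]).
have {}a1 := mulrn_eq (card_pos _) (a1 _ (fun j => sum_unitf j um) good); rewrite mU in a1.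
have {}a2 := mulrn_eq (card_pos _) (a2 _ (fun j => sum_unitf j um') good).
have mU' : map (fun w => comb U (emb w)) (map (@unitf m) [:: e1, e0 & es]) = [:: y, x & L].
  by move: mU => /= [-> -> ->].
rewrite mU' in a2; rewrite -a1 ?size_map // -a2 ?size_map //=.
by apply: Deg_swap => //; rewrite !size_map; clear -ses; move: ses; rewrite /=; lia.
Qed.

Lemma Tdeg_add w w' (L : seq VF) : size L = h -> gd m.+1 [:: w, w' & L] ->
  Tdeg (w + w' :: L) = Tdeg (w :: L) + Tdeg (w' :: L).
Proof.
move=> sL good; set U := [:: w, w' & L].
have sU : size U = m.+1 by rewrite /= sL.
have [e0 [e1 [es ees]]] : exists e0 e1 es, enum 'I_m.+1 = [:: e0, e1 & es].
  by have := size_enum_ord m.+1; case: (enum _) => [|e0 [|e1 es]] //= _; exists e0, e1, es.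
have um : uniq [:: e0, e1 & es] by rewrite -ees enum_uniq.
have ses : size es = h by have := size_enum_ord m.+1; rewrite ees => -[].
have mU : map (fun w => comb U (emb w)) (map (@unitf m.+1) [:: e0, e1 & es]) = U.
  by rewrite -ees -[RHS](map_comb_std sU) stdE -!map_comp.
pose w2 := [ffun j => unitf e0 j + unitf e1 j]%N.
pose us := map (@unitf m.+1) es.
have s1 j : (\sum_(w <- unitf e0 :: unitf e1 :: us) w j <= 1)%N by apply: (sum_unitf j um).
have a0 := @Tdeg_avg _ U (w2 :: us).
have a1 := @Tdeg_avg _ U (unitf e0 :: us).
have a2 := @Tdeg_avg _ U (unitf e1 :: us).
case: mU => m0 m1 mes.
have m2 : comb U (emb w2) = w + w' by rewrite embD combD m0 m1.
rewrite /= m2 mes in a0; rewrite /= m0 mes in a1; rewrite /= m1 mes in a2.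
have sus : size us = h by rewrite size_map.
have ss : (size us).+1 = m by rewrite sus.
have c0 j : (\sum_(w <- w2 :: us) w j <= 1)%N.
  by have := s1 j; rewrite !big_cons [w2 j]ffunE addnA.
have c1 j : (\sum_(w <- unitf e0 :: us) w j <= 1)%N.
  by have := s1 j; rewrite !big_cons; move: (\sum_(w <- us) w j)%N => x; clear; lia.
have c2 j : (\sum_(w <- unitf e1 :: us) w j <= 1)%N.
  by have := s1 j; rewrite !big_cons; move: (\sum_(w <- us) w j)%N => x; clear; lia.
apply: mulrn_add (a0 ss c0 good) (a1 ss c1 good) (a2 ss c2 good) _ (card_pos m.+1).
have -> : emb w2 = emb (unitf e0) + emb (unitf e1) by rewrite -embD.
apply: Deg_add; first by rewrite size_map sus.
move=> p; have [b hb] := good p; exists b => v.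
have -> : [:: emb (unitf e0), emb (unitf e1), 0, 0 & map (@emb m.+1) us] =
  map (@emb m.+1) [:: unitf e0, unitf e1, [ffun => 0%N], [ffun => 0%N] & us] by rewrite /= emb0.
move=> /incube_emb[n [n1 ->]]; apply: hb => j; apply: leq_trans (n1 j) _.
by have := s1 j; rewrite !big_cons !ffunE; lia.
Qed.

Lemma uniq_map_inj (S T : eqType) (f : S -> T) s : uniq (map f s) -> {in s &, injective f}.
Proof.
elim: s => //= x s IH /andP[xs us] y z; rewrite !inE => /orP[/eqP->|ys] /orP[/eqP->|zs] //.
- by move=> e; case/negP: xs; rewrite e map_f.
- by move=> e; case/negP: xs; rewrite -e map_f.
exact: IH.
Qed.

Lemma Tdeg_wedge (s s' : VF) (A B : seq VF) : odd h -> size A = h -> size B = h ->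
  let U := [:: s, s' & A ++ B] in uniq U -> gd (m + m) U ->
  (forall S, subseq S U -> size S = m -> S \notin [:: s :: A; s :: B; s' :: A; s' :: B] ->
     Tdeg S = 0) ->
  Tdeg (s :: A) * Tdeg (s' :: B) = Tdeg (s :: B) * Tdeg (s' :: A).
Proof.
move=> oh sA sB U uU good van.
pose k := (m + m)%N; pose lk (c : 'rV[Z]_k) := l (comb U c).
have sU : size U = k by rewrite /= size_cat sA sB /k; lia.
have [t [t' [A' [B' [et sA' sB']]]]] : exists t t' A' B',
    [/\ std k = [:: t, t' & A' ++ B'], size A' = h & size B' = h].
  have := size_std k; case: (std k) => [|t [|t' r]] //=; rewrite /k => sr; try lia.
  exists t, t', (take h r), (drop h r); rewrite cat_take_drop size_drop size_take.
  by split=> //; [case: ifP|]; lia.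
have mU : map (comb U) (std k) = U by apply: map_comb_std.
have inj : {in std k &, injective (comb U)} by apply: uniq_map_inj; rewrite mU.
have av S : subseq S (std k) -> size S = m ->
    Deg ord_max lk S *+ #|{: 'rV[Z]_m}| = Tdeg (map (comb U) S) *+ #|{: 'rV[Z]_k}|.
  rewrite stdE -map_comp => /subseqP[ma sma ->]; rewrite -map_mask => sS.
  have := @Tdeg_avg _ U (map (@unitf k) (mask ma (enum 'I_k))).
  rewrite -!map_comp; apply=> //; first by rewrite size_map in sS *; rewrite size_map.
  by move=> j; apply: sum_unitf; apply: mask_uniq; apply: enum_uniq.
have [ms ms' mA mB] : [/\ comb U t = s, comb U t' = s', map (comb U) A' = A & map (comb U) B' = B].
  move: mU; rewrite et /= map_cat => -[-> -> /eqP].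
  by rewrite eqseq_cat ?size_map ?sA' ?sA // => /andP[/eqP-> /eqP->].
have sub1 : subseq (t :: A') (std k) by rewrite et /= eqxx; apply: (subseq_trans (prefix_subseq A' B') (subseq_cons _ _)).
have sub2 : subseq (t :: B') (std k) by rewrite et /= eqxx; apply: (subseq_trans (suffix_subseq A' B') (subseq_cons _ _)).
have sub3 : subseq (t' :: A') (std k).
  by rewrite et; apply: subseq_trans (subseq_cons _ _); rewrite /= eqxx prefix_subseq.
have sub4 : subseq (t' :: B') (std k).
  by rewrite et; apply: subseq_trans (subseq_cons _ _); rewrite /= eqxx suffix_subseq.
have W : Deg ord_max lk (t :: A') * Deg ord_max lk (t' :: B') =
    Deg ord_max lk (t :: B') * Deg ord_max lk (t' :: A').
  have ustd : uniq [:: t, t' & A' ++ B'] by rewrite -et; apply: (@map_uniq _ _ (comb U)); rewrite mU.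
  apply: Deg_wedge => //; rewrite -et; first exact: std_gen.
    move=> p; have [b hb] := good p; exists b => e v /mapP[i _ ->].
    have -> : [:: emb (unitf i), 0 & std k] =
       map (@emb k) [:: unitf i, [ffun => 0%N] & map (@unitf k) (enum 'I_k)] by rewrite /= emb0 stdE.
    move=> /incube_emb[n [n1 ->]]; apply: hb => j; apply: leq_trans (n1 j) _.
    rewrite !big_cons !ffunE add0n; apply: (@leq_add _ _ 1 1); first exact: leq_b1.
    by rewrite sum_unitf ?enum_uniq.
  move=> S sS hS nS; have := av S sS hS.
  rewrite van ?size_map //; first by move=> e; apply: (mulrn_eq (card_pos m)); rewrite e !mul0rn.
    by have := map_subseq (comb U) sS; rewrite mU.
  apply: contra nS.
  have subS S' : subseq S' (std k) -> {subset S' <= std k} by move=> /mem_subseq.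
  rewrite -ms -ms' -mA -mB; rewrite !inE.
  have eqS S' : subseq S' (std k) -> map (comb U) S == map (comb U) S' -> S == S'.
    move=> sS' /eqP e; apply/eqP; move: e; have := subS _ sS; have := subS _ sS'.
    elim: S S' {sS hS sS'} => [|x S IH] [|y S'] //= h1 h2 [exy /IH ->].
    - by congr (_ :: _); apply: inj => //; [apply: h2|apply: h1]; rewrite mem_head.
    - by move=> z zS; apply: h1; rewrite inE zS orbT.
    by move=> z zS; apply: h2; rewrite inE zS orbT.
  case/or4P => [/(eqS (t :: A') sub1)|/(eqS (t :: B') sub2)|/(eqS (t' :: A') sub3)|/(eqS (t' :: B') sub4)] ->;
    by rewrite ?orbT.
have st x (C : seq 'rV[Z]_k) : size C = h -> size (x :: C) = m by move=> /= ->.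
have a1 := av _ sub1 (st _ _ sA'); rewrite map_cons ms mA in a1.
have a2 := av _ sub4 (st _ _ sB'); rewrite map_cons ms' mB in a2.
have a3 := av _ sub2 (st _ _ sB'); rewrite map_cons ms mB in a3.
have a4 := av _ sub3 (st _ _ sA'); rewrite map_cons ms' mA in a4.
exact: mulrn_mul a1 a2 a3 a4 W (card_pos k).
Qed.
End TorusDegree.
End Torus.
End TorusDegrees.

(** * The complex *)

Module TorusComplex.
Import all_boot.
Import zify.
Import BoundedQuantifier.
Set Implicit Arguments. Unset Strict Implicit. Unset Printing Implicit Defensive.

(* Locked so that powers of it are never computed. *)
Definition MM := locked 20.
Lemma MME : MM = 20. Proof. by rewrite /MM -lock. Qed.

Fixpoint vecs k : seq (seq nat) :=
  if k is k'.+1 then [seq a :: v | a <- iota 0 MM, v <- vecs k'] else [:: [::]].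

Definition stepv (th S : seq nat) := mkseq (fun i => (nth 0 th i + (i \in S)) %% MM) (size th).
Definition pathm (th p : seq nat) := [seq stepv th (take j p) | j <- iota 0 (size p).+1].
Definition shape k := [seq pathm th p | th <- vecs k, p <- permutations (iota 0 k)].

(** The change of the vertex number when all coordinates of the group move by 1. Vertex numbers are
    linear in these weights, which is how the parameter enters the code of a torus. *)
Definition gw (G : seq nat) := sumn [seq MM ^ x | x <- G].
Fixpoint dotv (th : seq nat) (Gs : seq (seq nat)) :=
  if th is a :: th' then if Gs is G :: Gs' then a * gw G + dotv th' Gs' else 0 else 0.
(* Vertex 0 is the cone apex; vertex v > 0 is the grid point whose coordinates are the base 20
   digits of v - 1. All coordinates of a group of [Gs] move together. *)
Definition vnum Gs th := (dotv th Gs).+1.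
Definition chains Gs := [seq [seq vnum Gs th | th <- ch] | ch <- shape (size Gs)].
Definition cone Gs := [seq 0 :: s | s <- chains Gs].
Definition single (U : seq nat) := [seq [:: x] | x <- U].
Definition digit v x := (v.-1 %/ MM ^ x) %% MM.
Definition cf Gs (th : seq nat) x := nth 0 th (find (fun G : seq nat => x \in G) Gs).
Definition twf N (Gs : seq (seq nat)) :=
  [&& uniq (flatten Gs), all (fun x => x < N) (flatten Gs) & all (fun G => 0 < size G) Gs].
Definition smp Gs th p := [seq vnum Gs t | t <- pathm th p].

Lemma MM_gt0 : 0 < MM. Proof. by rewrite MME. Qed.

Lemma mem_vecs k v : (v \in vecs k) = (size v == k) && all (fun a => a < MM) v.
Proof.
elim: k v => [|k IH] v /=; first by case: v.
apply/allpairsP/idP => [[[a w] [/= ha hw ->]]|].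
  by move: ha hw; rewrite mem_iota IH /= eqSS => -> /andP[-> ->].
case: v => [|a w] //= /andP[sw /andP[ha hw]]; exists (a, w); split=> //=.
  by rewrite mem_iota.
by rewrite IH hw andbT.
Qed.

Lemma mem_shape k ch : reflect (exists th p, [/\ size th = k, all (fun a => a < MM) th,
    perm_eq p (iota 0 k) & ch = pathm th p]) (ch \in shape k).
Proof.
apply: (iffP allpairsP) => [[[th p] [/= h1 h2 ->]]|[th [p [h1 h2 h3 ->]]]].
  move: h1 h2; rewrite mem_vecs mem_permutations => /andP[/eqP h1 h2] h3.
  by exists th, p.
by exists (th, p); rewrite mem_vecs mem_permutations h1 eqxx.
Qed.

Lemma mem_chains Gs s : reflect (exists th p, [/\ size th = size Gs, all (fun a => a < MM) th,
    perm_eq p (iota 0 (size Gs)) & s = smp Gs th p]) (s \in chains Gs).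
Proof.
apply: (iffP mapP) => [[ch /mem_shape[th [p [h1 h2 h3 ->]]] ->]|[th [p [h1 h2 h3 ->]]]].
  by exists th, p.
by exists (pathm th p) => //; apply/mem_shape; exists th, p.
Qed.

Lemma size_stepv th S : size (stepv th S) = size th.
Proof. by rewrite size_mkseq. Qed.

Lemma nth_stepv th S i : i < size th -> nth 0 (stepv th S) i = (nth 0 th i + (i \in S)) %% MM.
Proof. by move=> hi; rewrite nth_mkseq. Qed.

Lemma stepv_lt th S : all (fun a => a < MM) (stepv th S).
Proof. by apply/(all_nthP 0) => i; rewrite size_stepv => hi; rewrite nth_stepv // ltn_pmod ?MM_gt0. Qed.

Lemma cf_cons G Gs a th x : cf (G :: Gs) (a :: th) x = if x \in G then a else cf Gs th x.
Proof. by rewrite /cf /=; case: ifP. Qed.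

Lemma cf_notin Gs th x : size th = size Gs -> x \notin flatten Gs -> cf Gs th x = 0.
Proof.
move=> s xn; rewrite /cf nth_default // s leqNgt -has_find; apply/hasPn => G hG.
by apply: contra xn => hx; apply/flattenP; exists G.
Qed.

Lemma cf_lt Gs th x : all (fun a => a < MM) th -> cf Gs th x < MM.
Proof.
rewrite /cf; set i := find _ _ => /(all_nthP 0) h.
by case: (ltnP i (size th)) => [/h //|hi]; rewrite nth_default ?MM_gt0.
Qed.

Lemma cf_nth Gs th x i : uniq (flatten Gs) -> i < size Gs -> x \in nth [::] Gs i ->
  cf Gs th x = nth 0 th i.
Proof.
rewrite /cf => u hi hx; congr nth; move: u hi hx.
elim: Gs i => [|G Gs IH] [|i] //=; first by move=> _ _ ->.
rewrite cat_uniq => /and3P[_ h u] hi hx; rewrite ifF ?(IH i) //.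
apply: contraNF h => hG; apply/hasP; exists x => //.
by apply/flattenP; exists (nth [::] Gs i) => //; apply: mem_nth.
Qed.

Lemma dotvE N Gs th : uniq (flatten Gs) -> all (fun x => x < N) (flatten Gs) ->
  size th = size Gs -> dotv th Gs = \sum_(x < N) cf Gs th x * MM ^ x.
Proof.
elim: Gs th => [|G Gs IH] [|a th] //=; first by move=> *; rewrite big1 // => x _; rewrite /cf nth_nil.
rewrite cat_uniq all_cat => /and3P[uG hd uGs] /andP[aG aGs] [sz]; rewrite IH //.
under [RHS]eq_bigr do rewrite cf_cons.
rewrite (bigID (fun x : 'I_N => (x : nat) \in G)) [RHS](bigID (fun x : 'I_N => (x : nat) \in G)) /=.
rewrite addnA; congr (_ + _); last by apply: eq_bigr => x /negbTE->.
rewrite [X in _ + X]big1 ?addn0 => [|x xG]; last first.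
  rewrite cf_notin //; apply: contra hd => hx; by apply/hasP; exists (x : nat).
under [RHS]eq_bigr => x -> do [].
rewrite -big_distrr /=; congr (_ * _); rewrite /gw sumnE big_map.
rewrite -(big_mkord (fun x => x \in G) (fun x => MM ^ x)) /index_iota subn0 -[RHS]big_filter.
apply: perm_big; apply: uniq_perm => //; first by rewrite filter_uniq ?iota_uniq.
move=> x; rewrite mem_filter mem_iota /= add0n; case xG: (x \in G) => //=.
by rewrite (allP aG).
Qed.

Lemma digit_vnum N Gs th x : twf N Gs -> size th = size Gs -> all (fun a => a < MM) th ->
  digit (vnum Gs th) x = cf Gs th x.
Proof.
case/and3P => u aN _ sz lt; rewrite /digit /vnum /= (dotvE u aN sz).
rewrite (digitE (c := cf Gs th)) => [|i]; last exact: cf_lt.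
case: ltnP => // hx; rewrite cf_notin //; apply/negP => /(allP aN).
by rewrite ltnNge hx.
Qed.

Lemma sum_digits_lt (c : nat -> nat) N : (forall x, c x < MM) -> \sum_(x < N) c x * MM ^ x < MM ^ N.
Proof.
move=> h; elim: N => [|N IH]; first by rewrite big_ord0.
rewrite big_ord_recr /= expnS; apply: (@leq_trans ((c N).+1 * MM ^ N)); last by rewrite leq_mul2r h orbT.
by rewrite mulSn addnC -[X in _ < X]addnC ltn_add2l.
Qed.

Lemma vnum_lt N Gs th : twf N Gs -> size th = size Gs -> all (fun a => a < MM) th ->
  vnum Gs th < (MM ^ N).+1.
Proof.
case/and3P => u aN _ sz lt; rewrite ltnS /vnum (dotvE u aN sz).
by apply: sum_digits_lt => x; apply: cf_lt.
Qed.

Lemma vnum_inj N Gs th th' : twf N Gs -> size th = size Gs -> size th' = size Gs ->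
  all (fun a => a < MM) th -> all (fun a => a < MM) th' -> vnum Gs th = vnum Gs th' -> th = th'.
Proof.
move=> wf s s' l l' e; apply: (@eq_from_nth _ 0); rewrite ?s ?s' // => i hi.
have /and3P[u aN /all_nthP ne] := wf.
have := ne [::] i hi; case eG: (nth [::] Gs i) => [|x G] // _.
have hx : x \in nth [::] Gs i by rewrite eG mem_head.
rewrite -(cf_nth th u hi hx) -(cf_nth th' u hi hx).
by rewrite -(digit_vnum _ wf s l) e (digit_vnum _ wf s' l').
Qed.

Lemma mem_smp Gs th p v : size th = size Gs -> v \in smp Gs th p ->
  exists S, [/\ {subset S <= p}, v = vnum Gs (stepv th S) & exists j, S = take j p].
Proof.
move=> sz /mapP[t /mapP[j _ ->] ->]; exists (take j p); split=> //; last by exists j.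
by move=> i /mem_take.
Qed.

Lemma smp_lt N Gs th p v : twf N Gs -> size th = size Gs -> v \in smp Gs th p -> 0 < v < (MM ^ N).+1.
Proof.
move=> wf sz /(mem_smp sz)[S [_ -> _]] /=; apply: vnum_lt => //; rewrite ?size_stepv //.
exact: stepv_lt.
Qed.

Lemma size_smp Gs th p : size (smp Gs th p) = (size p).+1.
Proof. by rewrite !size_map size_iota. Qed.

Lemma smp_uniq N Gs th p : twf N Gs -> size th = size Gs -> all (fun a => a < MM) th ->
  perm_eq p (iota 0 (size Gs)) -> uniq (smp Gs th p).
Proof.
move=> wf sz lt pp; rewrite /smp /pathm -map_comp map_inj_in_uniq ?iota_uniq //.
have up : uniq p by rewrite (perm_uniq pp) iota_uniq.
have main i j : i < j -> j <= size p -> stepv th (take i p) = stepv th (take j p) -> False.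
  move=> ij jp /(congr1 (fun s => nth 0 s (nth 0 p i))).
  have ip : i < size p by apply: leq_trans jp.
  have hk : nth 0 p i < size th.
    by have := mem_nth 0 ip; rewrite (perm_mem pp) mem_iota sz.
  rewrite !nth_stepv //.
  have -> : nth 0 p i \in take j p by rewrite -(nth_take 0 ij) mem_nth // size_take; case: ifP.
  have -> : (nth 0 p i \in take i p) = false.
    apply/negP => /(nthP 0)[i' hi' e]; move: hi' e; rewrite size_take ip => hi'.
    rewrite nth_take // => /eqP; rewrite nth_uniq //; last by apply: ltn_trans ip.
    by move/eqP => e; rewrite e ltnn in hi'.
  move/(all_nthP 0): lt => /(_ _ hk); move: (nth 0 th _) => a ha; rewrite addn0 modn_small //=.
  have := MME; case: (ltnP (a + 1) MM) => h; first by rewrite modn_small //; lia.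
  have -> : a + 1 = MM by lia.
  by rewrite modnn; lia.
have inj t t' : all (fun a => a < MM) t -> all (fun a => a < MM) t' -> size t = size Gs ->
   size t' = size Gs -> vnum Gs t = vnum Gs t' -> t = t'.
  by move=> *; apply: (vnum_inj wf).
move=> i j; rewrite !mem_iota !add0n !ltnS => hi hj /= /inj e.
have {}e : stepv th (take i p) = stepv th (take j p) by apply: e; rewrite ?stepv_lt ?size_stepv.
case: (ltngtP i j) => // ij; last by case: (main _ _ ij hi).
by case: (main _ _ ij hj).
Qed.

Fixpoint subs (s : seq nat) := if s is x :: s' then map (cons x) (subs s') ++ subs s' else [:: [::]].

Lemma mem_subs s t : (t \in subs s) = subseq t s.
Proof.
elim: s t => [|x s IH] t /=; first by rewrite inE; case: t.
rewrite mem_cat IH; case: t => [|y t]; first by rewrite sub0seq orbT.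
case: eqP => [->|n].
  apply/orP/idP => [[/mapP[u + [->]]|h]|h].
  - by rewrite IH.
  - exact: subseq_trans (subseq_cons t x) h.
  by left; apply/mapP; exists t => //; rewrite IH.
by case: mapP => // -[u _ [e]]; rewrite e in n.
Qed.

Section Positions.
Variables (h g : nat).
Definition pr := 0.
Definition C0 := iota 1 h.-1.
Definition C1 := iota h h.-1.
Definition pt i := h + h.-1 + i.
(** The directions s_j come last, so that a longer system leaves the numbers of the earlier vertices
    unchanged. *)
Definition ps j := h + h.-1 + g + j.

(* The h.+1-dimensional subtori in [keepU] carry the degrees; all others are coned off. *)
Definition mainU i j := [:: ps 0, ps j & (pt i :: C0) ++ (pr :: C1)].
Definition keepU i j := [:: ps 0 :: pt i :: C0; ps 0 :: pr :: C1; ps j :: pt i :: C0; ps j :: pr :: C1].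
Definition coneU i j := [seq s <- subs (mainU i j) | (size s == h.+1) && (s \notin keepU i j)].
Definition mainT i j := chains (single (mainU i j)) ++ flatten [seq cone (single s) | s <- coneU i j].
(** Expanded bilinearly, the diagonal torus of [linkS] contains s_j t_i, s_j s_k, t_0 t_i and t_0
    s_k. The two other cones remove the middle terms, and the last one is -s_k t_0. *)
Definition linkU i j k := [:: ps j, ps k, pt 0, pt i & C0].
(* Coning off this diagonal torus forces d_k = a_i d_j. *)
Definition linkS i j k := [:: ps j; pt 0] :: [:: pt i; ps k] :: single C0.
Definition linkT (l : nat * nat * nat) := let: (i, j, k) := l in
  chains (single (linkU i j k)) ++ cone (single [:: ps j, ps k & C0])
  ++ cone (single [:: pt 0, pt i & C0]) ++ cone (linkS i j k).
Definition addU J := map ps J ++ pt 0 :: C0.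
(* Coning off this diagonal torus forces the sum of the d_j, j in J, to vanish. *)
Definition addS J := map ps J :: single (pt 0 :: C0).
Definition addT J := chains (single (addU J)) ++ cone (addS J).

Definition simps f A K := flatten [seq mainT i j | i <- iota 0 g, j <- iota 1 f.-1]
  ++ flatten (map linkT K) ++ flatten (map addT A).
End Positions.
End TorusComplex.

(** * Validity and dimension of the complex *)

Module ComplexShape.
Import all_boot.
Import zify.
Import LinkSystem TorusComplex.
Set Implicit Arguments. Unset Strict Implicit. Unset Printing Implicit Defensive.

Lemma flatten_single U : flatten (single U) = U.
Proof. by elim: U => //= x U ->. Qed.

Lemma mem_C0 h x : (x \in C0 h) = (0 < x < h).
Proof. by rewrite mem_iota; lia. Qed.

Lemma mem_C1 h x : (x \in C1 h) = (h <= x < h + h.-1).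
Proof. by rewrite mem_iota. Qed.

Section Complex.
Variables (h g f : nat) (A : seq (seq nat)) (K : seq link).
Notation ps := (ps h g). Notation pt := (pt h). Notation C0 := (C0 h). Notation C1 := (C1 h).

Definition torus Gs : Prop := [\/ exists i j, [/\ i < g, 0 < j < f & Gs = single (mainU h g i j)],
  exists i j k, (i, j, k) \in K /\ Gs = single (linkU h g i j k) |
  exists2 J, J \in A & Gs = single (addU h g J)].

Definition ctorus Gs : Prop := [\/ exists i j S, [/\ i < g, 0 < j < f, S \in coneU h g i j & Gs = single S],
  exists i j k, (i, j, k) \in K /\ [\/ Gs = single [:: ps j, ps k & C0],
     Gs = single [:: pt 0, pt i & C0] | Gs = linkS h g i j k] |
  exists2 J, J \in A & Gs = addS h g J].

Lemma mem_simps s : s \in simps h g f A K <->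
  (exists2 Gs, torus Gs & s \in chains Gs) \/ (exists2 Gs, ctorus Gs & s \in cone Gs).
Proof.
have sf i j T : i < g -> 0 < j < f -> T \in mainT h g i j ->
    T \in flatten [seq mainT h g i j | i <- iota 0 g, j <- iota 1 f.-1].
  move=> hi hj hT; apply/flattenP; exists (mainT h g i j) => //.
  by apply/allpairsP; exists (i, j); rewrite !mem_iota /=; split=> //; lia.
rewrite !mem_cat; split.
  case/or3P => /flattenP[T + hs].
  - case/allpairsP => -[i j] [/=]; rewrite !mem_iota => hi hj eT.
    have {}hi : i < g by []. have {}hj : 0 < j < f by lia.
    rewrite eT mem_cat in hs; case/orP: hs => [hs|/flattenP[T' /mapP[S hS ->] hs]].
      by left; eexists; [apply: Or31; exists i, j; split|exact: hs].
    by right; eexists; [apply: Or31; exists i, j, S; split|exact: hs].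
  - case/mapP => -[[i j] k] hl eT; move: hs; rewrite eT !mem_cat => /or4P[] hs.
    + by left; eexists; [apply: Or32; exists i, j, k; split|exact: hs].
    + by right; eexists; [apply: Or32; exists i, j, k; split; [|apply: Or31]|exact: hs].
    + by right; eexists; [apply: Or32; exists i, j, k; split; [|apply: Or32]|exact: hs].
    by right; eexists; [apply: Or32; exists i, j, k; split; [|apply: Or33]|exact: hs].
  case/mapP => J hJ eT; move: hs; rewrite eT mem_cat => /orP[] hs.
    by left; eexists; [apply: Or33; exists J|exact: hs].
  by right; eexists; [apply: Or33; exists J|exact: hs].
case=> -[Gs [[i [j]]|[i [j [k [hl]]]]|[J hJ]]].
- move=> [hi hj ->] hs; rewrite (sf i j s) //.
  by rewrite mem_cat hs.
- move=> -> hs; apply/or3P; apply: Or32; apply/flattenP; exists (linkT h g (i, j, k)); last by rewrite mem_cat hs.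
  exact: map_f.
- move=> -> hs; apply/or3P; apply: Or33; apply/flattenP; exists (addT h g J); last by rewrite mem_cat hs.
  exact: map_f.
- move=> [S [hi hj hS ->]] hs; rewrite (sf i j s) //; rewrite mem_cat; apply/orP; right.
  by apply/flattenP; exists (cone (single S)) => //; apply: map_f.
- move=> e hs; apply/or3P; apply: Or32; apply/flattenP; exists (linkT h g (i, j, k)); first exact: map_f.
  by rewrite !mem_cat; case: e hs => -> ->; rewrite ?orbT.
move=> -> hs; apply/or3P; apply: Or33; apply/flattenP; exists (addT h g J); last by rewrite mem_cat hs orbT.
exact: map_f.
Qed.

(** The d_j with j < f have main tori and may occur in links. The bound q also covers those that
    occur only in sums, such as the ones of the unary chain. *)
Variable q : nat.
Hypotheses (h0 : 0 < h) (g0 : 0 < g) (f2 : 2 <= f) (fq : f <= q).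
Hypothesis wf : sys_wf f g [::] K.
Hypothesis wfA : all (add_wf q) A.
Definition NN := h + h.-1 + g + q.

Lemma single_twf U : uniq U -> all (fun x => x < NN) U -> twf NN (single U).
Proof.
move=> u a; rewrite /twf flatten_single u a; apply/allP => G /mapP[x _ ->]; done.
Qed.

Lemma CC_iota : pr :: C0 ++ C1 = iota 0 (h + h.-1).
Proof. by rewrite iotaD -{3}(prednK h0) -{2}(prednK h0) /= add0n prednK. Qed.

Lemma mainU_uniq i j : i < g -> 0 < j -> uniq (mainU h g i j).
Proof.
move=> hi hj; have pe : perm_eq (mainU h g i j) [:: ps 0, ps j, pt i & pr :: C0 ++ C1].
  by rewrite /mainU /= !perm_cons -[pr :: C1]/([:: pr] ++ C1) perm_catCA.
rewrite (perm_uniq pe) CC_iota /= iota_uniq !inE !mem_iota /TorusComplex.ps /TorusComplex.pt.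
by lia.
Qed.

Lemma mainU_lt i j : i < g -> j < q -> all (fun x => x < NN) (mainU h g i j).
Proof.
move=> hi hj; rewrite /= all_cat /= /NN /TorusComplex.ps /TorusComplex.pt /pr.
have a0 : all (fun x => x < h + h.-1 + g + q) C0 by apply/allP => x; rewrite mem_C0; lia.
have a1 : all (fun x => x < h + h.-1 + g + q) C1 by apply/allP => x; rewrite mem_C1; lia.
by rewrite a0 a1; lia.
Qed.

Lemma C0_uniq : uniq C0. Proof. exact: iota_uniq. Qed.

Lemma all_C0 : all (fun x => x < NN) C0.
Proof. by apply/allP => x; rewrite mem_C0 /NN; lia. Qed.

Lemma torus_twf Gs : torus Gs -> twf NN Gs.
Proof.
case=> [[i [j [hi hj ->]]]|[i [j [k [hl ->]]]]|[J hJ ->]]; apply: single_twf.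
- by apply: mainU_uniq => //; case/andP: hj.
- by apply: mainU_lt => //; lia.
- have /andP[_ /allP/(_ _ hl)] := wf => hh; rewrite /link_wf /= in hh; rewrite /linkU /= !inE C0_uniq !mem_C0 /TorusComplex.ps /TorusComplex.pt; lia.
- have /andP[_ /allP/(_ _ hl)] := wf => hh; rewrite /link_wf /= in hh; rewrite /linkU /= all_C0 /NN /TorusComplex.ps /TorusComplex.pt; lia.
- rewrite cat_uniq map_inj_uniq; last by move=> x y; rewrite /TorusComplex.ps; lia.
  have /allP/(_ _ hJ)/and3P[-> _ _] := wfA.
  rewrite /= C0_uniq mem_C0 /TorusComplex.pt andbT; apply/andP; split; last by lia.
  apply/negP => /orP[/mapP[x _]|/hasP[x]]; first by rewrite /TorusComplex.ps; lia.
  by rewrite mem_C0 => hx /mapP[y _]; rewrite /TorusComplex.ps; lia.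
rewrite all_cat /= all_C0 andbT; apply/andP; split; last by rewrite /NN /TorusComplex.pt; lia.
have /allP/(_ _ hJ)/and3P[_ _ /allP aJ] := wfA.
by apply/allP => x /mapP[y /aJ hy ->]; rewrite /NN /TorusComplex.ps; lia.
Qed.

Lemma torus_size Gs : torus Gs -> size Gs <= h.+1.*2.
Proof.
case=> [[i [j [hi hj ->]]]|[i [j [k [hl ->]]]]|[J hJ ->]]; rewrite size_map /=.
- by rewrite size_cat /= !size_iota; lia.
- by rewrite size_iota; lia.
have /allP/(_ _ hJ)/and3P[_ sJ _] := wfA.
by rewrite size_cat /= size_map size_iota; lia.
Qed.

Lemma twf_merge Gs Gs' : flatten Gs' = flatten Gs -> all (fun G : seq nat => 0 < size G) Gs' ->
  twf NN Gs -> twf NN Gs'.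
Proof. by rewrite /twf => -> -> /and3P[-> ->]. Qed.

Lemma ctorus_twf Gs : ctorus Gs -> twf NN Gs /\ size Gs = h.+1.
Proof.
case=> [[i [j [S [hi /andP[j0 jf] + ->]]]]|[i [j [k [hl]]]]|[J hJ ->]].
- rewrite mem_filter mem_subs size_map => /andP[/andP[/eqP sS _] sub]; split=> //.
  apply: single_twf; first by apply: subseq_uniq sub _; apply: mainU_uniq.
  apply/allP => x /(mem_subseq sub); have jq := leq_trans jf fq.
  exact: (allP (mainU_lt hi jq)).
- have /andP[_ /allP/(_ _ hl) hh] := wf; rewrite /link_wf /= in hh.
  have t : twf NN (single (linkU h g i j k)) by apply: torus_twf; apply: Or32; exists i, j, k.
  have ss : (size (iota 1 h.-1)).+2 = h.+1 by rewrite size_iota prednK.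
  case=> ->; (split; last by rewrite /= ?size_map).
  + apply: single_twf; first by rewrite /= !inE C0_uniq !mem_C0 /TorusComplex.ps /TorusComplex.pt; lia.
    by rewrite /= all_C0 /NN /TorusComplex.ps /TorusComplex.pt; lia.
  + apply: single_twf; first by rewrite /= !inE C0_uniq !mem_C0 /TorusComplex.ps /TorusComplex.pt; lia.
    by rewrite /= all_C0 /NN /TorusComplex.ps /TorusComplex.pt; lia.
  rewrite /twf /linkS /= flatten_single /= !inE C0_uniq all_C0 !mem_C0 /NN /TorusComplex.ps /TorusComplex.pt.
  have -> : all (fun G : seq nat => 0 < size G) (single C0) by apply/allP => G /mapP[x _ ->].
  by lia.
have t : twf NN (single (addU h g J)) by apply: torus_twf; apply: Or33; exists J.
have /allP/(_ _ hJ)/and3P[_ sJ _] := wfA.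
split; last by rewrite /= size_map size_iota prednK.
apply: twf_merge t.
  by rewrite flatten_single /= flatten_single.
rewrite /= size_map; apply/andP; split; first by lia.
by apply/allP => G /mapP[x _ ->].
Qed.

Lemma simps_valid s : s \in simps h g f A K ->
  [/\ 0 < size s, uniq s, all (fun i => i < (MM ^ NN).+1) s & size s <= h.+1.*2.+1].
Proof.
case/mem_simps => -[Gs tGs].
  case/mem_chains => th [p [h1 h2 h3 ->]]; have wG := torus_twf tGs.
  rewrite size_smp (perm_size h3) size_iota; split=> //; last by rewrite ltnS torus_size.
    exact: (smp_uniq wG).
  by apply/allP => v /(smp_lt wG h1)/andP[].
have [wG sG] := ctorus_twf tGs.
case/mapP => s' /mem_chains[th [p [h1 h2 h3 ->]]] ->.
split=> //.
- rewrite cons_uniq (smp_uniq wG) // andbT; apply/negP => /(smp_lt wG h1); done.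
- by apply/allP => v; rewrite inE => /orP[/eqP->//|/(smp_lt wG h1)/andP[]].
rewrite -[size (0 :: _)]/((size (smp Gs th p)).+1).
by rewrite size_smp (perm_size h3) size_iota sG; lia.
Qed.

Lemma simps_top : has (fun s => size s == h.+1.*2.+1) (simps h g f A K).
Proof.
have tG : torus (single (mainU h g 0 1)) by apply: Or31; exists 0, 1.
set Gs := single _ in tG; pose th := nseq (size Gs) 0.
have sz : size Gs = h.+1.*2 by rewrite size_map /= size_cat /= !size_iota; lia.
apply/hasP; exists (smp Gs th (iota 0 (size Gs))); last by rewrite size_smp size_iota sz.
apply/mem_simps; left; exists Gs => //; apply/mem_chains; exists th, (iota 0 (size Gs)).
by rewrite size_nseq all_nseq MM_gt0 orbT; split.
Qed.
End Complex.
End ComplexShape.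

(** * The values of f at the vertices *)

Module VertexValues.
Import all_boot all_order all_algebra.
Import zify.
Import LinkSystem TorusComplex ComplexShape.
Set Implicit Arguments. Unset Strict Implicit. Unset Printing Implicit Defensive.

(* The grid points (4^k, 3^(m-k)), k <= m, span one Freudenthal simplex; they get the labels k <= m
   and all other grid points get the base label m.+1. *)
Definition pat m k := nseq k 4 ++ nseq (m - k) 3.
Definition labs m (w : seq nat) : nat := find (fun k => w == pat m k) (iota 0 m.+1).
Definition labP m (P : seq nat) v : nat := labs m [seq digit v x | x <- P].
(** The m + 2 vertices of a simplex around the origin: C times a unit vector for each label up to m,
    and -C(1, ..., 1) for the base label. *)
Definition rowv (C m k : nat) : seq rat :=
  mkseq (fun j => if k == m.+1 then - C%:R else if j == k then C%:R else 0)%R m.+1.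

Lemma nth_pat m k j : k <= m -> j < m -> nth 0 (pat m k) j = 3 + (j < k).
Proof.
move=> km jm; rewrite nth_cat size_nseq !nth_nseq; case: ltnP => //= hj.
by rewrite ifT //; lia.
Qed.

Lemma size_pat m k : k <= m -> size (pat m k) = m.
Proof. by move=> km; rewrite size_cat !size_nseq; lia. Qed.

Lemma pat_inj m k k' : k <= m -> k' <= m -> pat m k = pat m k' -> k = k'.
Proof.
move=> hk hk' e.
have H a b : a <= m -> b <= m -> pat m a = pat m b -> a <= b.
  move=> ha hb e'; rewrite leqNgt; apply/negP => lt.
  have := congr1 (fun s => nth 0 s b) e'; rewrite !nth_pat //; lia.
by apply/eqP; rewrite eqn_leq; apply/andP; split; apply: H.
Qed.

Lemma labs_le m w : labs m w <= m.+1.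
Proof. by apply: leq_trans (find_size _ _) _; rewrite size_iota. Qed.

Lemma labsP m w k : k <= m -> (labs m w == k) = (w == pat m k).
Proof.
move=> km; rewrite /labs; apply/eqP/eqP => [e|->].
  have h : has (fun k => w == pat m k) (iota 0 m.+1) by rewrite has_find e size_iota.
  by have := nth_find 0 h; rewrite e nth_iota // add0n => /eqP.
have h : has (fun k' => pat m k == pat m k') (iota 0 m.+1).
  by apply/hasP; exists k => //; rewrite mem_iota.
have lt : find (fun k' => pat m k == pat m k') (iota 0 m.+1) < m.+1.
  by move: h; rewrite has_find size_iota.
have /eqP := nth_find 0 h; rewrite nth_iota // add0n => /pat_inj e.
by rewrite -e.
Qed.

Section Values.
Variables (h g q C : nat).
Notation m := h.+1.
Definition P1 := [:: ps h g 0, pt h 0 & C0 h].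
Definition P2 := [:: ps h g 0, pr & C1 h].
Definition F0 := (ps h g 0).+1.
Definition onP (P : seq nat) v := all (fun x => (x \in P) || (digit v x == 0)) (iota 0 F0).
Definition zrow : seq rat := nseq m.+1 0%R.
Definition fv v := if onP P1 v then rowv C m (labP m P1 v) else
  if onP P2 v then rowv C m (labP m P2 v) else zrow.
(* The zero rows beyond the vertices below MM ^ F0 make the list grow with q in a uniform way. *)
Definition ivals := zrow :: [seq fv v | v <- iota 1 (MM ^ F0)] ++ nseq (MM ^ NN h g q - MM ^ F0) zrow.
Definition fvv v := if (0 < v) && (v <= MM ^ F0) then fv v else zrow.

Hypotheses (h0 : 0 < h) (g0 : 0 < g) (q0 : 0 < q).

Lemma F0_le : F0 <= NN h g q.
Proof. by rewrite /F0 /NN /ps; lia. Qed.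

Lemma powF0_le : MM ^ F0 <= MM ^ NN h g q.
Proof. by rewrite leq_exp2l ?F0_le // MME. Qed.

Lemma size_ivals : size ivals = (MM ^ NN h g q).+1.
Proof. by rewrite /= size_cat size_map size_iota size_nseq subnKC ?powF0_le. Qed.

Lemma nth_ivals v : v < size ivals -> nth [::] ivals v = fvv v.
Proof.
rewrite size_ivals; case: v => [|v] // hv; rewrite /= nth_cat size_map size_iota /fvv /=.
case: ltnP => hF; first by rewrite (nth_map 0) ?size_iota // nth_iota.
by rewrite nth_nseq ifT //; lia.
Qed.

(** The two subtori meet in the circle of s_0. A vertex there has a zero digit in each list, while
    the patterns contain only 3 and 4, so both labels are the base label and the order of the tests
    in [fv] does not matter. *)
Lemma fv_P2 v : onP P2 v -> fv v = rowv C m (labP m P2 v).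
Proof.
move=> o2; rewrite /fv; case: ifP => o1; last by rewrite o2.
congr rowv.
have z x : x \in pt h 0 :: C0 h -> digit v x = 0.
  move=> hx; have xF : x < F0.
    by move: hx; rewrite inE mem_C0 => /orP[/eqP->|]; rewrite /F0 /ps /pt; lia.
  have := allP o2 x; rewrite mem_iota add0n => /(_ xF)/orP[|/eqP//].
  move: hx; rewrite !inE mem_C1 mem_C0 /ps /pt /pr; lia.
have z' : digit v pr = 0.
  have := allP o1 pr; rewrite mem_iota => /(_ isT)/orP[|/eqP//].
  by rewrite !inE mem_C0 /ps /pt /pr; lia.
have bad (w : seq nat) : nth 0 w 1 = 0 -> size w = m -> labs m w = m.+1.
  move=> w1 sw; apply/eqP; rewrite eqn_leq labs_le ltnNge; apply/negP => hle.
  have /eqP e : w == pat m (labs m w) by rewrite -labsP.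
  by move: w1; rewrite e nth_pat.
rewrite /labP !bad //= ?size_map ?size_iota ?prednK //.
by apply: z; rewrite mem_head.
Qed.

Lemma rowv_size k : size (rowv C m k) = m.+1.
Proof. by rewrite size_mkseq. Qed.

Lemma ivals_size v : v \in ivals -> size v = m.+1.
Proof.
rewrite inE mem_cat => /or3P[/eqP->|/mapP[x _ ->]|]; first by rewrite size_nseq.
  by rewrite /fv; case: ifP => _; [|case: ifP => _]; rewrite ?rowv_size ?size_nseq.
by rewrite mem_nseq => /andP[_ /eqP->]; rewrite size_nseq.
Qed.

Lemma F0_P1 x : x \in P1 -> x < F0.
Proof. by rewrite !inE mem_C0 /F0 /ps /pt => /or3P[/eqP->|/eqP->|]; lia. Qed.

Lemma F0_P2 x : x \in P2 -> x < F0.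
Proof. by rewrite !inE mem_C1 /F0 /ps /pr => /or3P[/eqP->|/eqP->|]; lia. Qed.

Lemma onP_vnum N P th : uniq P -> (forall x, x \in P -> x < N) -> size th = size P ->
  all (fun a => a < MM) th -> (forall x, x \in P -> x < F0) ->
  let v := vnum (single P) th in [/\ onP P v, 0 < v <= MM ^ F0 & [seq digit v x | x <- P] = th].
Proof.
move=> uP lN sth lt lF v.
have wf N' : (forall x, x \in P -> x < N') -> twf N' (single P).
  move=> hx; rewrite /twf flatten_single uP /=; apply/andP; split; first by apply/allP.
  by apply/allP => G /mapP[x _ ->].
have st : size th = size (single P) by rewrite size_map.
have dig x : digit v x = cf (single P) th x by rewrite (digit_vnum _ (wf _ lF)).
split.
- apply/allP => x _; case xP: (x \in P) => //=; rewrite dig cf_notin // flatten_single xP //.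
- by rewrite /= -ltnS; apply: (vnum_lt (wf _ lF)).
apply: (@eq_from_nth _ 0); rewrite size_map ?sth // => i hi.
rewrite (nth_map 0) // dig (@cf_nth _ _ _ i) ?flatten_single ?size_map //.
by rewrite (nth_map 0) // mem_seq1.
Qed.
End Values.
End VertexValues.

(** * Maps without zeros give solutions *)

Module FineGrid.
Import all_boot all_order all_fingroup all_algebra.
Import zify.
Import TorusComplex CubeChains CochainDegree CupShuffle TorusDegrees.
Set Implicit Arguments. Unset Strict Implicit. Unset Printing Implicit Defensive.
Import GRing.Theory.

(** By Hermite's identity t/D is the mean of the floors of (t + r)/D over r < D. A point of the grid
    refined D times is thus the mean of D coarse grid points, and its barycentric coordinates are
    their frequencies. *)
Definition fl D t r := ((t + r) %/ D) %% MM.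

Lemma fl_mod D t r : 0 < D -> fl D (t %% (MM * D)) r = fl D t r.
Proof.
move=> D0; rewrite /fl {2}(divn_eq t (MM * D)) mulnA -addnA divnMDl //.
by rewrite modnMDl.
Qed.

Lemma fl0 D r : r < D -> fl D 0 r = 0.
Proof. by move=> h; rewrite /fl add0n divn_small // mod0n. Qed.

Lemma sorted_prefix (T : eqType) (k : T -> nat) s r : sorted (fun x y => k x <= k y) s ->
  exists j, forall x, (x \in take j s) = (x \in s) && (k x <= r).
Proof.
elim: s => [|a s IH] hs; first by exists 0.
case: (leqP (k a) r) => ha.
  have [j hj] := IH (path_sorted hs); exists j.+1 => x.
  by rewrite /= !inE hj; case: eqP => [->|//]; rewrite ha.
exists 0 => x; rewrite take0 in_nil; apply/esym/negP => /andP[xs hx].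
have tr : transitive (fun x y => k x <= k y) by move=> ? ? ?; apply: leq_trans.
have : all (fun y => k a <= k y) s by apply: order_path_min hs.
move/allP => ha'; move: xs; rewrite inE => /orP[/eqP e|/ha' h]; last by lia.
by rewrite e in hx; lia.
Qed.

Lemma divnD_step t D r : 0 < D -> r < D -> (t + r) %/ D = t %/ D + (D - t %% D <= r).
Proof.
move=> D0 rD; have hm := ltn_pmod t D0; rewrite {1}(divn_eq t D) -addnA divnMDl //; congr (_ + _).
case: leqP => h; last by rewrite divn_small //; lia.
have -> : t %% D + r = 1 * D + (t %% D + r - D) by lia.
by rewrite divnMDl // divn_small ?addn0 //; lia.
Qed.

(** Coordinate i steps up once r reaches D - (c_i mod D). Sorting the coordinates by this threshold
    gives the order p of the one simplex that contains all D coarse points. *)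
Lemma fine_chain Gs (c : seq nat) D : 0 < D -> size c = size Gs ->
  exists p, perm_eq p (iota 0 (size Gs)) /\ forall r, r < D ->
    vnum Gs (map (fun t => fl D t r) c) \in smp Gs (map (fun t => fl D t 0) c) p.
Proof.
move=> D0 sc; pose k i := D - nth 0 c i %% D.
pose p := sort (fun i j => k i <= k j) (iota 0 (size Gs)).
exists p; split; first by rewrite perm_sort.
move=> r rD; have [j hj] : exists j, forall x, (x \in take j p) = (x \in p) && (k x <= r).
  by apply: sorted_prefix; apply: sort_sorted => x y; apply: leq_total.
have -> : map (fun t => fl D t r) c = stepv (map (fun t => fl D t 0) c) (take j p).
  apply: (@eq_from_nth _ 0); rewrite ?size_stepv ?size_map // => i hi.
  rewrite nth_stepv ?size_map // !(nth_map 0) // hj mem_sort mem_iota add0n -sc hi /=.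
  by rewrite /fl addn0 modnDml divnD_step.
apply: map_f; case: (leqP j (size p)) => hjp.
  by apply/mapP; exists j => //; rewrite mem_iota add0n ltnS.
rewrite take_oversize; last exact: ltnW.
apply/mapP; exists (size p); last by rewrite take_size.
by rewrite mem_iota add0n ltnS leqnn.
Qed.

(** Only one r < D makes t + r + 1 a multiple of D. A unit step on the fine grid therefore moves
    mass at most 1/D per coordinate. *)
Lemma fl_step_count D t : 0 < D -> \sum_(r < D) (fl D t.+1 r != fl D t r) <= 1.
Proof.
move=> D0; have E r : (fl D t.+1 r != fl D t r) <= (D %| (t + r).+1).
  by rewrite /fl addSn divnS //; case: (D %| _); rewrite ?leq_b1 // add0n eqxx.
apply: (@leq_trans (\sum_(r < D) (D %| (t + r).+1))); first by apply: leq_sum => r _; apply: E.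
rewrite -big_mkcond sum1_card; apply/card_le1P => r; rewrite unfold_in => hr s.
rewrite !unfold_in /=; apply/idP/eqP => [hs|-> //]; apply/val_inj => /=.
move: hr hs; rewrite /dvdn -!addSn => /eqP hr /eqP hs.
have /eqP : t.+1 + s = t.+1 + r %[mod D] by rewrite hr hs.
by rewrite eqn_modDl !modn_small // => /eqP.
Qed.

Lemma fl_count D t n : 0 < D -> \sum_(r < D) (fl D (t + n) r != fl D t r) <= n.
Proof.
move=> D0; elim: n => [|n IH]; first by rewrite big1 // => r _; rewrite addn0 eqxx.
apply: leq_trans (_ : \sum_(r < D) ((fl D (t + n).+1 r != fl D (t + n) r) + (fl D (t + n) r != fl D t r)) <= _).
  apply: leq_sum => r _; rewrite addnS; case: (fl D (t + n) r =P fl D t r) => [->|_]; first by rewrite addn0.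
  by case: (_ != _) => /=; lia.
by rewrite big_split /=; apply: (@leq_add _ _ 1 n); first exact: fl_step_count.
Qed.

Lemma divn_step D t : 0 < D -> (t + D) %/ D = (t %/ D).+1.
Proof. by move=> D0; rewrite -{1}[D]mul1n addnC divnMDl // add1n. Qed.

(** The floor of (p + r1 + 1)/D lies between the two equal floors, because n <= 1 and r1 < r2; the
    result no longer involves n. *)
Lemma fl_twice D p n r1 r2 : 0 < D -> n <= 1 -> r1 < r2 -> r2 < D ->
  fl D (p + n) r1 = fl D (p + n) r2 -> fl D (p + n) r1 = ((p + r1.+1) %/ D) %% MM.
Proof.
move=> D0 n1 r12 r2D; rewrite /fl => e.
have l1 : (p + n + r1) %/ D <= (p + r1.+1) %/ D by apply: leq_div2r; clear -n1; lia.
have l2 : (p + r1.+1) %/ D <= (p + n + r2) %/ D by apply: leq_div2r; clear -n1 r12; lia.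
have l3 : (p + n + r2) %/ D <= ((p + n + r1) %/ D).+1.
  have -> : ((p + n + r1) %/ D).+1 = (p + n + r1 + D) %/ D by rewrite divn_step.
  by apply: leq_div2r; clear -n1 r12 r2D; lia.
suff e2 : (p + n + r2) %/ D = (p + n + r1) %/ D by congr (_ %% _); apply/eqP; rewrite eqn_leq l1 -e2.
move: e l1 l2 l3; set a := (p + n + r1) %/ D; set b := (p + n + r2) %/ D; set x := (_ + _) %/ D => e l1 l2 l3.
have hab : b = a \/ b = a.+1 by clear -l1 l2 l3; lia.
case: hab => // eb; move: e; rewrite eb -addn1.
move/eqP; rewrite -{1}[a]addn0 eqn_modDl mod0n modn_small ?MME //.
Qed.

Lemma fl_ge4 D t : 0 < D -> (t %/ D) %% MM = 4 -> 4 * D <= t.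
Proof. by move=> D0 et; rewrite -leq_divRL // -[X in X <= _]et leq_mod. Qed.

Lemma fl_lt3 D t : 0 < D -> (t %/ D) %% MM = 3 -> t <= MM * D -> t < 4 * D.
Proof.
move=> D0 et tQ; rewrite -ltn_divLR //.
case: (ltnP (t %/ D) MM) => hM; first by rewrite -(modn_small hM) et.
have eM : t %/ D = MM by apply/eqP; rewrite eqn_leq hM andbT -(mulnK MM D0) leq_div2r.
by move: et; rewrite eM modnn.
Qed.

Lemma count_iota k x : k <= x -> count (fun j => j < k) (iota 0 x) = k.
Proof.
move=> kx; rewrite -(subnKC kx) iotaD count_cat add0n.
have /eqP -> : count (fun j => j < k) (iota k (x - k)) == 0.
  by rewrite eqn0Ngt -has_count; apply/hasPn => j; rewrite mem_iota -leqNgt => /andP[].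
rewrite addn0 -[RHS](size_iota 0 k); apply/eqP; rewrite -all_count; apply/allP => j.
by rewrite mem_iota.
Qed.

Section Ref.
Local Open Scope ring_scope.
Variables (h D : nat).
Notation m := h.+1.
Notation Q := (MM * D)%N.
Notation Z := 'Z_Q.
Notation V := 'rV[Z]_m.
Hypothesis D0 : (0 < D)%N.

Lemma Q_gt1 : (1 < Q)%N.
Proof. by rewrite MME; lia. Qed.

Lemma val_emb k (p : 'rV[Z]_k) n j : nat_of_ord ((p + emb Q n)%R 0%R j) = ((p 0%R j + n j) %% Q)%N.
Proof.
have E (a b : nat) : ((a + b %% Q) %% (Zp_trunc Q).+2 = (a + b) %% Q)%N.
  by rewrite Zp_cast ?Q_gt1 // modnDmr.
by rewrite !mxE /= val_Zp_nat ?Q_gt1 // E.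
Qed.

Lemma fl_emb k (p : 'rV[Z]_k) n j r : fl D ((p + emb Q n)%R 0%R j) r = fl D (p 0%R j + n j) r.
Proof. by rewrite val_emb fl_mod. Qed.

Definition inset k (o : seq 'I_k) : {ffun 'I_k -> nat} := [ffun j => nat_of_bool (j \in o)].

Lemma sum_inset k (o : seq 'I_k) : uniq o -> \sum_(j <- o) emb Q (unitf j) = emb Q (inset o).
Proof.
move=> uo; rewrite -(big_map (@unitf k) predT (fun w => emb Q w)) sum_emb; congr emb.
apply/ffunP => j; rewrite !ffunE big_map; under eq_bigr do rewrite ffunE.
rewrite -big_mkcond /= sum1_count -count_uniq_mem //.
by apply: eq_count => i /=; rewrite eq_sym.
Qed.

Lemma pthE (W : zmodType) (p : W) s : pth p s = [seq p + \sum_(x <- take i s) x | i <- iota 0 (size s).+1].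
Proof.
elim: s p => [|x s IH] p; first by rewrite /= big_nil addr0.
rewrite -[pth p (x :: s)]/(p :: pth (p + x) s) IH.
rewrite -[iota 0 (size (x :: s)).+1]/(0%N :: iota (1 + 0) (size s).+1) iotaDl map_cons.
rewrite take0 big_nil addr0 -map_comp; congr (_ :: _).
by apply/eq_map => i /=; rewrite big_cons addrA.
Qed.

Variable lab0 : ('I_m -> nat) -> 'I_m.+2.
Hypothesis lab0P : forall w (k : 'I_m.+2), k != ord_max ->
  (lab0 w == k) = [forall j, w j == (3 + (j < k))%N].
Hypothesis eq_lab0 : forall w w', w =1 w' -> lab0 w = lab0 w'.

Definition l0 (c : V) := lab0 (fun j => fl D (c 0%R j) 0).

(** The hypothesis says that the label of a fine point is carried by a coarse point of multiplicity
    at least 2. Suppose a prism between the two labellings saw all m + 2 labels. By [fl_twice] each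
    label belongs to a coarse point of the form floor((p + n)/D), with n a vertex of the cube, or
    floor((p + r + 1)/D). All of these form a chain in one coarse cube, which has at most m + 1
    members. *)
Lemma ref_slice (l : V -> 'I_m.+2) :
  (forall c : V, exists r1 r2, [/\ (r1 < r2)%N, (r2 < D)%N, (forall j, fl D (c 0%R j) r1 = fl D (c 0%R j) r2) &
     lab0 (fun j => fl D (c 0%R j) r1) = l c]) ->
  Deg ord_max l (std Q m) = Deg ord_max l0 (std Q m).
Proof.
move=> hl; pose k (z : V * int) := if z.2 == 0 then l z.1 else l0 z.1.
have -> : Deg ord_max l (std Q m) = Deg ord_max (fun c => k (c, 0)) (std Q m) by [].
have -> : Deg ord_max l0 (std Q m) = Deg ord_max (fun c => k (c, 1)) (std Q m) by [].
apply: Deg_slice => [|p s hs]; first by rewrite size_std.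
pose F (o : option 'I_m) : V * int := if o is Some j then (emb Q (unitf j), 0) else (0, 1).
have hs' : perm_eq s (map F (None :: map Some (enum 'I_m))).
  by rewrite /= -map_comp; move: hs; rewrite /std -map_comp.
have [o ho es] := perm_map_ex hs'.
have uo : uniq o.
  rewrite (perm_uniq ho) /= map_inj_uniq ?enum_uniq ?andbT; last by move=> ? ? [].
  by apply/negP => /mapP[].
pose nn (o' : seq (option 'I_m)) : {ffun 'I_m -> nat} := [ffun j => nat_of_bool (Some j \in o')].
have nn1 o' j : (nn o' j <= 1)%N by rewrite ffunE leq_b1.
have sumF o' : uniq o' -> (\sum_(y <- o') F y).1 = emb Q (nn o').
  elim: o' => [|y o' IH] /=.
    move=> _; have -> : nn [::] = [ffun => 0%N] by apply/ffunP => j; rewrite !ffunE.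
    by rewrite big_nil emb0.
  case/andP => yn u; rewrite big_cons /= IH //; case: y yn => [j|] yn /=.
    rewrite -embD; congr emb; apply/ffunP => i; rewrite !ffunE inE.
    case: (i =P j) => [->|ne]; first by rewrite (negbTE yn) eqxx.
    by rewrite (_ : (Some i == Some j) = false) //; apply/eqP => -[].
  by rewrite add0r; congr emb; apply/ffunP => i; rewrite !ffunE inE.
have zE z : z \in pth (p, 0) s -> exists i, z.1 = p + emb Q (nn (take i o)).
  rewrite pthE => /mapP[i _ ->]; exists i.
  by rewrite es -map_take big_map /= sumF // take_uniq.
case: (boolP [exists b, all (fun z => k z != b) (pth (p, 0) s)]) => [/existsP[b /allP hb]|].
  by exists b.
rewrite negb_exists => /forallP all_b; exfalso.
(* Every label b is the label of a vertex [w b], and these vertices form a chain of cube vertices. *)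
pose C (w : 'I_m -> nat) := exists i, forall j, w j = ((p 0%R j + nn (take i o) j) %/ D)%N.
pose C' (w : 'I_m -> nat) := exists2 r, (r.+1 < D)%N & forall j, w j = ((p 0%R j + r.+1) %/ D)%N.
have hw b : exists w, (C w \/ C' w) /\ lab0 (fun j => w j %% MM)%N = b.
  have := all_b b; rewrite -has_predC => /hasP[z zs]; rewrite /= negbK => /eqP kz.
  have [i ez] := zE z zs; rewrite -kz /k; case: ifP => _.
    have [r1 [r2 [r12 r2D e <-]]] := hl z.1.
    exists (fun j => (p 0%R j + r1.+1) %/ D)%N; split; first by right; exists r1 => //; lia.
    apply: eq_lab0 => j; have := e j; rewrite ez !fl_emb => e'.
    by rewrite (fl_twice D0 _ r12 r2D e').
  exists (fun j => (p 0%R j + nn (take i o) j) %/ D)%N; split; first by left; exists i.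
  by apply: eq_lab0 => j; rewrite ez fl_emb /fl addn0.
have [w wP] := fin_all_exists hw.
pose F0 j := (p 0%R j %/ D)%N.
have stepD t : ((t + D) %/ D)%N = (t %/ D).+1 by rewrite divn_step.
have wl b j : (F0 j <= w b j <= (F0 j).+1)%N.
  rewrite /F0 -stepD; case: (wP b) => -[[i ->]|[r rD ->]] _; apply/andP; split; apply: leq_div2r.
  - exact: leq_addr.
  - by rewrite leq_add2l (leq_trans (nn1 _ _)).
  - exact: leq_addr.
  by rewrite leq_add2l ltnW.
have nnle i i' j : (i <= i')%N -> (nn (take i o) j <= nn (take i' o) j)%N.
  move=> ii; rewrite !ffunE; case hj: (Some j \in take i o) => //.
  by rewrite (mem_subseq _ hj) // -(take_takel _ ii) take_subseq.
have cmp b b' : (forall j, w b j <= w b' j)%N \/ (forall j, w b' j <= w b j)%N.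
  case: (wP b) => -[[i e]|[r rD e]] _; case: (wP b') => -[[i' e']|[r' rD' e']] _.
  - case: (leqP i i') => ii; [left|right] => j; rewrite e e'; apply: leq_div2r; rewrite leq_add2l nnle //.
    exact: ltnW.
  - by left=> j; rewrite e e'; apply: leq_div2r; rewrite leq_add2l (leq_trans (nn1 _ _)).
  - by right=> j; rewrite e e'; apply: leq_div2r; rewrite leq_add2l (leq_trans (nn1 _ _)).
  by case: (leqP r r') => ii; [left|right] => j; rewrite e e'; apply: leq_div2r; rewrite leq_add2l; lia.
pose rk b := (\sum_j (w b j - F0 j))%N.
have rk_lt b : (rk b < m.+1)%N.
  rewrite ltnS -[X in (_ <= X)%N](card_ord m) -sum1_card; apply: leq_sum => j _.
  by have := wl b j; lia.
have same b b' : (forall j, w b j <= w b' j)%N -> rk b = rk b' -> b = b'.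
  move=> le e; have [_ /esym] := leqif_sum (fun j (_ : predT j) => leqif_eq (leq_sub2r (F0 j) (le j))).
  rewrite -/(rk b) -/(rk b') e eqxx => /forallP ej.
  have [_ <-] := wP b; have [_ <-] := wP b'; apply: eq_lab0 => j.
  have := ej j; rewrite implyTb => /eqP.
  by have := wl b j; have := wl b' j => h1 h2 h3; congr (_ %% _)%N; move: h1 h2 h3; clear; lia.
have inj : injective (fun b => Ordinal (rk_lt b)).
  move=> b b' [e]; case: (cmp b b') => le; first exact: same.
  by apply/esym; apply: same.
by have := leq_card _ inj; rewrite !card_ord ltnn.
Qed.

Lemma cubn_single (X : Type) (W : zmodType) n (c : seq X -> int) (k : W -> X) p L :
  size L = n -> uniq L ->
  (forall s, perm_eq s L -> s != L -> c (map k (pth p s)) = 0) ->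
  cubn n c k p L = c (map k (pth p L)).
Proof.
elim: n c p L => [|n IH] c p [|x L] // [sL] /andP[xL uL] z; rewrite [LHS]/=.
rewrite (IH (fun t => c (k p :: t)) (p + x) L) // => [|s ps ns]; last first.
  by apply: (z (x :: s)); rewrite ?perm_cons // eqseq_cons eqxx.
rewrite [X in _ - X](_ : _ = 0) ?subr0 //.
rewrite (eq_Sel_perm (G' := fun _ _ => 0)); first by apply: Sel0.
move=> y R pR; apply: cubn_zero.
  by have := perm_size pR; rewrite /= -sL => <-.
move=> s ps; apply: (z (y :: s)).
  apply: perm_trans (_ : perm_eq (y :: x :: R) _); first by rewrite perm_cons.
  by rewrite -[[:: y, x & R]]/([:: y] ++ [:: x] ++ R) perm_catCA /= perm_cons.
rewrite eqseq_cons negb_and; apply/orP; left; apply: contraNneq xL => <-.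
by rewrite -(perm_mem pR) mem_head.
Qed.

(** A path that sees all labels 0, ..., m has to cross from 3 to 4 in every coordinate. This leaves
    the single cube at (4D - 1, ..., 4D - 1) with the standard order, where the determinant is that
    of the identity matrix. *)
Lemma Deg_l0 : Deg ord_max l0 (std Q m) = 1.
Proof.
pose ps : V := \row_j (4 * D).-1%:R.
have lt4 : (4 * D < Q)%N by rewrite MME; lia.
have psE j : nat_of_ord (ps 0 j) = (4 * D).-1.
  by rewrite mxE val_Zp_nat ?Q_gt1 // modn_small //; lia.
have pathP s : perm_eq s (std Q m) -> exists2 o, perm_eq o (enum 'I_m) &
    s = map (fun i => emb Q (unitf i)) o.
  by move=> /perm_map_ex[o]; exists o.
have ptE p o : uniq o -> map l0 (pth p (map (fun i => emb Q (unitf i)) o)) =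
    [seq lab0 (fun j => fl D (p 0%R j + inset (take i o) j) 0) | i <- iota 0 (size o).+1].
  move=> uo; rewrite pthE -map_comp size_map; apply/eq_map => i /=.
  rewrite -map_take big_map sum_inset ?take_uniq //; apply: eq_lab0 => j.
  by rewrite fl_emb.
have key p o : perm_eq o (enum 'I_m) -> uu ord_max (map l0 (pth p (map (fun i => emb Q (unitf i)) o))) != 0 ->
    p = ps /\ o = enum 'I_m.
  move=> po; have uo : uniq o by rewrite (perm_uniq po) enum_uniq.
  have so : size o = m by rewrite (perm_size po) size_enum_ord.
  rewrite ptE // => nz.
  have lab_in (k : 'I_m.+2) : k != ord_max -> exists2 i, (i <= m)%N &
      forall j, fl D (p 0%R j + inset (take i o) j) 0 = (3 + (j < k))%N.
    move=> nk; have : k \in [seq lab0 (fun j => fl D (p 0%R j + inset (take i o) j) 0) | i <- iota 0 (size o).+1].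
      apply: contraNT nz => kn; rewrite (uu_missing _ kn nk) //.
      by rewrite size_map size_iota so.
    case/mapP => i; rewrite mem_iota add0n so ltnS => im /esym/eqP.
    by rewrite lab0P // => /forallP hj; exists i => // j; apply/eqP.
  have [i0 _ h0] := lab_in ord0 isT.
  have km : (m < m.+2)%N by [].
  have nkm : Ordinal km != ord_max by apply/eqP => -[]; lia.
  have [im _ hm] := lab_in (Ordinal km) nkm.
  have pj j : nat_of_ord (p 0 j) = (4 * D).-1 /\ j \notin take i0 o.
    have e2 : fl D (p 0%R j + inset (take i0 o) j) 0 = 3 by rewrite h0.
    have e1 : fl D (p 0%R j + inset (take im o) j) 0 = 4 by rewrite hm /= ltn_ord.
    move: e1 e2; rewrite !ffunE /fl !addn0.
    have pQ : (p 0%R j < Q)%N by rewrite -[X in (_ < X)%N](Zp_cast Q_gt1) ltn_ord.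
    set a := nat_of_bool _; set b := nat_of_bool _ => e1 e2.
    have [a1 b1] : (a <= 1)%N /\ (b <= 1)%N by rewrite !leq_b1.
    have le4 := fl_ge4 D0 e1.
    have lt3 : (p 0%R j + b < 4 * D)%N by apply: (fl_lt3 D0 e2); clear -pQ b1; lia.
    have b0 : (b = 0)%N by clear -le4 lt3 a1 b1; lia.
    have pe : nat_of_ord (p 0 j) = (4 * D).-1 by clear -le4 lt3 a1 b0; lia.
    by move: b0; rewrite /b; case: (j \in take i0 o).
  have ep : p = ps.
    apply/matrixP => i j; rewrite ord1; apply: ord_inj.
    by have [-> _] := pj j; rewrite psE.
  split=> //.
  have fP (t : nat) : (t <= 1)%N -> fl D ((4 * D).-1 + t) 0 = (3 + t)%N.
    case: t => [|[|//]] _; rewrite /fl !addn0.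
      rewrite (_ : (4 * D).-1 = 3 * D + D.-1)%N; last by lia.
      by rewrite divnMDl // divn_small ?addn0 ?prednK // modn_small ?MME.
    by rewrite addn1 prednK ?muln_gt0 ?D0 // mulnK // modn_small ?MME.
  have pre (k : nat) : (k <= m)%N -> exists2 i, (i <= m)%N & forall j : 'I_m, (j \in take i o) = (j < k)%N.
    move=> hk; have hk2 : (k < m.+2)%N by lia.
    have nk : Ordinal hk2 != ord_max by apply/eqP => -[]; lia.
    have [i hi hh] := lab_in _ nk; exists i => // j; have := hh j.
    have [-> _] := pj j; rewrite fP ?ffunE ?leq_b1 //= => /addnI; by case: (j \in _) (j < k)%N => [] [].
  have tk (k : nat) : (k <= m)%N -> forall j : 'I_m, (j \in take k o) = (j < k)%N.
    move=> hk; have [i hi hh] := pre k hk; suff ei : k = i by move=> j; rewrite {1}ei hh.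
    have u1 : uniq (take i o) by rewrite take_uniq.
    have : perm_eq (take i o) (filter (fun j : 'I_m => (j < k)%N) (enum 'I_m)).
      apply: uniq_perm => //; first by rewrite filter_uniq ?enum_uniq.
      by move=> j; rewrite mem_filter mem_enum andbT hh.
    move/perm_size; rewrite size_takel ?so // size_filter -(count_map val (fun j => (j < k)%N)).
    by rewrite val_enum_ord count_iota.
  apply: (@eq_from_nth _ ord0); first by rewrite so size_enum_ord.
  move=> i; rewrite so => hi; apply: val_inj; rewrite /= nth_enum_ord //.
  have h1 : nth ord0 o i \in take i.+1 o by rewrite -(nth_take ord0 (ltnSn i)) mem_nth // size_takel ?so.
  have h2 : nth ord0 o i \notin take i o.
    apply/negP => /(nthP ord0)[i' hi' e]; move: hi' e; rewrite size_takel ?so ?(ltnW hi) // => hi'.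
    rewrite nth_take // => /eqP; rewrite nth_uniq ?so //; last by apply: ltn_trans hi.
    by move/eqP => e; rewrite e ltnn in hi'.
  move: h1 h2; rewrite !tk //; last exact: ltnW.
  by rewrite ltnS -leqNgt => l1 l2; apply/eqP; rewrite eqn_leq l1 l2.
rewrite /Deg (bigD1 ps) // big1 => [|p /andP[_ np]]; last first.
  apply: cubn_zero; first by rewrite size_std.
  move=> s /pathP[o po ->]; apply/eqP; apply: contraNT np => /(key _ _ po)[-> _].
  exact: eqxx.
apply: etrans (addr0 _) _; rewrite cubn_single; first last.
- move=> s /pathP[o po ->] ns; apply/eqP; apply: contraNT ns => /(key _ _ po)[_ ->].
  exact: eqxx.
- rewrite map_inj_in_uniq ?enum_uniq // => i j _ _ /matrixP/(_ 0 i).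
  rewrite !mxE !ffunE eqxx; case: eqP => // _ /eqP; by rewrite oner_eq0.
- by rewrite size_std.
rewrite ptE ?enum_uniq // size_enum_ord.
have -> : [seq lab0 (fun j => fl D (ps 0%R j + inset (take i (enum 'I_m)) j) 0) | i <- iota 0 m.+1] =
   [seq inord i | i <- iota 0 m.+1].
  apply/eq_in_map => i; rewrite mem_iota add0n => /andP[_ im].
  apply/eqP; rewrite lab0P; last by apply/eqP => /(congr1 val) /=; rewrite inordK //; lia.
  apply/forallP => j; rewrite psE ffunE inordK; last exact: ltnW.
  have -> : (j \in take i (enum 'I_m)) = (j < i)%N.
    rewrite -(mem_map val_inj) map_take val_enum_ord take_iota mem_iota add0n /=.
    by have := ltn_ord j; lia.
  case: (j < i)%N; rewrite /fl !addn0 ?addn1.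
    by rewrite prednK ?muln_gt0 ?D0 // mulnK // modn_small ?MME.
  rewrite (_ : (4 * D).-1 = 3 * D + D.-1)%N; last by lia.
  by rewrite divnMDl // divn_small ?addn0 ?prednK // modn_small ?MME.
rewrite /uu /dt -[RHS](det1 _ m.+2); congr (\det _); apply/matrixP => i j; rewrite !mxE.
rewrite nth_rcons size_map size_iota; case: ltnP => hi.
  by rewrite (nth_map 0%N) ?size_iota // nth_iota // add0n inord_val.
have ei : i = ord_max by apply: val_inj => /=; have := ltn_ord i; lia.
by rewrite ei /= eqxx.
Qed.
End Ref.
End FineGrid.

(** * Compactness, labels of vectors and comparison of norms *)

Module Compactness.
Import all_boot all_order all_algebra.
Import all_classical all_reals all_analysis.
Import ring lra.
Set Implicit Arguments. Unset Strict Implicit. Unset Printing Implicit Defensive.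
Import Order.TTheory GRing.Theory Num.Theory.
Import numFieldNormedType.Exports.
Local Open Scope classical_set_scope.
Local Open Scope ring_scope.

Section Compactness.
Variable R : realType.

Lemma sum_coord_continuous (I : finType) (T : topologicalType) (F : I -> T -> R) :
  (forall i, continuous (F i)) -> continuous (fun x => \sum_i F i x).
Proof.
move=> h x; have H s : \sum_(i <- s) F i y @[y --> x] --> \sum_(i <- s) F i x.
  elim: s => [|i s IH]; first by under eq_fun do rewrite big_nil; rewrite big_nil; exact: cvg_cst.
  by under eq_fun do rewrite big_cons; rewrite big_cons; apply: cvgD => //; apply: h.
exact: H.
Qed.

Lemma entry_continuous n i : continuous (fun x : 'rV[R]_n => x ord0 i).
Proof. exact: coord_continuous. Qed.

Definition face n (s : seq nat) : set 'rV[R]_n :=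
  [set x | (forall i, 0 <= x ord0 i) /\ \sum_i x ord0 i = 1 /\
    forall i : 'I_n, x ord0 i != 0 -> val i \in s].

Lemma face_closed n s : closed (@face n s).
Proof.
have -> : @face n s = \bigcap_(i in [set: 'I_n]) (fun x : 'rV[R]_n => x ord0 i) @^-1` [set y | 0 <= y]
    `&` ((fun x : 'rV[R]_n => \sum_i x ord0 i) @^-1` [set y | y = 1]
    `&` \bigcap_(i in [set i : 'I_n | val i \notin s]) (fun x : 'rV[R]_n => x ord0 i) @^-1` [set y | y = 0]).
  apply/seteqP; split=> x [h1 [h2 h3]]; split.
  - by move=> i _; apply: h1.
  - split=> // i /= his; apply/eqP; apply: contraNT his => /h3; done.
  - by move=> i; apply: h1.
  split=> // i; apply: contraNT => his; apply/eqP; exact: h3.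
apply: closedI; first apply: closed_bigI => i _.
  by apply: preimage_closed => [y _|]; [exact: entry_continuous|exact: closed_ge].
apply: closedI.
  apply: preimage_closed => [y _|]; last exact: closed_eq.
  by apply: sum_coord_continuous => i; apply: entry_continuous.
apply: closed_bigI => i _.
by apply: preimage_closed => [y _|]; [exact: entry_continuous|exact: closed_eq].
Qed.

Lemma realizE (I : inst) : @realiz R I = \big[setU/set0]_(s <- I.1) @face (nverts I) s.
Proof.
rewrite -bigcup_seq; apply/seteqP; split=> x.
  by move=> [h1 [h2 [s hs h3]]]; exists s.
by move=> [s hs [h1 [h2 h3]]]; split=> //; split=> //; exists s.
Qed.

Lemma realiz_le1 (I : inst) (x : 'rV[R]_(nverts I)) i : realiz I x -> x ord0 i <= 1.
Proof. by move=> [h1 [<- _]]; rewrite (bigD1 i) //= lerDl sumr_ge0. Qed.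

Lemma realiz_compact (I : inst) : compact (@realiz R I).
Proof.
have cB : compact [set v : 'rV[R]_(nverts I) | forall i, `[0, 1]%classic (v ord0 i)].
  exact: (@rV_compact R _ (fun _ : 'I_(nverts I) => `[0, 1]%classic : set R) (fun i => @segment_compact R 0 1)).
apply: (subclosed_compact _ cB).
  by rewrite realizE; apply: closed_bigsetU => s _; apply: face_closed.
by move=> x hx i /=; rewrite in_itv /= (realiz_le1 i hx) andbT; case: hx.
Qed.

Definition vl n (y : 'rV[R]_n) (j : 'I_n.+1) : R := if unlift ord_max j is Some i then y ord0 i else 0.
(** The index of a largest coordinate, with an additional coordinate 0 in last place. Near a nonzero
    vector some label is missing: that of a negative coordinate, or the last one if a coordinate is
    positive. *)
Definition lab n (y : 'rV[R]_n) : 'I_n.+1 := [arg max_(j > ord_max) vl y j]%O.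

Lemma lab_max n (y : 'rV[R]_n) j : vl y j <= vl y (lab y).
Proof. by rewrite /lab; case: arg_maxP => // i _ h; apply: h. Qed.

Lemma lab_neg n (y : 'rV[R]_n) i : y ord0 i < 0 -> lab y != lift ord_max i.
Proof.
move=> yi; apply/eqP => e; have := lab_max y ord_max.
by rewrite e /vl liftK unlift_none => /(lt_le_trans yi); rewrite ltxx.
Qed.

Lemma lab_pos n (y : 'rV[R]_n) i : 0 < y ord0 i -> lab y != ord_max.
Proof.
move=> yi; apply/eqP => e; have := lab_max y (lift ord_max i).
by rewrite e /vl liftK unlift_none => /(lt_le_trans yi); rewrite ltxx.
Qed.

Lemma uniform_label (I : inst) n (g : 'rV[R]_(nverts I) -> 'rV[R]_n) :
  {within realiz I, continuous g} -> (forall x, realiz I x -> g x != 0) ->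
  exists2 d : R, 0 < d & forall x, realiz I x -> exists b, forall y, realiz I y ->
    (forall i, `|x ord0 i - y ord0 i| <= d) -> lab (g y) != b.
Proof.
move=> /subspace_continuousP cg nz.
pose P (d : R) (x : 'rV[R]_(nverts I)) := exists b, forall y, realiz I y ->
    (forall i, `|x ord0 i - y ord0 i| <= d) -> lab (g y) != b.
have cov := (compact_near_coveringP (realiz I)).1 (@realiz_compact I).
have loc x : realiz I x -> exists2 r : R, 0 < r & exists b, forall y, realiz I y ->
    (forall i, `|x ord0 i - y ord0 i| < r) -> lab (g y) != b.
  move=> Kx; have cgi i : g y ord0 i @[y --> within (realiz I) (nbhs x)] --> g x ord0 i.
    apply: (cvg_comp g (fun y : 'rV[R]_n => y ord0 i) (cg x Kx)); exact: entry_continuous.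
  have fin b : (\forall y \near within (realiz I) (nbhs x), lab (g y) != b) ->
    exists2 r : R, 0 < r & exists b, forall y, realiz I y ->
    (forall i, `|x ord0 i - y ord0 i| < r) -> lab (g y) != b.
    rewrite near_withinE => /nbhs_ballP[r r0 hr]; exists r => //; exists b => y Ky hy.
    apply: hr => //; split=> // i j; rewrite ord1; exact: hy.
  have [i [hi|hi]] : exists i, g x ord0 i < 0 \/ 0 < g x ord0 i.
    have /eqP := nz x Kx; apply: contra_notP => /forallNP h; apply/matrixP => i j; rewrite ord1 mxE.
    have := h j; rewrite not_orE => -[/negP + /negP]; rewrite -!leNgt => h1 h2.
    by apply/eqP; rewrite eq_le h1 h2.
  - apply: (fin (lift ord_max i)); have := cgi i.
    move=> /cvgr_lt/(_ _ hi); apply: filterS => y; exact: lab_neg.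
  apply: (fin ord_max); have := cgi i.
  by move=> /cvgr_gt/(_ _ hi); apply: filterS => y; exact: lab_pos.
have near_P : \forall d \near 0^'+, realiz I `<=` P d.
  apply: cov => x Kx; have [r r0 [b hb]] := loc x Kx.
  exists (ball x (r / 2), [set d | d < r / 2]) => /=.
    split; first by apply: nbhsx_ballx; rewrite divr_gt0.
    by apply: nbhs_right_lt; rewrite divr_gt0.
  move=> [x' d] [/= hx' hd]; exists b => y Ky hy; apply: hb => // i.
  rewrite -(subrKA (x' ord0 i)); apply: le_lt_trans (ler_normD _ _) _.
  rewrite [ltRHS](splitr r); apply: ltr_leD; first by have [_] := hx'; apply.
  exact: le_trans (hy i) (ltW hd).
have [d [d0 hd]] := filter_ex (filterI (nbhs_right_gt (0 : R)) near_P).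
by exists d => // x Kx; apply: hd.
Qed.

Lemma norm_basic n (nrm : 'rV[R]_n -> R) : is_norm nrm ->
  [/\ nrm 0 = 0, forall x, nrm (- x) = nrm x & forall x, 0 <= nrm x].
Proof.
move=> [h1 h2 h3].
have n0 : nrm 0 = 0 by rewrite -(scale0r 0) h2 normr0 mul0r.
have nN x : nrm (- x) = nrm x by rewrite -scaleN1r h2 normrN normr1 mul1r.
by split=> // x; have := h3 x (- x); rewrite subrr n0 nN; lra.
Qed.

Lemma norm_upper n (nrm : 'rV[R]_n -> R) : (0 < n)%N -> is_norm nrm ->
  exists2 c : R, 0 < c & forall (x : 'rV[R]_n) M, (forall i, `|x ord0 i| <= M) -> nrm x <= c * M.
Proof.
move=> ngt hn; have [n0 nN ge0] := norm_basic hn; case: hn => h1 h2 h3.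
exists (1 + \sum_i nrm (delta_mx ord0 i)); first by rewrite ltr_pwDl // sumr_ge0.
move=> x M hM; have M0 : 0 <= M by apply: le_trans (hM (Ordinal ngt)).
have -> : x = \sum_i x ord0 i *: delta_mx ord0 i by apply: row_sum_delta.
have le s : nrm (\sum_(i <- s) x ord0 i *: delta_mx ord0 i) <= \sum_(i <- s) M * nrm (delta_mx ord0 i).
  elim: s => [|i s IH]; first by rewrite !big_nil n0.
  rewrite !big_cons; apply: le_trans (h3 _ _) _; apply: lerD => //.
  by rewrite h2 ler_wpM2r.
by apply: le_trans (le _) _; rewrite -mulr_sumr mulrC ler_wpM2r // lerDr.
Qed.

Lemma norm_continuous n (nrm : 'rV[R]_n -> R) : (0 < n)%N -> is_norm nrm -> continuous nrm.
Proof.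
move=> ngt hn; have [C C0 hC] := norm_upper ngt hn; have [n0 nN ge0] := norm_basic hn.
case: hn => h1 h2 h3 x A /nbhs_ballP[e0 /= e00 hA]; pose e := e0 / 2.
have e_gt0 : 0 < e by rewrite divr_gt0.
apply/nbhs_ballP; exists (e / C); first by rewrite /= divr_gt0.
move=> y [_ hy] /=; have hxy : nrm (x - y) <= e.
  have := hC (x - y) (e / C); rewrite mulrCA divff ?mulr1 ?gt_eqF //; apply=> i.
  by rewrite !mxE; apply: ltW; apply: hy.
apply: hA; rewrite /ball /= ltr_norml; have ee : e < e0 by rewrite /e; lra.
have := h3 (x - y) y; have := h3 (y - x) x; rewrite !subrK -(nN (y - x)) opprB.
by move=> h4 h5; apply/andP; split; lra.
Qed.

(** For each i, the norm has a positive minimum on the compact set of vectors of the unit cube with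
    i-th coordinate 1. A general vector is scaled by its largest coordinate, and the constants for
    all i are added. *)
Lemma norm_lower n (nrm : 'rV[R]_n -> R) : (0 < n)%N -> is_norm nrm ->
  exists2 c : R, 0 < c & forall (x : 'rV[R]_n) i, `|x ord0 i| <= c * nrm x.
Proof.
move=> ngt hn; have cn := norm_continuous ngt hn; have [n0 nN ge0] := norm_basic hn.
case: hn => h1 h2 h3.
have dist (i : 'I_n) : exists c : R, 0 < c /\
    forall x : 'rV[R]_n, (forall j, `|x ord0 j| <= `|x ord0 i|) -> `|x ord0 i| <= c * nrm x.
  pose A := [set x : 'rV[R]_n | forall j, `[-1, 1]%classic (x ord0 j)] `&` [set x : 'rV[R]_n | x ord0 i = 1].
  have cB : compact [set x : 'rV[R]_n | forall j, `[-1, 1]%classic (x ord0 j)].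
    exact: (@rV_compact R _ (fun _ : 'I_n => `[-1, 1]%classic : set R) (fun i => @segment_compact R (-1) 1)).
  have cA : compact A.
    apply: compact_closedI => //.
    apply: (@preimage_closed _ _ (fun x : 'rV[R]_n => x ord0 i) [set y | y = 1]) => [y _|].
      exact: entry_continuous.
    exact: closed_eq.
  have [|c cA' cmin] := EVT_min_rV _ cA (continuous_subspaceT cn).
    by exists (const_mx 1); split=> /= [j|]; rewrite ?mxE // in_itv /=; apply/andP; split; lra.
  have ci : c ord0 i = 1 by move: cA'; rewrite inE => -[_].
  have mu0 : 0 < nrm c.
    rewrite lt_neqAle ge0 andbT eq_sym; apply/eqP => /h1 e.
    by move: ci; rewrite e mxE => /eqP; rewrite eq_sym oner_eq0.
  exists (nrm c)^-1; split=> [|x hx]; first by rewrite invr_gt0.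
  have [->|xi] := eqVneq (x ord0 i) 0; first by rewrite normr0 mulr_ge0 // invr_ge0 ltW.
  have := cmin ((x ord0 i)^-1 *: x); rewrite h2 normfV mulrC ler_pdivlMr ?normr_gt0 // => hm.
  rewrite mulrC ler_pdivlMr // mulrC; apply: hm; rewrite inE; split=> /= [j|]; last by rewrite mxE mulVf.
  by rewrite in_itv /= mxE -ler_norml normrM normfV mulrC ler_pdivrMr ?normr_gt0 // mul1r.
have [c hc] := fin_all_exists dist.
exists (\sum_i c i); first by rewrite (bigD1 (Ordinal ngt)) //= ltr_pwDl ?(hc _).1 // sumr_ge0 // => i _; rewrite ltW ?(hc _).1.
move=> x j; pose i := [arg max_(i > Ordinal ngt) `|x ord0 i|]%O.
have hi k : `|x ord0 k| <= `|x ord0 i| by rewrite /i; case: arg_maxP => // k' _; apply.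
apply: le_trans (hi j) _; apply: le_trans ((hc i).2 x hi) _; apply: ler_wpM2r => //.
by rewrite (bigD1 i) //= lerDl sumr_ge0 // => k _; rewrite ltW ?(hc _).1.
Qed.
End Compactness.
End Compactness.

(** * A zero-free map near f yields a solution of the system *)

Module RootsForced.
Import all_boot all_order all_algebra.
Import all_classical all_reals all_analysis.
Import ring lra zify.
Import LinkSystem TorusComplex ComplexShape VertexValues CubeChains CochainDegree CupShuffle TorusDegrees FineGrid Compactness.
Set Implicit Arguments. Unset Strict Implicit. Unset Printing Implicit Defensive.
Import Order.TTheory GRing.Theory Num.Theory.
Import numFieldNormedType.Exports.
Local Open Scope classical_set_scope.
Local Open Scope ring_scope.

(** With n labels the most frequent one has frequency at least 1/n. A label that is dominant up to
    the error 2c keeps frequency at least 1/(2n), which for D >= 2n^2 amounts to n occurrences. *)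
Lemma count_arith (F : realFieldType) (C D n c ck cb : F) : C * ck - 2 * c * D <= C * cb ->
  D <= n * ck -> c * 4 * n <= C -> 2 * n * n <= D -> 0 < n -> 0 < C -> 0 < D -> n <= cb.
Proof.
move=> F1 F2 F3 F4 n0 C0 D0.
have G1 : n * (C * ck - 2 * c * D) <= n * (C * cb) by rewrite ler_pM2l.
have G2 : C * D <= C * (n * ck) by rewrite ler_pM2l.
have G3 : c * 4 * n * D <= C * D by rewrite ler_pM2r.
have G4 : C * D <= C * (2 * (n * cb)) by lra.
rewrite ler_pM2l // in G4; have : n * n <= n * cb by lra.
by rewrite ler_pM2l.
Qed.

Lemma link_arith (z3 x1 x2 y1 y2 y3 w2 w3 v1 v2 v3 w5 : int) : z3 = 0 -> z3 = x1 + x2 ->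
  y1 = - x1 -> y1 = y2 + y3 -> y2 = - w2 -> y3 = - w3 -> w3 = 0 ->
  v1 = - x2 -> v1 = v2 + v3 -> v2 = - w5 -> w5 = 0 -> w2 = v3.
Proof. lia. Qed.

Lemma prod_arith (a d r p r1 d' : int) : a * d = r * p -> r1 * d = r * d' -> r = 1 -> r1 = 1 -> p = a * d'.
Proof. by move=> e1 e2 r_1 r1_1; move: e1 e2; rewrite r_1 r1_1 !mul1r => <- <-. Qed.

Section Nonvanishing.
Variable R : realType.
Variables (h g f q C D : nat) (A : seq (seq nat)) (K : seq link).
Hypotheses (h0 : (0 < h)%N) (g0 : (0 < g)%N) (f2 : (2 <= f)%N) (fq : (f <= q)%N).
Hypothesis wf : sys_wf f g [::] K.
Hypothesis wfA : all (add_wf q) A.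
Hypothesis D0 : (0 < D)%N.
Notation m := h.+1.
Notation N := (NN h g q).
Notation Q := (MM * D)%N.
Notation Z := 'Z_Q.

Definition theI : inst := (simps h g f A K, ivals h g q C).
Notation I := theI.
Notation nv := (nverts I).

Lemma nvE : nv = (MM ^ N).+1.
Proof. by apply: size_ivals => //; apply: leq_trans fq; apply: leq_trans f2. Qed.

(** A point of the realization given by D equal masses. Points of the fine grids of tori and of
    cones have this form. *)
Definition bary (us : 'I_D -> nat) : 'rV[R]_nv :=
  \row_v ((\sum_(r < D) (us r == v :> nat))%N%:R / D%:R).

Lemma D0R : 0 < D%:R :> R. Proof. by rewrite ltr0n. Qed.

Lemma simp_lt s v : s \in I.1 -> v \in s -> (v < nv)%N.
Proof.
move=> hs hv; have [_ _ /allP al _] := simps_valid h0 g0 f2 fq wf wfA hs.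
by rewrite nvE; apply: al.
Qed.

Lemma bary_realiz us s : s \in I.1 -> (forall r, us r \in s) -> realiz I (bary us).
Proof.
move=> hs hus; split; first by move=> v; rewrite mxE divr_ge0 ?ler0n.
split; last first.
  exists s => // v; rewrite mxE; apply: contraNT => vs; rewrite big1 ?mul0r // => r _.
  by apply/eqP; rewrite eqb0; apply/eqP => e; case/negP: vs; move: (hus r); rewrite e.
under eq_bigr do rewrite mxE; rewrite -mulr_suml -natr_sum exchange_big /=.
rewrite (eq_bigr (fun=> 1%N)) => [|r _]; first by rewrite sum1_card card_ord divff ?gt_eqF ?D0R.
rewrite (bigD1 (Ordinal (simp_lt hs (hus r)))) //= eqxx big1 ?addn0 // => v nv'.
by apply/eqP; rewrite eqb0; apply: contraNneq nv' => e; apply/eqP/val_inj.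
Qed.

Lemma bary_close us us' v :
  `|bary us ord0 v - bary us' ord0 v| <= (\sum_(r < D) (us r != us' r))%N%:R / D%:R.
Proof.
rewrite !mxE -mulrBl normrM normfV [`|D%:R|]gtr0_norm ?D0R // ler_pM2r ?invr_gt0 ?D0R //.
rewrite !natr_sum -sumrB; apply: le_trans (ler_norm_sum _ _ _) _; apply: ler_sum => r _.
case: (us r =P us' r) => [->|_] /=; first by rewrite subrr normr0.
by case: (_ == _); case: (_ == _); rewrite /= ?subrr ?subr0 ?sub0r ?normrN ?normr0 ?normr1 ?ler01.
Qed.

Definition vtx (T : nat -> nat) (r : 'I_D) : nat := (\sum_(x < N) fl D (T x) r * MM ^ x)%N.+1.

Lemma vtx_vnum Gs (c : seq nat) T r : twf N Gs -> size c = size Gs ->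
  (forall x, (x < N)%N -> T x = cf Gs c x) -> vtx T r = vnum Gs (map (fun t => fl D t r) c).
Proof.
move=> /and3P[u aN _] sc hT; rewrite /vtx /vnum (dotvE u aN) ?size_map //; congr _.+1.
apply: eq_bigr => x _; rewrite hT //; congr (_ * _)%N; rewrite /cf.
case: (ltnP (find (fun G : seq nat => (x : nat) \in G) Gs) (size c)) => hi; first by rewrite (nth_map 0%N).
by rewrite !nth_default ?size_map // fl0.
Qed.

Lemma vtx_count (T T' : nat -> nat) : (forall x, (x < N)%N -> exists2 n, (n <= 2)%N &
    forall r, fl D (T' x) r = fl D (T x + n) r) ->
  (\sum_(r < D) (vtx T' r != vtx T r) <= 2 * N)%N.
Proof.
move=> hT; apply: (@leq_trans (\sum_(r < D) \sum_(x < N) (fl D (T' x) r != fl D (T x) r))%N).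
  apply: leq_sum => r _; case: eqP => //= ne; rewrite lt0n; apply/negP => /eqP/eqP.
  rewrite sum_nat_eq0 => /forallP e; apply: ne; congr _.+1; apply: eq_bigr => x _.
  by have := e x; rewrite implyTb eqb0 negbK => /eqP->.
rewrite exchange_big /=; apply: (@leq_trans (\sum_(x < N) 2)%N); last first.
  by rewrite sum_nat_const card_ord mulnC.
apply: leq_sum => x _; have [n n2 e] := hT x (ltn_ord x).
under eq_bigr do rewrite e; exact: leq_trans (fl_count _ _ D0) n2.
Qed.

Definition inK (us : 'I_D -> nat) := exists2 s, s \in I.1 & forall r, us r \in s.

Lemma inK_chain Gs (c : seq nat) T : twf N Gs -> size c = size Gs ->
  (forall x, (x < N)%N -> T x = cf Gs c x) -> exists2 s, s \in chains Gs & forall r, vtx T r \in s.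
Proof.
move=> wG sc hT; have [p [pp hp]] := fine_chain D0 sc.
exists (smp Gs (map (fun t => fl D t 0) c) p); last by move=> r; rewrite (vtx_vnum _ wG sc hT) hp.
apply/mem_chains; exists (map (fun t => fl D t 0) c), p; rewrite size_map; split=> //.
by apply/allP => t /mapP[t' _ ->]; rewrite ltn_pmod ?MM_gt0.
Qed.

Lemma inK_torus U T : torus h g f A K (single U) -> (forall x, (x < N)%N -> x \notin U -> T x = 0%N) ->
  inK (vtx T).
Proof.
move=> tU hT; have wG := torus_twf h0 g0 f2 fq wf wfA tU.
have uU : uniq U by have /and3P[] := wG; rewrite flatten_single.
have [||s hs hs'] := @inK_chain (single U) (map T U) T wG; first by rewrite !size_map.
  move=> x xN; case xU: (x \in U); last by rewrite cf_notin ?flatten_single ?size_map ?xU // hT ?xU.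
  rewrite (@cf_nth _ _ _ (index x U)) ?flatten_single ?size_map ?index_mem //.
    by rewrite (nth_map 0%N) ?index_mem // nth_index.
  by rewrite (nth_map 0%N) ?index_mem // nth_index // mem_seq1.
by exists s => //; apply/mem_simps; left; exists (single U).
Qed.

Definition gv (G : seq nat) : 'rV[Z]_N := \row_x ((x : nat) \in G)%:R.
Definition cvals k (c : 'rV[Z]_k) : seq nat := [seq nat_of_ord (c ord0 i) | i <- enum 'I_k].
Definition dig (T : 'rV[Z]_N) (x : nat) : nat := if insub x is Some i then nat_of_ord (T ord0 i) else 0%N.

Lemma size_cvals k (c : 'rV[Z]_k) : size (cvals c) = k.
Proof. by rewrite size_map size_enum_ord. Qed.

Lemma nth_cvals k (c : 'rV[Z]_k) (i : 'I_k) : nth 0%N (cvals c) i = c ord0 i.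
Proof. by rewrite (nth_map i) ?size_enum_ord // nth_ord_enum. Qed.

Lemma comb_gv k Gs (c : 'rV[Z]_k) x : size Gs = k -> uniq (flatten Gs) -> (x < N)%N ->
  dig (comb (map gv Gs) c) x = cf Gs (cvals c) x.
Proof.
move=> sk u xN; rewrite /dig insubT /= summxE.
have ik (i : 'I_k) : (i < size Gs)%N by rewrite sk.
case hx: (x \in flatten Gs); last first.
  rewrite cf_notin ?size_cvals ?hx // big1 // => i _; rewrite !mxE (nth_map [::]) // mxE /=.
  case xi: (x \in nth [::] Gs i); last by rewrite mulr0.
  by case/negP: (negbT hx); apply/flattenP; exists (nth [::] Gs i) => //; apply: mem_nth.
have [G GG xG] := flattenP hx; have iG : (index G Gs < k)%N by rewrite -sk index_mem.
have xi : x \in nth [::] Gs (Ordinal iG) by rewrite nth_index.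
rewrite (cf_nth _ u (ik (Ordinal iG)) xi) nth_cvals; congr nat_of_ord.
rewrite (bigD1 (Ordinal iG)) //= big1 => [|j nj].
  by rewrite addr0 !mxE (nth_map [::]) ?(ik (Ordinal iG)) // mxE /= xi mulr1.
rewrite !mxE (nth_map [::]) // mxE /=; case xj: (x \in nth [::] Gs j); last by rewrite mulr0.
have e1 := cf_nth (iota 0 (size Gs)) u (ik (Ordinal iG)) xi.
have := cf_nth (iota 0 (size Gs)) u (ik j) xj; rewrite e1 !nth_iota // ?(ik (Ordinal iG)) // !add0n => e.
by case/negP: nj; apply/eqP/val_inj; rewrite /= -e.
Qed.

Variable G : 'rV[R]_nv -> 'rV[R]_m.+1.
Variable d : R.
Hypothesis hd : forall x, realiz I x -> exists b, forall y, realiz I y ->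
    (forall i, `|x ord0 i - y ord0 i| <= d) -> lab (G y) != b.
Hypothesis Dd : (2 * N + 1)%N%:R / D%:R <= d.

Definition Lb us := lab (G (bary us)).
Definition ll (T : 'rV[Z]_N) := Lb (vtx (dig T)).

(** The number 2N + 1 allows for two unit steps in each of the N coordinates and for one mass moved
    to the apex of a cone. *)
Lemma miss us : inK us -> exists b, forall us', inK us' ->
  (\sum_(r < D) (us' r != us r) <= 2 * N + 1)%N -> Lb us' != b.
Proof.
move=> [s hs hus]; have [b hb] := hd (bary_realiz hs hus); exists b => us' [s' hs' hus'] le.
apply: hb => [|v]; first exact: (bary_realiz hs').
apply: le_trans (bary_close _ _ _) (le_trans _ Dd).
rewrite ler_pM2r ?invr_gt0 ?D0R // ler_nat; apply: leq_trans le.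
by apply: leq_sum => r _; rewrite eq_sym.
Qed.

Lemma comb_near k Gs (p : 'rV[Z]_k) (n : {ffun 'I_k -> nat}) x : size Gs = k -> uniq (flatten Gs) ->
  (forall j, n j <= 2)%N -> (x < N)%N -> exists2 k, (k <= 2)%N & forall r,
   fl D (dig (comb (map gv Gs) (p + emb Q n)%R) x) r = fl D (dig (comb (map gv Gs) p) x + k) r.
Proof.
move=> sk u n2 xN; rewrite !comb_gv //; case hx: (x \in flatten Gs); last first.
  by exists 0%N => // r; rewrite !cf_notin ?size_cvals ?hx // addn0.
have [G' GG xG] := flattenP hx; have iG : (index G' Gs < k)%N by rewrite -sk index_mem.
have xi : x \in nth [::] Gs (Ordinal iG) by rewrite nth_index.
have ik (i : 'I_k) : (i < size Gs)%N by rewrite sk.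
exists (n (Ordinal iG)) => // r; rewrite !(cf_nth _ u (ik (Ordinal iG)) xi) !nth_cvals.
exact: fl_emb.
Qed.

Lemma gd_torus k U Gs : size Gs = k -> torus h g f A K (single U) -> uniq (flatten Gs) ->
  {subset flatten Gs <= U} -> gd ll k (map gv Gs).
Proof.
move=> sk tU u sub p.
have inT (c : 'rV[Z]_k) : inK (vtx (dig (comb (map gv Gs) c))).
  apply: (inK_torus tU) => x xN xU; rewrite comb_gv // cf_notin ?size_cvals //.
  by apply: contra xU => /sub.
have [b hb] := miss (inT p); exists b => n n2; apply: hb; first exact: inT.
apply: leq_trans (leq_addr 1 _); apply: vtx_count => x xN; exact: comb_near.
Qed.

Lemma eq_Lb us us' : us =1 us' -> Lb us = Lb us'.
Proof.
move=> e; rewrite /Lb; congr (lab (G _)); apply/matrixP => i j; rewrite !mxE.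
by congr (_%:R / _); apply: eq_bigr => r _; rewrite e.
Qed.

Lemma Deg_const (b : 'I_m.+2) : Deg ord_max (fun _ : 'rV[Z]_m => b) (std Q m) = 0.
Proof.
rewrite /Deg big1 // => p _; apply: cubn_zero; first by rewrite size_std.
move=> s hs; apply: uu_dup; first by rewrite size_map size_pth (perm_size hs) size_std.
have := size_pth p s; rewrite (perm_size hs) size_std.
by case: (pth p s) => [|x [|y t]] //= _; rewrite mem_head.
Qed.

Lemma cone_count (v v' : 'I_D -> nat) i i' : i' = i \/ i' = i.+1 ->
  (\sum_(r < D) ((if r < i' then 0 else v' r) != (if r < i then 0 else v r)) <=
   \sum_(r < D) (v' r != v r) + 1)%N.
Proof.
move=> hi'; apply: (@leq_trans (\sum_(r < D) ((v' r != v r) + (r == i :> nat)))%N).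
  apply: leq_sum => r _; case: (ltngtP (r : nat) i) => hr /=.
  - have -> : (r < i')%N by case: hi' => ->; clear -hr; lia.
    by rewrite eqxx.
  - have -> : (r < i')%N = false by case: hi' => ->; clear -hr; lia.
    by rewrite addn0.
  by rewrite addn1; apply: leq_trans (leq_b1 _) _.
rewrite big_split /= leq_add2l.
case: (ltnP i D) => iD; last first.
  rewrite big1 // => r _; apply/eqP; rewrite eqb0; have hr := ltn_ord r.
  by rewrite neq_ltn (leq_trans hr).
rewrite (bigD1 (Ordinal iD)) //= eqxx big1 ?addn0 // => r nr.
by apply/eqP; rewrite eqb0; apply: contraNneq nr => e; apply/eqP/val_inj.
Qed.

(** The cone is contracted by moving the D masses to the apex one after the other. Each move is a
    homotopy, and after D moves the labelling is constant. *)
Lemma Tdeg_cone Gs : ctorus h g f A K Gs -> Tdeg ll (map gv Gs) = 0.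
Proof.
move=> cG; have [wG sG] := ctorus_twf h0 g0 f2 fq wf wfA cG.
have u : uniq (flatten Gs) by case/and3P: wG.
pose us i (c : 'rV[Z]_m) (r : 'I_D) := if (r < i)%N then 0%N else vtx (dig (comb (map gv Gs) c)) r.
have inC c i : inK (us i c).
  have [||s hs hs'] := @inK_chain Gs (cvals c) (dig (comb (map gv Gs) c)) wG; first by rewrite size_cvals.
    by move=> x xN; rewrite comb_gv.
  exists (0%N :: s); last by move=> r; rewrite /us; case: ifP; rewrite inE ?hs' ?orbT.
  by apply/mem_simps; right; exists Gs => //; apply: map_f.
pose kf i (c : 'rV[Z]_m) := Lb (us i c).
have st i : Deg ord_max (kf i) (std Q m) = Deg ord_max (kf i.+1) (std Q m).
  pose kk (z : 'rV[Z]_m * int) := kf (if z.2 == 0 then i else i.+1) z.1.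
  have -> : Deg ord_max (kf i) (std Q m) = Deg ord_max (fun c => kk (c, 0)) (std Q m) by [].
  have -> : Deg ord_max (kf i.+1) (std Q m) = Deg ord_max (fun c => kk (c, 1)) (std Q m) by [].
  apply: Deg_slice => [|p s hs]; first by rewrite size_std.
  have [b hb] := miss (inC p i); exists b => z zs; apply: hb; first exact: inC.
  have [z1 z2] := pth_slice hs zs.
  have e0 : 0 :: std Q m = map (@emb Q m) ([ffun => 0%N] :: map (@unitf m) (enum 'I_m)).
    by rewrite /= emb0 stdE.
  rewrite e0 in z1; have [n [n1 ez]] := incube_emb z1.
  have {}n1 j : (n j <= 2)%N.
    by apply: leq_trans (n1 j) _; rewrite big_cons ffunE add0n (leq_trans (sum_unitf _ _)) ?enum_uniq.
  apply: leq_trans (cone_count _ _ _) _; first by case: ifP; [left|right].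
  rewrite leq_add2r; apply: vtx_count => x xN; rewrite ez; exact: comb_near.
have -> : Tdeg ll (map gv Gs) = Deg ord_max (kf 0%N) (std Q m).
  by apply: eq_bigr => c _; apply: eq_cubnk => v; apply: eq_Lb.
have -> : Deg ord_max (kf 0%N) (std Q m) = Deg ord_max (kf D) (std Q m).
  have E i : Deg ord_max (kf 0%N) (std Q m) = Deg ord_max (kf i) (std Q m) by elim: i => // i ->.
  exact: E.
rewrite -(Deg_const (Lb (fun=> 0%N))); apply: eq_bigr => c _; apply: eq_cubnk => v.
by apply: eq_Lb => r; rewrite /us ltn_ord.
Qed.

Lemma plmap_bary us j : (forall r, us r < nv)%N -> plmap m.+1 I (bary us) ord0 j =
  (\sum_(r < D) ratr (nth 0 (nth [::] I.2 (us r)) j)) / D%:R.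
Proof.
move=> hus; rewrite mxE mulr_suml.
under eq_bigr => v _ do rewrite mxE natr_sum mulrAC -mulrA mulr_suml.
rewrite exchange_big /=; apply: eq_bigr => r _.
rewrite (bigD1 (Ordinal (hus r))) //= eqxx mul1r big1 ?addr0 // => v nv'.
rewrite (_ : (us r == v) = false) ?mul0r //; apply: contraNF nv' => /eqP e; apply/eqP/val_inj.
by rewrite /= e.
Qed.

Variable c0 : R.
Hypothesis Gclose : forall x, realiz I x -> forall j, `|G x ord0 j - plmap m.+1 I x ord0 j| <= c0.
Hypothesis Cbig : c0 * 4 * m.+1.+1%:R <= C%:R.
Hypothesis C0 : (0 < C)%N.
Hypothesis Dbig : (2 * m.+2 * m.+2 <= D)%N.

Definition lab0 (w : 'I_m -> nat) : 'I_m.+2 := inord (labs m [seq w j | j <- enum 'I_m]).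

Lemma eq_lab0 w w' : w =1 w' -> lab0 w = lab0 w'.
Proof. by move=> e; rewrite /lab0 (eq_map e). Qed.

Lemma lab0P w (k : 'I_m.+2) : k != ord_max -> (lab0 w == k) = [forall j, w j == (3 + (j < k))%N].
Proof.
move=> nk; have km : (k <= m)%N.
  by rewrite -ltnS ltn_neqAle -ltnS ltn_ord andbT; apply: contraNneq nk => e; apply/eqP/val_inj.
have -> : (lab0 w == k) = (labs m [seq w j | j <- enum 'I_m] == k).
  apply/eqP/eqP => [<-|e]; first by rewrite inordK // ltnS labs_le.
  by apply: val_inj; rewrite /lab0 /= inordK ?e.
rewrite labsP //; apply/eqP/forallP => [e j|hj].
  have := congr1 (fun s => nth 0%N s j) e; rewrite nth_pat // (nth_map j) ?size_enum_ord // nth_ord_enum.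
  by move=> ->.
apply: (@eq_from_nth _ 0%N); rewrite size_map size_enum_ord ?size_pat // => i hi.
rewrite nth_pat // (nth_map (Ordinal hi)) ?size_enum_ord // (nth_ord_enum _ (Ordinal hi)).
by apply/eqP; apply: hj.
Qed.

(** On the subtorus P the map f is C times the reference map and G stays within c0 of it, so the
    label of G at a fine point is one of large weight among the coarse points. This is the
    hypothesis of [ref_slice]. *)
Lemma Tdeg_ref U P : size P = m -> uniq P -> torus h g f A K (single U) -> {subset P <= U} ->
  (forall x, x \in P -> (x < F0 h g)%N) ->
  (forall v, onP h g P v -> fv h g C v = rowv C m (labP m P v)) ->
  Tdeg ll (map gv (single P)) = 1.
Proof.
move=> sP uP tU PU PF fvP; have wU := torus_twf h0 g0 f2 fq wf wfA tU.
have PN x : x \in P -> (x < N)%N.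
  by move=> /PU xU; have /and3P[_ /allP + _] := wU; rewrite flatten_single; apply.
have wP : twf N (single P) by apply: single_twf => //; apply/allP.
have sS : size (single P) = m by rewrite size_map.
rewrite /Tdeg (@ref_slice _ _ D0 lab0 eq_lab0); first exact: (Deg_l0 D0 lab0P eq_lab0).
move=> c; set T := comb _ c.
have TE x : (x < N)%N -> dig T x = cf (single P) (cvals c) x.
  by move=> xN; rewrite comb_gv // flatten_single.
pose th (r : nat) := map (fun t => fl D t r) (cvals c).
have sth r : size (th r) = m by rewrite size_map size_cvals.
have usE r : vtx (dig T) r = vnum (single P) (th r).
  by apply: (vtx_vnum _ wP) => //; rewrite size_cvals.
have lth r : all (fun a => a < MM)%N (th r) by apply/allP => t /mapP[t' _ ->]; rewrite ltn_pmod ?MM_gt0.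
have inT : inK (vtx (dig T)).
  apply: (inK_torus tU) => x xN xU; rewrite TE // cf_notin ?size_cvals ?flatten_single //.
  by apply: contra xU => /PU.
have [s0 hs0 hs0'] := inT.
have Tnv r : (vtx (dig T) r < nv)%N by apply: (simp_lt hs0).
have vx r : [/\ onP h g P (vtx (dig T) r), (0 < vtx (dig T) r <= MM ^ F0 h g)%N &
    [seq digit (vtx (dig T) r) x | x <- P] = th r].
  by rewrite usE; apply: (onP_vnum uP PN) => //; rewrite sth.
pose B (r : nat) : 'I_m.+2 := inord (labs m (th r)).
have Bl r : B r = lab0 (fun j => fl D (c ord0 j) r).
  by rewrite /lab0 /B /th /cvals -map_comp.
have valB r : (B r : nat) = labs m (th r) by rewrite inordK // ltnS labs_le.
have vrow (r : 'I_D) : nth [::] I.2 (vtx (dig T) r) = rowv C m (labs m (th r)).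
  rewrite nth_ivals //; last by apply: leq_trans fq; apply: leq_trans f2.
  by have [v1 v2 v3] := vx r; rewrite /fvv v2 fvP // /labP v3.
have val (r : 'I_D) (j : 'I_m.+1) : ratr (nth 0 (nth [::] I.2 (vtx (dig T) r)) j) =
   C%:R * ((B r == lift ord_max j)%:R - (B r == ord_max)%:R) :> R.
  have -> : (B r == lift ord_max j) = (labs m (th r) == j) by rewrite -(inj_eq (@ord_inj _)) lift_max valB.
  have -> : (B r == ord_max) = (labs m (th r) == m.+1) by rewrite -(inj_eq (@ord_inj _)) valB.
  rewrite vrow nth_mkseq //; case: eqP => [->|_]; first by rewrite rmorphN /= ratr_nat gtn_eqF ?ltn_ord // sub0r mulrN1.
  rewrite subr0 eq_sym; case: eqP => _; first by rewrite ratr_nat mulr1.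
  by rewrite rmorph0 mulr0.
pose cnt (k : 'I_m.+2) := (\sum_(r < D) (B r == k))%N.
set x := bary (vtx (dig T)).
have Kx : realiz I x by apply: (bary_realiz hs0).
have vF k : vl (plmap m.+1 I x) k = C%:R * ((cnt k)%:R - (cnt ord_max)%:R) / D%:R.
  case: (unliftP ord_max k) => [j ->|->]; rewrite /vl ?liftK ?unlift_none; last by rewrite subrr mulr0 mul0r.
  rewrite plmap_bary //; congr (_ / _); under eq_bigr do rewrite val.
  by rewrite -mulr_sumr sumrB !natr_sum.
have c00 : 0 <= c0 by apply: le_trans (Gclose Kx ord0).
have vG k : `|vl (G x) k - vl (plmap m.+1 I x) k| <= c0.
  by rewrite /vl; case: (unliftP ord_max k) => [j _|_]; rewrite ?Gclose // subrr normr0.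
pose b := lab (G x).
have key k : C%:R * (cnt k)%:R - 2 * c0 * D%:R <= C%:R * (cnt b)%:R :> R.
  have := lab_max (G x) k; have := vG k; have := vG b; rewrite -/b !vF !ler_norml => /andP[_ a1] /andP[a2 _] a3.
  have E : C%:R * ((cnt k)%:R - (cnt ord_max)%:R) / D%:R <= C%:R * ((cnt b)%:R - (cnt ord_max)%:R) / D%:R + 2 * c0 :> R.
    by lra.
  have := ler_wpM2r (ltW D0R) E; rewrite mulrDl !divfK ?gt_eqF ?D0R //; lra.
pose k := [arg max_(k > ord0) cnt k]%O.
have hk j : (cnt j <= cnt k)%N by rewrite /k; case: arg_maxP => // k' _; apply.
have Dk : (D <= m.+2 * cnt k)%N.
  apply: (@leq_trans (\sum_j cnt j)%N).
    rewrite exchange_big /= (eq_bigr (fun=> 1%N)) ?sum1_card ?card_ord // => r _.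
    by rewrite (bigD1 (B r)) //= eqxx big1 ?addn0 // => j nj; rewrite eq_sym (negbTE nj).
  by apply: leq_trans (leq_sum _ (fun j _ => hk j)) _; rewrite sum_nat_const card_ord.
have cb : (m.+2 <= cnt b)%N.
  have F1 := key k; have F2 : D%:R <= m.+2%:R * (cnt k)%:R :> R by rewrite -natrM ler_nat.
  have F4 : 2 * m.+2%:R * m.+2%:R <= D%:R :> R by rewrite -!natrM ler_nat.
  rewrite -(ler_nat R); by apply: (count_arith F1 F2 Cbig F4); rewrite ltr0n.
have [s1 hs1 hs1'] := @inK_chain (single P) (cvals c) (dig T) wP (etrans (size_cvals c) (esym sS)) TE.
have ss1 : size s1 = m.+1.
  by have [t [p [_ _ pp ->]]] := mem_chains _ _ hs1; rewrite size_smp (perm_size pp) size_iota sS.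
pose Sb := [pred r : 'I_D | B r == b].
have cSb : #|Sb| = cnt b by rewrite -sum1_card big_mkcond.
(* At least m + 2 of the coarse points carry the label b, and they lie in a simplex with m + 1
   vertices, so two of them coincide. *)
have : ~~ dinjectiveb (vtx (dig T)) Sb.
  apply/negP => ui; have := uniq_leq_size ui; rewrite size_map -cardE cSb => /(_ s1).
  rewrite ss1 => H; have := leq_trans cb (H _); rewrite ltnn => H'; apply: notF; apply: H'.
  by move=> v /mapP[r _ ->].
case/dinjectivePn => r1 r1b [r2 /andP[/= r21 r2b] ev].
have eth (r r' : 'I_D) : vtx (dig T) r = vtx (dig T) r' -> forall j, fl D (c ord0 j) r = fl D (c ord0 j) r'.
  move=> e j; have [_ _ t1] := vx r; have [_ _ t2] := vx r'.
  have : th r = th r' by rewrite -t1 -t2 e.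
  move=> /(congr1 (fun s => nth 0%N s j)); rewrite /th !(nth_map 0%N) ?size_cvals // nth_cvals; exact: id.
have fin (r r' : 'I_D) : (r < r')%N -> B r == b -> vtx (dig T) r = vtx (dig T) r' -> exists r1 r2 : nat,
  [/\ (r1 < r2)%N, (r2 < D)%N, forall j, fl D (c ord0 j) r1 = fl D (c ord0 j) r2 &
   lab0 (fun j => fl D (c ord0 j) r1) = ll T].
  move=> lt /eqP hb e; exists r, r'; split=> //; first exact: eth.
  by rewrite -Bl hb.
case: (ltngtP (r1 : nat) r2) => lt.
- exact: (fin r1 r2).
- exact: (fin r2 r1).
by case/negP: r21; apply/eqP/val_inj.
Qed.
Lemma gv_inj x y : (x < N)%N -> gv [:: x] = gv [:: y] -> x = y.
Proof.
move=> xN /matrixP/(_ ord0 (Ordinal xN)); rewrite !mxE /= !mem_seq1 eqxx; by case: eqP => // _ /eqP; rewrite oner_eq0.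
Qed.

Lemma gv_cons x G' : x \notin G' -> gv (x :: G') = gv [:: x] + gv G'.
Proof.
move=> xG; apply/matrixP => i j; rewrite !mxE inE mem_seq1; case: eqP => [->|_] /=; last by rewrite add0r.
by rewrite (negbTE xG) addr0.
Qed.

Notation ps := (ps h g). Notation pt := (pt h).
Notation CC0 := (TorusComplex.C0 h). Notation CC1 := (TorusComplex.C1 h).
Notation gvs U := (map gv (single U)).

Lemma gvsE U : gvs U = map (fun x => gv [:: x]) U.
Proof. by rewrite -map_comp. Qed.

(** [coneU] cones off precisely the (h + 1)-dimensional coordinate subtori whose degree [Tdeg_wedge]
    requires to vanish. *)
Lemma main_eq i j : odd h -> (i < g)%N -> (0 < j < f)%N ->
  Tdeg ll (gvs [:: ps 0, pt i & CC0]) * Tdeg ll (gvs [:: ps j, pr & CC1]) =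
  Tdeg ll (gvs [:: ps 0, pr & CC1]) * Tdeg ll (gvs [:: ps j, pt i & CC0]).
Proof.
move=> oh ig jf; have tU : torus h g f A K (single (mainU h g i j)) by apply: Or31; exists i, j.
have wU := torus_twf h0 g0 f2 fq wf wfA tU.
have /and3P[uU /allP aU _] := wU; rewrite flatten_single in uU aU.
have inj : {in mainU h g i j &, injective (fun x => gv [:: x])}.
  by move=> x y /aU xN _; apply: gv_inj.
have e U1 : gvs U1 = map (fun x => gv [:: x]) U1 by apply: gvsE.
have sz : size (mainU h g i j) = (m + m)%N by rewrite /= size_cat /= !size_iota; lia.
have EU : [:: gv [:: ps 0], gv [:: ps j] & gvs (pt i :: CC0) ++ gvs (pr :: CC1)] = gvs (mainU h g i j).
  by rewrite !e -map_cat.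
have sA : size (gvs (pt i :: CC0)) = h by rewrite !size_map /= size_iota prednK.
have sB : size (gvs (pr :: CC1)) = h by rewrite !size_map /= size_iota prednK.
have f1 : uniq [:: gv [:: ps 0], gv [:: ps j] & gvs (pt i :: CC0) ++ gvs (pr :: CC1)].
  by rewrite EU e map_inj_in_uniq.
have f3 : gd ll (m + m) [:: gv [:: ps 0], gv [:: ps j] & gvs (pt i :: CC0) ++ gvs (pr :: CC1)].
  by rewrite EU; apply: (gd_torus _ tU) => //; rewrite ?size_map // flatten_single.
apply: (Tdeg_wedge oh sA sB f1 f3); rewrite EU.
move=> S sub sS nS.
have [S' subS' eS] : exists2 S', subseq S' (mainU h g i j) & S = gvs S'.
  move: sub; rewrite e => /subseqP[ma sma ->]; exists (mask ma (mainU h g i j)); first exact: mask_subseq.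
  by rewrite e map_mask.
rewrite eS; apply: Tdeg_cone; apply: Or31; exists i, j, S'; split=> //.
rewrite mem_filter mem_subs subS' andbT; apply/andP; split; first by rewrite -sS eS !size_map.
apply: contra nS; rewrite eS !inE => /or4P[]/eqP->; rewrite eqxx ?orbT //.
Qed.

(** The coned diagonal (s_j + t_0)(t_i + s_k)C0 is expanded by additivity and swaps. Its terms s_j
    s_k and t_0 t_i are coned off, and t_0 s_k is -s_k t_0. *)
Lemma link_eq i j k : (i, j, k) \in K ->
  Tdeg ll (gvs [:: ps j, pt i & CC0]) = Tdeg ll (gvs [:: ps k, pt 0 & CC0]).
Proof.
move=> hl; have tU : torus h g f A K (single (linkU h g i j k)) by apply: Or32; exists i, j, k.
have wU := torus_twf h0 g0 f2 fq wf wfA tU.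
have /and3P[uU /allP aU _] := wU; rewrite flatten_single in uU aU.
have cz Gs : [\/ Gs = single [:: ps j, ps k & CC0], Gs = single [:: pt 0, pt i & CC0] | Gs = linkS h g i j k] ->
    Tdeg ll (map gv Gs) = 0.
  by move=> hG; apply: Tdeg_cone; apply: Or32; exists i, j, k.
have z1 := cz _ (Or31 _ _ erefl); have z2 := cz _ (Or32 _ _ erefl); have z3 := cz _ (Or33 _ _ erefl).
have sW : size (gvs CC0) = h.-1 by rewrite !size_map size_iota.
have /andP[_ /allP/(_ _ hl) hh] := wf; rewrite /link_wf /= in hh.
have GD n Gs : size Gs = n -> uniq (flatten Gs) -> {subset flatten Gs <= linkU h g i j k} -> gd ll n (map gv Gs).
  by move=> sG pG; apply: (gd_torus sG tU).
have E1 : gv [:: ps j; pt 0] = gv [:: ps j] + gv [:: pt 0].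
  by rewrite gv_cons // mem_seq1 /TorusComplex.ps /TorusComplex.pt; clear -hh; lia.
have E2 : gv [:: pt i; ps k] = gv [:: pt i] + gv [:: ps k].
  by rewrite gv_cons // mem_seq1 /TorusComplex.ps /TorusComplex.pt; clear -hh; lia.
have s0 : (size CC0).+2 = m by rewrite size_iota prednK.
have g1 : gd ll m.+1 [:: gv [:: ps j], gv [:: pt 0], gv [:: pt i; ps k] & gvs CC0].
  apply: (GD _ ([:: [:: ps j]; [:: pt 0]; [:: pt i; ps k]] ++ single CC0)); rewrite /= ?size_map ?s0 // flatten_single.
    by rewrite !inE iota_uniq !mem_C0 /TorusComplex.ps /TorusComplex.pt; clear -hh; lia.
  by move=> x; rewrite /linkU !inE mem_C0; clear; lia.
have gg a b c : [&& a != b, b != c, a != c, ~~ (0 < a < h)%N, ~~ (0 < b < h)%N & ~~ (0 < c < h)%N] ->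
    {subset [:: a; b; c] <= linkU h g i j k} -> gd ll m.+1 [:: gv [:: a], gv [:: b], gv [:: c] & gvs CC0].
  move=> ab sub; apply: (GD _ ([:: [:: a]; [:: b]; [:: c]] ++ single CC0)); rewrite /= ?size_map ?s0 // flatten_single.
    by rewrite !inE iota_uniq !mem_C0; clear -ab; lia.
  move=> x; rewrite -[[:: a, b, c & _]]/([:: a; b; c] ++ CC0) mem_cat => /orP[/sub//|].
  by rewrite /linkU !inE => ->; rewrite !orbT.
have gg2 a b : [&& a != b, ~~ (0 < a < h)%N & ~~ (0 < b < h)%N] ->
    {subset [:: a; b] <= linkU h g i j k} -> gd ll m [:: gv [:: a], gv [:: b] & gvs CC0].
  move=> ab sub; apply: (GD _ ([:: [:: a]; [:: b]] ++ single CC0)); rewrite /= ?size_map ?s0 // flatten_single.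
    by rewrite !inE iota_uniq !mem_C0; clear -ab; lia.
  move=> x; rewrite -[[:: a, b & _]]/([:: a; b] ++ CC0) mem_cat => /orP[/sub//|].
  by rewrite /linkU !inE => ->; rewrite !orbT.
have gg3 a : [&& a != pt i, a != ps k & ~~ (0 < a < h)%N] -> a \in linkU h g i j k ->
    gd ll m [:: gv [:: a], gv [:: pt i; ps k] & gvs CC0].
  move=> ab sub; apply: (GD _ ([:: [:: a]; [:: pt i; ps k]] ++ single CC0)); rewrite /= ?size_map ?s0 // flatten_single.
    by rewrite !inE iota_uniq !mem_C0; move: ab; rewrite /TorusComplex.ps /TorusComplex.pt; clear -hh; lia.
  move=> x; rewrite inE => /orP[/eqP->//|]; by rewrite /linkU !inE => /or3P[]->; rewrite ?orbT.
have sub2 a b : a \in linkU h g i j k -> b \in linkU h g i j k -> {subset [:: a; b] <= linkU h g i j k}.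
  by move=> ha hb x; rewrite !inE => /orP[]/eqP->.
have sub3 a b c : a \in linkU h g i j k -> b \in linkU h g i j k -> c \in linkU h g i j k -> {subset [:: a; b; c] <= linkU h g i j k}.
  by move=> ha hb hc x; rewrite !inE => /or3P[]/eqP->.
have mj : ps j \in linkU h g i j k by rewrite !inE eqxx.
have mk : ps k \in linkU h g i j k by rewrite !inE eqxx !orbT.
have m0 : pt 0 \in linkU h g i j k by rewrite !inE eqxx !orbT.
have mi : pt i \in linkU h g i j k by rewrite !inE eqxx !orbT.
have num : [/\ [&& ps j != pt i, ps j != ps k, ps j != pt 0, ps k != pt 0, ps k != pt i & pt 0 != pt i],
    ~~ (0 < ps j < h)%N, ~~ (0 < ps k < h)%N, ~~ (0 < pt 0 < h)%N & ~~ (0 < pt i < h)%N].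
  by rewrite /TorusComplex.ps /TorusComplex.pt; split; clear -hh; lia.
have [/and5P[nji njk nj0 nk0 /andP[nki n0i]] lj lk l0 li] := num.
have a1 := @Tdeg_add Q h N ll (gv [:: ps j]) (gv [:: pt 0]) (gv [:: pt i; ps k] :: gvs CC0).
have {}a1 := a1 (etrans (congr1 S sW) (prednK h0)) g1.
have a2 := @Tdeg_add Q h N ll (gv [:: pt i]) (gv [:: ps k]) (gv [:: ps j] :: gvs CC0) (etrans (congr1 S sW) (prednK h0)).
have a3 := @Tdeg_add Q h N ll (gv [:: pt i]) (gv [:: ps k]) (gv [:: pt 0] :: gvs CC0) (etrans (congr1 S sW) (prednK h0)).
have {}a2 := a2 (gg _ _ _ _ (sub3 _ _ _ mi mk mj)).
have {}a3 := a3 (gg _ _ _ _ (sub3 _ _ _ mi mk m0)).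
rewrite -E2 in a2 a3; rewrite -E1 in a1.
have s1 := @Tdeg_swap Q h N ll (gv [:: ps j]) (gv [:: pt i; ps k]) (gvs CC0) sW h0 (gg3 _ _ mj).
have s2 := @Tdeg_swap Q h N ll (gv [:: ps j]) (gv [:: pt i]) (gvs CC0) sW h0 (gg2 _ _ _ (sub2 _ _ mj mi)).
have s3 := @Tdeg_swap Q h N ll (gv [:: ps j]) (gv [:: ps k]) (gvs CC0) sW h0 (gg2 _ _ _ (sub2 _ _ mj mk)).
have s4 := @Tdeg_swap Q h N ll (gv [:: pt 0]) (gv [:: pt i; ps k]) (gvs CC0) sW h0 (gg3 _ _ m0).
have s5 := @Tdeg_swap Q h N ll (gv [:: pt 0]) (gv [:: pt i]) (gvs CC0) sW h0 (gg2 _ _ _ (sub2 _ _ m0 mi)).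
have {}a2 : Tdeg ll [:: gv [:: pt i; ps k], gv [:: ps j] & gvs CC0] = Tdeg ll [:: gv [:: pt i], gv [:: ps j] & gvs CC0] + Tdeg ll [:: gv [:: ps k], gv [:: ps j] & gvs CC0].
  by apply: a2; rewrite eq_sym nki eq_sym njk [pt i == _]eq_sym nji li lk lj.
have {}a3 : Tdeg ll [:: gv [:: pt i; ps k], gv [:: pt 0] & gvs CC0] = Tdeg ll [:: gv [:: pt i], gv [:: pt 0] & gvs CC0] + Tdeg ll [:: gv [:: ps k], gv [:: pt 0] & gvs CC0].
  by apply: a3; rewrite eq_sym nki nk0 [pt i == _]eq_sym n0i li lk l0.
have {}s1 := s1 (introT and3P (And3 nji njk lj)).
have {}s2 := s2 (introT and3P (And3 nji lj li)).
have {}s3 := s3 (introT and3P (And3 njk lj lk)).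
have n0k : pt 0 != ps k by rewrite eq_sym.
have {}s4 := s4 (introT and3P (And3 n0i n0k l0)).
have {}s5 := s5 (introT and3P (And3 n0i l0 li)).
have z1' : Tdeg ll [:: gv [:: ps j], gv [:: ps k] & gvs CC0] = 0 := z1.
have z2' : Tdeg ll [:: gv [:: pt 0], gv [:: pt i] & gvs CC0] = 0 := z2.
have z3' : Tdeg ll [:: gv [:: ps j; pt 0], gv [:: pt i; ps k] & gvs CC0] = 0 := z3.
exact: link_arith z3' a1 s1 a2 s2 s3 z1' s4 a3 s5 z2'.
Qed.

(** Additivity splits the coned diagonal direction one summand at a time; the subtori needed on the
    way all lie in the torus of J. *)
Lemma add_eq J : J \in A -> \sum_(j <- J) Tdeg ll (gvs [:: ps j, pt 0 & CC0]) = 0.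
Proof.
move=> hJ; have tU : torus h g f A K (single (addU h g J)) by apply: Or33; exists J.
have wU := torus_twf h0 g0 f2 fq wf wfA tU.
have /and3P[uU /allP aU _] := wU; rewrite flatten_single in uU aU.
have z : Tdeg ll (map gv (addS h g J)) = 0 by apply: Tdeg_cone; apply: Or33; exists J.
have /allP/(_ _ hJ)/and3P[uJ sJ _] := wfA.
have H J' : J' != [::] -> subseq J' J -> Tdeg ll (gv (map ps J') :: gvs (pt 0 :: CC0)) =
    \sum_(j <- J') Tdeg ll (gvs [:: ps j, pt 0 & CC0]).
  elim: J' => // j J' IH _ sub; case: (eqVneq J' [::]) => [->|nJ]; first by rewrite big_seq1.
  have sub' : subseq J' J by apply: subseq_trans (subseq_cons J' j) sub.
  have su : subseq (addU h g (j :: J')) (addU h g J) by rewrite /addU cat_subseq // map_subseq.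
  rewrite big_cons -IH // map_cons gv_cons; last first.
    rewrite mem_map; last by move=> x y; rewrite /TorusComplex.ps; clear; lia.
    by have := subseq_uniq sub uJ => /= /andP[].
  apply: Tdeg_add; first by rewrite !size_map /= size_iota prednK.
  have sz : size ([:: [:: ps j]; map ps J'] ++ single (pt 0 :: CC0)) = m.+1.
    by rewrite /= size_map size_iota prednK.
  apply: (gd_torus sz tU); rewrite /= flatten_single; first exact: (subseq_uniq su uU).
  exact: mem_subseq su.
by rewrite -H //; apply/eqP => e; rewrite e in sJ.
Qed.

Lemma P_size : size (P1 h g) = m /\ size (P2 h g) = m.
Proof. by rewrite /= !size_iota prednK. Qed.

Lemma nonvanishing_sat : odd h -> exists a d : nat -> int, [/\ a 0%N = 1, d 0%N = 1 & sat A K a d].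
Proof.
move=> oh; have q0 : (0 < q)%N by apply: leq_trans fq; apply: leq_trans f2.
have jf : (0 < 1 < f)%N by [].
have tU : torus h g f A K (single (mainU h g 0 1)) by apply: Or31; exists 0%N, 1%N.
have [sP1 sP2] := P_size.
have sub1 : subseq (P1 h g) (mainU h g 0 1).
  rewrite /mainU /P1 -[[:: TorusComplex.ps h g 0, pt 0 & _]]/([:: TorusComplex.ps h g 0] ++ (pt 0 :: CC0)).
  rewrite -[[:: TorusComplex.ps h g 0, TorusComplex.ps h g 1 & _]]/([:: TorusComplex.ps h g 0] ++ (TorusComplex.ps h g 1 :: (pt 0 :: CC0) ++ (pr :: CC1))).
  apply: cat_subseq => //; apply: subseq_trans (subseq_cons _ _); exact: prefix_subseq.
have sub2 : subseq (P2 h g) (mainU h g 0 1).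
  rewrite /mainU /P2 -[[:: TorusComplex.ps h g 0, pr & _]]/([:: TorusComplex.ps h g 0] ++ (pr :: CC1)).
  rewrite -[[:: TorusComplex.ps h g 0, TorusComplex.ps h g 1 & _]]/([:: TorusComplex.ps h g 0] ++ (TorusComplex.ps h g 1 :: (pt 0 :: CC0) ++ (pr :: CC1))).
  apply: cat_subseq => //; apply: subseq_trans (subseq_cons _ _); exact: suffix_subseq.
have uU := mainU_uniq h0 g0 f2 fq wf wfA g0 (isT : 0 < 1)%N.
have r1 : Tdeg ll (gvs (P1 h g)) = 1.
  apply: (Tdeg_ref sP1 (subseq_uniq sub1 uU) tU (mem_subseq sub1)).
    by move=> x hx; exact: (F0_P1 h0 g0 q0 hx).
  by move=> v hv; rewrite /fv hv.
have r2 : Tdeg ll (gvs (P2 h g)) = 1.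
  apply: (Tdeg_ref sP2 (subseq_uniq sub2 uU) tU (mem_subseq sub2)).
    by move=> x hx; exact: (F0_P2 h0 g0 q0 hx).
  by move=> v hv; exact: (fv_P2 _ h0 g0 q0 hv).
pose a i := Tdeg ll (gvs [:: ps 0, pt i & CC0]).
(* By the main relation for i = 0 and the two reference degrees 1, this equals the degree on s_j, r
   and C1 for 0 < j < f. For larger j only this torus is in the complex. *)
pose d' j := Tdeg ll (gvs [:: ps j, pt 0 & CC0]).
have prod i j : (i < g)%N -> (j < f)%N -> Tdeg ll (gvs [:: ps j, pt i & CC0]) = a i * d' j.
  move=> ig jf'; case: (posnP j) => [->|j0]; first by rewrite /d' r1 mulr1.
  have jj : (0 < j < f)%N := introT andP (conj j0 jf').
  have e1 := main_eq oh ig jj; have e2 := main_eq oh g0 jj.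
  exact: prod_arith e1 e2 r2 r1.
have lnk i j k : (i, j, k) \in K -> a i * d' j = d' k.
  move=> hl; have /andP[_ /allP/(_ _ hl)] := wf; rewrite /link_wf => /and4P[/andP[_ ig] jf' _ _].
  have e1 := link_eq hl.
  have e2 := prod i j ig jf'.
  rewrite -e2.
  exact: e1.
exists a, d'; split; [exact: r1|exact: r1|split].
  by move=> J hJ; apply: add_eq.
by move=> [[i j] k] hl; apply: lnk.
Qed.
End Nonvanishing.
End RootsForced.

(** * Solutions give perturbations without zeros *)

Module PeriodicHats.
Import all_boot all_order all_algebra.
Import all_classical all_reals all_analysis.
Import ring lra zify.
Set Implicit Arguments. Unset Strict Implicit. Unset Printing Implicit Defensive.
Import Order.TTheory GRing.Theory Num.Theory.
Import numFieldNormedType.Exports.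
Local Open Scope classical_set_scope.
Local Open Scope ring_scope.

Section Periodic.
Variable R : realType.
Implicit Types (s t : R) (k : int).

(** The distance from t to the multiples of 20. *)
Definition per t : R := let f := t - 20 * (Num.floor (t / 20))%:~R in Num.min f (20 - f).

Lemma per_floor t : let f := t - 20 * (Num.floor (t / 20))%:~R in 0 <= f < 20.
Proof.
have /andP[h1 h2] := floor_itv (t / 20); rewrite /= intrD in h2.
by apply/andP; split; lra.
Qed.

Lemma per_ex t : exists k, per t = `|t - 20 * k%:~R|.
Proof.
have /= := per_floor t; rewrite /per; set n := Num.floor _ => /andP[h1 h2].
case: (leP (t - 20 * n%:~R) (20 - (t - 20 * n%:~R))) => h.
  by exists n; rewrite ger0_norm.
exists (n + 1); rewrite intrD ler0_norm; lra.
Qed.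

Lemma per_le t k : per t <= `|t - 20 * k%:~R|.
Proof.
have /= := per_floor t; rewrite /per; set n := Num.floor _ => /andP[h1 h2].
have [kn|nk] := leP k n.
  have : k%:~R <= n%:~R :> R by rewrite ler_int.
  by move=> h; rewrite ge_min; apply/orP; left; rewrite ger0_norm; lra.
have : (n + 1)%:~R <= k%:~R :> R by rewrite ler_int; lia.
rewrite intrD => h; rewrite ge_min; apply/orP; right; rewrite ler0_norm; lra.
Qed.

Lemma per_ge0 t : 0 <= per t.
Proof. by have [k ->] := per_ex t; apply: normr_ge0. Qed.

Lemma per_le10 t : per t <= 10.
Proof.
have /= := per_floor t; rewrite /per; set f := t - _ => /andP[h1 h2].
by case: (leP f (20 - f)); lra.
Qed.

Lemma per_rep t : exists k s, t = s + 20 * k%:~R /\ `|s| = per t.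
Proof. by have [k e] := per_ex t; exists k, (t - 20 * k%:~R); rewrite subrK -e. Qed.

Lemma per_small s k : `|s| <= 10 -> per (s + 20 * k%:~R) = `|s|.
Proof.
move=> hs; apply/eqP; rewrite eq_le; apply/andP; split.
  by have := per_le (s + 20 * k%:~R) k; rewrite addrK.
have [k' ->] := per_ex (s + 20 * k%:~R); rewrite -addrA -mulrBr -intrB.
have [->|n0] := eqVneq (k - k') 0; first by rewrite mulr0 addr0.
have : 1 <= `|(k - k')%:~R| :> R.
  by rewrite -intr_norm -[1]/(1%:~R) ler_int; lia.
move: hs; case: (ger0P s) => h1 hs; case: (ger0P (k - k')%:~R) => h2 h3.
- by rewrite ger0_norm; lra.
- by rewrite ler0_norm; lra.
- by rewrite ger0_norm; lra.
by rewrite ler0_norm; lra.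
Qed.

Lemma per_lip s t : `|per s - per t| <= `|s - t|.
Proof.
have H a b : per a - per b <= `|a - b|.
  have [k e] := per_ex b; have := per_le a k; have := ler_normD (a - b) (b - 20 * k%:~R).
  by rewrite subrKA -e; lra.
by rewrite ler_norml; have := H s t; have := H t s; rewrite distrC; lra.
Qed.

Lemma per_shift t k : per (t + 20 * k%:~R) = per t.
Proof.
have [k' [s [-> hs]]] := per_rep t; rewrite -addrA -mulrDr -intrD !per_small //.
all: by rewrite hs per_le10.
Qed.

(** A substitute of period 20 for the positive part: equal to it on [-1, 1], at least s for |s| <=
    4, and at least 1 at distance 2 or more from the multiples of 20. *)
Definition up t : R := Num.max 0 (Num.max (5 - per (t - 5)) (per t - 1)).

Lemma up_shift t k : up (t + 20 * k%:~R) = up t.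
Proof. by rewrite /up per_shift [t + _ - 5]addrAC per_shift. Qed.

Lemma per_sub5 s : `|s| <= 4 -> per (s - 5) = 5 - s.
Proof.
rewrite ler_norml => hs; have := @per_small (s - 5) 0; rewrite mulr0 addr0 => ->.
  by rewrite ler0_norm; lra.
by rewrite ler_norml; lra.
Qed.

Lemma up_ge s k : `|s| <= 4 -> s <= up (s + 20 * k%:~R).
Proof. by move=> hs; rewrite up_shift /up per_sub5 // subKr !le_max lexx orbT. Qed.

Lemma up_small s k : `|s| <= 1 -> up (s + 20 * k%:~R) = Num.max 0 s.
Proof.
move=> hs; rewrite up_shift /up per_sub5; last by lra.
have := @per_small s 0; rewrite mulr0 addr0 => ->; last by lra.
rewrite subKr maxA; apply/max_idPl; rewrite le_max; apply/orP; left; lra.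
Qed.

Lemma up_far t : 1 <= per t -> 1 <= up t \/ 1 <= up (- t).
Proof.
move=> h; have [h2|h2] := leP 2 (per t).
  by left; rewrite !le_max; apply/orP; right; apply/orP; right; lra.
have [k [s [e hs]]] := per_rep t; rewrite -hs in h h2.
have [s0|s0] := lerP 0 s.
  left; rewrite e; apply: le_trans (up_ge k _); rewrite ger0_norm // in h h2 *; lra.
right; rewrite e opprD -mulrN -intrN; apply: le_trans (up_ge _ _); rewrite ?normrN ltr0_norm // in h h2 *; lra.
Qed.

Lemma up_per2 t : 2 <= per t -> 1 <= up t.
Proof. by move=> h; rewrite !le_max; apply/orP; right; apply/orP; right; lra. Qed.

End Periodic.

Section Hats.
Variables (R : realType) (m : nat).
Hypothesis m1 : (1 < m)%N.
Definition MX (F : nat -> R) : R := \big[Num.max/0]_(j < m) F j.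
Definition vv (k j : nat) : R := (3 + (j < k))%N%:R.
(** The hat function of the Freudenthal triangulation at a grid point v is the positive part of 1 -
    max (z - v)^+ - max (v - z)^+. Here v is the k-th pattern, and [up] makes the formula
    periodic. *)
Definition hat k (z : nat -> R) : R :=
  Num.max 0 (1 - MX (fun j => up (z j - vv k j)) - MX (fun j => up (vv k j - z j))).
Definition shat (z : nat -> R) : R := \sum_(k < m.+1) hat k z.
(** Coordinate k of the simplicial map that sends pattern k to the unit vector e_k and every other
    grid point to -(1, ..., 1). *)
Definition qv k (z : nat -> R) : R := hat k z - Num.max 0 (1 - shat z).

Lemma MX_ge F j : (j < m)%N -> F j <= MX F.
Proof. by move=> jm; apply: (le_bigmax _ (fun j : 'I_m => F j) (Ordinal jm)). Qed.

Lemma MX_le F b : 0 <= b -> (forall j, (j < m)%N -> F j <= b) -> MX F <= b.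
Proof. by move=> b0 h; apply: bigmax_le => // j _; apply: h. Qed.

Lemma MX_ge0 F : 0 <= MX F. Proof. exact: bigmax_ge_id. Qed.

Lemma hat_ge0 k z : 0 <= hat k z. Proof. by rewrite le_max lexx. Qed.

Lemma hat_le1 k z : hat k z <= 1.
Proof.
rewrite ge_max ler01; have := MX_ge0 (fun j => up (z j - vv k j)).
by have := MX_ge0 (fun j => up (vv k j - z j)); lra.
Qed.

Lemma hat_posE k z : 0 < hat k z ->
  hat k z = 1 - MX (fun j => up (z j - vv k j)) - MX (fun j => up (vv k j - z j)).
Proof. by rewrite lt_max ltxx /= /hat => h; apply/max_idPr; apply: ltW. Qed.

Lemma hat_pos_per k z j : (j < m)%N -> 0 < hat k z -> per (z j - vv k j) < 1.
Proof.
move=> jm h; rewrite ltNge; apply/negP => /up_far; rewrite opprB.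
have := MX_ge (fun j => up (z j - vv k j)) jm; have := MX_ge (fun j => up (vv k j - z j)) jm.
have := MX_ge0 (fun j => up (z j - vv k j)); have := MX_ge0 (fun j => up (vv k j - z j)).
by move: h; rewrite /= => /[dup] /hat_posE -> ? ? ? ? ? [] ?; lra.
Qed.

Lemma hat_shift k z (c : nat -> int) : hat k (fun j => z j + 20 * (c j)%:~R) = hat k z.
Proof.
rewrite /hat /MX; congr (Num.max 0 (1 - _ - _)); apply: eq_bigr => j _.
  by rewrite addrAC up_shift.
by rewrite opprD addrA -mulrN -intrN up_shift.
Qed.

Lemma eq_hat k z z' : (forall j, (j < m)%N -> z j = z' j) -> hat k z = hat k z'.
Proof.
by move=> e; rewrite /hat /MX; congr (Num.max 0 (1 - _ - _)); apply: eq_bigr => j _; rewrite e.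
Qed.

Lemma eq_qv k z z' : (forall j, (j < m)%N -> z j = z' j) -> qv k z = qv k z'.
Proof.
move=> e; rewrite /qv (eq_hat _ e); congr (_ - Num.max 0 (1 - _)).
by apply: eq_bigr => i _; apply: eq_hat.
Qed.

Lemma qv_shift k z (c : nat -> int) : qv k (fun j => z j + 20 * (c j)%:~R) = qv k z.
Proof.
rewrite /qv hat_shift; congr (_ - Num.max 0 (1 - _)).
by apply: eq_bigr => i _; apply: hat_shift.
Qed.

Lemma qv_bound k z : `|qv k z| <= 1.
Proof.
have h0 := hat_ge0 k z; have h1 := hat_le1 k z.
have s0 : 0 <= shat z by apply: sumr_ge0 => i _; apply: hat_ge0.
rewrite /qv ler_norml; have [h|h] := leP 0 (1 - shat z); lra.
Qed.

Lemma qv_base z : (exists2 j, (j < m)%N & forall k : int, ~ 2 < z j - 20 * k%:~R < 5) ->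
  forall k, (k <= m)%N -> qv k z = -1.
Proof.
move=> [j jm hj].
have hz i : hat i z = 0.
  apply/eqP; rewrite eq_le hat_ge0 andbT leNgt; apply/negP => /(hat_pos_per jm).
  have [k [s [e hs]]] := per_rep (z j - vv i j); rewrite -hs ltr_norml => /andP[h1 h2].
  apply: (hj k); have : vv i j = 3 \/ vv i j = 4 by rewrite /vv; case: (j < i)%N; [right|left].
  by case=> ev; rewrite ev in e; apply/andP; split; lra.
move=> k _; rewrite /qv hz /shat big1 // subr0 sub0r; congr (- _); apply/max_idPr; exact: ler01.
Qed.

(** The point is then interior to the reference simplex, and the hats are its barycentric
    coordinates. *)
Lemma hats_pos z : (forall k, (k <= m)%N -> 0 < hat k z) ->
  exists (c : nat -> int) (u : nat -> R), [/\ forall j, (j < m)%N -> z j = 3 + u j + 20 * (c j)%:~R /\ 0 < u j < 1,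
    hat 0 z = 1 - u 0%N, forall k, (0 < k < m)%N -> hat k z = u k.-1 - u k & hat m z = u m.-1].
Proof.
move=> hp.
have C j : exists c : int, (j < m)%N -> 0 < z j - 3 - 20 * c%:~R < 1.
  case: (ltnP j m) => jm; last by exists 0.
  have := hat_pos_per jm (hp 0%N isT); have := hat_pos_per jm (hp m (leqnn m)).
  have [k [s [e hs]]] := per_rep (z j - vv 0 j); have [k' [s' [e' hs']]] := per_rep (z j - vv m j).
  rewrite -hs -hs' !ltr_norml /vv jm ltn0 addn0 in e e' * => /andP[a1 a2] /andP[a3 a4].
  have kk : k = k'.
    have e4 : z j - 4 = s' + 20 * k'%:~R := e'.
    have : (-1 < (k - k')%:~R :> R) && ((k - k')%:~R < 1 :> R) by rewrite intrB; apply/andP; split; lra.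
    rewrite -[1]/(1%:~R) -intrN !ltr_int; lia.
  have e4 : z j - 4 = s' + 20 * k%:~R by rewrite kk; exact: e'.
  by exists k => _; apply/andP; split; lra.
have [c hc] := choice C; pose u j := z j - 3 - 20 * (c j)%:~R.
have u01 j : (j < m)%N -> 0 < u j < 1 by apply: hc.
have zE j : z j = 3 + u j + 20 * (c j)%:~R by rewrite /u; ring.
have upE k j : (j < m)%N -> up (z j - vv k j) = if (j < k)%N then 0 else u j.
  move=> jm; have := u01 j jm => hu; rewrite zE /vv; case: ifP => jk.
    have -> : 3 + u j + 20 * (c j)%:~R - (3 + true)%N%:R = (u j - 1) + 20 * (c j)%:~R by rewrite -?[(3 + true)%N]/4%N -?[(3 + false)%N]/3%N; ring.
    by rewrite up_small ?ler_norml; [apply/max_idPl; lra|lra].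
  have -> : 3 + u j + 20 * (c j)%:~R - (3 + false)%N%:R = u j + 20 * (c j)%:~R by rewrite -?[(3 + true)%N]/4%N -?[(3 + false)%N]/3%N; ring.
  by rewrite up_small ?ler_norml; [apply/max_idPr; lra|lra].
have dnE k j : (j < m)%N -> up (vv k j - z j) = if (j < k)%N then 1 - u j else 0.
  move=> jm; have := u01 j jm => hu; rewrite zE /vv; case: ifP => jk.
    have -> : (3 + true)%N%:R - (3 + u j + 20 * (c j)%:~R) = (1 - u j) + 20 * (- c j)%:~R by rewrite -?[(3 + true)%N]/4%N -?[(3 + false)%N]/3%N intrN; ring.
    by rewrite up_small ?ler_norml; [apply/max_idPr; lra|lra].
  have -> : (3 + false)%N%:R - (3 + u j + 20 * (c j)%:~R) = - u j + 20 * (- c j)%:~R by rewrite -?[(3 + true)%N]/4%N -?[(3 + false)%N]/3%N intrN; ring.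
  by rewrite up_small ?ler_norml; [apply/max_idPl; lra|lra].
(* The hat at pattern j pays u_j for coordinate j and 1 - u_i for coordinate i < j, so its
   positivity means u_j < u_i. *)
have lt i j : (i < j)%N -> (j < m)%N -> u j < u i.
  move=> ij jm; have im := ltn_trans ij jm; have := hp j (ltnW jm); move=> /[dup] /hat_posE -> hh.
  have := MX_ge (fun j0 => up (z j0 - vv j j0)) jm; have := MX_ge (fun j0 => up (vv j j0 - z j0)) im.
  by rewrite /= upE // dnE // ltnn ij; lra.
have MU k : (k < m)%N -> MX (fun j => up (z j - vv k j)) = u k.
  move=> km; apply/eqP; rewrite eq_le; apply/andP; split; last by have := MX_ge (fun j => up (z j - vv k j)) km; rewrite /= upE // ltnn.
  apply: MX_le => [|j jm]; first by have := u01 k km; lra.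
  rewrite upE //; case: ltnP => kj; first by have := u01 k km; lra.
  move: kj; rewrite leq_eqVlt => /orP[/eqP->//|kj]; apply: ltW; exact: lt.
have MD k : (0 < k <= m)%N -> MX (fun j => up (vv k j - z j)) = 1 - u k.-1.
  move=> /andP[k0 km]; have km' : (k.-1 < m)%N by rewrite prednK.
  apply/eqP; rewrite eq_le; apply/andP; split; last first.
    by have := MX_ge (fun j => up (vv k j - z j)) km'; rewrite /= dnE // ltn_predL k0.
  apply: MX_le => [|j jm]; first by have := u01 _ km'; lra.
  rewrite dnE //; case: ltnP => kj; last by have := u01 _ km'; lra.
  have : (j <= k.-1)%N by rewrite -ltnS prednK.
  rewrite leq_eqVlt => /orP[/eqP->//|kj']; have := lt _ _ kj' km'; lra.
exists c, u; split.
- by move=> j jm; split=> //; apply: u01.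
- rewrite hat_posE ?hp // MU //; last exact: ltnW.
  have -> : MX (fun j => up (vv 0 j - z j)) = 0; last by rewrite subr0.
  by apply/eqP; rewrite eq_le MX_ge0 andbT; apply: MX_le => // j jm; rewrite dnE // ltn0.
- by move=> k /andP[k0 km]; rewrite hat_posE ?hp ?(ltnW km) // MU // MD ?k0 ?(ltnW km) //; ring.
rewrite hat_posE ?hp // MD ?leqnn ?(ltnW m1) //.
have -> : MX (fun j => up (z j - vv m j)) = 0; last by ring.
by apply/eqP; rewrite eq_le MX_ge0 andbT; apply: MX_le => // j jm; rewrite upE // jm.
Qed.

Lemma sum_hats z u : hat 0 z = 1 - u 0%N -> (forall k, (0 < k < m)%N -> hat k z = u k.-1 - u k) ->
  hat m z = u m.-1 -> shat z = 1 /\ \sum_(k < m.-1) hat k.+2 z = u 1%N.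
Proof.
move=> e0 ek em.
have T n : (n.+2 <= m)%N -> \sum_(k < n) hat k.+2 z + u n.+1 = u 1%N.
  elim: n => [|n IH] hn; first by rewrite big_ord0 add0r.
  by rewrite big_ord_recr /= ek /= -?IH; [ring|exact: ltnW|lia].
have S : \sum_(k < m.-1) hat k.+2 z = u 1%N.
  case: m m1 em T => [|[|n]] //= _ em T; rewrite big_ord_recr /= em; exact: T.
split=> //; rewrite /shat big_ord_recl e0.
have -> : \sum_(i < m) hat (lift ord0 i) z = hat 1 z + \sum_(k < m.-1) hat k.+2 z.
  by case: m m1 {T S e0 ek em} => // n _; rewrite big_ord_recl.
rewrite S ek ?m1 //=; ring.
Qed.

(** At a zero all hats equal the positive part of 1 minus their sum. If they were 0 their sum could
    not reach 1; if they were positive the point would be interior to the reference simplex and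
    their sum equal to 1. *)
Lemma qv_neq0 z : exists2 k, (k <= m)%N & qv k z != 0.
Proof.
apply: contrapT => /forall2NP H.
have e k : (k <= m)%N -> hat k z = Num.max 0 (1 - shat z).
  by move=> km; have [//|/negP] := H k; rewrite negbK /qv subr_eq0 => /eqP.
have [s1|s1] := leP 1 (shat z).
  have z0 k : (k <= m)%N -> hat k z = 0 by move=> km; rewrite e //; apply/max_idPl; rewrite subr_le0.
  by move: s1; rewrite /shat big1 ?ler10 // => i _; apply: z0; rewrite -ltnS.
have hp k : (k <= m)%N -> 0 < hat k z by move=> km; rewrite e // lt_max; apply/orP; right; lra.
have [c [u [_ e0 ek em]]] := hats_pos hp.
by have [s _] := sum_hats e0 ek em; rewrite s ltxx in s1.
Qed.

(* The direction of the ray that the model map must avoid on coned tori. *)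
Definition zst (k : nat) : R := if (k < 2)%N then 1 else 2 / m.-1%:R.

(** On the ray all hats are positive and their sum lam + lam + 2 lam is 1. Hence lam = 1/4, and the
    first two coordinates of the interior point are 3 + 3/4 and 3 + 1/2. *)
Lemma qv_ray z (lam : R) : 0 < lam -> (forall k, (k <= m)%N -> qv k z = lam * zst k) ->
  exists c : nat -> int, [/\ z 0%N = 15 / 4 + 20 * (c 0%N)%:~R, z 1%N = 7 / 2 + 20 * (c 1%N)%:~R &
    forall j, (j < m)%N -> 3 < z j - 20 * (c j)%:~R < 4].
Proof.
move=> l0 e; have m0 : 0 < m.-1%:R :> R by rewrite ltr0n -ltnS prednK // ltnW.
have z0 k : 0 < zst k by rewrite /zst; case: ifP => // _; rewrite divr_gt0.
have hp k : (k <= m)%N -> 0 < hat k z.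
  move=> km; have := e k km; rewrite /qv => ek; have := mulr_gt0 l0 (z0 k).
  by rewrite -ek; have : 0 <= Num.max 0 (1 - shat z) by [rewrite le_max lexx]; lra.
have [c [u [hz e0 ek em]]] := hats_pos hp; have [s1 s2] := sum_hats e0 ek em.
have hk k : (k <= m)%N -> hat k z = lam * zst k.
  by move=> km; rewrite -e // /qv s1 subrr maxxx subr0.
have h0 : 1 - u 0%N = lam by rewrite -e0 hk // /zst /= mulr1.
have h1 : u 0%N - u 1%N = lam by rewrite -(ek 1%N) // hk ?(ltnW m1) // /zst /= mulr1.
have h2 : u 1%N = 2 * lam.
  rewrite -s2 (eq_bigr (fun=> lam * (2 / m.-1%:R))) => [|k _]; last first.
    by rewrite hk /zst //; have := ltn_ord k; lia.
  rewrite sumr_const card_ord -mulr_natr; field; by rewrite gt_eqF.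
have [za _] := hz 0%N (ltnW m1); have [zb _] := hz 1%N m1.
exists c; split; [lra|lra|] => j jm; have [-> hu] := hz j jm; apply/andP; split; lra.
Qed.
End Hats.
End PeriodicHats.

(** * Hats at convex combinations of grid points *)

Module HatInterpolation.
Import all_boot all_order all_algebra.
Import all_classical all_reals all_analysis.
Import ring lra zify.
Import PeriodicHats.
Set Implicit Arguments. Unset Strict Implicit. Unset Printing Implicit Defensive.
Import Order.TTheory GRing.Theory Num.Theory.
Local Open Scope ring_scope.

Section Interpolation.
Variables (R : realType) (m : nat) (T : finType) (y : T -> R).
Hypothesis y0 : forall v, 0 <= y v.
Hypothesis y1 : \sum_v y v = 1.

Definition chain_on (l : T -> nat -> int) := forall v w, y v != 0 -> y w != 0 ->
  (forall j, (j < m)%N -> l v j <= l w j <= l v j + 1) \/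
  (forall j, (j < m)%N -> l w j <= l v j <= l w j + 1).

Definition wsum (l : T -> nat -> int) j : R := \sum_v y v * (l v j)%:~R.

Lemma sum_y (b : R) : \sum_v y v * b = b.
Proof. by rewrite -mulr_suml y1 mul1r. Qed.

Lemma wsum_small l j b : (forall v, y v != 0 -> `|l v j| <= b) -> `|wsum l j| <= b%:~R.
Proof.
move=> hb; apply: le_trans (ler_norm_sum _ _ _) _.
rewrite -[b%:~R]sum_y; apply: ler_sum => v _.
rewrite normrM ger0_norm //; case: (eqVneq (y v) 0) => [->|yv]; first by rewrite !mul0r.
by rewrite ler_wpM2l // -intr_norm ler_int hb.
Qed.

Definition Up (l : T -> nat -> int) v := [exists j : 'I_m, 1 <= l v j].

(* The least vertex of the chain in Up has a coordinate that is at least 1 on all of Up. *)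
Lemma MX_up l (c : nat -> int) : chain_on l -> (forall v j, y v != 0 -> (j < m)%N -> `|l v j| <= 4) ->
  \sum_(v | Up l v) y v <= MX m (fun j => up (wsum l j + 20 * (c j)%:~R)).
Proof.
move=> chain small; case: (boolP [exists v, (y v != 0) && Up l v]) => [/existsP[a0 ha0]|]; last first.
  rewrite negb_exists => /forallP h; rewrite big1 ?MX_ge0 // => v uv.
  by have := h v; rewrite uv andbT negbK => /eqP.
pose rk v := absz (\sum_(j < m) (l v j + 4)).
pose a := [arg min_(v < a0 | (y v != 0) && Up l v) rk v].
have [ya ua amin] : [/\ y a != 0, Up l a & forall v, y v != 0 -> Up l v -> (rk a <= rk v)%N].
  by rewrite /a; case: arg_minnP => // v /andP[h1 h2] h3; split=> // w w1 w2; apply: h3; rewrite w1.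
have [j hj] := existsP ua.
have le_a v : y v != 0 -> Up l v -> forall i, (i < m)%N -> l a i <= l v i.
  move=> yv uv; have rk_le := amin v yv uv.
  case: (chain a v ya yv) => hc i im; first by have /andP[] := hc i im.
  have nn w (yw : y w != 0) (i' : 'I_m) : 0 <= l w i' + 4 by have := small w i' yw (ltn_ord i'); lia.
  have rkE w : y w != 0 -> (rk w)%:Z = \sum_(j < m) (l w j + 4).
    by move=> yw; rewrite /rk gez0_abs // sumr_ge0 // => i' _; apply: nn.
  have le1 : \sum_(j < m) (l a j + 4) <= \sum_(j < m) (l v j + 4) by rewrite -!rkE // lez_nat.
  have := le1; rewrite (bigD1 (Ordinal im)) //= [leRHS](bigD1 (Ordinal im)) //=.
  have : \sum_(i0 < m | i0 != Ordinal im) (l v i0 + 4) <= \sum_(i0 < m | i0 != Ordinal im) (l a i0 + 4).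
    by apply: ler_sum => i' _; rewrite lerD2r; have /andP[] := hc i' (ltn_ord i').
  by move: (\sum_(i0 < m | _) _) (\sum_(i0 < m | _) _) => s1 s2; lia.
apply: le_trans (MX_ge (fun j => up (wsum l j + 20 * (c j)%:~R)) (ltn_ord j)).
have sm := wsum_small (fun v yv => small v j yv (ltn_ord j)).
apply: le_trans (up_ge _ sm).
rewrite big_mkcond; apply: ler_sum => v _; case: (eqVneq (y v) 0) => [->|yv]; first by rewrite mul0r if_same.
case: ifP => uv.
  rewrite -[leLHS]mulr1 ler_wpM2l // -[1]/(1%:~R) ler_int; exact: le_trans hj (le_a v yv uv j (ltn_ord j)).
rewrite mulr_ge0 // ler0z.
by case: (chain a v ya yv) => hc; have /andP[] := hc j (ltn_ord j); move: hj; lia.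
Qed.

Variables (l : T -> nat -> int) (k : nat).
Hypothesis chain : chain_on l.
Definition vk j : int := (3 + (j < k))%N%:Z.
Definition isv v := [forall j : 'I_m, (20 %| l v j - vk j)%Z].
Definition piv : R := \sum_(v | isv v) y v.

Lemma vvE j : vv R k j = (vk j)%:~R. Proof. by []. Qed.

Lemma piv_ge0 : 0 <= piv. Proof. by apply: sumr_ge0. Qed.

(** The interpolation property of hats. With U and L the weights of the vertices that exceed,
    respectively fall below, the pattern in some coordinate, every vertex is in U, in L or at the
    pattern. This bounds the hat from above; if the pattern itself has weight, the three classes are
    disjoint and the bound is attained. *)
Lemma hat_weight : hat m k (wsum l) = piv.
Proof.
have [v0 yv0] : exists v, y v != 0.
  apply/existsP; apply: contraT; rewrite negb_exists => /forallP h.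
  move: y1; rewrite big1 => [/eqP|v _]; first by rewrite eq_sym oner_eq0.
  by have := h v; rewrite negbK => /eqP.
have diff1 v j : y v != 0 -> (j < m)%N -> `|l v j - l v0 j| <= 1.
  by move=> yv jm; case: (chain yv yv0) => /(_ j jm); lia.
have piv_in v : isv v -> y v != 0 -> forall j, (j < m)%N -> exists c, l v j - vk j = c * 20.
  by move=> /forallP hv _ j jm; have /dvdzP[c e] := hv (Ordinal jm); exists c.
(* Vertices of a chain differ by at most 1 per coordinate, so if one of them is at distance 3 from
   the pattern the whole combination is at distance 2, where [up] is at least 1. *)
case: (pselect (exists2 j, (j < m)%N & forall c : int, 3 <= `|l v0 j - vk j - 20 * c|)) => [[j jm far]|near].
  have -> : piv = 0.
    rewrite /piv big1 // => v hv; apply/eqP; apply: contraT => yv.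
    have [c e] := piv_in v hv yv j jm; have := far c; have := diff1 v j yv jm; lia.
  suff : 2 <= per (wsum l j - vv R k j).
    move=> /up_per2 h; rewrite /hat; apply/max_idPl.
    have := MX_ge (fun j => up (wsum l j - vv R k j)) jm; have := MX_ge0 m (fun j => up (vv R k j - wsum l j)).
    by rewrite /=; lra.
  have [c ->] := per_ex (wsum l j - vv R k j).
  have -> : wsum l j - vv R k j - 20 * c%:~R = (l v0 j - vk j - 20 * c)%:~R + wsum (fun v j => l v j - l v0 j) j.
    have -> : wsum (fun v j => l v j - l v0 j) j = wsum l j - (l v0 j)%:~R.
      rewrite -[X in _ - X]sum_y -sumrB; apply: eq_bigr => v _.
      by rewrite intrB mulrBr.
    by rewrite !intrB intrM vvE; ring.
  have h3 : 3 <= `|(l v0 j - vk j - 20 * c)%:~R| :> R by rewrite -intr_norm -[3]/(3%:~R) ler_int.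
  have h1 := @wsum_small (fun v j => l v j - l v0 j) j 1 (fun v yv => diff1 v j yv jm).
  have := lerB_normD (l v0 j - vk j - 20 * c)%:~R (wsum (fun v j => l v j - l v0 j) j).
  by move: h1; rewrite -[1%:~R]/1; lra.
have C j : exists c : int, (j < m)%N -> `|l v0 j - vk j - 20 * c| <= 2.
  case: (ltnP j m) => jm; last by exists 0.
  apply: contrapT => /forallNP H; apply: near; exists j => // c; rewrite leNgt; apply/negP => lt; apply: (H c) => _.
  by rewrite -ltzD1; apply: lt_le_trans lt _.
have [c hc] := choice C; pose dl v j := l v j - vk j - 20 * c j.
have small v j : y v != 0 -> (j < m)%N -> `|dl v j| <= 4.
  by move=> yv jm; have := diff1 v j yv jm; have := hc j jm; rewrite /dl; lia.
have chd : chain_on dl.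
  move=> v w yv yw; case: (chain yv yw) => h; [left|right] => j jm; have := h j jm; rewrite /dl; lia.
have chn : chain_on (fun v j => - dl v j).
  move=> v w yv yw; case: (chain yv yw) => h; [right|left] => j jm; have := h j jm; rewrite /dl; lia.
have smn v j : y v != 0 -> (j < m)%N -> `|- dl v j| <= 4 by move=> yv jm; rewrite normrN small.
have isvE v : y v != 0 -> isv v = [forall j : 'I_m, dl v j == 0].
  move=> yv; apply/forallP/forallP => h j; have := h j.
    move=> /dvdzP[c' e]; have := small v j yv (ltn_ord j); rewrite /dl e; lia.
  by rewrite /dl => /eqP e; apply/dvdzP; exists (c j); lia.
have tU j : wsum l j - vv R k j = wsum dl j + 20 * (c j)%:~R.
  rewrite vvE -[(vk j)%:~R]sum_y -[20 * _]sum_y /wsum -sumrB -big_split; apply: eq_bigr => v _ /=.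
  by rewrite /dl !intrB intrM; ring.
have tL j : vv R k j - wsum l j = wsum (fun v j => - dl v j) j + 20 * (- c j)%:~R.
  rewrite -opprB tU opprD intrN mulrN; congr (_ - _); rewrite /wsum -sumrN.
  by apply: eq_bigr => v _; rewrite intrN mulrN.
pose U := \sum_(v | Up dl v) y v; pose L := \sum_(v | Up (fun v j => - dl v j) v) y v.
have hU : U <= MX m (fun j => up (wsum l j - vv R k j)).
  have := MX_up c chd small; rewrite -/U /MX; under [X in _ <= X -> _]eq_bigr do rewrite -tU; exact: id.
have hL : L <= MX m (fun j => up (vv R k j - wsum l j)).
  have := @MX_up _ (fun j => - c j) chn smn; rewrite -/L /MX; under [X in _ <= X -> _]eq_bigr do rewrite -tL; exact: id.
have cover : 1 <= U + L + piv.
  rewrite -y1 /U /L /piv !(big_mkcond (fun v => Up _ v)) (big_mkcond isv) -!big_split /=.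
  apply: ler_sum => v _; case: (eqVneq (y v) 0) => [->|yv]; first by rewrite !if_same !addr0.
  have yv0' := y0 v; rewrite isvE //.
  case: (boolP (Up dl v)) => u1; case: (boolP (Up _ v)) => u2; case: (boolP [forall _, _]) => u3; rewrite ?addr0 ?add0r; try lra.
  case/negP: u3; apply/forallP => j; apply/eqP.
  move: u1 u2; rewrite !negb_exists => /forallP/(_ j) a1 /forallP/(_ j) a2; lia.
apply/eqP; rewrite eq_le; apply/andP; split.
  by rewrite ge_max piv_ge0; move: hU hL cover; lra.
have [->|p0] := eqVneq piv 0; first exact: hat_ge0.
have piv0 : 0 < piv by rewrite lt_neqAle eq_sym p0 piv_ge0.
have [v1 iv1 yv1] : exists2 v1, isv v1 & y v1 != 0.
  apply/exists_inP; apply: contraLR piv0; rewrite negb_exists_in => /forall_inP h.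
  by rewrite -leNgt /piv big1 // => v hv; have := h v hv; rewrite negbK => /eqP.
rewrite isvE // in iv1; move/forallP: iv1 => iv1.
have one v j : y v != 0 -> (j < m)%N -> `|dl v j| <= 1.
  move=> yv jm; have /eqP := iv1 (Ordinal jm) => /= e1.
  by case: (chd v v1 yv yv1) => /(_ j jm); rewrite e1; lia.
have sgn v : y v != 0 -> ~~ (Up dl v && Up (fun v j => - dl v j) v).
  move=> yv; apply/negP => /andP[/existsP[i hi] /existsP[j hj]].
  have /eqP ei := iv1 i; have /eqP ej := iv1 j.
  by case: (chd v v1 yv yv1) => H; have := H i (ltn_ord i); have := H j (ltn_ord j); rewrite ei ej; lia.
have leU j (l' : T -> nat -> int) : (j < m)%N -> (forall v, y v != 0 -> `|l' v j| <= 1) ->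
    forall cc, up (wsum l' j + 20 * cc%:~R) <= \sum_(v | Up l' v) y v.
  move=> jm h cc; rewrite up_small; last exact: (@wsum_small l' j 1).
  rewrite ge_max sumr_ge0 //= [leRHS]big_mkcond; apply: ler_sum => v _.
  case: (eqVneq (y v) 0) => [->|yv]; first by rewrite mul0r if_same.
  case: ifP => uv; first by rewrite -[leRHS]mulr1 ler_wpM2l // -[1]/(1%:~R) ler_int; have := h v yv; lia.
  rewrite mulr_ge0_le0 // lerz0; move/negbT: uv; rewrite negb_exists => /forallP/(_ (Ordinal jm)) /=; lia.
have hU' : MX m (fun j => up (wsum l j - vv R k j)) <= U.
  apply: MX_le => [|j jm]; first exact: sumr_ge0.
  by rewrite tU; apply: leU => // v yv; apply: one.
have hL' : MX m (fun j => up (vv R k j - wsum l j)) <= L.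
  apply: MX_le => [|j jm]; first exact: sumr_ge0.
  by rewrite tL; apply: leU => // v yv; rewrite normrN; apply: one.
have disj : U + L + piv <= 1.
  rewrite -y1 /U /L /piv !(big_mkcond (fun v => Up _ v)) (big_mkcond isv) -!big_split /=.
  apply: ler_sum => v _; case: (eqVneq (y v) 0) => [->|yv]; first by rewrite !if_same !addr0.
  have yv0' := y0 v; have := sgn v yv; rewrite isvE //.
  case: (boolP (Up dl v)) => u1; case: (boolP (Up _ v)) => u2 //= _;
    case: (boolP [forall _, _]) => u3; rewrite ?addr0 ?add0r //.
    by case/existsP: u1 => j; have /eqP -> := forallP u3 j.
  by case/existsP: u2 => j; have /eqP -> := forallP u3 j.
by rewrite le_max; apply/orP; right; move: hU' hL' disj; lra.
Qed.
End Interpolation.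
End HatInterpolation.

(** * The model map of a solution and the ray it avoids on cones *)

Module ModelMap.
Import all_boot all_order all_algebra.
Import all_classical all_reals all_analysis.
Import ring lra zify.
Import LinkSystem TorusComplex ComplexShape VertexValues PeriodicHats.
Set Implicit Arguments. Unset Strict Implicit. Unset Printing Implicit Defensive.
Import Order.TTheory GRing.Theory Num.Theory.
Import numFieldNormedType.Exports.
Local Open Scope classical_set_scope.
Local Open Scope ring_scope.

Section Limits.
Variables (R : realType) (T : Type) (F : set_system T) (FF : Filter F).
Implicit Types (f g : T -> R).

Lemma max_cvg f g (a b : R) : f @ F --> a -> g @ F --> b ->
  (fun x => Num.max (f x) (g x)) @ F --> Num.max a b.
Proof.
move=> fa gb; rewrite maxr_absE; under eq_fun do rewrite maxr_absE.
by apply: cvgM; [apply: cvgD; [exact: cvgD|apply: cvg_norm; exact: cvgB]|exact: cvg_cst].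
Qed.

Lemma min_cvg f g (a b : R) : f @ F --> a -> g @ F --> b ->
  (fun x => Num.min (f x) (g x)) @ F --> Num.min a b.
Proof.
move=> fa gb; rewrite minr_absE; under eq_fun do rewrite minr_absE.
by apply: cvgM; [apply: cvgB; [exact: cvgD|apply: cvg_norm; exact: cvgB]|exact: cvg_cst].
Qed.

Lemma per_continuous : continuous (@per R).
Proof.
move=> x; apply/cvgrPdist_le => /= e e0; near=> y.
apply: le_trans (per_lip x y) _; near: y; exact: cvgr_dist_le.
Unshelve. all: by end_near.
Qed.

Lemma per_cvg f (a : R) : f @ F --> a -> (fun x => per (f x)) @ F --> per a.
Proof. by move=> fa; apply: (cvg_comp f (@per R) fa); apply: per_continuous. Qed.

Lemma up_cvg f (a : R) : f @ F --> a -> (fun x => up (f x)) @ F --> up a.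
Proof.
move=> fa; rewrite /up; apply: max_cvg; first exact: cvg_cst.
apply: max_cvg; apply: cvgB; try exact: cvg_cst; last exact: per_cvg.
by apply: per_cvg; apply: cvgB => //; exact: cvg_cst.
Qed.

Lemma big_max_cvg (I : Type) (r : seq I) (f : I -> T -> R) (a : I -> R) : (forall i, f i @ F --> a i) ->
  (fun x => \big[Num.max/0]_(i <- r) f i x) @ F --> \big[Num.max/0]_(i <- r) a i.
Proof.
move=> h; elim: r => [|i r IH]; first by rewrite big_nil; under eq_fun do rewrite big_nil; exact: cvg_cst.
by rewrite big_cons; under eq_fun do rewrite big_cons; exact: max_cvg.
Qed.

Lemma big_sum_cvg (I : Type) (r : seq I) (f : I -> T -> R) (a : I -> R) : (forall i, f i @ F --> a i) ->
  (fun x => \sum_(i <- r) f i x) @ F --> \sum_(i <- r) a i.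
Proof.
move=> h; elim: r => [|i r IH]; first by rewrite big_nil; under eq_fun do rewrite big_nil; exact: cvg_cst.
by rewrite big_cons; under eq_fun do rewrite big_cons; exact: cvgD.
Qed.

Lemma big_prod_cvg (I : Type) (r : seq I) (f : I -> T -> R) (a : I -> R) : (forall i, f i @ F --> a i) ->
  (fun x => \prod_(i <- r) f i x) @ F --> \prod_(i <- r) a i.
Proof.
move=> h; elim: r => [|i r IH]; first by rewrite big_nil; under eq_fun do rewrite big_nil; exact: cvg_cst.
by rewrite big_cons; under eq_fun do rewrite big_cons; exact: cvgM.
Qed.

Lemma hat_cvg m k (z : nat -> T -> R) (a : nat -> R) : (forall j, z j @ F --> a j) ->
  (fun x => hat m k (fun j => z j x)) @ F --> hat m k a.
Proof.
move=> h; rewrite /hat /MX; apply: max_cvg; first exact: cvg_cst.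
apply: cvgB; [apply: cvgB; first exact: cvg_cst|]; apply: big_max_cvg => j; apply: up_cvg.
  by apply: cvgB => //; exact: cvg_cst.
by apply: cvgB => //; exact: cvg_cst.
Qed.

Lemma qv_cvg m k (z : nat -> T -> R) (a : nat -> R) : (forall j, z j @ F --> a j) ->
  (fun x => qv m k (fun j => z j x)) @ F --> qv m k a.
Proof.
move=> h; rewrite /qv; apply: cvgB; first exact: hat_cvg.
apply: max_cvg; first exact: cvg_cst.
by apply: cvgB; [exact: cvg_cst|apply: big_sum_cvg => i; exact: hat_cvg].
Qed.
End Limits.

Section Phi.
Variables (R : realType) (h g f q : nat) (a d : nat -> int).
Hypotheses (h0 : (0 < h)%N) (g0 : (0 < g)%N) (f2 : (2 <= f)%N) (fq : (f <= q)%N).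
Hypotheses (a0 : a 0%N = 1) (d0 : d 0%N = 1).
Notation m := h.+1.
Notation ps := (ps h g). Notation pt := (pt h). Notation C0 := (C0 h). Notation C1 := (C1 h).
Implicit Types (th : nat -> R).

Definition Lc th : R := \sum_(j < q) (d j)%:~R * th (ps j).
Definition Wc th : R := \sum_(i < g) (a i)%:~R * th (pt i).
(** A switch: 0 as soon as r or a coordinate of C1 is 0 modulo 20, and 1 where all of them are at
    distance at least 1 from the multiples of 20. *)
Definition mu th : R := \prod_(x <- pr :: C1) Num.min 1 (per (th x)).
Definition z1 th j : R := nth 0 [:: Lc th - 3 * mu th, Wc th & map th C0] j.
Definition z2 th j : R := nth 0 [:: Lc th, th pr & map th C1] j.
(* The two blocks are never both different from their base value -1: the shift 3 mu separates
   the values of [Lc] that they need. *)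
Definition Phi th k : R := qv m k (z1 th) + qv m k (z2 th) + 1.

Lemma m_gt1 : (1 < m)%N. Proof. by rewrite ltnS. Qed.

Lemma Phi_cvg (T : Type) (F : set_system T) (FF : Filter F) (t : nat -> T -> R) (l : nat -> R) k :
  (forall x, t x @ F --> l x) -> (fun y => Phi (fun x => t x y) k) @ F --> Phi l k.
Proof.
move=> ht.
have cL : (fun y => Lc (fun x => t x y)) @ F --> Lc l.
  by apply: big_sum_cvg => j; apply: cvgM => //; exact: cvg_cst.
have cW : (fun y => Wc (fun x => t x y)) @ F --> Wc l.
  by apply: big_sum_cvg => j; apply: cvgM => //; exact: cvg_cst.
have cm : (fun y => mu (fun x => t x y)) @ F --> mu l.
  by apply: big_prod_cvg => j; apply: min_cvg; [exact: cvg_cst|exact: per_cvg].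
have cn (s : seq nat) i : (fun y => nth 0 (map (fun x => t x y) s) i) @ F --> nth 0 (map l s) i.
  case: (ltnP i (size s)) => hi; last first.
    by rewrite nth_default ?size_map //; under eq_fun do rewrite nth_default ?size_map //; exact: cvg_cst.
  by rewrite (nth_map 0%N) //; under eq_fun do rewrite (nth_map 0%N) //; exact: ht.
rewrite /Phi; apply: cvgD; last exact: cvg_cst.
apply: cvgD; apply: qv_cvg => -[|[|j]]; rewrite /z1 /z2 /=; try exact: cn; try by [].
by apply: cvgB => //; apply: cvgM => //; exact: cvg_cst.
Qed.

Lemma eq_Phi th th' k : (forall x, th x = th' x) -> Phi th k = Phi th' k.
Proof. by move=> e; congr (Phi _ k); apply/funext. Qed.

Lemma Phi_shift th (c : nat -> int) k : Phi (fun x => th x + 20 * (c x)%:~R) k = Phi th k.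
Proof.
have eL : Lc (fun x => th x + 20 * (c x)%:~R) = Lc th + 20 * (\sum_(j < q) d j * c (ps j))%:~R.
  rewrite /Lc rmorph_sum mulr_sumr -big_split; apply: eq_bigr => j _ /=; rewrite intrM; ring.
have eW : Wc (fun x => th x + 20 * (c x)%:~R) = Wc th + 20 * (\sum_(i < g) a i * c (pt i))%:~R.
  rewrite /Wc rmorph_sum mulr_sumr -big_split; apply: eq_bigr => j _ /=; rewrite intrM; ring.
have em : mu (fun x => th x + 20 * (c x)%:~R) = mu th.
  by apply: eq_bigr => x _; rewrite per_shift.
have en (s : seq nat) i : nth 0 (map (fun x => th x + 20 * (c x)%:~R) s) i = nth 0 (map th s) i + 20 * (nth 0 (map c s) i)%:~R.
  case: (ltnP i (size s)) => hi; last by rewrite !nth_default ?size_map // mulr0 addr0.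
  by rewrite !(nth_map 0%N).
rewrite /Phi; congr (_ + _ + _).
  rewrite -(qv_shift _ _ (z1 th) (nth 0 [:: \sum_(j < q) d j * c (ps j), \sum_(i < g) a i * c (pt i) & map c C0])).
  by apply: eq_qv => -[|[|j]] _; rewrite /z1 /= ?eL ?eW ?em ?en //; ring.
rewrite -(qv_shift _ _ (z2 th) (nth 0 [:: \sum_(j < q) d j * c (ps j), c pr & map c C1])).
by apply: eq_qv => -[|[|j]] _; rewrite /z2 /= ?eL ?en.
Qed.

Lemma mu01 th : 0 <= mu th <= 1.
Proof.
rewrite /mu; elim: (pr :: C1) => [|x s IH]; first by rewrite big_nil ler01 lexx.
rewrite big_cons; have h1 : 0 <= Num.min 1 (per (th x)) <= 1 by rewrite le_min ler01 per_ge0 ge_min lexx.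
by case/andP: IH => i1 i2; case/andP: h1 => h1 h2; rewrite mulr_ge0 //= mulr_ile1.
Qed.

Lemma mu_pr0 th : th pr = 0 -> mu th = 0.
Proof.
move=> e; rewrite /mu big_cons e; have := @per_small R 0 0; rewrite mulr0 addr0 normr0 => -> //.
by rewrite (min_idPr ler01) mul0r.
Qed.

Lemma int_gap (x y : int) (u v : R) : u = v + 20 * (x - y)%:~R -> -19 < v - u < 19 -> x = y.
Proof.
move=> e hv; have : (-1 < (x - y)%:~R :> R) && ((x - y)%:~R < 1 :> R) by apply/andP; split; lra.
by rewrite -[1]/(1%:~R) -intrN !ltr_int; lia.
Qed.

Lemma size_C0 : size C0 = h.-1. Proof. exact: size_iota. Qed.
Lemma size_C1 : size C1 = h.-1. Proof. exact: size_iota. Qed.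

(** If the second block is not at its base value, all its coordinates lie in (2, 5) modulo 20. Then
    mu = 1, and the first coordinate L - 3 of the first block lies in (-1, 2) modulo 20, so the
    first block is at its base value. *)
Lemma Phi_cases th : (forall k, (k <= m)%N -> Phi th k = qv m k (z1 th)) \/
  (forall k, (k <= m)%N -> Phi th k = qv m k (z2 th)).
Proof.
case: (pselect (exists2 j, (j < m)%N & forall k : int, ~ 2 < z2 th j - 20 * k%:~R < 5)) => [b2|nb2].
  by left=> k km; rewrite /Phi (qv_base b2) // subrK.
have all2 j : (j < m)%N -> exists k : int, 2 < z2 th j - 20 * k%:~R < 5.
  move=> jm; apply: contrapT => H; apply: nb2; exists j => // k hk; apply: H; by exists k.
have pr1 x : x \in pr :: C1 -> Num.min 1 (per (th x)) = 1.
  move=> hx; have [k hk] : exists k : int, 2 < th x - 20 * k%:~R < 5.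
    move: hx; rewrite inE => /orP[/eqP->|hx]; first by have := all2 1%N m_gt1.
    have ix : (index x C1 < size C1)%N by rewrite index_mem.
    have := all2 (index x C1).+2; rewrite /z2 /= (nth_map 0%N) // nth_index //; apply.
    by move: ix; rewrite size_C1; lia.
  apply/min_idPl; have -> : th x = th x - 20 * k%:~R + 20 * k%:~R by rewrite subrK.
  by rewrite per_small ?ger0_norm; lra.
have m1 : mu th = 1.
  by rewrite /mu big_seq (eq_bigr (fun=> 1)) ?big1_eq // => x; apply: pr1.
have [k0 hk0] := all2 0%N isT; rewrite /z2 /= in hk0.
right=> k km; rewrite /Phi (@qv_base _ _ (z1 th)) //; first by rewrite addrAC addNr add0r.
exists 0%N => // k1; rewrite /z1 /= m1 => hk1.
have e : k0 = k1 by apply: (@int_gap k0 k1 (Lc th - 20 * k1%:~R) (Lc th - 20 * k0%:~R)); [rewrite intrB; ring|lra].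
by rewrite e in hk0; lra.
Qed.

Lemma Phi_bound th k : `|Phi th k| <= 3.
Proof.
have := qv_bound m k (z1 th); have := qv_bound m k (z2 th); rewrite /Phi.
by rewrite !ler_norml; lra.
Qed.

Lemma Phi_neq0 th : exists2 k, (k <= m)%N & Phi th k != 0.
Proof.
case: (Phi_cases th) => e; [have [k km hk] := qv_neq0 m_gt1 (z1 th)|have [k km hk] := qv_neq0 m_gt1 (z2 th)].
all: by exists k => //; rewrite e.
Qed.

Definition rayA th := exists c0 c1 : int, [/\ Lc th - 3 * mu th = 15 / 4 + 20 * c0%:~R,
  Wc th = 7 / 2 + 20 * c1%:~R & forall x, x \in C0 -> th x != 0].
Definition rayB th := exists c0 : int, Lc th = 15 / 4 + 20 * c0%:~R /\
  forall x, x \in pr :: C1 -> th x != 0.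

Lemma int34 (x : R) (c : int) : 3 < x - 20 * c%:~R < 4 -> x != 0.
Proof.
move=> hx; apply/eqP => e; have : (-1 < c%:~R :> R) && (c%:~R < 0 :> R) by apply/andP; split; lra.
by rewrite -[1]/(1%:~R) -intrN -[0]/(0%:~R) !ltr_int; lia.
Qed.

Lemma Phi_ray th lam : 0 < lam -> (forall k, (k <= m)%N -> Phi th k = lam * zst R m k) -> rayA th \/ rayB th.
Proof.
move=> l0 e; case: (Phi_cases th) => eq.
  have [k km|c [e0 e1 ej]] := qv_ray m_gt1 (z := z1 th) l0; first by rewrite -eq ?e.
  left; exists (c 0%N), (c 1%N); split=> // x hx; have ix : (index x C0 < size C0)%N by rewrite index_mem.
  have := ej (index x C0).+2; rewrite /z1 /= (nth_map 0%N) // nth_index // => H; apply: (int34 (H _)).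
  by move: ix; rewrite size_C0; lia.
have [k km|c [e0 e1 ej]] := qv_ray m_gt1 (z := z2 th) l0; first by rewrite -eq ?e.
right; exists (c 0%N); split=> // x; rewrite inE => /orP[/eqP->|hx]; first by apply: (int34 (ej 1%N m_gt1)).
have ix : (index x C1 < size C1)%N by rewrite index_mem.
have := ej (index x C1).+2; rewrite /z2 /= (nth_map 0%N) // nth_index // => H; apply: (int34 (H _)).
by move: ix; rewrite size_C1; lia.
Qed.

Variables (A : seq (seq nat)) (K : seq link).
Hypothesis wf : sys_wf f g [::] K.
Hypothesis wfA : all (add_wf q) A.
Hypothesis satAK : sat A K a d.

Definition onT (Gs : seq (seq nat)) th := (forall x, x \notin flatten Gs -> th x = 0) /\
  (forall G x y, G \in Gs -> x \in G -> y \in G -> th x = th y).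

Lemma no_quarter (c : int) (x : R) : -3 <= x <= 0 -> x != 15 / 4 + 20 * c%:~R.
Proof.
move=> hx; apply/eqP => e; have : (-1 < c%:~R :> R) && (c%:~R < 0 :> R) by apply/andP; split; lra.
by rewrite -[1]/(1%:~R) -intrN -[0]/(0%:~R) !ltr_int; lia.
Qed.

Lemma no_half (c : int) : (0 : R) != 7 / 2 + 20 * c%:~R.
Proof.
apply/eqP => e; have : (-1 < c%:~R :> R) && (c%:~R < 0 :> R) by apply/andP; split; lra.
by rewrite -[1]/(1%:~R) -intrN -[0]/(0%:~R) !ltr_int; lia.
Qed.

Lemma Lc0 th : (forall j, (j < q)%N -> th (ps j) = 0) -> Lc th = 0.
Proof. by move=> e; rewrite /Lc big1 // => j _; rewrite e ?mulr0. Qed.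

Lemma Wc0 th : (forall i, (i < g)%N -> th (pt i) = 0) -> Wc th = 0.
Proof. by move=> e; rewrite /Wc big1 // => j _; rewrite e ?mulr0. Qed.

Lemma subseq_uniq_eq (S P U : seq nat) : uniq U -> subseq S U -> subseq P U ->
  {subset P <= S} -> size P = size S -> S = P.
Proof.
move=> uU sS sP PS sz; have uP := subseq_uniq sP uU; have uS := subseq_uniq sS uU.
have [_ e] := uniq_min_size uP PS (eq_leq (esym sz)).
have /subseq_uniqP := sS => /(_ uU) ->; have /subseq_uniqP := sP => /(_ uU) ->.
by apply: eq_filter => x; rewrite e.
Qed.

(** Meeting the ray requires t_i and C0, or r and C1, to be nonzero coordinates, so that S contains
    these directions. A nonzero L adds s_0 or s_j, and by size S would be one of the kept subtori.
    The case L = 0 is excluded because -3 mu lies in [-3, 0]. *)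
Lemma cone_main i j S th : (i < g)%N -> (0 < j < f)%N -> S \in coneU h g i j ->
  onT (single S) th -> ~ (rayA th \/ rayB th).
Proof.
move=> ig jf; rewrite mem_filter mem_subs => /andP[/andP[/eqP sS nS] sub] [th0 _].
rewrite flatten_single in th0.
have uU : uniq (mainU h g i j) by apply: (mainU_uniq h0 g0 f2 fq wf wfA) => //; case/andP: jf.
have inS x : th x != 0 -> x \in S by apply: contraR => /th0->.
have inU x : th x != 0 -> x \in mainU h g i j by move=> /inS; apply: mem_subseq.
have Lnz : Lc th != 0 -> ps 0 \in S \/ ps j \in S.
  move=> nz; apply: contrapT => /not_orP[n1 n2]; case/negP: nz; apply/eqP; apply: Lc0 => j' jq.
  apply/eqP; apply: contraT => nz; have := inU _ nz; rewrite !inE mem_cat !inE mem_C0 mem_C1.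
  have pse a1 b1 : (ps a1 == ps b1) = (a1 == b1) by rewrite /TorusComplex.ps eqn_add2l.
  rewrite (pse j' 0%N) (pse j' j).
  case: (j' =P 0%N) => [e|_]; first by case: n1; rewrite -e; apply: inS.
  case: (j' =P j) => [e|_]; first by case: n2; rewrite -e; apply: inS.
  by rewrite /TorusComplex.ps /TorusComplex.pt /pr; clear -ig h0; lia.
have keep P y : (y == ps 0) || (y == ps j) -> P \in [:: pt i :: C0; pr :: C1] -> {subset P <= S} -> y \in S -> False.
  move=> hy hP PS yS; have sP : size P = h by move: hP; rewrite !inE => /orP[]/eqP->; rewrite /= size_iota prednK.
  have sub1 : subseq P ((pt i :: C0) ++ (pr :: C1)).
    by move: hP; rewrite !inE => /orP[]/eqP->; [exact: prefix_subseq|exact: suffix_subseq].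
  have subP : subseq (y :: P) (mainU h g i j).
    case/orP: hy => /eqP->; rewrite /mainU.
      by rewrite -[_ :: P]/([:: ps 0] ++ P) -[X in subseq _ X]/([:: ps 0] ++ _) cat_subseq // (subseq_trans sub1) // subseq_cons.
    by apply: subseq_trans (subseq_cons _ _); rewrite /= eqxx.
  have e : S = y :: P.
    apply: (subseq_uniq_eq uU sub subP); last by rewrite /= sP sS.
    by move=> x; rewrite inE => /orP[/eqP->|/PS].
  case/negP: nS; rewrite e; case/orP: hy => /eqP->; move: hP; rewrite !inE => /orP[]/eqP->; by rewrite eqxx ?orbT.
case=> [[c0 [c1 [eL eW hC]]]|[c0 [eL hC]]].
  have ti : pt i \in S.
    apply: contraT => n; have e := no_half c1; rewrite -eW Wc0 ?eqxx // in e => i' ig'.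
    apply/eqP; apply: contraT => nz; have := inU _ nz; rewrite !inE mem_cat !inE mem_C0 mem_C1.
    case: (i' =P i) => [e'|ne]; first by case/negP: n; rewrite -e'; apply: inS.
    by rewrite /TorusComplex.ps /TorusComplex.pt /pr; move: ne ig'; clear -h0; lia.
  have PS : {subset pt i :: C0 <= S} by move=> x; rewrite inE => /orP[/eqP->|/hC/inS].
  have [/Lnz[yS|yS]|/negPn/eqP L0] := boolP (Lc th != 0).
  - by apply: (@keep (pt i :: C0) (ps 0)) => //; rewrite ?eqxx // mem_head.
  - by apply: (@keep (pt i :: C0) (ps j)) => //; rewrite ?eqxx ?orbT // mem_head.
  have := mu01 th => hm; have := @no_quarter c0 (Lc th - 3 * mu th); rewrite eL eqxx => H.
  by apply: notF; apply: H; rewrite -eL L0; lra.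
have PS : {subset pr :: C1 <= S} by move=> x /hC/inS.
have [|yS|yS] := Lnz.
- by apply/eqP => e; have := @no_quarter c0 0; rewrite -eL e eqxx => H; apply: notF; apply: H; lra.
- by apply: (@keep (pr :: C1) (ps 0)) => //; rewrite ?eqxx // !inE eqxx orbT.
by apply: (@keep (pr :: C1) (ps j)) => //; rewrite ?eqxx ?orbT // !inE eqxx orbT.
Qed.

Lemma no_rayB th : th pr = 0 -> ~ rayB th.
Proof. by move=> e [c [_ /(_ pr)]]; rewrite mem_head e eqxx => /(_ isT). Qed.

Lemma no_rayA_L th : th pr = 0 -> Lc th = 0 -> ~ rayA th.
Proof.
move=> e L0 [c0 [c1 [eL _ _]]]; have := @no_quarter c0 0; rewrite -eL L0 mu_pr0 // mulr0 subr0 eqxx => H.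
by apply: notF; apply: H; lra.
Qed.

Lemma sum_two n (e : nat -> R) j k (X Y : R) : (j < n)%N -> (k < n)%N -> j != k -> e j = X -> e k = Y ->
  (forall i, (i < n)%N -> i != j -> i != k -> e i = 0) -> \sum_(i < n) e i = X + Y.
Proof.
move=> jn kn jk ej ek e0; rewrite (bigD1 (Ordinal jn)) //= (bigD1 (Ordinal kn)) /=; last by rewrite -(inj_eq val_inj) /= eq_sym.
by rewrite big1 ?addr0 ?ej ?ek // => i /andP[h1 h2]; apply: e0.
Qed.

(** On the cones of links and sums r = 0, so only the first block can meet the ray, and mu = 0. On
    the two coordinate cones of a link W = 0 or L = 0. On its diagonal L = d_j W, by d_k = a_i d_j.
    On the diagonal of a sum L is the sum of the d_j times the common coordinate, hence 0. *)
Lemma cone_no_ray Gs th : ctorus h g f A K Gs -> onT Gs th -> ~ (rayA th \/ rayB th).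
Proof.
case=> [[i [j [S [ig jf hS ->]]]]|[i [j [k [hl]]]]|[J hJ ->]].
- by move=> onth; exact: (cone_main ig jf hS onth).
- have /andP[_ /allP/(_ _ hl)] := wf; rewrite /link_wf /= => hh.
  have eqs (s : seq nat) x : x \notin s -> flatten (single s) = s by rewrite flatten_single.
  case=> -> [th0 thG]; rewrite /= ?flatten_single in th0.
  + have pr0 : th pr = 0 by apply: th0; rewrite !inE mem_C0 /pr /TorusComplex.ps; clear -hh h0; lia.
    case; last exact: no_rayB.
    move=> [c0 [c1 [_ eW _]]]; have := no_half c1; rewrite -eW Wc0 ?eqxx // => i' ig'.
    by apply: th0; rewrite !inE mem_C0 /TorusComplex.pt /TorusComplex.ps; clear -hh h0 ig'; lia.
  + have pr0 : th pr = 0 by apply: th0; rewrite !inE mem_C0 /pr /TorusComplex.pt; clear -hh h0; lia.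
    case; last exact: no_rayB.
    apply: no_rayA_L => //; apply: Lc0 => j' jq.
    by apply: th0; rewrite !inE mem_C0 /TorusComplex.pt /TorusComplex.ps; clear -hh h0 jq; lia.
  have pr0 : th pr = 0 by apply: th0; rewrite !inE mem_C0 /pr /TorusComplex.pt /TorusComplex.ps; clear -hh h0; lia.
  case; last exact: no_rayB.
  move=> [c0 [c1 [eL eW _]]]; rewrite mu_pr0 // mulr0 subr0 in eL.
  have ej : th (ps j) = th (pt 0) by apply: (thG [:: ps j; pt 0]); rewrite !inE eqxx ?orbT.
  have ek : th (ps k) = th (pt i) by apply: (thG [:: pt i; ps k]); rewrite !inE eqxx ?orbT.
  have EL : Lc th = (d j)%:~R * th (pt 0) + (d k)%:~R * th (pt i).
    apply: (@sum_two q (fun j => (d j)%:~R * th (ps j)) j k); rewrite ?ej ?ek //; try by move: hh fq; clear; lia.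
    move=> j' jq n1 n2; rewrite th0 ?mulr0 // !inE mem_C0 /TorusComplex.pt /TorusComplex.ps; move: n1 n2; clear -hh h0 jq; lia.
  have EW : Wc th = th (pt 0) + (a i)%:~R * th (pt i).
    apply: (@sum_two g (fun i => (a i)%:~R * th (pt i)) 0 i); rewrite ?a0 ?mul1r //; try by move: hh g0; clear; lia.
    move=> j' jq n1 n2; rewrite th0 ?mulr0 // !inE mem_C0 /TorusComplex.pt /TorusComplex.ps; move: n1 n2; clear -hh h0 jq; lia.
  have dk : d k = a i * d j by have [_ /(_ _ hl)] := satAK => /= ->.
  have E : Lc th = (d j)%:~R * Wc th by rewrite EL EW dk intrM; ring.
  (* Four times L = d_j W at the ray: an odd integer would equal an even one. *)
  have E4 : (15 + 80 * c0)%:~R = (2 * (d j * (7 + 40 * c1)))%:~R :> R.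
    rewrite !rmorphD !rmorphM !rmorphD !rmorphM /=; have := E; rewrite eL eW => E'.
    have -> : 15%:~R + 80%:~R * c0%:~R = 4 * (15 / 4 + 20 * c0%:~R) :> R by field.
    by rewrite E'; field.
  by move/eqP: E4; rewrite eqr_int => /eqP; move: (d j * _) => x; clear; lia.
have /allP/(_ _ hJ)/and3P[uJ sJ jJ] := wfA.
move=> [th0 thG]; rewrite /= flatten_single in th0.
have pr0 : th pr = 0.
  apply: th0; rewrite mem_cat negb_or !inE mem_C0 /pr /TorusComplex.pt; apply/andP; split; last by clear -h0; lia.
  by apply/mapP => -[x _]; rewrite /TorusComplex.ps; clear -h0; lia.
case; last exact: no_rayB.
apply: no_rayA_L => //.
have [j0 hj0] : exists j0, j0 \in J by case: (J) sJ => // j0 J' _; exists j0; rewrite mem_head.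
have eJ j : j \in J -> th (ps j) = th (ps j0).
  by move=> hj; apply: (thG (map ps J)); rewrite ?mem_head // map_f.
have : Lc th = (\sum_(j <- J) d j)%:~R * th (ps j0).
  rewrite rmorph_sum mulr_suml /Lc (bigID (fun j : 'I_q => (j : nat) \in J)) /= [X in _ + X]big1 ?addr0.
    rewrite -(big_mkord (fun j => j \in J) (fun j => (d j)%:~R * th (ps j))) -big_filter.
    rewrite [RHS](_ : _ = \sum_(j <- J) (d j)%:~R * th (ps j)); last first.
      by rewrite [RHS]big_seq [LHS]big_seq; apply: eq_bigr => j hj; rewrite eJ.
    apply: perm_big; apply: uniq_perm => //; first by rewrite filter_uniq ?iota_uniq.
    move=> j; rewrite mem_filter mem_iota subn0 add0n; case hj: (j \in J) => //=.
    exact: (allP jJ).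
  move=> j nj; rewrite th0 ?mulr0 // mem_cat negb_or !inE mem_C0; apply/andP; split.
    by rewrite mem_map // => x y; rewrite /TorusComplex.ps; clear; lia.
  by rewrite /TorusComplex.ps /TorusComplex.pt; move: (nat_of_ord j); clear -h0 g0; lia.
by have [-> // _] := satAK; rewrite mul0r.
Qed.
End Phi.
End ModelMap.

(** * Lifts of simplices from tori to integer points *)

Module SimplexLifts.
Import all_boot all_order all_algebra.
Import all_classical all_reals all_analysis.
Import ring lra zify.
Import LinkSystem TorusComplex ComplexShape VertexValues Compactness RootsForced PeriodicHats HatInterpolation ModelMap.
Set Implicit Arguments. Unset Strict Implicit. Unset Printing Implicit Defensive.
Import Order.TTheory GRing.Theory Num.Theory.
Import numFieldNormedType.Exports.
Local Open Scope classical_set_scope.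
Local Open Scope ring_scope.

Section Paste.
Variable R : realType.

Lemma row_continuous (T : topologicalType) n (F : 'I_n -> T -> R) :
  (forall j, continuous (F j)) -> continuous (fun x => \row_j F j x : 'rV[R]_n).
Proof.
move=> cF x; apply/cvg_ballP => e e0.
have H : \forall y \near x, forall j, ball (F j x) e (F j y).
  by apply: filter_forall => j; have := cF j x; move/cvg_ballP => /(_ e e0).
near=> y; split=> // i j; rewrite !mxE; move: j; near: y; exact: H.
Unshelve. all: by end_near.
Qed.

Lemma paste (T U : topologicalType) (I : eqType) (r : seq I) (A : I -> set T) (G : T -> U) :
  (forall s, s \in r -> closed (A s)) ->
  (forall s, s \in r -> exists2 G', continuous G' & forall x, A s x -> G x = G' x) ->
  {within \big[setU/set0]_(s <- r) A s, continuous G}.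
Proof.
elim: r => [|s r IH] cl hG; first by rewrite big_nil; exact: continuous_subspace0.
rewrite big_cons; apply: withinU_continuous.
- by apply: cl; rewrite mem_head.
- by apply: closed_bigsetU => t tr; apply: cl; rewrite inE tr orbT.
- have [G' cG' e] := hG s (mem_head _ _).
  apply: (@subspace_eq_continuous _ _ _ (G' : subspace (A s) -> U)).
    by move=> x /set_mem hx; exact: (esym (e x hx)).
  exact: continuous_subspaceT.
by apply: IH => t tr; [apply: cl|apply: hG]; rewrite inE tr orbT.
Qed.
End Paste.

Section Lifts.
Variables (h g f q : nat) (A : seq (seq nat)) (K : seq link).
Hypotheses (h0 : (0 < h)%N) (g0 : (0 < g)%N) (f2 : (2 <= f)%N) (fq : (f <= q)%N).
Hypothesis wf : sys_wf f g [::] K.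
Hypothesis wfA : all (add_wf q) A.

(** An integer lift of the coordinates of the vertices along the simplex: a base point plus nested
    0-1 increments. Vertex 0 is the apex and has no coordinates. For a cone the lift also respects
    the groups of the coned torus, as [onT] requires. *)
Definition liftP (s : seq nat) (l : nat -> nat -> nat) := exists (c : nat -> nat) (e : nat -> nat -> bool),
  [/\ forall v p, l v p = (c p + e v p)%N,
      forall v p, v \in s -> v != 0%N -> digit v p = ((c p + e v p) %% 20)%N,
      forall v v', v \in s -> v' \in s -> v != 0%N -> v' != 0%N ->
        (forall p, e v p -> e v' p) \/ (forall p, e v' p -> e v p) &
      0%N \in s -> exists2 Gs, ctorus h g f A K Gs & forall v, v \in s -> v != 0%N ->
        (forall p, p \notin flatten Gs -> l v p = 0%N) /\
        (forall G p p', G \in Gs -> p \in G -> p' \in G -> l v p = l v p')].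

Lemma smp_lift N Gs th p : twf N Gs -> size th = size Gs -> all (fun a => a < MM)%N th ->
  perm_eq p (iota 0 (size Gs)) ->
  exists (c : nat -> nat) (e : nat -> nat -> bool),
  [/\ forall v x, v \in smp Gs th p -> digit v x = ((c x + e v x) %% 20)%N,
      forall v v', v \in smp Gs th p -> v' \in smp Gs th p ->
        (forall x, e v x -> e v' x) \/ (forall x, e v' x -> e v x),
      forall v x, x \notin flatten Gs -> (c x + e v x)%N = 0%N &
      forall v G x y, G \in Gs -> x \in G -> y \in G -> (c x + e v x)%N = (c y + e v y)%N].
Proof.
move=> tw sth lth pp; have /and3P[uG _ _] := tw.
pose ix x := find (fun G : seq nat => x \in G) Gs.
pose S v := take (index v (smp Gs th p)) p.
exists (cf Gs th), (fun v x => (ix x < size Gs)%N && (ix x \in S v)).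
have vE v : v \in smp Gs th p -> v = vnum Gs (stepv th (S v)).
  move=> hv; have iv : (index v (smp Gs th p) < size (smp Gs th p))%N by rewrite index_mem.
  rewrite -{1}(nth_index 0%N hv); move: iv; rewrite size_smp => iv.
  rewrite /smp (nth_map [::]) ?size_map ?size_iota //; congr vnum.
  by rewrite /pathm (nth_map 0%N) ?size_iota // nth_iota.
split.
- move=> v x hv; rewrite {1}(vE v hv) (digit_vnum x tw) ?size_stepv ?stepv_lt //.
  rewrite /cf -/(ix x); case: ltnP => hx; last first.
    by rewrite !nth_default ?size_stepv ?sth.
  by rewrite nth_stepv ?sth // MME.
- move=> v v' hv hv'; case: (leqP (index v (smp Gs th p)) (index v' (smp Gs th p))) => hi; [left|right] => x /andP[-> /=].
    by rewrite /S -{1}(subnKC hi) => H; rewrite -(subnKC hi) takeD mem_cat; move: H; rewrite /S ?takeD => ->.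
  by rewrite /S -(subnKC (ltnW hi)) takeD mem_cat => ->.
- move=> v x hx; rewrite cf_notin // ltnNge -ltnS ltnS.
  by rewrite (_ : (size Gs <= ix x)%N) // leqNgt -has_find; apply/hasPn => G hG; apply: contra hx => xG; apply/flattenP; exists G.
move=> v G x y hG hx hy; have e z : z \in G -> ix z = index G Gs.
  move=> hz; have iG : (index G Gs < size Gs)%N by rewrite index_mem.
  have := @cf_nth Gs (iota 0 (size Gs)) z (index G Gs) uG iG; rewrite nth_index // => /(_ hz).
  rewrite /cf -/(ix z); case: (ltnP (ix z) (size Gs)) => hz'; first by rewrite !nth_iota.
  by have : has (fun G : seq nat => z \in G) Gs; [apply/hasP; exists G|rewrite has_find ltnNge hz'].
by rewrite /cf -!/(ix _) !e.
Qed.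

Lemma simp_lift s : s \in simps h g f A K -> exists l, liftP s l.
Proof.
case/mem_simps => -[Gs tGs].
  case/mem_chains => th [p [sth lth pp ->]].
  have tw := torus_twf h0 g0 f2 fq wf wfA tGs.
  have [c [e [h1 h2 h3 h4]]] := smp_lift tw sth lth pp.
  exists (fun v p => (c p + e v p)%N), c, e; split=> //; first by move=> v x hv _; apply: h1.
    by move=> v v' hv hv' _ _; apply: h2.
  by move=> /(smp_lt tw sth).
case/mapP => s' /mem_chains[th [p [sth lth pp ->]]] ->.
have [tw _] := ctorus_twf h0 g0 f2 fq wf wfA tGs.
have [c [e [h1 h2 h3 h4]]] := smp_lift tw sth lth pp.
have ins v : v \in 0%N :: smp Gs th p -> v != 0%N -> v \in smp Gs th p.
  by rewrite inE => /orP[/eqP->|].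
exists (fun v p => (c p + e v p)%N), c, e; split=> //.
- by move=> v x hv n; apply: h1; apply: ins.
- by move=> v v' hv hv' n n'; apply: h2; apply: ins.
move=> _; exists Gs => // v hv n; split=> [x|G x y]; first exact: h3.
exact: h4.
Qed.

Definition lft s : nat -> nat -> nat :=
  if pselect (s \in simps h g f A K) is left hs then projT1 (cid (simp_lift hs)) else fun _ _ => 0%N.

Lemma lftP s : s \in simps h g f A K -> liftP s (lft s).
Proof. by rewrite /lft; case: pselect => // hs _; case: cid. Qed.

(** The difference of two lifts is a multiple of 20 at each common vertex and varies by at most 2
    between vertices, so it is constant; [Phi_shift] then makes [Phi] independent of the lift. *)
Lemma lift_diff s s' l l' v v' p : liftP s l -> liftP s' l' -> v \in s -> v \in s' -> v' \in s -> v' \in s' ->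
  v != 0%N -> v' != 0%N -> (l v p)%:Z - (l' v p)%:Z = (l v' p)%:Z - (l' v' p)%:Z /\ exists k, (l v p)%:Z - (l' v p)%:Z = 20 * k.
Proof.
move=> [c [e [E D _ _]]] [c' [e' [E' D' _ _]]] vs vs' ws ws' nv nw.
have := D v p vs nv; have := D v' p ws nw; rewrite (D' v p vs' nv) (D' v' p ws' nw) !E !E'.
move: (c p) (c' p) (e v p) (e v' p) (e' v p) (e' v' p); clear => x y b1 b2 b3 b4 h1 h2; split.
  by case: b1 h1 h2 => //; case: b2 => //; case: b3 => //; case: b4; lia.
exists (((x + b1) %/ 20)%N%:Z - ((y + b3) %/ 20)%N%:Z).
rewrite {1}(divn_eq (x + b1) 20) {1}(divn_eq (y + b3) 20) h2; lia.
Qed.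
End Lifts.
End SimplexLifts.

(** * The model map agrees with f / C on the support of f *)

Module ModelExact.
Import all_boot all_order all_algebra.
Import all_classical all_reals all_analysis.
Import ring lra zify.
Import LinkSystem TorusComplex ComplexShape VertexValues Compactness RootsForced PeriodicHats HatInterpolation ModelMap SimplexLifts.
Set Implicit Arguments. Unset Strict Implicit. Unset Printing Implicit Defensive.
Import Order.TTheory GRing.Theory Num.Theory.
Import numFieldNormedType.Exports.
Local Open Scope classical_set_scope.
Local Open Scope ring_scope.

Lemma small_base (R : realType) (t : R) (k : int) : `|t - 20 * k%:~R| <= 1 ->
  forall k' : int, ~ 2 < t - 20 * k'%:~R < 5.
Proof.
rewrite ler_norml => H k' H'.
have : (0 < (k - k')%:~R :> R) && ((k - k')%:~R < 1 :> R) by rewrite intrB; apply/andP; split; lra.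
by rewrite -[1]/(1%:~R) -[0]/(0%:~R) !ltr_int; lia.
Qed.

Lemma lab_base m P v p : size P = m -> p \in P -> digit v p != 3%N -> digit v p != 4%N -> labP m P v = m.+1.
Proof.
move=> sP pP n3 n4; apply/eqP; rewrite eqn_leq labs_le ltnNge; apply/negP => hle.
have /eqP e : [seq digit v x | x <- P] == pat m (labP m P v) by rewrite -labsP.
have ip : (index p P < m)%N by rewrite -sP index_mem.
have := congr1 (fun s => nth 0%N s (index p P)) e; rewrite nth_pat // (nth_map 0%N) ?sP // nth_index //.
by case: (_ < labP m P v)%N => e'; [case/negP: n4|case/negP: n3]; rewrite e'.
Qed.

Section Exact.
Variables (R : realType) (h g f q C : nat) (a d : nat -> int) (A : seq (seq nat)) (K : seq link).
Hypotheses (h0 : (0 < h)%N) (g0 : (0 < g)%N) (f2 : (2 <= f)%N) (fq : (f <= q)%N).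
Hypotheses (a0 : a 0%N = 1) (d0 : d 0%N = 1).
Notation m := h.+1.
Notation ps := (ps h g). Notation pt := (pt h).
Notation P1 := (P1 h g). Notation P2 := (P2 h g). Notation onP := (onP h g).

(** The vertices of the two reference subtori; f vanishes at all others. *)
Definition VA v := (0 < v <= MM ^ F0 h g)%N && (onP P1 v || onP P2 v).

Variables (nv : nat) (y : 'I_nv -> R) (s : seq nat) (l : nat -> nat -> nat).
Hypothesis lP : liftP h g f A K s l.
Hypothesis y0 : forall v, 0 <= y v.
Hypothesis y1 : \sum_v y v = 1.
Hypothesis supp : forall v, y v != 0 -> ((v : nat) \in s) && VA v.

Lemma VA_zero v P p : (0 < v <= MM ^ F0 h g)%N -> onP P v -> p \notin P -> digit v p = 0%N.
Proof.
move=> /andP[v0 vle] o pP; case: (ltnP p (F0 h g)) => hp.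
  by have := allP o p; rewrite mem_iota (negbTE pP) add0n => /(_ hp)/eqP.
rewrite /digit divn_small ?mod0n //; apply: leq_trans (leq_pexp2l MM_gt0 hp).
by case: (v) v0 vle.
Qed.

Lemma row_val P v k : (k <= m)%N -> fvv h g C v = rowv C m (labP m P v) ->
  ratr (nth 0 (fvv h g C v) k) = C%:R * ((labP m P v == k)%:R - (labP m P v == m.+1)%:R) :> R.
Proof.
move=> km ->; rewrite /rowv nth_mkseq //; case: eqP => [->|ne].
  have -> : (h.+2 == k) = false by rewrite gtn_eqF.
  by rewrite rmorphN /= ratr_nat /= sub0r mulrN1.
by rewrite eq_sym; case: eqP => _; rewrite ?ratr_nat ?rmorph0 /= subr0 ?mulr1 ?mulr0.
Qed.

Lemma fvv_P1 v : (0 < v <= MM ^ F0 h g)%N -> onP P1 v -> fvv h g C v = rowv C m (labP m P1 v).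
Proof. by move=> hv o; rewrite /fvv hv /fv o. Qed.

Lemma fvv_P2 v : (0 < v <= MM ^ F0 h g)%N -> onP P2 v -> fvv h g C v = rowv C m (labP m P2 v).
Proof. by move=> hv o; rewrite /fvv hv (fv_P2 (q := 1) _ h0 g0). Qed.

Lemma exists_supp : exists v, y v != 0.
Proof.
apply/existsP; apply: contraT; rewrite negb_exists => /forallP hh.
move: y1; rewrite big1 => [/eqP|v _]; first by rewrite eq_sym oner_eq0.
by have := hh v; rewrite negbK => /eqP.
Qed.

Variable v0 : 'I_nv.
Hypothesis yv0 : y v0 != 0.
(** The lift is normalised so that the coordinates of v0 are its digits. Coordinates whose digits
    are 0 at all vertices then vanish exactly, and not only modulo 20. *)
Definition lz (v p : nat) : int := (l v p)%:Z - 20 * (l v0 p %/ 20)%N%:Z.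

Lemma suppn v : y v != 0 -> (v : nat) \in s /\ (v : nat) != 0%N.
Proof. by move=> /supp/andP[-> /andP[/andP[]]]; rewrite lt0n. Qed.

Lemma lz_dvd v p : y v != 0 -> exists z, lz v p = (digit v p)%:Z + 20 * z.
Proof.
case: lP => c [e [E D _ _]] /suppn[vs vn]; exists ((l v p %/ 20)%N%:Z - (l v0 p %/ 20)%N%:Z).
rewrite /lz (D v p vs vn) -E {1}(divn_eq (l v p) 20); move: (_ %/ _)%N (_ %/ _)%N (_ %% _)%N; clear; lia.
Qed.

Lemma lz_v0 p : lz v0 p = (digit v0 p)%:Z.
Proof.
case: lP => c [e [E D _ _]]; have [vs vn] := suppn yv0.
rewrite /lz (D v0 p vs vn) -E {1}(divn_eq (l v0 p) 20); move: (_ %/ _)%N (_ %% _)%N; clear; lia.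
Qed.

Lemma lz_chain v w : y v != 0 -> y w != 0 -> (forall p, lz v p <= lz w p <= lz v p + 1) \/ (forall p, lz w p <= lz v p <= lz w p + 1).
Proof.
case: lP => c [e [E _ Ch _]] /suppn[vs vn] /suppn[ws wn].
case: (Ch v w vs ws vn wn) => H; [left|right] => p; have := H p; rewrite /lz !E;
  move: (c p) (e v p) (e w p) (_ %/ _)%N; clear => x [] [] z hh; lia.
Qed.

Lemma lz_near v w p : y v != 0 -> y w != 0 -> `|lz v p - lz w p| <= 1.
Proof. by move=> yv yw; case: (lz_chain yv yw) => /(_ p); lia. Qed.

Lemma digit_lt20 v p : (digit v p < 20)%N.
Proof. by rewrite /digit MME ltn_pmod. Qed.

Definition th' p : R := \sum_v y v * (lz v p)%:~R.

Lemma th_shift k : Phi h g q a d (fun p => \sum_v y v * (l v p)%:R) k = Phi h g q a d th' k.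
Proof.
rewrite -(Phi_shift h g q a d th' (fun p => (l v0 p %/ 20)%N%:Z) k).
apply: eq_Phi => p; rewrite /th' -[X in _ + X](sum_y y1) -big_split; apply: eq_bigr => v _ /=.
rewrite -mulrDr; congr (_ * _); rewrite /lz intrB intrM -!pmulrn; ring.
Qed.

Lemma th_zero p : (forall v, y v != 0 -> digit v p = 0%N) -> th' p = 0.
Proof.
move=> z; rewrite /th' big1 // => v _; case: (eqVneq (y v) 0) => [->|yv]; first by rewrite mul0r.
have [k e] := lz_dvd p yv; have := lz_near p yv yv0; rewrite lz_v0 z // in e *; rewrite z // => h1.
have -> : lz v p = 0 by move: e h1; clear; lia.
by rewrite mulr0.
Qed.

Lemma th_small p v1 : y v1 != 0 -> digit v1 p = 0%N -> forall k : int, ~ 2 < th' p - 20 * k%:~R < 5.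
Proof.
move=> yv1 z; have [k e] := lz_dvd p yv1; rewrite z add0r in e.
apply: (@small_base _ _ k); have -> : th' p - 20 * k%:~R = \sum_v y v * (lz v p - 20 * k)%:~R.
  rewrite -[20 * _](sum_y y1) -sumrB; apply: eq_bigr => v _; rewrite -mulrBr intrB intrM; congr (_ * (_ - _)).
apply: le_trans (ler_norm_sum _ _ _) _; rewrite -[leRHS](sum_y y1); apply: ler_sum => v _.
rewrite normrM ger0_norm //; case: (eqVneq (y v) 0) => [->|yv]; first by rewrite !mul0r.
by rewrite ler_wpM2l // -intr_norm -[1]/(1%:~R) ler_int -e lz_near.
Qed.

Lemma digit_small p v v1 : y v1 != 0 -> digit v1 p = 0%N -> y v != 0 -> digit v p != 3%N /\ digit v p != 4%N.
Proof.
move=> yv1 z yv; have [k e] := lz_dvd p yv1; have [k' e'] := lz_dvd p yv; have := lz_near p yv yv1.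
have := digit_lt20 v p; rewrite z in e; move: (digit v p) e e' => x e e'; rewrite e e'; clear; lia.
Qed.

Lemma block P k (kP : (k <= m)%N) : size P = m -> (forall v, y v != 0 -> fvv h g C v = rowv C m (labP m P v)) ->
  \sum_v y v * ratr (nth 0 (fvv h g C v) k) = C%:R * qv m k (fun j => th' (nth 0%N P j)).
Proof.
move=> sP hv.
have hatE k' : (k' <= m)%N -> hat m k' (fun j => th' (nth 0%N P j)) = \sum_v y v * (labP m P v == k')%:R.
  move=> km; have ch : chain_on m y (fun v j => lz v (nth 0%N P j)).
    by move=> v w yv yw; case: (lz_chain yv yw) => H; [left|right] => j _; exact: H.
  rewrite (hat_weight y0 y1 k' ch) /piv big_mkcond; apply: eq_bigr => v _.
  case: (eqVneq (y v) 0) => [->|yv]; first by rewrite mul0r if_same.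
  rewrite (_ : isv _ _ _ _ = (labP m P v == k')); first by case: (_ == _); rewrite ?mulr1 ?mulr0.
  rewrite /labP labsP //; apply/forallP/eqP => [H|e j].
    apply: (@eq_from_nth _ 0%N); rewrite size_map ?size_pat // sP // => j jm.
    rewrite (nth_map 0%N) ?sP // nth_pat //; have := H (Ordinal jm); rewrite /vk /=.
    have [z ->] := lz_dvd (nth 0%N P j) yv; have := digit_lt20 v (nth 0%N P j).
    move: (digit v _) (j < k')%N => x b hx /dvdzP[w]; move: hx; case: b; clear; lia.
  have [z ->] := lz_dvd (nth 0%N P j) yv; have := congr1 (fun s => nth 0%N s j) e.
  rewrite nth_pat // (nth_map 0%N) ?sP // => ->; rewrite /vk; apply/dvdzP; exists z; lia.
have sE : 1 - shat m (fun j => th' (nth 0%N P j)) = \sum_v y v * (labP m P v == m.+1)%:R.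
  rewrite /shat (eq_bigr (fun k : 'I_m.+1 => \sum_v y v * (labP m P v == k)%:R)); last first.
    by move=> k' _; rewrite hatE // -ltnS.
  rewrite exchange_big -{1}y1 -sumrB; apply: eq_bigr => v _ /=; rewrite -mulr_sumr.
  have := labs_le m [seq digit v x | x <- P]; rewrite -/(labP m P v) leq_eqVlt ltnS.
  case: eqP => [->|ne] /= hl.
    by rewrite big1 ?mulr0 ?subr0 ?mulr1 // => i _; rewrite gtn_eqF.
  have hl' : (labP m P v < m.+1)%N by [].
  rewrite (bigD1 (Ordinal hl')) //= eqxx big1 ?addr0 ?mulr1 ?mulr0 ?subrr // => i ni.
  by rewrite (_ : (_ == _) = false) //; apply: contraNF ni => /eqP e; apply/eqP/val_inj.
rewrite /qv sE hatE // (max_idPr _); last by apply: sumr_ge0 => v _; rewrite mulr_ge0 // ler0n.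
rewrite -sumrB mulr_sumr; apply: eq_bigr => v _; case: (eqVneq (y v) 0) => [->|yv]; first by rewrite !mul0r subrr mulr0.
by rewrite (row_val kP (hv v yv)); ring.
Qed.

Lemma size_P1 : size P1 = m. Proof. by rewrite /= size_iota prednK. Qed.
Lemma size_P2 : size P2 = m. Proof. by rewrite /= size_iota prednK. Qed.

Lemma zero_both p : p \notin P1 -> p \notin P2 -> th' p = 0.
Proof.
move=> n1 n2; apply: th_zero => v /supp/andP[_ /andP[hv /orP[op|op]]]; [exact: (VA_zero hv op n1)|exact: (VA_zero hv op n2)].
Qed.

Lemma LcE : Lc h g q d th' = th' (ps 0).
Proof.
have q0 : (0 < q)%N by apply: leq_trans fq; apply: leq_trans f2.
rewrite /Lc (bigD1 (Ordinal q0)) //= d0 mul1r big1 ?addr0 // => j nj.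
have j1 : (0 < j)%N by rewrite lt0n; apply: contraNneq nj => e; apply/eqP/val_inj.
rewrite zero_both ?mulr0 //; rewrite !inE ?mem_C0 ?mem_C1 /TorusComplex.ps /TorusComplex.pt /pr; move: (nat_of_ord j) j1; clear -h0 g0; lia.
Qed.

Lemma WcE : Wc h g a th' = th' (pt 0).
Proof.
rewrite /Wc (bigD1 (Ordinal g0)) //= a0 mul1r big1 ?addr0 // => j nj.
have j1 : (0 < j)%N by rewrite lt0n; apply: contraNneq nj => e; apply/eqP/val_inj.
have jg := ltn_ord j.
rewrite zero_both ?mulr0 //; rewrite !inE ?mem_C0 ?mem_C1 /TorusComplex.ps /TorusComplex.pt /pr; move: (nat_of_ord j) j1 jg; clear -h0; lia.
Qed.

Lemma z2E k : qv m k (z2 h g q d th') = qv m k (fun j => th' (nth 0%N P2 j)).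
Proof.
apply: eq_qv => -[|[|j]] jm; rewrite /z2 /= ?LcE //; rewrite (nth_map 0%N) // size_iota; move: jm; clear -h0; lia.
Qed.

Lemma z1_nth j : (0 < j < m)%N -> z1 h g q a d th' j = th' (nth 0%N P1 j).
Proof.
case: j => [|[|j]] jm; rewrite /z1 /= ?WcE //; rewrite (nth_map 0%N) // size_iota; move: jm; clear -h0; lia.
Qed.

Lemma base0 k z j : (k <= m)%N -> (j < m)%N -> z j = 0 -> qv m k z = -1 :> R.
Proof.
move=> km jm e; apply: qv_base => //; exists j => // k'; apply: (@small_base _ _ 0).
by rewrite e mulr0 subr0 normr0 ler01.
Qed.

(** If all vertices lie on one of the two subtori, the other block is at its base value and [block]
    applies. Otherwise each list contains a coordinate that is 0 at some vertex, hence within 1 of 0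
    at all of them. No vertex then has a pattern label, and both sides are -C. *)
Lemma exact_plmap k : (k <= m)%N ->
  \sum_v y v * ratr (nth 0 (fvv h g C v) k) = C%:R * Phi h g q a d (fun p => \sum_v y v * (l v p)%:R) k.
Proof.
move=> km; rewrite th_shift.
have vr v : y v != 0 -> (0 < v <= MM ^ F0 h g)%N by move=> /supp/andP[_ /andP[]].
have [all1|/existsNP[v1 /not_implyP[yv1 n1]]] := pselect (forall v, y v != 0 -> onP P1 v).
  have z p : p \notin P1 -> th' p = 0.
    by move=> n; apply: th_zero => v yv; apply: (VA_zero (vr v yv) (all1 v yv) n).
  have pr0 : th' pr = 0 by apply: z; rewrite !inE mem_C0 /TorusComplex.ps /TorusComplex.pt /pr; clear -h0; lia.
  rewrite (block km size_P1); last by move=> v yv; apply: fvv_P1; [exact: vr|exact: all1].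
  rewrite /Phi (@base0 _ (z2 h g q d th') 1) // subrK; congr (_ * _); apply: eq_qv => -[|j] jm.
    by rewrite /z1 /= mu_pr0 // mulr0 subr0 LcE.
  by rewrite z1_nth.
have [all2|/existsNP[v2 /not_implyP[yv2 n2]]] := pselect (forall v, y v != 0 -> onP P2 v).
  have z p : p \notin P2 -> th' p = 0.
    by move=> n; apply: th_zero => v yv; apply: (VA_zero (vr v yv) (all2 v yv) n).
  have pt0 : th' (pt 0) = 0 by apply: z; rewrite !inE mem_C1 /TorusComplex.ps /TorusComplex.pt /pr; clear -h0 g0; lia.
  rewrite (block km size_P2); last by move=> v yv; apply: fvv_P2; [exact: vr|exact: all2].
  by rewrite /Phi (@base0 _ (z1 h g q a d th') 1) ?z1_nth // z2E addrAC addNr add0r.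
have o1 : onP P2 v1 by have /andP[_ /andP[_ /orP[/n1|]]] := supp yv1.
have o2 : onP P1 v2 by have /andP[_ /andP[_ /orP[|/n2]]] := supp yv2.
have pick P v : ~ onP P v -> exists2 p, p \notin P & digit v p != 0%N.
  by move=> /negP; rewrite -has_predC => /hasP[p _ /=]; rewrite negb_or => /andP[pn dn]; exists p.
have [p pn dp] := pick _ _ n1; have [p' pn' dp'] := pick _ _ n2.
have p2 : p \in P2 by apply: contraNT dp => n; rewrite (VA_zero (vr _ yv1) o1 n).
have p1 : p' \in P1 by apply: contraNT dp' => n; rewrite (VA_zero (vr _ yv2) o2 n).
have zp : digit v2 p = 0%N by apply: (VA_zero (vr _ yv2) o2 pn).
have zp' : digit v1 p' = 0%N by apply: (VA_zero (vr _ yv1) o1 pn').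
have -> : \sum_v y v * ratr (nth 0 (fvv h g C v) k) = - C%:R.
  rewrite -[RHS](sum_y y1); apply: eq_bigr => v _; case: (eqVneq (y v) 0) => [->|yv]; first by rewrite !mul0r.
  congr (_ * _); have /andP[_ /andP[hv /orP[op|op]]] := supp yv.
    have [b3 b4] := digit_small yv1 zp' yv.
    by rewrite (row_val km (fvv_P1 hv op)) (lab_base size_P1 p1 b3 b4) eqxx gtn_eqF // sub0r mulrN1.
  have [b3 b4] := digit_small yv2 zp yv.
  by rewrite (row_val km (fvv_P2 hv op)) (lab_base size_P2 p2 b3 b4) eqxx gtn_eqF // sub0r mulrN1.
rewrite /Phi z2E (qv_base (m := m) (z := fun j => th' (nth 0%N P2 j))) //; last first.
  by exists (index p P2); rewrite ?nth_index //; [rewrite -size_P2 index_mem|exact: th_small zp].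
rewrite (qv_base (m := m) (z := z1 h g q a d th')) //; first by rewrite subrK mulrN1.
have ip : (0 < index p' P1 < m)%N.
  rewrite -size_P1 index_mem p1 andbT lt0n; apply: contraNneq pn' => e.
  by rewrite -(nth_index 0%N p1) e /= mem_head.
exists (index p' P1); first by case/andP: ip.
by rewrite z1_nth // nth_index //; exact: th_small zp'.
Qed.
End Exact.
End ModelExact.

(** * Small perturbations of f without zeros *)

Module Perturbation.
Import all_boot all_order all_algebra.
Import all_classical all_reals all_analysis.
Import ring lra zify.
Import LinkSystem TorusComplex ComplexShape VertexValues Compactness RootsForced PeriodicHats HatInterpolation ModelMap SimplexLifts ModelExact.
Set Implicit Arguments. Unset Strict Implicit. Unset Printing Implicit Defensive.
Import Order.TTheory GRing.Theory Num.Theory.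
Import numFieldNormedType.Exports.
Local Open Scope classical_set_scope.
Local Open Scope ring_scope.

Section Perturb.
Variables (R : realType) (h g f q C : nat) (a d : nat -> int) (A : seq (seq nat)) (K : seq link).
Hypotheses (h0 : (0 < h)%N) (g0 : (0 < g)%N) (f2 : (2 <= f)%N) (fq : (f <= q)%N).
Hypotheses (a0 : a 0%N = 1) (d0 : d 0%N = 1).
Hypothesis wf : sys_wf f g [::] K.
Hypothesis wfA : all (add_wf q) A.
Hypothesis satAK : sat A K a d.
Variables (dl ep : R).
Hypotheses (dl0 : 0 < dl) (dl2 : dl <= 1 / 2) (ep0 : 0 < ep).
Notation m := h.+1.
Notation I := (theI h g f q C A K).
Notation nv := (nverts I).
Notation VA := (VA h g).
Notation Phi := (Phi h g q a d).
Implicit Types (x : 'rV[R]_nv) (l : nat -> nat -> nat).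

Definition wA x : R := \sum_(v < nv) x ord0 v * (VA v)%:R.
Definition phi x : R := Num.max 0 (1 - wA x / dl).
(** Weights in which the vertices off the support of f fade out as the weight [wA] of the support
    grows to [dl]; beyond that only the support counts, and the model map agrees with f / C. *)
Definition uu x (v : 'I_nv) : R := x ord0 v * (if VA v then 1 else phi x).
Definition u0 x : R := \sum_(v < nv) uu x v * (v == 0%N :> nat)%:R.
Definition SS x : R := \sum_(v < nv) uu x v * (v != 0%N :> nat)%:R.
Definition YY l x p : R := \sum_(v < nv) uu x v * ((v != 0%N :> nat)%:R * (l v p)%:R).
Definition th l x p : R := YY l x p / Num.max (SS x) (dl / 2).
(* Written homogeneously in the weights [uu], which retract onto the support of f where [dl <= wA]. *)
Definition GG l x k : R := Num.max 0 (SS x - u0 x) * Phi (th l x) k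
  - Num.min (SS x + u0 x) (2 * u0 x) * zst R m k.
(** Shrinks f to 0 where [wA] is at most [dl], so that only the perturbing term matters in the
    region where it differs from the model of f. *)
Definition coef x : R := Num.max 0 (wA x - dl) / Num.max (wA x) dl.
Definition gg l x : 'rV[R]_m.+1 := \row_k (coef x * plmap m.+1 I x ord0 k + ep * GG l x k).

Section Continuity.
Variables (T : Type) (F : set_system T) (FF : Filter F) (X : T -> 'rV[R]_nv) (x0 : 'rV[R]_nv).
Hypothesis cX : forall v, (fun t => X t ord0 v) @ F --> x0 ord0 v.

Lemma wA_cvg : (fun t => wA (X t)) @ F --> wA x0.
Proof. by apply: big_sum_cvg => v; apply: cvgM => //; exact: cvg_cst. Qed.

Lemma uu_cvg v : (fun t => uu (X t) v) @ F --> uu x0 v.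
Proof.
rewrite /uu; apply: cvgM => //; case: ifP => _; first exact: cvg_cst.
apply: max_cvg; first exact: cvg_cst.
by apply: cvgB; [exact: cvg_cst|apply: cvgM; [exact: wA_cvg|exact: cvg_cst]].
Qed.

Lemma SS_cvg : (fun t => SS (X t)) @ F --> SS x0.
Proof. by apply: big_sum_cvg => v; apply: cvgM; [exact: uu_cvg|exact: cvg_cst]. Qed.

Lemma u0_cvg : (fun t => u0 (X t)) @ F --> u0 x0.
Proof. by apply: big_sum_cvg => v; apply: cvgM; [exact: uu_cvg|exact: cvg_cst]. Qed.

Lemma coef_cvg : (fun t => coef (X t)) @ F --> coef x0.
Proof.
apply: cvgM; first by apply: max_cvg; [exact: cvg_cst|apply: cvgB; [exact: wA_cvg|exact: cvg_cst]].
apply: cvgV; first by rewrite gt_eqF // lt_max dl0 orbT.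
by apply: max_cvg; [exact: wA_cvg|exact: cvg_cst].
Qed.

Lemma plmap_cvg k : (fun t => plmap m.+1 I (X t) ord0 k) @ F --> plmap m.+1 I x0 ord0 k.
Proof.
rewrite mxE; under eq_fun do rewrite mxE.
by apply: big_sum_cvg => v; apply: cvgM => //; exact: cvg_cst.
Qed.

Lemma th_cvg l p : (fun t => th l (X t) p) @ F --> th l x0 p.
Proof.
apply: cvgM; first by apply: big_sum_cvg => v; apply: cvgM; [exact: uu_cvg|exact: cvg_cst].
apply: cvgV; first by rewrite gt_eqF // lt_max divr_gt0 ?orbT.
by apply: max_cvg; [exact: SS_cvg|exact: cvg_cst].
Qed.

Lemma GG_cvg l k : (fun t => GG l (X t) k) @ F --> GG l x0 k.
Proof.
apply: cvgB; apply: cvgM.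
- by apply: max_cvg; [exact: cvg_cst|apply: cvgB; [exact: SS_cvg|exact: u0_cvg]].
- by apply: (Phi_cvg FF) => p; exact: th_cvg.
- apply: min_cvg; first by apply: cvgD; [exact: SS_cvg|exact: u0_cvg].
  by apply: cvgM; [exact: cvg_cst|exact: u0_cvg].
exact: cvg_cst.
Qed.

Lemma ggk_cvg l (k : 'I_m.+1) : (fun t => coef (X t) * plmap m.+1 I (X t) ord0 k + ep * GG l (X t) k) @ F -->
  coef x0 * plmap m.+1 I x0 ord0 k + ep * GG l x0 k.
Proof.
apply: cvgD; apply: cvgM; [exact: coef_cvg|exact: plmap_cvg|exact: cvg_cst|exact: GG_cvg].
Qed.
End Continuity.

Lemma gg_cont l : continuous (gg l).
Proof.
apply: row_continuous => k x.
exact: (@ggk_cvg _ (nbhs x) (nbhs_filter x) id x (fun v => @entry_continuous R nv v x) l k).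
Qed.

Section Face.
Variables (s : seq nat) (x : 'rV[R]_nv).
Hypothesis sI : s \in simps h g f A K.
Hypothesis xs : face s x.

Lemma x_ge0 v : 0 <= x ord0 v. Proof. by case: xs. Qed.
Lemma x_sum : \sum_v x ord0 v = 1. Proof. by case: xs => _ []. Qed.
Lemma x_supp v : x ord0 v != 0 -> (v : nat) \in s. Proof. by case: xs => _ [_]; apply. Qed.

Lemma wA01 : 0 <= wA x <= 1.
Proof.
apply/andP; split; first by apply: sumr_ge0 => v _; rewrite mulr_ge0 ?x_ge0 ?ler0n.
rewrite -x_sum; apply: ler_sum => v _; rewrite -[leRHS]mulr1 ler_wpM2l ?x_ge0 //.
by case: (VA v); rewrite ?ler01.
Qed.

Lemma phi01 : 0 <= phi x <= 1.
Proof.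
rewrite /phi le_max lexx ge_max ler01 /= gerBl divr_ge0 //; last exact: ltW.
by case/andP: wA01.
Qed.

Lemma uu_ge0 v : 0 <= uu x v.
Proof. by rewrite mulr_ge0 ?x_ge0 //; case: ifP => _; rewrite ?ler01 //; case/andP: phi01. Qed.

Lemma uu_supp v : uu x v != 0 -> (v : nat) \in s.
Proof. by rewrite mulf_eq0 negb_or => /andP[/x_supp]. Qed.

Lemma SS_ge0 : 0 <= SS x.
Proof. by apply: sumr_ge0 => v _; rewrite mulr_ge0 ?uu_ge0 ?ler0n. Qed.

Lemma u0_ge0 : 0 <= u0 x.
Proof. by apply: sumr_ge0 => v _; rewrite mulr_ge0 ?uu_ge0 ?ler0n. Qed.

Lemma tauE : SS x + u0 x = wA x + phi x * (1 - wA x).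
Proof.
have -> : 1 - wA x = \sum_v (x ord0 v - x ord0 v * (VA v)%:R) by rewrite -{1}x_sum -sumrB.
rewrite /SS /u0 -big_split /= mulr_sumr -big_split /=; apply: eq_bigr => v _.
rewrite /uu; case: (VA v); case: (_ == _) => /=; ring.
Qed.

(** For [wA] = t dl with t < 1 the excess is (1 - t)(1 - dl (1 + t)), which is nonnegative because
    dl <= 1/2. *)
Lemma tau_ge : dl <= SS x + u0 x.
Proof.
rewrite tauE; have /andP[w0 w1] := wA01; case: (leP dl (wA x)) => hw.
  have /andP[p0 _] := phi01; have : 0 <= phi x * (1 - wA x) by rewrite mulr_ge0 // subr_ge0.
  lra.
pose t := wA x / dl; have et : wA x = t * dl by rewrite /t divfK ?gt_eqF.
have t1 : t < 1 by rewrite /t ltr_pdivrMr ?mul1r.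
have t0 : 0 <= t by rewrite divr_ge0 // ltW.
have -> : phi x = 1 - t by apply/max_idPr; rewrite subr_ge0 ltW.
rewrite et -subr_ge0.
have -> : t * dl + (1 - t) * (1 - t * dl) - dl = (1 - t) * (1 - dl * (1 + t)) by ring.
rewrite mulr_ge0 ?subr_ge0 ?(ltW t1) //; apply: le_trans (_ : 1 / 2 * 2 <= 1); last by lra.
by apply: ler_pM; [exact: ltW|lra|by []|lra].
Qed.

Lemma tau_le : SS x + u0 x <= 1.
Proof.
rewrite tauE; have /andP[w0 w1] := wA01; have /andP[p0 p1] := phi01.
have : phi x * (1 - wA x) <= 1 * (1 - wA x) by rewrite ler_wpM2r // subr_ge0.
lra.
Qed.

Lemma SS_max : u0 x <= SS x -> Num.max (SS x) (dl / 2) = SS x.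
Proof. by move=> le; apply/max_idPl; have := tau_ge; lra. Qed.

Lemma SS_supp : SS x != 0 -> exists v : 'I_nv, uu x v != 0 /\ v != 0%N :> nat.
Proof.
move=> n; apply: contrapT => H; case/negP: n; apply/eqP; apply: big1 => v _.
case: (eqVneq (v : nat) 0%N) => nv; first by rewrite mulr0.
case: (eqVneq (uu x v) 0) => uv; first by rewrite uv mul0r.
by case: H; exists v.
Qed.

Lemma GG_bound l k : (k <= m)%N -> `|GG l x k| <= 5.
Proof.
move=> km; apply: le_trans (ler_normB _ _) _.
have S0 := SS_ge0; have U0 := u0_ge0; have T1 := tau_le.
have b1 : `|Num.max 0 (SS x - u0 x) * Phi (th l x) k| <= 1 * 3.
  rewrite normrM; apply: ler_pM => //; last exact: Phi_bound.
  by rewrite ger0_norm ?le_max ?lexx // ge_max ler01; lra.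
have z2 : `|zst R m k| <= 2.
  rewrite /zst; case: ifP => _; first by rewrite normr1; lra.
  rewrite ger0_norm ?divr_ge0 // ler_pdivrMr ?ltr0n //= -[leLHS]mulr1 ler_wpM2l // ler1n //.
have b2 : `|Num.min (SS x + u0 x) (2 * u0 x) * zst R m k| <= 1 * 2.
  rewrite normrM; apply: ler_pM => //; rewrite ger0_norm ?ge_min ?T1 // le_min; lra.
lra.
Qed.

(** On a common face the two lifts differ by constant multiples of 20, which [Phi] does not see.
    Where the apex outweighs the base, [Phi] is multiplied by 0. *)
Lemma gg_agree s' : s' \in simps h g f A K -> face s' x ->
  gg (lft h0 g0 f2 fq wf wfA s) x = gg (lft h0 g0 f2 fq wf wfA s') x.
Proof.
move=> sI' xs'; set l := lft _ _ _ _ _ _ s; set l' := lft _ _ _ _ _ _ s'.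
apply/rowP => k; rewrite mxE [RHS]mxE; suff -> : GG l x k = GG l' x k by [].
rewrite /GG; congr (_ - _).
case: (leP (SS x - u0 x) 0) => hS; first by rewrite ?(max_idPl hS) !mul0r.
congr (_ * _); have SSm := SS_max _; rewrite -subr_ge0 in SSm.
have [v [uv vn]] : exists v : 'I_nv, uu x v != 0 /\ v != 0%N :> nat.
  by apply: SS_supp; rewrite gt_eqF //; have := u0_ge0; lra.
have S0 : SS x != 0 by rewrite gt_eqF //; have := u0_ge0; lra.
have lP := lftP h0 g0 f2 fq wf wfA sI; have lP' := lftP h0 g0 f2 fq wf wfA sI'.
have inf' w : uu x w != 0 -> (w : nat) \in s'.
  by rewrite mulf_eq0 negb_or => /andP[n _]; case: xs' => _ [_]; apply.
have /choice[kap hk] p := (lift_diff p lP lP' (uu_supp uv) (inf' v uv) (uu_supp uv) (inf' v uv) vn vn).2.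
rewrite -(Phi_shift h g q a d (th l' x) kap); apply: eq_Phi => p; rewrite /th SSm ?(ltW hS) //.
apply: (mulIf S0); rewrite mulrDl !divfK //.
rewrite [20 * _ * SS x](_ : _ = \sum_(w < nv) uu x w * ((w != 0%N :> nat)%:R * (20 * kap p)%:~R)); last first.
  by rewrite mulrC /SS mulr_suml; apply: eq_bigr => w _; rewrite -mulrA intrM.
rewrite /YY -big_split /=; apply: eq_bigr => w _; rewrite -mulrDr.
case: (eqVneq (uu x w) 0) => uw; first by rewrite uw !mul0r.
case: (eqVneq (w : nat) 0%N) => wn; first by rewrite !mul0r addr0.
have [e _] := lift_diff p lP lP' (uu_supp uw) (inf' w uw) (uu_supp uv) (inf' v uv) wn vn.
rewrite !mul1r; congr (_ * _); have := hk p; rewrite -/l -/l' -e => e'.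
by rewrite -[(l w p)%:R]/((l w p)%:Z%:~R) -[(l' w p)%:R]/((l' w p)%:Z%:~R) -e' -intrD; congr (_%:~R); rewrite addrC subrK.
Qed.

Lemma plmap_VA k : plmap m.+1 I x ord0 k = \sum_(v < nv) x ord0 v * (VA v)%:R * ratr (nth 0 (fvv h g C v) k).
Proof.
have q0 : (0 < q)%N by apply: leq_trans fq; apply: leq_trans f2.
rewrite mxE; apply: eq_bigr => v _.
have vlt : (v < size (ivals h g q C))%N by exact: ltn_ord.
rewrite nth_ivals //.
case hv: (VA v); first by rewrite mulr1.
rewrite mulr0 mul0r (_ : nth 0 _ _ = 0) ?rmorph0 ?mulr0 //.
move: hv; rewrite /ModelExact.VA /fvv; case: (0 < v <= MM ^ F0 h g)%N => /=; last by rewrite /zrow nth_nseq if_same.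
by move/norP => [/negbTE n1 /negbTE n2]; rewrite /fv n1 n2 /zrow nth_nseq if_same.
Qed.

(** Here the cut-off [phi] is 0, so [th] is computed from the support vertices alone, with their
    weights divided by [wA]. *)
Lemma plmap_exact l k : liftP h g f A K s l -> dl <= wA x -> (k <= m)%N -> forall k' : 'I_m.+1, k' = k :> nat ->
  plmap m.+1 I x ord0 k' = C%:R * wA x * Phi (th l x) k.
Proof.
move=> lP hw km k' ek; have w0 : 0 < wA x by exact: lt_le_trans hw.
have ph : phi x = 0 by apply/max_idPl; rewrite subr_le0 ler_pdivlMr // mul1r.
pose y (v : 'I_nv) := x ord0 v * (VA v)%:R / wA x.
have uy v : uu x v * (v != 0%N :> nat)%:R = y v * wA x.
  have -> : y v * wA x = x ord0 v * (VA v)%:R by rewrite /y divfK // gt_eqF.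
  rewrite /uu ph; case hv: (VA v); rewrite ?mulr0 ?mul0r //.
  by rewrite /ModelExact.VA -lt0n in hv *; case/andP: hv => /andP[-> _] _; rewrite !mulr1.
have y1 : \sum_v y v = 1 by rewrite -mulr_suml divff ?gt_eqF.
have y0 v : 0 <= y v by rewrite divr_ge0 ?(ltW w0) // mulr_ge0 ?x_ge0 ?ler0n.
have sy v : y v != 0 -> ((v : nat) \in s) && VA v.
  rewrite /y !mulf_eq0 !negb_or => /andP[/andP[xv Vv] _]; rewrite x_supp //=.
  by move: Vv; case: (VA v); rewrite ?eqxx.
have SW : SS x = wA x.
  by rewrite /SS (eq_bigr (fun v => y v * wA x)) => [|v _]; rewrite ?uy // -mulr_suml y1 mul1r.
have [v0 yv0] := exists_supp y1.
have := exact_plmap C h0 g0 f2 fq a0 d0 lP y0 y1 sy yv0 km.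
rewrite plmap_VA ek => e.
rewrite mulrAC (@eq_Phi _ _ _ _ _ _ _ (fun p => \sum_v y v * (l v p)%:R)).
  rewrite -e mulr_suml; apply: eq_bigr => v _; rewrite /y; field; exact: lt0r_neq0.
move=> p; rewrite /th SW (max_idPl _); last by move: hw dl0; lra.
rewrite /YY mulr_suml; apply: eq_bigr => v _; rewrite mulrA uy; field; exact: lt0r_neq0.
Qed.

Lemma plmap_le k : `|plmap m.+1 I x ord0 k| <= C%:R * wA x.
Proof.
rewrite plmap_VA; apply: le_trans (ler_norm_sum _ _ _) _; rewrite /wA mulr_sumr; apply: ler_sum => v _.
rewrite normrM ger0_norm ?mulr_ge0 ?x_ge0 ?ler0n // [leRHS]mulrC ler_wpM2l ?mulr_ge0 ?x_ge0 ?ler0n //.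
have rb c j : `|ratr (nth 0 (rowv C m c) j)| <= C%:R :> R.
  case: (ltnP j m.+1) => hj; last by rewrite nth_default ?size_mkseq // rmorph0 normr0.
  rewrite /rowv nth_mkseq //; case: ifP => _; first by rewrite rmorphN /= normrN ratr_nat normr_nat.
  by case: ifP => _; rewrite ?ratr_nat ?normr_nat // rmorph0 normr0.
rewrite /fvv; case: (_ && _); last by rewrite /zrow nth_nseq if_same rmorph0 normr0.
by rewrite /fv; case: ifP => _; [|case: ifP => _]; rewrite ?rb // /zrow nth_nseq if_same rmorph0 normr0.
Qed.

Lemma gg_close l k : `|gg l x ord0 k - plmap m.+1 I x ord0 k| <= C%:R * dl + ep * 5.
Proof.
rewrite mxE addrAC; apply: le_trans (ler_normD _ _) _; apply: lerD; last first.
  by rewrite normrM gtr0_norm // ler_wpM2l ?(ltW ep0) // GG_bound // -ltnS.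
have /andP[w0 w1] := wA01; have := plmap_le k; move: (plmap _ _ _ _ _) => P hP.
rewrite /coef; case: (leP dl (wA x)) => hw.
  have wp : 0 < wA x by exact: lt_le_trans hw.
  rewrite (max_idPr _) ?subr_ge0 //.
  have -> : (wA x - dl) / wA x * P - P = - (dl / wA x * P) by field; exact: lt0r_neq0.
  rewrite normrN normrM ger0_norm ?divr_ge0 ?(ltW dl0) // mulrAC ler_pdivrMr // -mulrA mulrCA.
  by rewrite ler_wpM2l ?(ltW dl0).
rewrite (max_idPl _) ?mul0r ?sub0r ?normrN; last by rewrite subr_le0 ltW.
by apply: le_trans hP _; rewrite ler_wpM2l ?ler0n // ltW.
Qed.

(** Where [wA] is at least [dl], the vector is a positive multiple of [Phi]. Elsewhere only [GG]
    remains: near the apex it is a nonzero multiple of [zst], and with u0 = 0 a nonzero multiple of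
    [Phi]. In between a zero would put [Phi] on the ray over a coned torus. *)
Lemma gg_neq0 : gg (lft h0 g0 f2 fq wf wfA s) x != 0.
Proof.
set l := lft _ _ _ _ _ _ s; have lP : liftP h g f A K s l by exact: lftP.
apply/eqP => /rowP g_0; have S0 := SS_ge0; have U0 := u0_ge0; have T0 := tau_ge.
have g0' k : (k <= m)%N -> forall k' : 'I_m.+1, k' = k :> nat -> coef x * plmap m.+1 I x ord0 k' + ep * GG l x k = 0.
  by move=> km k' ek; have := g_0 k'; rewrite !mxE ek.
have /andP[w0 w1] := wA01.
case: (leP dl (wA x)) => hw.
  have wp : 0 < wA x by exact: lt_le_trans hw.
  have ph : phi x = 0 by apply/max_idPl; rewrite subr_le0 ler_pdivlMr // mul1r.
  have u00 : u0 x = 0.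
    apply: big1 => v _; rewrite /uu ph; case hv: (VA v); rewrite ?mulr0 ?mul0r //.
    by move: hv; rewrite /ModelExact.VA lt0n; case: (_ == _); rewrite ?mulr0.
  have SW : SS x = wA x by have := tauE; rewrite u00 ph mul0r !addr0.
  have [k km] := Phi_neq0 h0 g0 f2 fq a0 d0 (th l x); case/negP; apply/eqP.
  have := g0' k km (Ordinal (km : (k < m.+1)%N)) erefl.
  rewrite (plmap_exact lP hw km) // /GG u00 mulr0 subr0 addr0 SW (max_idPr w0) (min_idPr _) // mul0r subr0.
  set P := Phi _ k => e.
  have : (coef x * C%:R + ep) * wA x * P = 0 by rewrite -e; ring.
  move/eqP; rewrite mulf_eq0 => /orP[|/eqP //]; rewrite gt_eqF //; apply: mulr_gt0 => //.
  apply: ltr_wpDl => //; rewrite mulr_ge0 ?ler0n // divr_ge0 // ?le_max ?lexx //.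
  by rewrite w0.
have c0 : coef x = 0 by rewrite /coef (max_idPl _) ?mul0r // subr_le0 ltW.
have G0 k : (k <= m)%N -> GG l x k = 0.
  move=> km; have := g0' k km (Ordinal (km : (k < m.+1)%N)) erefl.
  by rewrite c0 mul0r add0r => /eqP; rewrite mulf_eq0 gt_eqF //= => /eqP.
case: (leP (SS x) (u0 x)) => hSU.
  have := G0 0%N isT; rewrite /GG (max_idPl _) ?mul0r ?subr_le0 // (min_idPl _); last by lra.
  by rewrite /zst /= mulr1; move: T0 dl0; lra.
have SSm := SS_max (ltW hSU); have Sp : 0 < SS x by lra.
case: (eqVneq (u0 x) 0) => u00.
  have [k km] := Phi_neq0 h0 g0 f2 fq a0 d0 (th l x); case/negP; apply/eqP.
  have := G0 k km; rewrite /GG u00 subr0 addr0 mulr0 (min_idPr S0) mul0r subr0 (max_idPr S0) => /eqP.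
  by rewrite mulf_eq0 gt_eqF //= => /eqP.
have up : 0 < u0 x by rewrite lt_def u00.
have ray : rayA h g q a d (th l x) \/ rayB h g q d (th l x).
  apply: (Phi_ray h0 g0 f2 fq a0 d0 (lam := 2 * u0 x / (SS x - u0 x))).
    by rewrite divr_gt0 ?mulr_gt0 ?subr_gt0.
  move=> k km; have := G0 k km; rewrite /GG (max_idPr _) ?subr_ge0 ?(ltW hSU) // (min_idPr _); last by lra.
  move/eqP; rewrite subr_eq0 => /eqP e; apply: (@mulfI _ (SS x - u0 x)); first by rewrite subr_eq0 gt_eqF.
  by rewrite e; field; rewrite subr_eq0 gt_eqF.
have zs : 0%N \in s.
  apply: contraT => n; case/negP: u00; apply/eqP; apply: big1 => v _.
  case: (eqVneq (uu x v) 0) => uv; first by rewrite uv mul0r.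
  case: (eqVneq (v : nat) 0%N) => v0; last by rewrite mulr0.
  by have := uu_supp uv; rewrite v0 (negbTE n).
have [c [e [_ _ _ /(_ zs)[Gs cG hG]]]] := lP.
apply: (cone_no_ray h0 g0 f2 fq a0 d0 wf wfA satAK cG _ ray); split=> [p hp|G p p' GG' hp hp'].
  rewrite /th /YY big1 ?mul0r // => v _; case: (eqVneq (uu x v) 0) => uv; first by rewrite uv mul0r.
  case: (eqVneq (v : nat) 0%N) => vn; first by rewrite mul0r mulr0.
  by have [-> // _] := hG v (uu_supp uv) vn; rewrite !mulr0.
congr (_ / _); apply: eq_bigr => v _; case: (eqVneq (uu x v) 0) => uv; first by rewrite uv !mul0r.
case: (eqVneq (v : nat) 0%N) => vn; first by rewrite !mul0r.
by have [_ H] := hG v (uu_supp uv) vn; rewrite (H G p p').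
Qed.
End Face.

Lemma perturbation : exists G : 'rV[R]_nv -> 'rV[R]_m.+1, [/\ {within realiz I, continuous G},
  forall x, realiz I x -> forall k, `|G x ord0 k - plmap m.+1 I x ord0 k| <= C%:R * dl + ep * 5 &
  forall x, realiz I x -> G x != 0].
Proof.
pose L := lft h0 g0 f2 fq wf wfA.
(* The first simplex containing x. By [gg_agree] the choice is immaterial, so on each closed simplex
   the map is given by one continuous formula. *)
pose sel (x : 'rV[R]_nv) := nth [::] I.1 (find (fun s => `[< face s x >]) I.1).
have selP x : realiz I x -> sel x \in simps h g f A K /\ face (sel x) x.
  move=> [x0 [x1 [s hs xs]]]; have hh : has (fun s => `[< face s x >]) I.1.
    by apply/hasP; exists s => //; apply/asboolP; split.
  by split; [apply: mem_nth; rewrite -has_find|apply/asboolP; exact: (nth_find [::] hh)].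
exists (fun x => gg (L (sel x)) x); split.
- rewrite realizE; apply: paste => [s _|s hs]; first exact: face_closed.
  exists (gg (L s)); first exact: gg_cont.
  move=> x xs; have [|s1 s2] := selP x; last exact: (gg_agree s1 s2 hs xs).
  by case: xs => x0 [x1 x2]; split=> //; split=> //; exists s.
- by move=> x /selP[s1 s2] k; apply: (gg_close s2).
by move=> x /selP[s1 s2]; apply: gg_neq0.
Qed.
End Perturb.
End Perturbation.

(** * Computability of the instances *)

Module InstanceCode.
Import all_boot all_order all_algebra.
Import all_classical.
Import zify.
Import Diophantine BoundedQuantifier RecursiveGraph UniversalSet LinkSystem TorusComplex ComplexShape VertexValues RootsForced.
Set Implicit Arguments. Unset Strict Implicit. Unset Printing Implicit Defensive.
Local Open Scope nat_scope.

(** One step of the coding of sequences behind [pickle]: the code of a list from the codes of its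
    head and of its tail. *)
Definition cc (a m : nat) := 2 ^ a * m.*2.+1.

Lemma pickle_seq (T : countType) (s : seq T) : pickle s = foldr cc 0 (map pickle s).
Proof. by []. Qed.

Lemma pickle_pair (T U : countType) (x : T) (y : U) :
  pickle (x, y) = cc (pickle x) (cc (pickle y) 0).
Proof. by []. Qed.

Lemma pickle_inst (s : seq (seq nat)) (t : seq (seq rat)) :
  pickle ((s, t) : inst) = cc (foldr cc 0 (map pickle s)) (cc (foldr cc 0 (map pickle t)) 0).
Proof. by rewrite pickle_pair !pickle_seq. Qed.

Lemma diof_subn s t : diof s -> diof t -> diof (fun v => s v - t v).
Proof.
move=> hs ht; apply: diof_fun2 => //.
apply: (@dio_ext _ (fun v => v 2 + v 0 = v 1 \/ (v 1 <= v 2 /\ v 0 = 0))); first by move=> v; lia.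
by dio.
Qed.

Lemma diof_cc s t : diof s -> diof t -> diof (fun v => cc (s v) (t v)).
Proof. by move=> hs ht; rewrite /cc; under eq_fun do rewrite -muln2; dio. Qed.

Lemma diof_foldr (T : Type) (s : seq T) (F : T -> (nat -> nat) -> nat) r :
  (forall x, diof (F x)) -> diof r -> diof (fun v => foldr cc (r v) [seq F x v | x <- s]).
Proof. by move=> hF hr; elim: s => //= x s IH; apply: diof_cc. Qed.

Fixpoint alld (r : seq ((nat -> nat) -> nat)) : Prop := if r is t :: r' then diof t /\ alld r' else True.

Fixpoint dotw (th W : seq nat) :=
  if th is a :: th' then if W is w :: W' then a * w + dotw th' W' else 0 else 0.

Lemma dotvE' th Gs : dotv th Gs = dotw th (map gw Gs).
Proof. by elim: th Gs => [|a th IH] [|G Gs] //=; rewrite IH. Qed.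

Lemma diof_dotw th r : alld r -> diof (fun v => dotw th [seq t v | t <- r]).
Proof.
elim: th r => [|a th IH] [|t r] /=; try by move=> _; exact: diof_const.
by move=> [ht hr]; have := IH r hr => H; dio.
Qed.

Section Chains.
Variables (Gs : (nat -> nat) -> seq (seq nat)) (r : seq ((nat -> nat) -> nat)).
Hypothesis rE : forall v, map gw (Gs v) = [seq t v | t <- r].
Hypothesis hr : alld r.

(** The shape of a torus depends only on its dimension; the parameter enters through the weights of
    the directions. A torus of fixed dimension therefore contributes a fixed number of applications
    of [cc]. *)
Lemma chainsE v : chains (Gs v) = [seq [seq (dotw th [seq t v | t <- r]).+1 | th <- ch] | ch <- shape (size r)].
Proof.
have -> : size r = size (Gs v) by rewrite -(size_map gw) rE size_map.
by apply: eq_map => ch; apply: eq_map => th; rewrite /vnum dotvE' rE.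
Qed.

Lemma diof_simplex ch : diof (fun v => foldr cc 0 [seq (dotw th [seq t v | t <- r]).+1 | th <- ch]).
Proof.
apply: (@diof_foldr _ ch (fun th v => (dotw th [seq t v | t <- r]).+1) (fun=> 0)); last exact: diof_const.
by move=> th; apply: diof_S; apply: diof_dotw.
Qed.

Lemma enc_chains R : diof R -> diof (fun v => foldr cc (R v) (map pickle (chains (Gs v)))).
Proof.
move=> hR; under eq_fun do rewrite chainsE -map_comp.
apply: (@diof_foldr _ _ (fun ch v => pickle [seq (dotw th [seq t v | t <- r]).+1 | th <- ch])) => // ch.
under eq_fun do rewrite pickle_seq map_id; exact: diof_simplex.
Qed.

Lemma enc_cone R : diof R -> diof (fun v => foldr cc (R v) (map pickle (cone (Gs v)))).
Proof.
move=> hR; rewrite /cone; under eq_fun do rewrite chainsE -!map_comp.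
apply: (@diof_foldr _ _ (fun ch v => pickle (0 :: [seq (dotw th [seq t v | t <- r]).+1 | th <- ch]))) => // ch.
under eq_fun do rewrite pickle_seq map_id /=; apply: diof_cc; [exact: diof_const|exact: diof_simplex].
Qed.
End Chains.

Lemma alld_cat r r' : alld r -> alld r' -> alld (r ++ r').
Proof. by elim: r => //= t r IH [ht hr] hr'; split=> //; exact: IH. Qed.

Lemma alld_map (F : nat -> nat) r : (forall t, diof t -> diof (fun v => F (t v))) -> alld r ->
  alld [seq (fun v => F (t v)) | t <- r].
Proof. by move=> hF; elim: r => //= t r IH [ht hr]; split; [exact: hF|exact: IH]. Qed.

Lemma alld_const (s : seq nat) : alld [seq (fun=> x) | x <- s].
Proof. by elim: s => //= x s IH; split=> //; exact: diof_const. Qed.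

Lemma gw1 x : gw [:: x] = MM ^ x. Proof. by rewrite /gw /= addn0. Qed.

Lemma diof_sum r : alld r -> diof (fun v => sumn [seq t v | t <- r]).
Proof. by elim: r => [_|t r IH /= [ht /IH hr]]; [exact: diof_const|dio]. Qed.

Lemma enc_addT h g rJ R : alld rJ -> diof R ->
  diof (fun v => foldr cc (R v) (map pickle (addT h g [seq t v | t <- rJ]))).
Proof.
move=> hJ hR; rewrite /addT; under eq_fun do rewrite map_cat foldr_cat.
have hW : alld [seq (fun v => MM ^ ps h g (t v)) | t <- rJ].
  by apply: (@alld_map (fun x => MM ^ ps h g x)) => // t ht; rewrite /ps; dio.
have hC : alld [seq (fun=> MM ^ x) | x <- pt h 0 :: C0 h].
  by have := alld_const [seq MM ^ x | x <- pt h 0 :: C0 h]; rewrite -map_comp.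
have e (s : seq nat) : map gw (single s) = [seq MM ^ x | x <- s].
  by rewrite -map_comp; apply: eq_map => x; exact: gw1.
apply: (@enc_chains (fun v => single (addU h g [seq t v | t <- rJ]))
   ([seq (fun v => MM ^ ps h g (t v)) | t <- rJ] ++ [seq (fun=> MM ^ x) | x <- pt h 0 :: C0 h])).
- by move=> v; rewrite e /addU !map_cat -!map_comp.
- exact: alld_cat.
apply: (@enc_cone (fun v => addS h g [seq t v | t <- rJ])
   ((fun v => sumn [seq t v | t <- [seq (fun v => MM ^ ps h g (t v)) | t <- rJ]]) :: [seq (fun=> MM ^ x) | x <- pt h 0 :: C0 h])) => //.
- by move=> v; rewrite /addS [LHS]map_cons e /= /gw -!map_comp.
by split=> //; exact: diof_sum.
Qed.

Lemma enc_const (T : countType) (s : seq T) R : diof R -> diof (fun v => foldr cc (R v) (map pickle s)).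
Proof. by move=> hR; apply: (@diof_foldr _ s (fun x _ => pickle x)) => // x; exact: diof_const. Qed.

Section Encoding.
Variables (h g f C : nat) (A : seq (seq nat)) (K : seq link).

(** The largest index in the unary chain is [cn f e] = f + 2 + 2e. *)
Definition the_inst e : inst := theI h g f (f + 3 + 2 * e) C (param_adds A f e) K.

Definition chain_code e := foldr cc 0 (map pickle (flatten (map (addT h g) (chain_adds f e)))).

(** The number of tori of the chain varies, so the code is built by recursion on e. [chain_adds]
    puts the newest block in front, and a step only prepends to the code obtained so far. *)
Lemma diof_chain_code t : diof t -> diof (fun v => chain_code (t v)).
Proof.
pose st i y := foldr cc y (map pickle (addT h g [:: cx f i; cn f i] ++ addT h g [:: f; cn f i; cx f i.+1])).
apply: (diof_iter (step := st)) => [i|].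
  by rewrite /chain_code /= /st !map_cat !foldr_cat.
suff : diof (fun v => st (v 0) (v 1)) by [].
rewrite /st; under eq_fun do rewrite map_cat foldr_cat.
apply: (@enc_addT h g [:: (fun v => cx f (v 0)); (fun v => cn f (v 0))]).
  by rewrite /alld /cx /cn; do ![split] => //; dio.
apply: (@enc_addT h g [:: (fun=> f); (fun v => cn f (v 0)); (fun v => cx f (v 0).+1)]).
  by rewrite /alld /cx /cn; do ![split] => //; dio.
exact: diof_var.
Qed.

Lemma diof_nseq c t : diof t -> diof (fun v => foldr cc 0 (nseq (t v) c)).
Proof.
apply: (@diof_iter (fun n => foldr cc 0 (nseq n c)) (fun _ y => cc c y)) => //.
suff : diof (fun v => cc c (v 1)) by [].
by apply: diof_cc; [exact: diof_const|exact: diof_var].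
Qed.

Lemma pickle_the_inst e : pickle (the_inst e) =
  cc (foldr cc (foldr cc (foldr cc (chain_code e) (map pickle (addT h g [:: 1; cn f e])))
       (map pickle (addT h g [:: cx f e; cn f e])))
     (map pickle (flatten [seq mainT h g i j | i <- iota 0 g, j <- iota 1 f.-1] ++ flatten (map (linkT h g) K)
        ++ flatten (map (addT h g) (A ++ base_adds f)))))
  (cc (foldr cc (foldr cc 0 (nseq (MM ^ (h + h.-1 + g + (f + 3 + 2 * e)) - MM ^ F0 h g) (pickle (zrow h))))
     (map pickle (zrow h :: [seq fv h g C v | v <- iota 1 (MM ^ F0 h g)]))) 0).
Proof.
rewrite /the_inst /theI pickle_inst; apply: (f_equal2 cc).
  rewrite /chain_code -!foldr_cat -!map_cat; congr (foldr cc 0 (map pickle _)).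
  by rewrite /simps /param_adds !map_cat !flatten_cat /= cats0 -!catA.
apply: (congr1 (fun x => cc x 0)).
by rewrite -map_nseq -foldr_cat -map_cat.
Qed.

Lemma diof_inst : diof (fun v => pickle (the_inst (v 0))).
Proof.
under eq_fun do rewrite pickle_the_inst.
apply: diof_cc.
  apply: enc_const.
  apply: (@enc_addT h g [:: (fun v => cx f (v 0)); (fun v => cn f (v 0))]).
    by rewrite /alld /cx /cn; do ![split] => //; dio.
  apply: (@enc_addT h g [:: (fun=> 1); (fun v => cn f (v 0))]).
    by rewrite /alld /cx /cn; do ![split] => //; dio.
  by apply: diof_chain_code; exact: diof_var.
apply: diof_cc; last exact: diof_const.
by apply: enc_const; apply: diof_nseq; apply: diof_subn; dio.
Qed.
End Encoding.
End InstanceCode.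

(** * Solvability of the system and robustness of f *)

Module Robust.
Import all_boot all_order all_algebra.
Import all_classical all_reals all_analysis.
Import ring lra zify.
Import Diophantine BoundedQuantifier RecursiveGraph UniversalSet LinkSystem TorusComplex ComplexShape VertexValues Compactness RootsForced Perturbation InstanceCode.
Import Order.TTheory GRing.Theory Num.Theory.
Local Open Scope ring_scope.

Set Implicit Arguments. Unset Strict Implicit. Unset Printing Implicit Defensive.

Lemma param_wf g f A K e : (2 <= f)%N -> sys_wf f g A K -> all (add_wf (f + 3 + 2 * e)) (param_adds A f e).
Proof.
move=> f2 /andP[wA _]; rewrite /param_adds !all_cat; apply/and4P; split.
- apply: sub_all wA => J /and3P[u s hJ]; apply/and3P; split=> //.
  by apply: sub_all hJ => j hj; lia.
- by rewrite /base_adds /cx /add_wf /= !inE; lia.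
- by rewrite /end_adds /cx /cn /add_wf /= !inE; lia.
apply/allP => J /mem_chain[i ie]; rewrite /chain_block /cx /cn !inE => /orP[]/eqP->.
  by rewrite /add_wf /= !inE; lia.
by rewrite /add_wf /= !inE; lia.
Qed.

Section Robustness.
Variables (R : realType) (h : nat) (nrm : 'rV[R]_h.+2 -> R).
Hypotheses (h0 : (0 < h)%N) (hodd : odd h) (hn : is_norm nrm).
Variables (f g q C : nat) (A : seq (seq nat)) (K : seq link).
Hypotheses (f2 : (2 <= f)%N) (g0 : (0 < g)%N) (fq : (f <= q)%N).
Hypotheses (wf : sys_wf f g [::] K) (wfA : all (add_wf q) A).
Notation I := (theI h g f q C A K).

Lemma theI_valid : valid_inst h.+2 (2 * h.+2 - 2) I.
Proof.
have -> : (2 * h.+2 - 2 = h.+1.*2)%N by clear; lia.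
split; last by apply/allP => v hv; apply/eqP; apply: ivals_size hv.
  apply/allP => s hs; have [s1 s2 s3 s4] := simps_valid h0 g0 f2 fq wf wfA hs.
  by rewrite s1 s2 s4 /= (nvE C A K h0 g0 f2 fq) s3.
exact: (simps_top h0 g0 f2 fq wf wfA).
Qed.

Lemma solvable_not_robust : solvable A K -> ~ rob_pos_correct nrm I.
Proof.
move=> [a [d [a0 d0 s]]] [al [al0 [_ H]]].
have [c c0 hc] := norm_upper (ltn0Sn _) hn.
pose B : R := c * (C%:R + 5); have B0 : 0 < B by rewrite mulr_gt0 // ltr_wpDl ?ler0n.
(* This number serves as both [dl] and [ep]: each coordinate changes by at most (C + 5)e, hence the
   norm by at most B e <= al. *)
pose e := Num.min (1 / 2) (al / B).
have e0 : 0 < e by rewrite lt_min !divr_gt0.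
have e2 : e <= 1 / 2 by rewrite ge_min lexx.
have eB : e <= al / B by rewrite ge_min lexx orbT.
have [G [Gc Gl Gn]] := perturbation C h0 g0 f2 fq a0 d0 wf wfA s e0 e2 e0.
have [x Kx|x [Kx /eqP]] := H G Gc; last by apply/negP; exact: Gn.
apply: le_trans (hc _ (C%:R * e + e * 5) _) _.
  by move=> k; rewrite !mxE; have := Gl x Kx k; rewrite !mxE.
move: eB; rewrite ler_pdivlMr // /B; lra.
Qed.

Lemma robust_of_unsolvable (c : R) : (forall (x : 'rV[R]_h.+2) i, `|x ord0 i| <= c * nrm x) ->
  c * 4 * h.+3%:R <= C%:R -> (0 < C)%N -> 0 <= c -> ~ solvable A K -> Sf nrm I 1.
Proof.
move=> hc hC C0 c0 ns; split=> // G Gc Gl; apply: contrapT => nz; apply: ns.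
have nz' x : realiz I x -> G x != 0.
  by move=> Kx; apply/eqP => e; apply: nz; exists x.
have [dl dl0 hd] := uniform_label Gc nz'.
pose N := NN h g q.
(* The first bound is for the counting argument with h + 3 labels in [Tdeg_ref]; the second keeps
   all the moves of masses allowed in [miss] within the radius of uniform labels. *)
pose D := maxn (2 * h.+3 * h.+3) (Num.bound ((2 * N + 1)%N%:R / dl)).+1.
have D0 : (0 < D)%N by rewrite leq_max ltnS leq0n orbT.
have Dd : (2 * N + 1)%N%:R / D%:R <= dl.
  rewrite ler_pdivrMr ?ltr0n // mulrC -ler_pdivrMr //; apply: ltW.
  apply: lt_le_trans (archi_boundP _) _; first by rewrite divr_ge0 ?ler0n // ltW.
  by rewrite ler_nat leq_max leqnSn orbT.
have cl x : realiz I x -> forall j, `|G x ord0 j - plmap h.+2 I x ord0 j| <= c.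
  move=> Kx j; have := hc (G x - plmap h.+2 I x) j; rewrite mxE [X in _ + X]mxE => /le_trans; apply.
  by rewrite -[leRHS]mulr1 ler_wpM2l // Gl.
exact: (nonvanishing_sat h0 g0 f2 fq wf wfA D0 hd Dd cl hC C0 (leq_maxl _ _) hodd).
Qed.
End Robustness.
End Robust.

(** * The diagonal instance refutes the algorithm *)

Import all_boot all_order all_algebra.
Import all_classical all_reals all_analysis.
Import Diophantine RecursiveGraph UniversalSet LinkSystem TorusComplex RootsForced Compactness InstanceCode Robust.
Import Order.TTheory GRing.Theory Num.Theory.
Local Open Scope ring_scope.

(* Output 0 means "rob(f) > 0", output 1 means "rob(f) < 1". *)
Theorem theorem1p3 (R : realType) (n : nat) (nrm : 'rV[R]_n -> R) :
  (2 < n)%N -> odd n -> is_norm nrm ->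
  ~ exists phi : recf,
      forall I : inst, valid_inst n (2 * n - 2) I ->
        exists y : nat, rec_eval phi [:: pickle I] y /\
          ((y = 0%N /\ rob_pos_correct nrm I) \/ (y = 1%N /\ rob_lt1_correct nrm I)).
Proof.
case: n nrm => [|[|h]] // nrm h0 oh hn [phi hphi].
have hodd : odd h by move: oh; rewrite /= !negbK.
have [c c0 hc] := norm_lower (ltn0Sn _) hn.
(* Scaling f by C turns the fixed error 1 into a small relative error, as the counting of labels
   requires. *)
pose C := (Num.bound (c * 4 * h.+3%:R)).+1.
have hC : c * 4 * h.+3%:R <= C%:R.
  apply: ltW; apply: lt_le_trans (archi_boundP _) _; first by rewrite !mulr_ge0 ?(ltW c0).
  by rewrite ler_nat leqnSn.
have [p [q hpq]] := dio_univ.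
have [f [g [A [K [f2 g0 swf hsys]]]]] := system_of_dexp p q.
have univE k : univ k <-> solvable (param_adds A f k) K.
  by rewrite (param_solvable k f2 swf) -hsys -(hpq (fun=> k)).
(* All other data are fixed before k, so the code of the instance is a function of k alone. *)
have [k hk] := @diagonal phi (fun e => pickle (the_inst h g f C A K e)) (diof_inst h g f C A K).
have wf : sys_wf f g [::] K by case/andP: swf => _ wK; rewrite /sys_wf wK.
have fq : (f <= f + 3 + 2 * k)%N by rewrite -addnA leq_addr.
have wfA := param_wf k f2 swf.
have [y [ey ans]] := hphi (the_inst h g f C A K k) (theI_valid h0 C f2 g0 fq wf wfA).
case: ans => -[e0 corr]; rewrite {}e0 in ey.
  by apply: (solvable_not_robust h0 hn f2 g0 fq wf wfA _ corr); apply/univE/hk.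
apply: corr; apply: (robust_of_unsolvable h0 hodd f2 g0 fq wf wfA hc hC) => //; first exact: ltW.
(* Were the system solvable, the algorithm would also output 0 here, against its unique output 1. *)
by move=> /univE/hk/(rec_eval_det ey).
Qed.
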